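(* Let $\{X_t:t\ge 0\}$ be the $\mathfrak N(\mathbb R_+)$-valued process defined as the pathwise unique solution of the stochastic integral equation: almost surely, for all $t\ge 0$, $x\ge 0$, $$X_t(x)=X_0(x-t)+\int_0^t\int_0^{\langle X_{s-},\alpha\rangle}\int_0^1\int_{\mathbb N}\int_0^{p(A(X_{s-},y),z)}\Big[z\,1_{\{t-s\le x\}}-1_{\{A(X_{s-},y)+t-s\le x\}}\Big]M(ds,du,dy,dz,dv).$$ Then $\{X_t:t\ge 0\}$ is an $(\alpha,g)$-age-structured branching process.
   Context: $\mathbb R_+=[0,\infty)$, $\mathbb N=\{0,1,2,\dots\}$. $\mathfrak M(\mathbb R_+)$ is the space of finite Borel measures on $\mathbb R_+$ with the weak convergence topology and $\mathfrak N(\mathbb R_+)$ is its subset of integer-valued measures. $B(\mathbb R_+)$ is the space of bounded Borel functions on $\mathbb R_+$ and $B(\mathbb R_+)^+$ the subset of positive (nonnegative) ones; $\langle\nu,f\rangle=\int f\,d\nu$. A measure $\mu\in\mathfrak M(\mathbb R_+)$ is identified with its distribution function $\mu(x)=\mu([0,x])$ for $x\ge0$, $\mu(x)=0$ for $x<0$. Integrals $\int_a^b$ are over $(a,b]$. Parameters: $\alpha\in B(\mathbb R_+)^+$ is bounded away from zero; $g(x,z)=\sum_{i=0}^\infty p(x,i)z^i$ is a Borel function on $\mathbb R_+\times[0,1]$ with $p(x,i)\ge0$, $\sum_i p(x,i)=1$, and $\sup_{x\ge0}\sum_{i\ge1}i\,p(x,i)<\infty$. For $\mu\in\mathfrak N(\mathbb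 R_+)\setminus\{0\}$ and $y\in(0,1]$ write $A(\mu,y)=\inf\{w\ge0:\int_{[0,w]}\alpha\,d\mu>\langle\mu,\alpha\rangle y\}$ (for $y$ uniform on $(0,1]$, $A(\mu,y)$ has law $\alpha(x)\mu(dx)/\langle\mu,\alpha\rangle$). On a filtered probability space $(\Omega,\mathcal F,\mathcal F_t,\mathbf P)$ satisfying the usual hypotheses, $M(dt,du,dy,dz,dv)$ is an $(\mathcal F_t)$-Poisson random measure on $(0,\infty)^2\times(0,1]\times\mathbb N\times(0,1]$ with intensity $dt\,du\,dy\,\pi(dz)\,dv$, where $\pi$ is the counting measure on $\mathbb N$. $X_0$ is an $\mathcal F_0$-measurable random element of $\mathfrak N(\mathbb R_+)$. The solution is càdlàg, $(\mathcal F_t)$-adapted, with values in $\mathfrak N(\mathbb R_+)$ and a.s. infinite lifetime. A Markov process with state space $\mathfrak N(\mathbb R_+)$ is called an $(\alpha,g)$-age-structured branching process if it has transition semigroup $(Q_t)_{t\ge0}$ defined by $$\int_{\mathfrak N(\mathbb R_+)}e^{-\langle\nu,f\rangle}Q_t(\sigma,d\nu)=e^{-\langle\sigma,u_tf\rangle},\qquad \sigma\in\mathfrak N(\mathbb R_+),\ f\in B(\mathbb R_+)^+,$$ where $u_tf(x)\ge 0$ is the unique solution of $$e^{-u_tf(x)}=e^{-f(x+t)}+\int_0^t\alpha(x+s)\big[g(x+s,e^{-u_{t-s}f(0)})-e^{-u_{t-s}f(x+s)}\big]ds,\qquad t,x\ge 0.$$ *)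

(* Defs.v *)
From HB Require Import structures.
From mathcomp Require Import all_boot all_order all_algebra.
From mathcomp Require Import all_classical all_reals all_analysis.
From mathcomp Require Import measurable_realfun.
Import Order.TTheory GRing.Theory Num.Theory.
Import numFieldNormedType.Exports.

Set Implicit Arguments.
Unset Strict Implicit.
Unset Printing Implicit Defensive.

Local Open Scope classical_set_scope.
Local Open Scope ring_scope.

(* Functions and measures on [0, +oo[ are represented by functions on R of which
   only the values on `[0, +oo[ matter, and by Borel measures on R that do not
   charge `]-oo, 0[. *)

Section function_classes.
Context {R : realType}.
Implicit Types f : R -> R.

Definition bounded_on_nonneg f := exists C, forall x, 0 <= x -> `|f x| <= C.

(* C_b(R_+) *)
Definition bounded_continuous f :=
  {within `[0, +oo[, continuous f} /\ bounded_on_nonneg f.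

Definition bounded_continuous_fun := {f : R -> R | bounded_continuous f}.

HB.instance Definition _ := gen_eqMixin bounded_continuous_fun.
HB.instance Definition _ := gen_choiceMixin bounded_continuous_fun.

(* B(R_+)^+ *)
Definition bounded_borel_nonneg f :=
  [/\ measurable_fun (`[0, +oo[ : set R) f, bounded_on_nonneg f &
      forall x, 0 <= x -> 0 <= f x].

Definition bounded_away_from_zero f :=
  exists c, 0 < c /\ forall x, 0 <= x -> c <= f x.

End function_classes.
Arguments bounded_continuous_fun R : clear implicits.

Section nat_measure.
Context {R : realType}.

(* the space N(R_+) of integer-valued finite Borel measures on R_+ *)
Record nat_measure := NatMeasure {
  nat_measure_val :> {finite_measure set (measurableTypeR R) -> \bar R} ;
  nat_measure_nonneg : nat_measure_val (`]-oo, 0[%classic : set R) = 0%E ;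
  nat_measure_nat : forall B, measurable B ->
    exists n : nat, nat_measure_val B = n%:R%:E }.

Implicit Types (mu nu : nat_measure) (f : R -> R).

Definition nat_measure0 : nat_measure.
Proof.
refine (@NatMeasure mzero _ _) => [//|B _].
by exists 0%N.
Defined.

(* <mu, f> *)
Definition pairing mu f : R := \int[mu]_(x in `[0, +oo[) f x.

(* the distribution function; `[0, x] is empty when x < 0 *)
Definition distribution_fun mu (x : R) : \bar R := mu (`[0, x]%classic : set R).

HB.instance Definition _ := gen_eqMixin nat_measure.
HB.instance Definition _ := gen_choiceMixin nat_measure.
HB.instance Definition _ := isPointed.Build nat_measure nat_measure0.

Definition bounded_continuous_pairings mu :
    {ptws bounded_continuous_fun R -> R} :=
  fun h => pairing mu (sval h).

(* weak convergence topology: the coarsest one for which mu |-> <mu, f> is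
   continuous for all bounded continuous f *)
HB.instance Definition _ := Topological.copy nat_measure
  (initial_topology bounded_continuous_pairings).

(* Borel sigma-algebra of the weak convergence topology *)
HB.instance Definition _ := @isMeasurable.Build
  (sigma_display (@open nat_measure)) nat_measure <<s @open nat_measure >>
  (@sigma_algebra0 _ setT (@open nat_measure))
  (@sigma_algebraC _ (@open nat_measure))
  (@sigma_algebra_bigcup _ setT (@open nat_measure)).

End nat_measure.
Arguments nat_measure R : clear implicits.

Section age_structured_branching.
Context {R : realType}.
Implicit Types (alpha f : R -> R) (p : R -> nat -> R) (g : R -> R -> R).

Definition pgf p : R -> R -> R :=
  fun x z => limn (series (fun i => p x i * z ^+ i)).

Definition offspring_law p :=
  [/\ forall x i, 0 <= x -> 0 <= p x i,
      forall x, 0 <= x -> (\sum_(0 <= i <oo) (p x i)%:E = 1)%E,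
      measurable_fun (`[0, +oo[ `*` `[0, 1] : set (R * R))
        (fun xz : R * R => pgf p xz.1 xz.2) &
      (ereal_sup [set \sum_(1 <= i <oo) (i%:R * p x i)%:E | x in `[0%R, +oo[]
         < +oo)%E ].

(* u t x stands for u_t f(x) *)
Definition cumulant_solution alpha g f (u : R -> R -> R) :=
  [/\ measurable_fun (`[0, +oo[ `*` `[0, +oo[ : set (R * R))
        (fun tx : R * R => u tx.1 tx.2),
      forall t x, 0 <= t -> 0 <= x -> 0 <= u t x &
      forall t x, 0 <= t -> 0 <= x ->
        expR (- u t x) = expR (- f (x + t)) +
          \int[lebesgue_measure]_(s in `]0, t])
            (alpha (x + s) * (g (x + s) (expR (- u (t - s) 0))
                              - expR (- u (t - s) (x + s)))) ].

Definition cumulant_unique_solution alpha g f (u : R -> R -> R) :=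
  cumulant_solution alpha g f u /\
  forall u', cumulant_solution alpha g f u' ->
    forall t x, 0 <= t -> 0 <= x -> u' t x = u t x.

Definition transition_semigroup d (S : measurableType d)
    (Q : R -> R.-pker S ~> S) :=
  (forall x B, measurable B -> Q 0 x B = \d_x B) /\
  (forall s t x B, 0 <= s -> 0 <= t -> measurable B ->
     Q (s + t) x B = (\int[Q s x]_y Q t y B)%E).

Definition age_branching_semigroup alpha g
    (Q : R -> R.-pker (nat_measure R) ~> (nat_measure R)) :=
  transition_semigroup Q /\
  forall f, bounded_borel_nonneg f ->
    exists u, cumulant_unique_solution alpha g f u /\
      forall t sigma, 0 <= t ->
        (\int[Q t sigma]_nu (expR (- pairing nu f))%:E
          = (expR (- pairing sigma (u t)))%:E)%E.

End age_structured_branching.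

Section stochastic_basis.
Context {R : realType} {d : measure_display} {Omega : measurableType d}.
Variables (P : probability Omega R) (F : R -> set (set Omega)).

Record usual_filtration : Prop := UsualFiltration {
  filtration_sigma : forall t, 0 <= t -> sigma_algebra setT (F t) ;
  filtration_measurable : forall t, 0 <= t -> F t `<=` measurable ;
  filtration_mono : forall s t, 0 <= s -> s <= t -> F s `<=` F t ;
  filtration_right_continuous : forall t, 0 <= t ->
    \bigcap_(s in `]t, +oo[) F s `<=` F t ;
  filtration_complete : forall A, P.-negligible A -> F 0 A }.

Definition adapted d' (S : measurableType d') (X : R -> Omega -> S) :=
  forall t B, 0 <= t -> measurable B -> F t (X t @^-1` B).

(* the last clause reads P(X_t \in B | F_s) = Q_{t-s}(X_s, B) *)
Definition markov_process d' (S : measurableType d')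
    (Q : R -> R.-pker S ~> S) (X : R -> Omega -> S) :=
  adapted X /\
  forall s t A B, 0 <= s -> s <= t -> F s A -> measurable B ->
    P (A `&` X t @^-1` B) = (\int[P]_(w in A) Q (t - s)%R (X s w) B)%E.

Definition age_structured_branching_process (alpha : R -> R) (g : R -> R -> R)
    (X : R -> Omega -> nat_measure R) :=
  exists Q, age_branching_semigroup alpha g Q /\ markov_process Q X.

End stochastic_basis.

(* coordinates are (t, u, y, z, v) *)
Notation mark_space R := (R * R * R * nat * R)%type.

Section poisson_random_measure.
Context {R : realType}.

Definition mark_domain : set (mark_space R) :=
  `]0, +oo[ `*` `]0, +oo[ `*` `]0, 1] `*` [set: nat] `*` `]0, 1].

(* only the values on subsets of mark_domain are used *)
Definition mark_intensity : set (mark_space R) -> \bar R :=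
  (lebesgue_measure \x lebesgue_measure \x lebesgue_measure
     \x counting \x lebesgue_measure)%E.

Context {d : measure_display} {Omega : measurableType d}.
Variables (P : probability Omega R) (F : R -> set (set Omega)).
Variable M : R.-ker Omega ~> mark_space R.

Definition mark_sets : set (set (mark_space R)) :=
  [set B | measurable B /\ B `<=` mark_domain].

Definition finite_mark_sets : set (set (mark_space R)) :=
  [set B | mark_sets B /\ (mark_intensity B < +oo)%E].

Definition future_sigma (t : R) : set (set Omega) :=
  <<s [set C | exists B V, [/\ mark_sets B,
         B `<=` [set e | t < e.1.1.1.1], measurable V &
         C = (fun w => M w B) @^-1` V] ] >>.

(* the Poisson weights are written out because poisson_pmf 0 is constantly 1 *)
Record adapted_poisson_random_measure : Prop := AdaptedPRM {
  prm_poisson : forall B (n : nat), finite_mark_sets B ->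
    P [set w | M w B = n%:R%:E] =
      (fine (mark_intensity B) ^+ n / n`!%:R
         * expR (- fine (mark_intensity B)))%:E ;
  prm_independent : forall n (B : 'I_n -> set (mark_space R))
      (V : 'I_n -> set (\bar R)),
    (forall i, finite_mark_sets (B i)) -> trivIset setT B ->
    (forall i, measurable (V i)) ->
    P (\bigcap_i [set w | V i (M w (B i))]) =
      (\prod_i P [set w | V i (M w (B i))])%E ;
  prm_adapted : forall t B V, 0 <= t -> mark_sets B ->
    B `<=` [set e | e.1.1.1.1 <= t] -> measurable V ->
    F t [set w | V (M w B)] ;
  prm_future_independent : forall t A C, 0 <= t -> F t A ->
    future_sigma t C -> P (A `&` C) = (P A * P C)%E }.

End poisson_random_measure.

Section stochastic_equation.
Context {R : realType} {d : measure_display} {Omega : measurableType d}.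

(* Since sup = 0 on the empty set, inf is 0 when the set is empty, which for
   alpha > 0, mu <> 0 and y \in ]0, 1] occurs only at y = 1, a Lebesgue-null
   value of the mark. *)
Definition age_quantile (alpha : R -> R) (mu : nat_measure R) (y : R) : R :=
  inf [set w | 0 <= w /\
    pairing mu alpha * y < \int[mu]_(x in `[0, w]) alpha x].

Definition cadlag (T : ptopologicalType) (x : R -> T) :=
  (forall t, 0 <= t -> x s @[s --> t^'+] --> x t) /\
  (forall t, 0 < t -> cvg (x s @[s --> t^'-])).

Definition left_limit (T : ptopologicalType) (x : R -> T) (t : R) : T :=
  lim (x s @[s --> t^'-]).

Variables (P : probability Omega R) (F : R -> set (set Omega)).
Variable M : R.-ker Omega ~> mark_space R.
Variables (alpha : R -> R) (p : R -> nat -> R).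

Definition jump_region (x : R -> nat_measure R) (t : R) :
    set (mark_space R) :=
  [set e | mark_domain e /\
    let: (s, u, y, z, v) := e in
    [/\ s <= t, u <= pairing (left_limit x s) alpha &
        v <= p (age_quantile alpha (left_limit x s) y) z]].

Definition jump_size (x : R -> nat_measure R) (t a : R)
    (e : mark_space R) : R :=
  let: (s, u, y, z, v) := e in
  z%:R * (t - s <= a)%R%:R
    - (age_quantile alpha (left_limit x s) y + t - s <= a)%R%:R.

(* As distribution_fun is finite, the equation in \bar R forces both the positive and the
   negative part of the integrand to be integrable: here +oo - +oo is -oo. *)
Definition solves_equation (x : R -> nat_measure R) (w : Omega) :=
  forall t a, 0 <= t -> 0 <= a ->
    (distribution_fun (x t) a = distribution_fun (x 0%R) (a - t)%R +
       \int[M w]_(e in jump_region x t) (jump_size x t a e)%:E)%E.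

Definition stochastic_equation_solution (X : R -> Omega -> nat_measure R) :=
  adapted F X /\
  {ae P, forall w, cadlag (X ^~ w) /\ solves_equation (X ^~ w) w}.

End stochastic_equation.

(* Main.v *)
Require Import Defs.
From HB Require Import structures.
From mathcomp Require Import all_boot all_order all_algebra.
From mathcomp Require Import all_classical all_reals all_analysis.
From mathcomp Require Import measurable_realfun lra ring.
Import Order.TTheory GRing.Theory Num.Theory.
Import numFieldNormedType.Exports.

Set Implicit Arguments.
Unset Strict Implicit.
Unset Printing Implicit Defensive.

Local Open Scope classical_set_scope.
Local Open Scope ring_scope.

(** The transition semigroup. Let every individual have events at a constant rate [c] that
    bounds [alpha]; an event at the age [y] is a branching with probability [alpha y / c]
    and changes nothing otherwise. Counting the events along the lines of descent, the law
    of the descendants of one individual is an increasing limit of sub-probability kernels,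
    and so a kernel. Conditioning on the first event gives an equation for its Laplace
    functional, in which exchanging two integrals removes the fictitious events: the result
    is the cumulant equation ([survival_equation]). Iterating the Lipschitz bound of the
    generating functions shows that its solution is unique ([cumulant_equation_unique]),
    which yields the flow property of the cumulant and, for [f = 0], total mass one. An
    initial population has independent lines of descent, and since Laplace functionals
    determine finite measures on the space of states ([laplace_determines]), the flow
    property is the semigroup property.

    The Markov property. By the same determination it is enough to show
    [E (1_A * exp (- <X_T, f>)) = E (1_A * exp (- <X_s, u_(T-s) f>))] for each event [A] of the
    past of [s] ([markov_laplace]). Instead of stochastic calculus, the interval [[s, T]] is
    cut into short steps, and the value [exp (- <X_r, u_(T-r) f>)] is followed along the
    grid. As long as the population has at most [n] individuals, only the marks in a box of
    finite intensity matter, except that branchings into more than [Z] offspring have to be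
    excluded; they are, because they would make the population exceed [n]
    ([large_births_null]). If the box of a step contains no point, the population only ages;
    if it contains one, at most one individual branches, and the final state is an explicit
    function of the initial state and of the point ([no_point_value], [one_point_value]). Two
    points or more have a probability quadratic in the length of the step. Given the past,
    the point is distributed according to the intensity ([frozen_campbell]), so the expected
    value after the step is an explicit integral, and the cumulant equation says that it
    equals the value before the step, up to an error that is quadratic in the length [delta]
    of the step plus a multiple of [delta / Z] ([one_step_value], [step_value_error]).

    Adding these errors over the grid leaves a multiple of the mesh, a multiple of [1 / Z],
    and the probability that the population has exceeded [n]. They vanish when the mesh tends
    to 0, then [Z] to infinity, then [n] to infinity: a path with left and right limits has
    bounded total mass on a compact interval ([mass_bounded]). *)

(** * Integer-valued measures and their atoms *)

Section finite_measures_on_the_line.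
Context {R : realType}.

Lemma finite_measure_lty d (T : measurableType d)
    (m : {finite_measure set T -> \bar R}) (A : set T) : measurable A ->
  (m A < +oo)%E.
Proof. by move=> mA; rewrite ltey_eq fin_num_measure. Qed.

Lemma cdf_cvg_total (m : {finite_measure set (measurableTypeR R) -> \bar R}) :
  m (`]-oo, n%:R]%classic : set R) @[n --> \oo] --> m setT.
Proof.
have -> : setT = \bigcup_n (`]-oo, n%:R]%classic : set R).
  apply/esym; rewrite -subTset => x _; exists (Num.truncn x).+1 => //=.
  by rewrite in_itv/= ltW// truncnS_gt.
apply: nondecreasing_cvg_mu => //.
  by apply: bigcupT_measurable => n; exact: measurable_itv.
move=> i j ij; apply/subsetPset => x /=; rewrite !in_itv/= => /le_trans; apply.
by rewrite ler_nat.
Qed.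
Arguments cdf_cvg_total m : clear implicits.

Lemma cdf_right_continuous
    (m : {finite_measure set (measurableTypeR R) -> \bar R}) (a : R) :
  m (`]-oo, a + n.+1%:R^-1]%classic : set R) @[n --> \oo]
    --> m (`]-oo, a]%classic : set R).
Proof.
have -> : (`]-oo, a]%classic : set R) =
    \bigcap_n (`]-oo, a + n.+1%:R^-1]%classic : set R).
  apply/seteqP; split=> x /=; rewrite in_itv/=.
    move=> xa n _ /=; rewrite in_itv/=; apply: (le_trans xa).
    by rewrite lerDl invr_ge0.
  move=> h; apply/ler_addgt0Pr => e e0.
  have := h (Num.truncn e^-1) I; rewrite /= in_itv/= => /le_trans; apply.
  rewrite lerD2l invf_ple ?posrE//.
  exact/ltW/truncnS_gt.
apply: nonincreasing_cvg_mu => //.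
- exact: finite_measure_lty.
- by apply: bigcapT_measurable => n; exact: measurable_itv.
- move=> i j ij; apply/subsetPset => x /=; rewrite !in_itv/= => /le_trans; apply.
  by rewrite lerD2l lef_pV2 ?posrE// ler_nat.
Qed.
Arguments cdf_right_continuous m a : clear implicits.

(** The rays generate the Borel sets and are stable under intersection. *)
Lemma eq_measure_cdf (m1 m2 : {finite_measure set (measurableTypeR R) -> \bar R}) :
  (forall a, m1 (`]-oo, a]%classic : set R) = m2 (`]-oo, a]%classic : set R)) ->
  forall B, measurable B -> m1 B = m2 B.
Proof.
move=> h B mB.
have hT : m1 setT = m2 setT.
  have := cdf_cvg_total m2; under eq_fun do rewrite -h.
  move=> h2; have h1 := cdf_cvg_total m1.
  by rewrite -(cvg_lim _ h1)// -(cvg_lim _ h2).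
have hc a : m1 (`]a, +oo[%classic : set R) = m2 (`]a, +oo[%classic : set R).
  have -> : (`]a, +oo[%classic : set R) = setT `\` `]-oo, a]%classic.
    by rewrite setTD setCitvl.
  by rewrite !measureD//= ?setTI ?hT ?h//; exact: finite_measure_lty.
apply: (@measure_unique _ R (measurableTypeR R) (@RGenOInfty.G R)
   (fun n => `](- n%:R), +oo[%classic : set R) _ _ _ _ m1 m2) => //.
- exact: RGenOInfty.measurableE.
- move=> _ _ [x ->] [y ->]; exists (Num.max x y).
  by apply/seteqP; split=> z /=; rewrite !in_itv/= !andbT gt_max => /andP.
- by move=> n; exists (- n%:R).
- rewrite -subTset => x _; exists (Num.truncn (- x)).+1 => //=.
  by rewrite in_itv/= andbT ltrNl truncnS_gt.
- by move=> _ [x ->]; exact: hc.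
- by move=> n; exact: finite_measure_lty.
Qed.

End finite_measures_on_the_line.
Arguments cdf_cvg_total {R} m.
Arguments cdf_right_continuous {R} m a.

Section atoms.
Context {R : realType}.
Implicit Types (mu nu : nat_measure R) (f : R -> R) (v : nat -> R).

(** States that agree on the Borel sets can differ elsewhere as set functions, and
    only the values on Borel sets matter. *)
Definition same_measure mu nu := forall B, measurable B -> mu B = nu B.

Definition mass mu : nat := sval (cid (nat_measure_nat mu measurableT)).

Lemma massE mu : mu setT = (mass mu)%:R%:E.
Proof. by rewrite /mass; case: cid. Qed.

(** The position of the [m]-th atom, in increasing order, is a quantile of the
    distribution function; this makes it a measurable function of [mu]. *)
Definition atom mu (m : nat) : R :=
  inf [set a | 0 <= a /\ (m.+1%:R%:E <= mu `]-oo, a]%classic)%E].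

Lemma nat_measure_lt0 mu (a : R) : a < 0 -> mu `]-oo, a]%classic = 0%E.
Proof.
move=> a0; apply/eqP; rewrite eq_le measure_ge0 andbT.
rewrite -(nat_measure_nonneg mu); apply: le_measure; rewrite ?inE//.
by move=> x /=; rewrite !in_itv/= => /le_lt_trans; apply.
Qed.

Lemma atom_ge0 mu m : 0 <= atom mu m.
Proof. rewrite /atom; set E := [set _ | _].
have [->|E0] := eqVneq E set0; first by rewrite inf0.
by apply: lb_le_inf; [exact/set0P|move=> x []]. Qed.

(** The distribution function is right-continuous, so the infimum that defines the
    atom is attained. *)
Lemma atomP mu m (a : R) : (m < mass mu)%N ->
  ((m.+1%:R%:E <= mu `]-oo, a]%classic)%E <-> atom mu m <= a).
Proof.
move=> mN; set E := [set a | 0 <= a /\ (m.+1%:R%:E <= mu `]-oo, a]%classic)%E].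
have lbE : has_lbound E by exists 0 => x [].
have E0 : E !=set0.
  apply: contrapT => E0; have : (mu setT <= m%:R%:E)%E; last first.
    by rewrite massE lee_fin ler_nat leqNgt mN.
  have cT := cdf_cvg_total mu; rewrite -(cvg_lim _ cT)//.
  apply: lime_le; first by apply/cvg_ex; eexists; exact: cT.
  apply: nearW => n; rewrite leNgt; apply/negP => h; apply: E0.
  exists n%:R; split; first exact: ler0n.
  move: h; have [k ->] := nat_measure_nat mu (measurable_itv `]-oo, (n%:R:R)]).
  by rewrite lte_fin lee_fin ltr_nat ler_nat.
split=> [h|].
  apply: ge_inf => //; split => //; rewrite leNgt; apply/negP => a0.
  by move: h; rewrite nat_measure_lt0// lee_fin leNgt ltr0n.
move=> ha.
have h n : (m.+1%:R%:E <= mu `]-oo, (a + n.+1%:R^-1)%R]%classic)%E.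
  have [|b [_ hb] blt] := @inf_adherent _ E n.+1%:R^-1 _ (conj E0 lbE).
    by rewrite invr_gt0.
  apply: (le_trans hb); apply: le_measure; rewrite ?inE//.
  move=> x /=; rewrite !in_itv/= => /le_trans; apply; apply/ltW/(lt_le_trans blt).
  by rewrite lerD2r.
have ca := cdf_right_continuous mu a; rewrite -(cvg_lim _ ca)//.
by apply: lime_ge; [apply/cvg_ex; eexists; exact: ca|exact: nearW].
Qed.

Lemma nat_measure_cdfE mu (a : R) :
  mu `]-oo, a]%classic = (\sum_(m < mass mu) (atom mu m <= a)%R%:R)%:E.
Proof.
have [k hk] := nat_measure_nat mu (measurable_itv `]-oo, a]).
rewrite hk; congr (_%:E).
have kN : (k <= mass mu)%N.
  rewrite -(ler_nat R) -lee_fin -hk -massE; apply: le_measure; rewrite ?inE//.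
transitivity (\sum_(m < mass mu) (m < k)%:R : R); last first.
  apply: eq_bigr => m _; congr (nat_of_bool _)%:R.
  apply/idP/idP => [mk|].
    by apply/(atomP a (ltn_ord m)); rewrite hk lee_fin ler_nat.
  by move/(atomP a (ltn_ord m)); rewrite hk lee_fin ler_nat.
rewrite -natr_sum; congr (_%:R).
rewrite -(big_mkord predT (fun m => nat_of_bool (m < k)%N)) /=.
rewrite (big_cat_nat _ kN)//= [X in (_ + X)%N]big1_seq ?addn0; last first.
  by move=> i /=; rewrite mem_index_iota => /andP[ki _]; rewrite ltnNge ki.
rewrite big_mkord -[LHS]card_ord -sum1_card.
by apply: eq_bigr => i _; rewrite ltn_ord.
Qed.

(** It suffices to compare on the rays: the ranks of the atoms in [`]-oo, a]] are
    those below the integer value of the distribution function at [a]. *)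
Lemma nat_measureE mu B : measurable B ->
  mu B = (\sum_(m < mass mu) \d_(atom mu m : measurableTypeR R) B)%E.
Proof.
move=> mB.
pose nu : {measure set (measurableTypeR R) -> \bar R} :=
  msum (fun m => \d_(atom mu m : measurableTypeR R)) (mass mu).
have fnu : fin_num_fun nu.
  move=> A mA.
  suff -> : nu A = (\sum_(m < mass mu) \1_A (atom mu m))%:E by [].
  by rewrite -sumEFin.
pose nu' := HB.pack_for (FiniteMeasure.type (measurableTypeR R) R) (Measure.sort nu)
  (Measure_isFinite.Build _ _ _ nu fnu).
rewrite (@eq_measure_cdf R mu nu') // => a.
rewrite nat_measure_cdfE /nu' /= /msum -sumEFin.
by apply: eq_bigr => m _; rewrite /= /dirac indicE mem_setE in_itv.
Qed.

End atoms.

Section integrals_over_atoms.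
Context {R : realType}.
Implicit Types (mu nu : nat_measure R) (f : R -> R) (v : nat -> R) (n : nat).

(** Any enumeration of the atoms is admitted, increasing or not, so that sums and
    shifts of states are easy to describe. *)
Definition has_atoms mu n v := forall B : set (measurableTypeR R), measurable B ->
  mu B = (\sum_(m < n) \1_B (v m))%:E.

Lemma has_atoms_atom mu : has_atoms mu (mass mu) (atom mu).
Proof. by move=> B mB; rewrite nat_measureE// -sumEFin. Qed.

Lemma has_atoms_mass mu n v : has_atoms mu n v -> mass mu = n.
Proof.
move=> h; have := h _ measurableT.
under eq_bigr do rewrite indicT; rewrite sumr_const card_ord massE => -[] /eqP.
by rewrite eqr_nat => /eqP.
Qed.

Lemma has_atoms_ge0 mu n v m : has_atoms mu n v -> (m < n)%N -> 0 <= v m.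
Proof.
move=> h mn; rewrite leNgt; apply/negP => vm0.
have := nat_measure_nonneg mu; rewrite (h _ (measurable_itv _)).
rewrite (bigD1 (Ordinal mn))//= indicE mem_set/=; last by rewrite in_itv.
move=> [] /eqP; rewrite paddr_eq0 ?oner_eq0//.
by rewrite sumr_ge0.
Qed.

Lemma ge0_integral_has_atoms mu n v (f : R -> \bar R) : has_atoms mu n v ->
  measurable_fun setT f -> (forall x, 0 <= f x)%E ->
  (\int[mu]_x f x = \sum_(m < n) f (v m))%E.
Proof.
move=> h mf f0.
rewrite (eq_measure_integral (msum (fun m => \d_(v m : measurableTypeR R)) n)).
  rewrite ge0_integral_measure_sum//.
  by apply: eq_bigr => m _; rewrite integral_dirac// diracT mul1e.
by move=> A mA _; apply: (etrans (h _ mA)); rewrite /= /msum -sumEFin.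
Qed.

Lemma integral_has_atoms mu n v (D : set R) f : has_atoms mu n v ->
  measurable D -> measurable_fun D f ->
  (\int[mu]_(x in D) (f x)%:E)%E = (\sum_(m < n) (f \_ D) (v m))%:E.
Proof.
move=> h mD mf; rewrite integral_mkcond.
set g := f \_ D.
have mg : measurable_fun setT g by rewrite -measurable_restrictT.
have -> : (fun x => (f x)%:E) \_ D = EFin \o g.
  by apply/funext => x; rewrite /g /= !patchE; case: ifP.
have pE x : (EFin \o g)^\+%E x = (Num.max (g x) 0)%:E by rewrite funeposE /= EFin_max.
have nE x : (EFin \o g)^\-%E x = (Num.max (- g x) 0)%:E by rewrite funenegE /= EFin_max.
have mE : measurable_fun setT (EFin \o g) by exact/measurable_EFinP.
rewrite integralE (ge0_integral_has_atoms h) //; last exact: measurable_funepos.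
rewrite (ge0_integral_has_atoms h) //; last exact: measurable_funeneg.
under eq_bigr do rewrite pE; under [X in (_ - X)%E]eq_bigr do rewrite nE.
rewrite !sumEFin -EFinB -sumrB; congr (_%:E); apply: eq_bigr => m _.
by rewrite /Num.max; case: ltP => h1; case: ltP => h2; lra.
Qed.

Lemma pairing_has_atoms mu n v f : has_atoms mu n v ->
  measurable_fun (`[0, +oo[ : set R) f -> pairing mu f = \sum_(m < n) f (v m).
Proof.
move=> h mf; rewrite /pairing /Rintegral (integral_has_atoms h)//=.
apply: eq_bigr => m _; rewrite patchE mem_set//= in_itv/= andbT.
exact: has_atoms_ge0 h _.
Qed.

Lemma pairingE mu f : measurable_fun (`[0, +oo[ : set R) f ->
  pairing mu f = \sum_(m < mass mu) f (atom mu m).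
Proof. exact/pairing_has_atoms/has_atoms_atom. Qed.

Lemma Rintegral_initial mu f (w : R) : measurable_fun (`[0, +oo[ : set R) f ->
  \int[mu]_(x in `[0, w]) f x =
    \sum_(m < mass mu) f (atom mu m) * (atom mu m <= w)%R%:R.
Proof.
move=> mf; rewrite /Rintegral (integral_has_atoms (has_atoms_atom mu))//=; last first.
  by apply: measurable_funS mf => // x /=; rewrite !in_itv/= andbT => /andP[].
apply: eq_bigr => m _; rewrite patchE mem_setE in_itv/= atom_ge0/=.
by case: ifP; rewrite ?mulr1 ?mulr0.
Qed.

Lemma distribution_funE mu (a : R) :
  distribution_fun mu a = (\sum_(m < mass mu) (atom mu m <= a)%R%:R)%:E.
Proof.
rewrite /distribution_fun (has_atoms_atom _ (measurable_itv _)); congr (_%:E).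
by apply: eq_bigr => m _; rewrite indicE mem_setE in_itv/= atom_ge0.
Qed.

Lemma distribution_fun_cdf mu (a : R) :
  distribution_fun mu a = mu `]-oo, a]%classic.
Proof. by rewrite distribution_funE nat_measure_cdfE. Qed.

Lemma same_measure_cdf mu nu :
  (forall a, mu `]-oo, a]%classic = nu `]-oo, a]%classic) -> same_measure mu nu.
Proof. by move=> h; exact: eq_measure_cdf. Qed.

Lemma same_measure_distribution mu nu :
  (forall a, 0 <= a -> distribution_fun mu a = distribution_fun nu a) ->
  same_measure mu nu.
Proof.
move=> h; apply: same_measure_cdf => a; have [a0|a0] := leP 0 a.
  by rewrite -!distribution_fun_cdf h.
by rewrite !nat_measure_lt0.
Qed.

Lemma same_measure_atoms mu nu : same_measure mu nu ->
  has_atoms mu (mass nu) (atom nu).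
Proof. by move=> h B mB; rewrite (h _ mB) (has_atoms_atom _ mB). Qed.

Lemma same_measure_mass mu nu : same_measure mu nu -> mass mu = mass nu.
Proof. by move=> /same_measure_atoms /has_atoms_mass. Qed.

Lemma same_measure_pairing mu nu f : same_measure mu nu ->
  measurable_fun (`[0, +oo[ : set R) f -> pairing mu f = pairing nu f.
Proof.
by move=> h mf; rewrite (pairing_has_atoms (same_measure_atoms h))// -pairingE.
Qed.

(** ** Building states from finitely many atoms *)

Definition sum_diracs n v : {measure set (measurableTypeR R) -> \bar R} :=
  msum (fun m => \d_(`|v m| : measurableTypeR R)) n.

Lemma sum_diracsE n v B :
  sum_diracs n v B = (\sum_(m < n) \1_B `|v m|)%:E.
Proof. by rewrite -sumEFin. Qed.

Lemma sum_diracs_fin n v : fin_num_fun (sum_diracs n v).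
Proof. by move=> A mA; rewrite sum_diracsE. Qed.

Definition fin_sum_diracs n v : {finite_measure set (measurableTypeR R) -> \bar R} :=
  HB.pack_for (FiniteMeasure.type (measurableTypeR R) R)
    (Measure.sort (sum_diracs n v))
    (Measure_isFinite.Build _ _ _ (sum_diracs n v) (sum_diracs_fin n v)).

Lemma sum_diracs_nonneg n v : fin_sum_diracs n v (`]-oo, 0[%classic : set R) = 0%E.
Proof.
rewrite sum_diracsE big1// => m _.
by rewrite indicE memNset//= in_itv/= ltNge normr_ge0.
Qed.

Lemma sum_diracs_nat n v B : measurable B ->
  exists k : nat, fin_sum_diracs n v B = k%:R%:E.
Proof.
by exists (\sum_(m < n) nat_of_bool (`|v m|%R \in B))%N; rewrite sum_diracsE natr_sum.
Qed.

(** The absolute values make the construction total in the list of ages. *)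
Definition of_atoms n v : nat_measure R :=
  NatMeasure (sum_diracs_nonneg n v) (sum_diracs_nat n v).

Lemma has_atoms_of_atoms n v : has_atoms (of_atoms n v) n (fun m => `|v m|).
Proof. by move=> B mB; rewrite -sum_diracsE. Qed.

Lemma has_atoms_of_atoms_ge0 n v : (forall m, (m < n)%N -> 0 <= v m) ->
  has_atoms (of_atoms n v) n v.
Proof.
move=> v0 B mB; rewrite (has_atoms_of_atoms _ _ mB); congr (_%:E).
by apply: eq_bigr => m _; rewrite ger0_norm// v0.
Qed.

Definition nat_dirac (x : R) := of_atoms 1 (fun=> x).

Definition age_shift (q : R) mu := of_atoms (mass mu) (fun m => atom mu m + q).

Definition nat_add mu nu := of_atoms (mass mu + mass nu)
  (fun m => if (m < mass mu)%N then atom mu m else atom nu (m - mass mu)%N).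

Lemma nat_addE mu nu B : measurable B -> nat_add mu nu B = (mu B + nu B)%E.
Proof.
move=> mB; rewrite (has_atoms_of_atoms_ge0 _ mB); last first.
  by move=> m _; case: ifP => _; exact: atom_ge0.
rewrite (has_atoms_atom mu mB) (has_atoms_atom nu mB) -EFinD; congr (_%:E).
rewrite big_split_ord/=; congr (_ + _); apply: eq_bigr => i _.
  by rewrite ltn_ord.
by rewrite ltnNge leq_addr/= addKn.
Qed.

Lemma age_shift_atoms q mu : 0 <= q ->
  has_atoms (age_shift q mu) (mass mu) (fun m => atom mu m + q).
Proof.
by move=> q0; apply: has_atoms_of_atoms_ge0 => m _; rewrite addr_ge0// atom_ge0.
Qed.

Lemma pairing_age_shift q mu f : 0 <= q -> measurable_fun (`[0, +oo[ : set R) f ->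
  pairing (age_shift q mu) f = \sum_(m < mass mu) f (atom mu m + q).
Proof. by move=> q0 mf; rewrite (pairing_has_atoms (age_shift_atoms _ q0)). Qed.

Lemma distribution_age_shift q mu a : 0 <= q ->
  distribution_fun (age_shift q mu) a = distribution_fun mu (a - q).
Proof.
move=> q0; rewrite distribution_fun_cdf (age_shift_atoms _ q0 (measurable_itv _)) distribution_funE.
by congr (_%:E); apply: eq_bigr => m _; rewrite indicE mem_setE in_itv/= lerBrDr.
Qed.

Lemma pairing_nat_add mu nu f : measurable_fun (`[0, +oo[ : set R) f ->
  pairing (nat_add mu nu) f = pairing mu f + pairing nu f.
Proof.
move=> mf; rewrite !pairingE//.
set v := fun m => if (m < mass mu)%N then atom mu m else atom nu (m - mass mu)%N.
rewrite -(pairingE _ mf) (@pairing_has_atoms _ (mass mu + mass nu) v)//; last first.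
  apply: has_atoms_of_atoms_ge0 => m _; rewrite /v.
  by case: ifP => _; exact: atom_ge0.
rewrite big_split_ord/=; congr (_ + _); apply: eq_bigr => i _; rewrite /v.
  by rewrite ltn_ord.
by rewrite ltnNge leq_addr/= addKn.
Qed.

Lemma pairing_nat_dirac x f : measurable_fun (`[0, +oo[ : set R) f ->
  pairing (nat_dirac x) f = f `|x|.
Proof.
by move=> mf; rewrite (pairing_has_atoms (@has_atoms_of_atoms 1 _))// big_ord1.
Qed.

Lemma pairing0 f : measurable_fun (`[0, +oo[ : set R) f ->
  pairing (nat_measure0 : nat_measure R) f = 0.
Proof.
move=> mf; rewrite (@pairing_has_atoms _ 0 (fun=> 0))// ?big_ord0//.
by move=> B mB; rewrite big_ord0.
Qed.

End integrals_over_atoms.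

(** * The Borel sets of the space of states *)

Section measurability_lemmas.
Context {R : realType}.

Lemma measurable_nat_fun d (T : measurableType d) (N : T -> nat) :
  (forall n, measurable [set t | N t = n]) -> measurable_fun setT N.
Proof.
move=> h _ B _; rewrite setTI.
have -> : N @^-1` B = \bigcup_(n in B) [set t | N t = n].
  by apply/seteqP; split=> [t Bt|t [n Bn /= Nt]]; [exists (N t)|rewrite /= Nt].
exact: bigcup_measurable.
Qed.

(** Case distinction over the countably many values of the index. *)
Lemma measurable_fun_nat_index d d' (T : measurableType d) (U : measurableType d')
    (N : T -> nat) (F : nat -> T -> U) : measurable_fun setT N ->
  (forall n, measurable_fun setT (F n)) -> measurable_fun setT (fun t => F (N t) t).
Proof.
move=> mN mF _ B mB; rewrite setTI.
have -> : (fun t => F (N t) t) @^-1` B =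
    \bigcup_n ((N @^-1` [set n]) `&` (F n @^-1` B)).
  by apply/seteqP; split=> [t Bt|t [n _ [/= ->]]]//; exists (N t).
apply: bigcupT_measurable => n; apply: measurableI.
  by rewrite -[X in measurable X]setTI; exact: mN.
by rewrite -[X in measurable X]setTI; exact: mF.
Qed.

Lemma measurable_fun_rays d (T : measurableType d) (f : T -> R) :
  (forall a, measurable [set t | f t <= a]) -> measurable_fun setT f.
Proof.
move=> h; apply: (measurability _ (RGenOInfty.measurableE R)) => _ [_ [x ->] <-].
rewrite setTI -[X in measurable X]setCK; apply: measurableC.
rewrite (_ : ~` _ = [set t | f t <= x])//; apply/seteqP; split=> t /=.
  by rewrite in_itv/= andbT => /negP; rewrite -leNgt.
by rewrite in_itv/= andbT => tx; apply/negP; rewrite -leNgt.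
Qed.

Lemma measurable_set_le d (T : measurableType d) (f g : T -> R) :
  measurable_fun setT f -> measurable_fun setT g ->
  measurable [set t | f t <= g t].
Proof.
move=> mf mg; have := measurable_fun_ler mf mg.
move=> /(_ measurableT [set true] Logic.I); rewrite setTI.
by congr measurable; apply/seteqP; split => t.
Qed.

Lemma measurable_set_lt d (T : measurableType d) (f g : T -> R) :
  measurable_fun setT f -> measurable_fun setT g ->
  measurable [set t | f t < g t].
Proof.
move=> mf mg; have := measurable_fun_ltr mf mg.
move=> /(_ measurableT [set true] Logic.I); rewrite setTI.
by congr measurable; apply/seteqP; split => t.
Qed.

Lemma measurable_fun_nonneg_norm (f : R -> R) :
  measurable_fun (`[0, +oo[ : set R) f -> measurable_fun setT (fun x : R => f `|x|).
Proof.
move=> mf; change (measurable_fun setT (f \o @Num.Def.normr R R)).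
apply: (@measurable_comp _ _ _ _ _ _ (`[0, +oo[%classic : set R)) => //.
by move=> _ [x _ <-] /=; rewrite in_itv/= andbT.
Qed.

Lemma cvg_sum_ord (T : Type) (F : set_system T) (FF : Filter F) (n : nat)
    (u : nat -> T -> R) (l : nat -> R) :
  (forall m, (m < n)%N -> u m x @[x --> F] --> l m) ->
  (\sum_(m < n) u m x) @[x --> F] --> \sum_(m < n) l m.
Proof.
elim: n => [|n IH] h.
  by under eq_fun do rewrite big_ord0; rewrite big_ord0; exact: cvg_cst.
under eq_fun do rewrite big_ord_recr/=; rewrite big_ord_recr/=.
by apply: cvgD; [apply: IH => m mn; apply: h; exact: ltnW|exact: h].
Qed.

End measurability_lemmas.

Section borel_sets_of_states.
Context {R : realType}.
Local Notation S := (nat_measure R).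
Implicit Types (mu nu : nat_measure R) (f : R -> R) (v : nat -> R) (n : nat).

Lemma bounded_continuous_measurable f : bounded_continuous f ->
  measurable_fun (`[0, +oo[ : set R) f.
Proof.
by move=> [cf _]; apply: subspace_continuous_measurable_fun => //; exact: measurable_itv.
Qed.

Lemma measurable_pairing_continuous f : bounded_continuous f ->
  measurable_fun setT (fun mu => pairing mu f).
Proof.
move=> hf.
pose h : bounded_continuous_fun R := exist _ f hf.
apply: (measurability _ (RGenOInfty.measurableE R)) => _ [_ [x ->] <-].
rewrite setTI; apply: sub_sigma_algebra.
exists [set p : {ptws bounded_continuous_fun R -> R} | p h > x].
  apply: (open_comp (f := fun p : {ptws bounded_continuous_fun R -> R} => p h)
                    (D := [set y | y > x])) => /=.
    by move=> p _; exact: (@proj_continuous _ (fun=> R) h).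
  exact: open_gt.
by apply/seteqP; split => mu /=; rewrite in_itv/= andbT.
Qed.

Lemma open_weak_near (U : set S) (w : nat -> S) mu : open U -> U mu ->
  (forall f, bounded_continuous f ->
     pairing (w k) f @[k --> \oo] --> pairing mu f) ->
  \forall k \near \oo, U (w k).
Proof.
move=> [V oV <-] Vmu cw.
have : (fun k => bounded_continuous_pairings (w k)) @ \oo -->
    (bounded_continuous_pairings mu : {ptws bounded_continuous_fun R -> R}).
  apply/cvg_sup => h; apply/cvg_image.
    by rewrite eqEsubset; split=> y // _; exists (cst y).
  move=> W hW; exists ((fun p => p h) @^-1` W).
    exact: cw (svalP h) W hW.
  by rewrite eqEsubset; split=> [y [p + <-]//|y Wy]; exists (cst y).
by apply; exact: open_nbhs_nbhs.
Qed.

(** Otherwise atoms converging to those of [mu] would give states outside [U] whose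
    pairings with all the bounded continuous functions converge to those of [mu]. *)
Lemma open_of_atoms (U : set S) mu : open U -> U mu ->
  exists k : nat, forall v,
    (forall m, (m < mass mu)%N -> 0 <= v m /\ `|v m - atom mu m| < k.+1%:R^-1) ->
    U (of_atoms (mass mu) v).
Proof.
move=> oU Umu; apply: contrapT => /forallNP h.
have {}h k : exists v, (forall m, (m < mass mu)%N ->
    0 <= v m /\ `|v m - atom mu m| < k.+1%:R^-1) /\ ~ U (of_atoms (mass mu) v).
  by have /existsNP[v /not_implyP] := h k; exists v.
have [w hw] := choice h.
suff : \forall k \near \oo, U (of_atoms (mass mu) (w k)).
  by case=> k _ /(_ k (leqnn k)); exact: (hw k).2.
apply: (open_weak_near oU Umu) => f hf.
have mf := bounded_continuous_measurable hf.
rewrite pairingE//.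
rewrite (_ : (fun k => _) = fun k => \sum_(m < mass mu) f (w k m)); last first.
  apply/funext => k; apply: pairing_has_atoms mf; apply: has_atoms_of_atoms_ge0.
  by move=> m /(hw k).1[].
apply: (@cvg_sum_ord R _ _ _ _ (fun m k => f (w k m)) (fun m => f (atom mu m))).
move=> m mm.
have /subspace_continuousP cf := hf.1.
have am : (`[0, +oo[%classic : set R) (atom mu m).
  by rewrite /= in_itv/= andbT atom_ge0.
apply: (cvg_comp _ f _ (cf _ am)) => A /= hA.
have : (fun k => w k m) @ \oo --> atom mu m.
  apply/cvgrPdist_lt => e e0; near=> k.
  have /(_ _ mm)[_] := (hw k).1.
  rewrite distrC => /lt_trans; apply.
  by near: k; exact: near_infty_natSinv_lt (PosNum e0).
move=> /(_ _ hA) /= [N _ hN]; exists N => // k /hN /=; apply.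
by rewrite in_itv/= andbT; have [] := (hw k).1 _ mm.
Unshelve. all: by end_near. Qed.

(** An open set only sees pairings, and these only see Borel sets. *)
Lemma open_same_measure (U : set S) mu nu : open U -> same_measure mu nu ->
  U mu -> U nu.
Proof.
move=> oU mn Umu.
suff : \forall k \near \oo, U nu by case=> k _ /(_ k (leqnn k)).
apply: (open_weak_near (w := fun=> nu) oU Umu) => f hf.
rewrite (same_measure_pairing mn (bounded_continuous_measurable hf)).
exact: cvg_cst.
Qed.

Section maps_into_states.
Context d (T : measurableType d) (h : T -> S).
Hypothesis mh : forall a : R, measurable_fun setT (fun t => h t `]-oo, a]%classic).

Lemma measurable_mass_of_cdf : measurable_fun setT (fun t => mass (h t)).
Proof.
apply: measurable_nat_fun => n.
have mT : measurable_fun setT (fun t => h t setT).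
  apply: (@emeasurable_fun_cvg _ _ _ setT
      (fun k t => h t (`]-oo, k%:R]%classic : set R))) => [m|t _].
    exact: mh.
  exact: cdf_cvg_total.
have := mT measurableT [set n%:R%:E] (emeasurable_set1 _); rewrite setTI.
congr measurable; apply/seteqP; split => t /=; rewrite massE.
  by move=> [] /eqP; rewrite eqr_nat => /eqP.
by move=> ->.
Qed.

Lemma measurable_atom_of_cdf m : measurable_fun setT (fun t => atom (h t) m).
Proof.
apply: measurable_fun_rays => a.
have mm : measurable [set t | (m < mass (h t))%N].
  have := measurable_mass_of_cdf measurableT
    (Y := [set n | (m < n)%N]); rewrite setTI; exact.
have -> : [set t | atom (h t) m <= a] =
    ([set t | (m < mass (h t))%N] `&`
     (fun t => h t `]-oo, a]%classic) @^-1` `[m.+1%:R%:E, +oo[%classic) `|`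
    (~` [set t | (m < mass (h t))%N] `&` [set t | 0 <= a]).
  apply/seteqP; split=> t /=.
    move=> ha; have [mt|mt] := boolP (m < mass (h t))%N.
      left; split => //; rewrite in_itv/= andbT.
        exact/(atomP a mt).
    by right; split; [exact/negP|exact: le_trans (atom_ge0 _ _) ha].
  move=> [[mt]|[mt a0]]; first by rewrite in_itv/= andbT => /(atomP a mt).
  rewrite /atom; set E := [set _ | _]; suff -> : E = set0 by rewrite inf0.
  rewrite -subset0 => x [_]; apply/negP; rewrite -ltNge.
  apply: le_lt_trans (_ : (mass (h t))%:R%:E < _)%E.
    by rewrite -massE; apply: le_measure; rewrite ?inE.
  by rewrite lte_fin ltr_nat ltnS leqNgt; exact/negP.
apply: measurableU; apply: measurableI => //.
- by rewrite -[X in measurable X]setTI; apply: mh => //; exact: emeasurable_itv.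
- exact: measurableC.
- have [a0|a0] := boolP (0 <= a).
    by rewrite (_ : [set t | _] = setT)//; apply/seteqP; split.
  by rewrite (_ : [set t | _] = set0)//; apply/seteqP; split=> // t /= /(negP a0).
Qed.

(** An open set of states with [n] atoms is a countable union of rational boxes for
    the vector of atoms, and the atoms are quantiles of the distribution function. *)
Lemma measurable_state_of_cdf : measurable_fun setT h.
Proof.
apply: (measurability (@open S)) => // _ [U oU <-]; rewrite setTI.
pose box (i : nat * seq rat * nat) mu := mass mu = i.1.1 /\
  forall m, (m < i.1.1)%N -> `|atom mu m - ratr (nth 0 i.1.2 m)| < i.2.+1%:R^-1.
have -> : h @^-1` U =
    \bigcup_(i in [set i | forall mu, box i mu -> U mu]) [set t | box i (h t)].
  apply/seteqP; split=> t /=; last by move=> [i hi]; exact: hi.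
  move=> Ut; have [k hk] := open_of_atoms oU Ut.
  have e0 : 0 < (k.*2.+1.+1)%:R^-1 :> R by rewrite invr_gt0.
  have hq m : exists q : rat, `|atom (h t) m - ratr q| < (k.*2.+1.+1)%:R^-1 :> R.
    have [|q] := @rat_in_itvoo R (atom (h t) m) (atom (h t) m + (k.*2.+1.+1)%:R^-1).
      by rewrite ltrDl.
    rewrite in_itv/= => /andP[q1 q2]; exists q.
    by rewrite distrC ger0_norm ?subr_ge0 ?ltW// ltrBlDl.
  have [q {}hq] := choice hq.
  exists (mass (h t), mkseq q (mass (h t)), k.*2.+1) => /=; last first.
    by split => // m mm; rewrite nth_mkseq.
  move=> mu [/= mass_mu hmu].
  have : U (of_atoms (mass (h t)) (atom mu)).
    apply: hk => m mm; split; first exact: atom_ge0.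
    have := hmu _ mm; rewrite nth_mkseq// => h1; have h2 := hq m.
    have -> : k.+1%:R^-1 = (k.*2.+1.+1)%:R^-1 + (k.*2.+1.+1)%:R^-1 :> R.
      rewrite -doubleS -mul2n natrM invfM -mulrDl -[in LHS](mul1r k.+1%:R^-1).
      by congr (_ * _); lra.
    rewrite distrC in h2.
    rewrite (_ : _ - _ = (atom mu m - ratr (q m)) + (ratr (q m) - atom (h t) m)).
      by apply: le_lt_trans (ler_normD _ _) _; exact: ltrD.
    by lra.
  apply: open_same_measure => // B mB; rewrite -mass_mu.
  rewrite (has_atoms_of_atoms _ _ mB) (has_atoms_atom _ mB); congr (_%:E).
  by apply: eq_bigr => m _; rewrite ger0_norm// atom_ge0.
have mbox i : measurable [set t | box i (h t)].
  have -> : [set t | box i (h t)] = [set t | mass (h t) = i.1.1] `&`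
      \bigcap_(m in [set m | (m < i.1.1)%N])
        [set t | `|atom (h t) m - ratr (nth 0 i.1.2 m)| < i.2.+1%:R^-1].
    by apply/seteqP; split=> t.
  apply: measurableI.
    have := measurable_mass_of_cdf measurableT (Y := [set i.1.1]).
    by rewrite setTI; exact.
  apply: bigcap_measurableType => m _; apply: measurable_set_lt => //.
  apply: measurableT_comp => //; apply: measurable_funB => //.
  exact: measurable_atom_of_cdf.
rewrite bigcup_mkcond.
apply: countable_bigcupT_measurable; first exact: countableP.
by move=> i; case: ifP.
Qed.

End maps_into_states.
End borel_sets_of_states.

Section bounded_functions.
Context d (T : measurableType d) {R : realType}.
Variable m : {finite_measure set T -> \bar R}.

Lemma bounded_integrable (C : R) (f : T -> R) : measurable_fun setT f ->
  (forall x, `|f x| <= C) -> m.-integrable setT (EFin \o f).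
Proof.
move=> mf fC; apply: measurable_bounded_integrable => //.
  exact: finite_measure_lty.
exists C; split; first exact: num_real.
by move=> y Cy x _ /=; apply: le_trans (fC x) (ltW Cy).
Qed.

Lemma bounded_cvg_integral (C : R) (f_ : nat -> T -> R) (f : T -> R) :
  (forall n, measurable_fun setT (f_ n)) -> (forall n x, `|f_ n x| <= C) ->
  (forall x, f_ n x @[n --> \oo] --> f x) ->
  (\int[m]_x (f_ n x)%:E)%E @[n --> \oo] --> (\int[m]_x (f x)%:E)%E.
Proof.
move=> mf fC ff; apply: (@dominated_cvg _ _ _ m setT _ _ _ (cst C%:E)) => //.
- by move=> n; exact/measurable_EFinP.
- by move=> x _; apply: cvg_EFin; [exact: nearW|exact: ff].
- by apply: (@bounded_integrable `|C|) => // x.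
- by move=> n x _; rewrite lee_fin.
Qed.

End bounded_functions.

Section state_measurability.
Context {R : realType}.
Local Notation S := (nat_measure R).
Implicit Types (mu nu : nat_measure R) (f : R -> R) (v : nat -> R) (n : nat).

(** Continuous, equal to 1 before [a], and decreasing to 0 after [a] as [k] grows. *)
Definition decay (a : R) (k : nat) : R -> R :=
  fun x => expR (- (`|x - a| + (x - a))) ^+ k.

Lemma decay_continuous a k : bounded_continuous (decay a k).
Proof.
split.
  apply: continuous_subspaceT.
  have -> : decay a k = expR \o (fun x => k%:R * - (`|x - a| + (x - a))).
    by apply/funext => x; rewrite /decay /= expRM_natl.
  move=> x; apply: continuous_comp; last exact: continuous_expR.
  apply: cvgM; first exact: cvg_cst.
  apply: cvgN; apply: cvgD; last by apply: cvgB; [exact: cvg_id|exact: cvg_cst].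
  by apply: cvg_norm; apply: cvgB; [exact: cvg_id|exact: cvg_cst].
exists 1 => x _; rewrite ger0_norm ?exprn_ge0 ?expR_ge0//.
rewrite exprn_ile1 ?expR_ge0// expR_le1 oppr_le0.
by have := ler_norm (a - x); rewrite distrC; lra.
Qed.

Lemma decay_cvg a x : decay a k x @[k --> \oo] --> ((x <= a)%R%:R : R).
Proof.
rewrite /decay; have [xa|ax] := leP x a.
  rewrite ler0_norm ?subr_le0// addrC subrr oppr0 expR0.
  by under eq_fun do rewrite expr1n; exact: cvg_cst.
apply: cvg_expr; rewrite ger0_norm ?expR_ge0// expR_lt1 oppr_lt0.
by rewrite ger0_norm ?subr_ge0 ?ltW// addr_gt0 ?subr_gt0.
Qed.

Lemma measurable_cdf (a : R) : measurable_fun setT (fun mu => mu `]-oo, a]%classic).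
Proof.
under eq_fun do rewrite nat_measure_cdfE.
apply/measurable_EFinP.
apply: (@measurable_fun_cvg _ _ _ setT (fun k mu => pairing mu (decay a k))).
  by move=> k; exact: measurable_pairing_continuous (decay_continuous a k).
move=> mu _.
under eq_fun do rewrite (pairingE _ (bounded_continuous_measurable (decay_continuous _ _))).
apply: (@cvg_sum_ord R _ _ _ _ (fun m k => decay a k (atom mu m))
  (fun m => (atom mu m <= a)%R%:R)) => m _.
exact: decay_cvg.
Qed.

Lemma measurable_mass : measurable_fun setT (@mass R).
Proof. exact: (measurable_mass_of_cdf measurable_cdf). Qed.

Lemma measurable_atom m : measurable_fun setT (fun mu => atom mu m).
Proof. exact: (measurable_atom_of_cdf measurable_cdf). Qed.

Section maps.
Context d (T : measurableType d).

Lemma measurable_mass_comp (h : T -> S) : measurable_fun setT h ->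
  measurable_fun setT (fun t => mass (h t)).
Proof. by move=> mh; apply: (measurableT_comp measurable_mass). Qed.

Lemma measurable_atom_comp (h : T -> S) m : measurable_fun setT h ->
  measurable_fun setT (fun t => atom (h t) m).
Proof. by move=> mh; apply: (measurableT_comp (measurable_atom m)). Qed.

Lemma measurable_sum_atoms (h : T -> S) (f : T * R -> R) :
  measurable_fun setT h -> measurable_fun setT f ->
  measurable_fun setT (fun t => \sum_(m < mass (h t)) f (t, atom (h t) m)).
Proof.
move=> mh mf; apply: (@measurable_fun_nat_index _ _ _ _ (fun t => mass (h t))
  (fun n t => \sum_(m < n) f (t, atom (h t) m))).
  exact: measurable_mass_comp.
move=> n; apply: measurable_sum => m; apply: measurableT_comp => //.
by apply: measurable_fun_pair => //; exact: measurable_atom_comp.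
Qed.

Lemma measurable_of_atoms (N : T -> nat) (v : T -> nat -> R) :
  measurable_fun setT N -> (forall m, measurable_fun setT (v ^~ m)) ->
  measurable_fun setT (fun t => of_atoms (N t) (v t)).
Proof.
move=> mN mv; apply: measurable_state_of_cdf => a.
rewrite (_ : (fun t => _) =
    fun t => (\sum_(m < N t) (`|v t m| <= a)%R%:R)%:E); last first.
  apply/funext => t; rewrite (has_atoms_of_atoms _ _ (measurable_itv _)).
  by congr (_%:E); apply: eq_bigr => m _; rewrite indicE mem_setE in_itv.
apply/measurable_EFinP; apply: (@measurable_fun_nat_index _ _ _ _ N
  (fun n t => \sum_(m < n) (`|v t m| <= a)%R%:R : R)) => // n.
apply: measurable_sum => m.
rewrite (_ : (fun t => _) = \1_[set t | `|v t m| <= a]).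
  apply: measurable_indic; apply: measurable_set_le => //.
  by apply: measurableT_comp => //; exact: mv.
by apply/funext => t; rewrite indicE mem_setE.
Qed.

Lemma measurable_nat_add (g h : T -> S) : measurable_fun setT g ->
  measurable_fun setT h -> measurable_fun setT (fun t => nat_add (g t) (h t)).
Proof.
move=> mg mh; apply: measurable_of_atoms.
  by apply: measurable_fun_addn; exact: measurable_mass_comp.
move=> m; apply: (@measurable_fun_nat_index _ _ _ _ (fun t => mass (g t))
  (fun n t => if (m < n)%N then atom (g t) m else atom (h t) (m - n)%N)).
  exact: measurable_mass_comp.
by move=> n /=; case: (m < n)%N; exact: measurable_atom_comp.
Qed.

Lemma measurable_nat_dirac (x : T -> R) : measurable_fun setT x ->
  measurable_fun setT (fun t => nat_dirac (x t)).
Proof. by move=> mx; apply: measurable_of_atoms. Qed.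

Lemma measurable_age_shift (q : T -> R) (h : T -> S) : measurable_fun setT q ->
  measurable_fun setT h -> measurable_fun setT (fun t => age_shift (q t) (h t)).
Proof.
move=> mq mh; apply: measurable_of_atoms; first exact: measurable_mass_comp.
by move=> m; apply: measurable_funD => //; exact: measurable_atom_comp.
Qed.

Lemma measurable_pairing_comp (h : T -> S) f : measurable_fun setT h ->
  measurable_fun (`[0, +oo[ : set R) f ->
  measurable_fun setT (fun t => pairing (h t) f).
Proof.
move=> mh mf.
rewrite (_ : (fun t => _) =
    fun t => \sum_(m < mass (h t)) f `|(t, atom (h t) m).2|); last first.
  apply/funext => t; rewrite pairingE//.
  by apply: eq_bigr => m _; rewrite ger0_norm// atom_ge0.
apply: (measurable_sum_atoms (f := fun p => f `|p.2|)) => //.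
by apply: (measurableT_comp (measurable_fun_nonneg_norm mf)).
Qed.

Lemma measurable_state_of_pairing (h : T -> S) :
  (forall f, bounded_continuous f -> measurable_fun setT (fun t => pairing (h t) f)) ->
  measurable_fun setT h.
Proof.
move=> hf; apply: measurable_state_of_cdf => a.
under eq_fun do rewrite nat_measure_cdfE.
apply/measurable_EFinP.
apply: (@measurable_fun_cvg _ _ _ setT (fun k t => pairing (h t) (decay a k))).
  by move=> k; exact: hf (decay_continuous a k).
move=> t _.
under eq_fun do rewrite (pairingE _ (bounded_continuous_measurable (decay_continuous _ _))).
apply: (@cvg_sum_ord R _ _ _ _ (fun m k => decay a k (atom (h t) m))
  (fun m => (atom (h t) m <= a)%R%:R)) => m _.
exact: decay_cvg.
Qed.

End maps.

(** The bounded continuous functions [decay a k] recover the distribution function. *)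
Lemma same_measure_of_pairing mu nu :
  (forall f, bounded_continuous f -> pairing mu f = pairing nu f) ->
  same_measure mu nu.
Proof.
move=> h; apply: same_measure_cdf => a; rewrite !nat_measure_cdfE; congr (_%:E).
have c (s : S) : pairing s (decay a k) @[k --> \oo] -->
    (\sum_(m < mass s) (atom s m <= a)%R%:R : R).
  under eq_fun do rewrite (pairingE _ (bounded_continuous_measurable (decay_continuous _ _))).
  apply: (@cvg_sum_ord R _ _ _ _ (fun m k => decay a k (atom s m))
    (fun m => (atom s m <= a)%R%:R)) => m _.
  exact: decay_cvg.
rewrite -(cvg_lim _ (c mu))// -(cvg_lim _ (c nu))//; congr (lim _).
by under eq_fun do rewrite (h _ (decay_continuous _ _)).
Qed.

End state_measurability.

(** * Laplace functionals *)

Section laplace_functionals.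
Context {R : realType}.
Local Notation S := (nat_measure R).
Implicit Types (mu nu : nat_measure R) (f : R -> R).

Definition laplace f mu : R := expR (- pairing mu f).

Lemma pairing_ge0 f mu : bounded_borel_nonneg f -> 0 <= pairing mu f.
Proof.
by move=> [mf _ f0]; rewrite pairingE// sumr_ge0// => m _; rewrite f0// atom_ge0.
Qed.

Lemma laplace_gt0 f mu : 0 < laplace f mu.
Proof. exact: expR_gt0. Qed.

Lemma laplace_le1 f mu : bounded_borel_nonneg f -> laplace f mu <= 1.
Proof. by move=> hf; rewrite /laplace expR_le1 oppr_le0 pairing_ge0. Qed.

Lemma measurable_laplace f : measurable_fun (`[0, +oo[ : set R) f ->
  measurable_fun setT (laplace f).
Proof.
move=> mf; apply: measurableT_comp; first exact: measurable_expR.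
by apply: measurable_funN; apply: (measurable_pairing_comp (h := id)).
Qed.

Definition count_le (a : R) mu : nat := (\sum_(m < mass mu) (atom mu m <= a)%R)%N.

Lemma count_leE a mu : mu `]-oo, a]%classic = (count_le a mu)%:R%:E.
Proof. by rewrite nat_measure_cdfE natr_sum. Qed.

Lemma measurable_count_le_eq a k : measurable [set mu | count_le a mu = k].
Proof.
have := @measurable_cdf R a measurableT [set k%:R%:E] (emeasurable_set1 _).
rewrite setTI; congr measurable; apply/seteqP; split => mu /=; rewrite count_leE.
  by move=> [] /eqP; rewrite eqr_nat => /eqP.
by move=> ->.
Qed.

Lemma bounded_borel_nonnegD (f g : R -> R) : bounded_borel_nonneg f ->
  bounded_borel_nonneg g -> bounded_borel_nonneg (f \+ g).
Proof.
move=> [mf [C hC] f0] [mg [D hD] g0]; split; first exact: measurable_funD.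
  exists (C + D) => x x0; apply: le_trans (ler_normD _ _) _.
  by apply: lerD; [exact: hC|exact: hD].
by move=> x x0; apply: addr_ge0; [exact: f0|exact: g0].
Qed.

Lemma bounded_borel_nonneg_step (a : R) (n : nat) :
  bounded_borel_nonneg (fun x => n%:R * (x <= a)%R%:R).
Proof.
split.
- apply: measurable_funTS; apply: measurable_funM => //.
  rewrite (_ : (fun x => _) = \1_(`]-oo, a]%classic : set R)).
    exact: measurable_indic.
  by apply/funext => t; rewrite indicE mem_setE in_itv.
- by exists n%:R => x _; rewrite ger0_norm ?mulr_ge0//; case: (x <= a); rewrite ?mulr1 ?mulr0 ?ler0n.
- by move=> x _; rewrite mulr_ge0.
Qed.

Lemma laplaceD f g mu : measurable_fun (`[0, +oo[ : set R) f ->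
  measurable_fun (`[0, +oo[ : set R) g ->
  laplace (f \+ g) mu = laplace f mu * laplace g mu.
Proof.
move=> mf mg; rewrite /laplace -expRD -opprD; congr (expR (- _)).
rewrite !pairingE//; first by rewrite -big_split.
exact: measurable_funD.
Qed.

Lemma laplace_step (a : R) (n : nat) mu :
  laplace (fun x => n%:R * (x <= a)%R%:R) mu = expR (- (n * count_le a mu)%:R).
Proof.
rewrite /laplace pairingE; last by have [] := bounded_borel_nonneg_step a n.
by rewrite -mulr_sumr natrM natr_sum.
Qed.

Lemma laplace0 mu : laplace (fun=> 0) mu = 1.
Proof. by rewrite /laplace pairingE// big1 ?oppr0 ?expR0. Qed.

Lemma bounded_borel_nonneg0 : bounded_borel_nonneg (fun=> 0 : R).
Proof. by split => //; exists 0 => x _; rewrite normr0. Qed.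

Section determination.
Variables m1 m2 : {finite_measure set S -> \bar R}.
Hypothesis m12 : forall f, bounded_borel_nonneg f ->
  (\int[m1]_mu (laplace f mu)%:E = \int[m2]_mu (laplace f mu)%:E)%E.

Let agree (phi : S -> R) := [/\ measurable_fun setT phi, (forall mu, 0 <= phi mu <= 1) &
  forall f, bounded_borel_nonneg f ->
    (\int[m1]_mu (phi mu * laplace f mu)%:E = \int[m2]_mu (phi mu * laplace f mu)%:E)%E].

Let agree1 : agree (fun=> 1).
Proof.
split => [//|mu|f hf]; first by rewrite ler01 lexx.
by under eq_integral do rewrite mul1r; rewrite m12//; under [in RHS]eq_integral do rewrite mul1r.
Qed.

Let agree_bound phi f mu : agree phi -> bounded_borel_nonneg f ->
  `|phi mu * laplace f mu| <= 1.
Proof.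
move=> [_ p01 _] hf; have /andP[p0 p1] := p01 mu.
rewrite ger0_norm ?mulr_ge0 ?(ltW (laplace_gt0 _ _))//.
by rewrite mulr_ile1 ?laplace_le1// ltW// laplace_gt0.
Qed.

Let agree_measurable phi f : agree phi -> bounded_borel_nonneg f ->
  measurable_fun setT (fun mu => phi mu * laplace f mu).
Proof.
by move=> [mp _ _] [mf _ _]; apply: measurable_funM => //; exact: measurable_laplace.
Qed.

(** On the states with at least [k] atoms in [[0, a]], the functionals
    [expR (n (k - count))] decrease to the indicator of [count = k]. *)
Let agree_eq (a : R) (k : nat) phi : agree (fun mu => phi mu * (k <= count_le a mu)%N%:R) ->
  (forall mu, 0 <= phi mu <= 1) -> measurable_fun setT phi ->
  agree (fun mu => phi mu * (count_le a mu == k)%:R).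
Proof.
move=> ak p01 mp; split.
- apply: measurable_funM => //.
  rewrite (_ : (fun x => _) = \1_[set mu | count_le a mu = k]).
    by apply: measurable_indic; exact: measurable_count_le_eq.
  apply/funext => mu; rewrite indicE; congr (nat_of_bool _)%:R.
  by apply/eqP/idP; rewrite inE.
- move=> mu; case: eqP => _; rewrite ?mulr1 ?mulr0 ?ler01 ?lexx//; exact: p01.
move=> f hf.
pose u n mu := expR ((n * k)%:R) * (phi mu * (k <= count_le a mu)%N%:R *
   laplace (f \+ (fun x => n%:R * (x <= a)%R%:R)) mu).
have mf : measurable_fun (`[0, +oo[ : set R) f by have [] := hf.
have uE n mu : u n mu = phi mu * laplace f mu * (k <= count_le a mu)%N%:R *
    expR (- (1 * (count_le a mu - k)%:R)) ^+ n.
  rewrite /u; have [kc|_] := boolP (k <= count_le a mu)%N; last first.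
    by rewrite !(mulr0, mul0r).
  rewrite laplaceD//; last by have [] := bounded_borel_nonneg_step a n.
  rewrite laplace_step !mulr1 mul1r -expRM_natl mulrN -natrM -[in LHS](subnK kc).
  rewrite mulnDr natrD opprD expRD.
  rewrite [X in _ * X](_ : _ = (phi mu * laplace f mu * expR (- (n * (count_le a mu - k))%:R)) * expR (- (n * k)%:R)); last by ring.
  by rewrite mulrCA -expRD subrr expR0 mulr1.
have cu mu : u n mu @[n --> \oo] --> phi mu * (count_le a mu == k)%:R * laplace f mu.
  under eq_fun do rewrite uE mul1r.
  have [ck|] := eqVneq (count_le a mu) k.
    rewrite ck leqnn !mulr1 subnn oppr0 expR0.
    by under eq_fun do rewrite expr1n mulr1; exact: cvg_cst.
  have [kc ck|kc _] := boolP (k <= count_le a mu)%N; last first.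
    by under eq_fun do rewrite mulr0 mul0r; rewrite mulr0 mul0r; exact: cvg_cst.
  rewrite mulr0 mul0r -(mulr0 (phi mu * laplace f mu * 1)).
  apply: cvgMl_tmp; apply: cvg_expr.
  rewrite ger0_norm ?expR_ge0// expR_lt1 oppr_lt0 ltr0n subn_gt0.
  by rewrite ltn_neqAle eq_sym ck.
have mu_ n : measurable_fun setT (u n).
  apply: measurable_funM => //; apply: agree_measurable => //.
  by apply: bounded_borel_nonnegD => //; exact: bounded_borel_nonneg_step.
have ub n mu : `|u n mu| <= 1.
  rewrite uE normrM -[leRHS]mulr1; apply: ler_pM => //.
    rewrite mulrAC; exact: (agree_bound mu ak hf).
  rewrite normrX exprn_ile1// ger0_norm ?expR_ge0// expR_le1 oppr_le0.
suff e n : (\int[m1]_mu (u n mu)%:E = \int[m2]_mu (u n mu)%:E)%E.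
  have c1 := bounded_cvg_integral (m := m1) mu_ ub cu.
  have c2 := bounded_cvg_integral (m := m2) mu_ ub cu.
  rewrite -(cvg_lim _ c1)// -(cvg_lim _ c2)//; congr (lim _).
  by under eq_fun do rewrite e.
rewrite /u.
have hfn : bounded_borel_nonneg (f \+ (fun x => n%:R * (x <= a)%R%:R)).
  by apply: bounded_borel_nonnegD => //; exact: bounded_borel_nonneg_step.
under eq_integral do rewrite EFinM; under [in RHS]eq_integral do rewrite EFinM.
rewrite !integralZl//.
- by have [_ _ ->] := ak.
- apply: (@bounded_integrable _ _ _ m2 1 _ (agree_measurable ak hfn)) => mu.
  exact: (agree_bound mu ak hfn).
- apply: (@bounded_integrable _ _ _ m1 1 _ (agree_measurable ak hfn)) => mu.
  exact: (agree_bound mu ak hfn).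
Qed.

Let agree_ge (a : R) phi : agree phi ->
  forall k, agree (fun mu => phi mu * (k <= count_le a mu)%N%:R).
Proof.
move=> ap; have [mp p01 _] := ap; elim=> [|k IH].
  by under eq_fun do rewrite mulr1.
have ae := agree_eq IH p01 mp.
have e mu : phi mu * (k < count_le a mu)%N%:R =
   phi mu * (k <= count_le a mu)%N%:R - phi mu * (count_le a mu == k)%:R.
  by case: (ltngtP k (count_le a mu)) => _ /=; ring.
split.
- under eq_fun do rewrite e.
  by apply: measurable_funB; [case: IH|case: ae].
- move=> mu; case: (_ < _)%N; rewrite ?mulr1 ?mulr0 ?ler01 ?lexx//; exact: p01.
move=> f hf.
have i1 (m : {finite_measure set S -> \bar R}) psi : agree psi ->
    m.-integrable setT (EFin \o (fun mu => psi mu * laplace f mu)).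
  by move=> h; apply: (@bounded_integrable _ _ _ m 1 _ (agree_measurable h hf)) => mu;
    exact: (agree_bound mu h hf).
under eq_integral do rewrite e mulrBl EFinB.
under [in RHS]eq_integral do rewrite e mulrBl EFinB.
rewrite !integralB_EFin//; [|exact: i1..].
have [_ _ h1] := IH; have [_ _ h2] := ae.
by congr (_ - _)%E; [exact: h1|exact: h2].
Qed.

(** Both measures give the same mass to the events that prescribe the numbers of atoms
    in finitely many intervals [[0, a]]: starting from Laplace functionals,
    multiplying by the indicator of [count_le a = k] preserves the equality of all the
    integrals. These events form a pi-system that generates the Borel sets. *)
Lemma laplace_determines B : measurable B -> m1 B = m2 B.
Proof.
pose cyl (l : seq (R * nat)) : set S := [set mu | all (fun p => count_le p.1 mu == p.2) l].
have acyl l : agree (fun mu => (all (fun p => count_le p.1 mu == p.2) l)%:R).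
  elim: l => [|[a k] l IH]; first exact: agree1.
  under eq_fun do rewrite /= -mulnb natrM mulrC.
  by apply: agree_eq; [exact: agree_ge|case: IH|case: IH].
have mcyl l : measurable (cyl l).
  elim: l => [|[a k] l IH]; first by rewrite (_ : cyl _ = setT)//; apply/seteqP; split.
  rewrite (_ : cyl _ = [set mu | count_le a mu = k] `&` cyl l).
    by apply: measurableI => //; exact: measurable_count_le_eq.
  apply/seteqP; split => mu; rewrite /cyl /=.
    by move=> /andP[/eqP].
  by move=> [-> ->]; rewrite eqxx.
have cylE (m : {finite_measure set S -> \bar R}) l : m (cyl l) =
   (\int[m]_mu ((all (fun p => count_le p.1 mu == p.2) l)%:R * laplace (fun=> 0) mu)%:E)%E.
  rewrite -[cyl l]setIT -integral_indic//.
  apply: eq_integral => mu _; rewrite laplace0 mulr1 indicE; congr (nat_of_bool _)%:R%:E.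
  by apply/idP/idP; rewrite inE.
apply: (measure_unique (range cyl) (fun=> cyl [::])) => //.
- rewrite eqEsubset; split; last first.
    by apply: smallest_sub; [exact: sigma_algebra_measurable|move=> _ [l _ <-]].
  move=> A mA.
  pose T := g_sigma_algebraType (range cyl).
  have mid : measurable_fun (setT : set T) (id : T -> S).
    apply: measurable_state_of_cdf => a.
    rewrite (_ : (fun t => _) = fun t : T => (count_le a (t : S))%:R%:E); last first.
      by apply/funext => t; exact: count_leE.
    have mc : measurable_fun (setT : set T) (count_le a : T -> nat).
      apply: measurable_nat_fun => n; apply: sub_sigma_algebra; exists [:: (a, n)] => //.
      apply/seteqP; split => mu; rewrite /cyl /=.
        by rewrite andbT => /eqP.
      by move=> ->; rewrite eqxx.
    by apply/measurable_EFinP; exact: (measurable_fun_nat_index (F := fun n _ => n%:R : R) mc).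
  by have := mid measurableT A mA; rewrite setTI.
- move=> _ _ [l1 _ <-] [l2 _ <-]; exists (l1 ++ l2) => //.
  by apply/seteqP; split => mu; rewrite /cyl /= all_cat => /andP.
- by apply/seteqP; split => // mu _; exists 0%N.
- move=> _ [l _ <-]; apply: (etrans (cylE m1 l)); apply: etrans (esym (cylE m2 l)).
  by have [_ _] := acyl l; apply; exact: bounded_borel_nonneg0.
- by move=> _; exact: finite_measure_lty.
Qed.

End determination.

End laplace_functionals.

(** * Offspring laws and uniqueness for the cumulant equation *)

Lemma measurable_fun_pair_on d d1 d2 (T : measurableType d) (T1 : measurableType d1)
    (T2 : measurableType d2) (D : set T) (f : T -> T1) (g : T -> T2) :
  measurable_fun D f -> measurable_fun D g -> measurable_fun D (fun t => (f t, g t)).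
Proof.
move=> mf mg mD; apply: (measurability _ (measurable_prod_measurableType T1 T2)) => //.
move=> _ [_ [A mA [B mB <-]] <-].
rewrite (_ : D `&` _ = (D `&` f @^-1` A) `&` (D `&` g @^-1` B)).
  by apply: measurableI; [exact: mf|exact: mg].
by apply/seteqP; split => t /=; tauto.
Qed.

Section offspring.
Context {R : realType}.
Variable p : R -> nat -> R.
Hypothesis hp : offspring_law p.

Lemma offspring_ge0 x i : 0 <= x -> 0 <= p x i.
Proof. by move=> x0; case: hp => h _ _ _; exact: h. Qed.

Lemma offspring_partial_le1 x n : 0 <= x -> \sum_(i < n) p x i <= 1.
Proof.
move=> x0; rewrite -lee_fin -sumEFin; have [h0 h1 _ _] := hp.
rewrite -(h1 x x0) -(big_mkord predT (fun i => (p x i)%:E)).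
by apply: nneseries_lim_ge => i _ _; rewrite lee_fin h0.
Qed.

Lemma offspring_le1 x i : 0 <= x -> p x i <= 1.
Proof.
move=> x0; apply: le_trans (offspring_partial_le1 i.+1 x0).
rewrite big_ord_recr/= lerDr sumr_ge0// => j _; exact: offspring_ge0.
Qed.

Lemma offspring_mean : exists2 m, 0 <= m &
  forall x, 0 <= x -> forall n, \sum_(i < n) i%:R * p x i <= m.
Proof.
have [h0 _ _ h3] := hp; set s := ereal_sup _ in h3.
have s0 : (0 <= s)%E.
  apply: le_trans (_ : (\sum_(1 <= i <oo) (i%:R * p 0 i)%:E <= s)%E).
    by apply: nneseries_ge0 => i _ _; rewrite lee_fin mulr_ge0// h0.
  by apply: ereal_sup_ubound; exists 0 => //=; rewrite in_itv/= lexx.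
exists (fine s); first exact: fine_ge0.
move=> x x0 n; rewrite -lee_fin fineK ?ge0_fin_numE// -sumEFin.
apply: le_trans (_ : (\sum_(1 <= i <oo) (i%:R * p x i)%:E <= s)%E); last first.
  by apply: ereal_sup_ubound; exists x => //=; rewrite in_itv/= andbT.
case: n => [|n].
  by rewrite big_ord0; apply: nneseries_ge0 => i _ _; rewrite lee_fin mulr_ge0// h0.
rewrite -(big_mkord predT (fun i => (i%:R * p x i)%:E)) big_ltn// mul0r add0e.
by apply: nneseries_lim_ge => i _ _; rewrite lee_fin mulr_ge0// h0.
Qed.

Definition pgf_trunc x z n := \sum_(i < n) p x i * z ^+ i.

Lemma pgf_trunc_le x z n k : 0 <= x -> 0 <= z -> (n <= k)%N ->
  pgf_trunc x z n <= pgf_trunc x z k.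
Proof.
move=> x0 z0 nk; rewrite /pgf_trunc -!(big_mkord predT (fun i => p x i * z ^+ i)).
rewrite (big_cat_nat _ nk)//= lerDl sumr_ge0// => i _.
by rewrite mulr_ge0 ?exprn_ge0// offspring_ge0.
Qed.

Lemma pgf_trunc_ge0 x z n : 0 <= x -> 0 <= z -> 0 <= pgf_trunc x z n.
Proof.
by move=> x0 z0; apply: sumr_ge0 => i _; rewrite mulr_ge0 ?exprn_ge0// offspring_ge0.
Qed.

Lemma pgf_trunc_le1 x z n : 0 <= x -> 0 <= z <= 1 -> pgf_trunc x z n <= 1.
Proof.
move=> x0 /andP[z0 z1]; apply: le_trans (offspring_partial_le1 n x0).
apply: ler_sum => i _; rewrite -[leRHS]mulr1 ler_wpM2l ?offspring_ge0//.
exact: exprn_ile1.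
Qed.

Lemma pgf_cvg x z : 0 <= x -> 0 <= z <= 1 -> pgf_trunc x z n @[n --> \oo] --> pgf p x z.
Proof.
move=> x0 z01; have /andP[z0 z1] := z01; rewrite /pgf.
have -> : series (fun i => p x i * z ^+ i) = pgf_trunc x z.
  by apply/funext => n; rewrite /series /= big_mkord.
apply: nondecreasing_is_cvgn; first by move=> n k; exact: pgf_trunc_le.
by exists 1 => _ [n _ <-]; exact: pgf_trunc_le1.
Qed.

Lemma pgf_trunc_le_pgf x z n : 0 <= x -> 0 <= z <= 1 -> pgf_trunc x z n <= pgf p x z.
Proof.
move=> x0 z01; have /andP[z0 z1] := z01; have c := pgf_cvg x0 z01.
rewrite -(cvg_lim _ c)//; apply: nondecreasing_cvgn_le.
  by move=> i j; exact: pgf_trunc_le.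
by apply/cvg_ex; eexists; exact: c.
Qed.

Lemma pgf_le x z b : 0 <= x -> 0 <= z <= 1 -> (forall n, pgf_trunc x z n <= b) ->
  pgf p x z <= b.
Proof.
move=> x0 z01 h; have c := pgf_cvg x0 z01; rewrite -(cvg_lim _ c)//.
by apply: limr_le; [apply/cvg_ex; eexists; exact: c|exact: nearW].
Qed.

Lemma pgf_ge0 x z : 0 <= x -> 0 <= z <= 1 -> 0 <= pgf p x z.
Proof.
move=> x0 z01; apply: le_trans (pgf_trunc_le_pgf 0 x0 z01).
by rewrite /pgf_trunc big_ord0.
Qed.

Lemma pgf_le1 x z : 0 <= x -> 0 <= z <= 1 -> pgf p x z <= 1.
Proof. by move=> x0 z01; apply: pgf_le => // n; exact: pgf_trunc_le1. Qed.

Lemma pgf1 x : 0 <= x -> pgf p x 1 = 1.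
Proof.
move=> x0; have [h0 h1 _ _] := hp.
have z01 : 0 <= (1 : R) <= 1 by rewrite ler01 lexx.
apply/eqP; rewrite eq_le pgf_le1//= -lee_fin -(h1 x x0).
apply: lime_le.
  by apply: is_cvg_nneseries => i _ _; rewrite lee_fin h0.
apply: nearW => n; rewrite big_mkord sumEFin lee_fin.
apply: le_trans (pgf_trunc_le_pgf n x0 z01).
by apply: ler_sum => i _; rewrite expr1n mulr1.
Qed.

(** The weights sum to at most one, so the terms after the first [n] contribute at
    most [z ^+ n]. *)
Lemma pgf_remainder_power x z n : 0 <= x -> 0 <= z <= 1 ->
  pgf p x z <= pgf_trunc x z n + z ^+ n.
Proof.
move=> x0 z01; have /andP[z0 z1] := z01; apply: pgf_le => // k.
have [kn|/ltnW nk] := leqP k n.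
  by apply: le_trans (pgf_trunc_le x0 z0 kn) _; rewrite lerDl exprn_ge0.
rewrite /pgf_trunc -!(big_mkord predT (fun i => p x i * z ^+ i)).
rewrite (big_cat_nat _ nk)//= lerD2l.
apply: le_trans (_ : \sum_(n <= i < k) p x i * z ^+ n <= _).
  rewrite big_nat_cond [leRHS]big_nat_cond; apply: ler_sum => i /andP[/andP[ni _] _].
  by rewrite ler_wpM2l ?offspring_ge0// ler_wiXn2l.
rewrite -mulr_suml -[leRHS]mul1r ler_wpM2r ?exprn_ge0//.
apply: le_trans (offspring_partial_le1 k x0).
rewrite -[leRHS](big_mkord predT (fun i => p x i)) [leRHS](big_cat_nat _ nk)//=.
rewrite lerDr sumr_ge0//.
by move=> i _; exact: offspring_ge0.
Qed.

Variable m : R.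
Hypothesis hm : forall x, 0 <= x -> forall n, \sum_(i < n) i%:R * p x i <= m.

(** Markov inequality for the offspring number. *)
Lemma pgf_remainder_mean x z n : 0 <= x -> 0 <= z <= 1 ->
  pgf p x z <= pgf_trunc x z n.+1 + m / n.+1%:R.
Proof.
move=> x0 z01; have /andP[z0 z1] := z01; apply: pgf_le => // k.
have m0 : 0 <= m by have := hm x0 0; rewrite big_ord0.
have [kn|/ltnW nk] := leqP k n.+1.
  by apply: le_trans (pgf_trunc_le x0 z0 kn) _; rewrite lerDl divr_ge0.
rewrite /pgf_trunc -!(big_mkord predT (fun i => p x i * z ^+ i)).
rewrite (big_cat_nat _ nk)//= lerD2l ler_pdivlMr ?ltr0n// mulrC mulr_sumr.
apply: le_trans (hm x0 k).
rewrite -[leRHS](big_mkord predT (fun i => i%:R * p x i)) [leRHS](big_cat_nat _ nk)//=.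
rewrite -[leLHS]add0r lerD ?sumr_ge0//.
  by move=> i _; rewrite mulr_ge0 ?offspring_ge0.
rewrite big_nat_cond [leRHS]big_nat_cond; apply: ler_sum => i /andP[/andP[ni _] _].
rewrite ler_pM ?mulr_ge0 ?exprn_ge0 ?offspring_ge0 ?ler_nat//.
by rewrite -[leRHS]mulr1 ler_wpM2l ?offspring_ge0// exprn_ile1.
Qed.

Lemma expr_lipschitz (z w : R) i : 0 <= z <= 1 -> 0 <= w <= 1 ->
  `|z ^+ i - w ^+ i| <= i%:R * `|z - w|.
Proof.
move=> /andP[z0 z1] /andP[w0 w1]; elim: i => [|i IH]; first by rewrite subrr normr0 mul0r.
rewrite (_ : _ - _ = z * (z ^+ i - w ^+ i) + (z - w) * w ^+ i); last first.
  by rewrite !exprS; ring.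
apply: le_trans (ler_normD _ _) _; rewrite !normrM -natr1 mulrDl mul1r.
apply: lerD.
  apply: le_trans IH; rewrite -[leRHS]mul1r ler_wpM2r// ger0_norm//.
rewrite -[leRHS]mulr1 ler_wpM2l// ger0_norm ?exprn_ge0//; exact: exprn_ile1.
Qed.

(** The derivative of the generating function on [[0, 1]] is at most the mean. *)
Lemma pgf_lipschitz x z w : 0 <= x -> 0 <= z <= 1 -> 0 <= w <= 1 ->
  `|pgf p x z - pgf p x w| <= m * `|z - w|.
Proof.
move=> x0 z01 w01.
have c : `|pgf_trunc x z n - pgf_trunc x w n| @[n --> \oo] --> `|pgf p x z - pgf p x w|.
  by apply: cvg_norm; apply: cvgB; exact: pgf_cvg.
rewrite -(cvg_lim _ c)//; apply: limr_le; first by apply/cvg_ex; eexists; exact: c.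
apply: nearW => n; rewrite -sumrB; apply: le_trans (ler_norm_sum _ _ _) _.
apply: le_trans (_ : (\sum_(i < n) i%:R * p x i) * `|z - w| <= _); last first.
  by rewrite ler_wpM2r// hm.
rewrite mulr_suml; apply: ler_sum => i _.
rewrite -mulrBr normrM ger0_norm ?offspring_ge0// mulrAC mulrC ler_wpM2r ?offspring_ge0//.
exact: expr_lipschitz.
Qed.

Lemma measurable_pgf_comp d (T : measurableType d) (D : set T) (a b : T -> R) :
  measurable D -> measurable_fun D a -> measurable_fun D b ->
  (forall t, D t -> 0 <= a t) -> (forall t, D t -> 0 <= b t <= 1) ->
  measurable_fun D (fun t => pgf p (a t) (b t)).
Proof.
move=> mD ma mb a0 b01; have [_ _ mg _] := hp.
apply: (measurable_comp _ _ mg (g := fun t => (a t, b t))).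
- by apply: measurableX; exact: measurable_itv.
- move=> _ [t Dt <-]; split => /=; rewrite in_itv/=; last exact: b01.
  by rewrite a0.
- exact: measurable_fun_pair_on.
Qed.

(** The joint measurability of the generating function gives that of its coefficients,
    recovered one at a time from their values at small arguments. *)
Lemma measurable_offspring k : measurable_fun setT (fun x : R => p `|x| k).
Proof.
elim/ltn_ind: k => k IH.
pose z n : R := n.+1%:R^-1.
have z01 n : 0 <= z n <= 1 by rewrite invr_ge0 ler0n invf_le1 ?ltr0n// ler1n.
have zgt0 n : 0 < z n by rewrite invr_gt0.
apply: (@measurable_fun_cvg _ _ _ setT
  (fun n (x : R) => (pgf p `|x| (z n) - \sum_(i < k) p `|x| i * z n ^+ i) / z n ^+ k)).
  move=> n; apply: measurable_funM => //; apply: measurable_funB.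
    by apply: measurable_pgf_comp.
  by apply: measurable_sum => i; apply: measurable_funM => //; exact: IH.
move=> x _.
have c1 : cst (p `|x| k) n @[n --> \oo] --> p `|x| k by exact: cvg_cst.
have c2 : p `|x| k + z n @[n --> \oo] --> p `|x| k.
  rewrite -[X in _ --> X]addr0; apply: cvgD; first exact: cvg_cst.
  exact: cvg_harmonic.
apply: (squeeze_cvgr _ c1 c2); apply: nearW => n.
have zk : 0 < z n ^+ k by rewrite exprn_gt0.
rewrite ler_pdivlMr// ler_pdivrMr// lerBrDl lerBlDl mulrDl -exprS.
have e : pgf_trunc `|x| (z n) k.+1 =
    \sum_(i < k) p `|x| i * z n ^+ i + p `|x| k * z n ^+ k.
  by rewrite /pgf_trunc big_ord_recr.
rewrite -e addrA -e pgf_trunc_le_pgf//=; exact: pgf_remainder_power.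
Qed.

End offspring.

Section exponential_integral.
Context {R : realType}.
Local Notation leb := (@lebesgue_measure R).

Lemma integral_exp_decay (c t : R) : 0 < c -> 0 <= t ->
  (\int[leb]_(s in `]0%R, t]) (c * expR (- (c * s)))%:E = (1 - expR (- (c * t)))%:E)%E.
Proof.
move=> c0; rewrite le_eqVlt => /predU1P[<-|t0].
  by rewrite set_itvoc0 integral_set0 mulr0 oppr0 expR0 subrr.
rewrite integral_itv_obnd_cbnd; last first.
  apply/measurable_EFinP; apply: measurable_funTS; apply: measurable_funM => //.
  apply: measurableT_comp; first exact: measurable_expR.
  by apply: measurable_funN; exact: measurable_funM.
have := exponential_prob_itv0c c t0; rewrite mulNr EFinB => <-.
apply: eq_integral => s; rewrite inE/= in_itv/= => /andP[s0 _].
by rewrite exponential_pdfE// -mulNr.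
Qed.

End exponential_integral.

Section cumulant_uniqueness.
Context {R : realType}.
Local Notation leb := (@lebesgue_measure R).
Variables (alpha : R -> R) (p : R -> nat -> R) (f : R -> R).
Hypothesis halpha : bounded_borel_nonneg alpha.
Hypothesis hp : offspring_law p.

Lemma expRN_itv (x : R) : 0 <= x -> 0 <= expR (- x) <= 1.
Proof. by move=> x0; rewrite expR_ge0 expR_le1 oppr_le0. Qed.

Lemma lebesgue_oc_lty (t : R) : (leb (`]0%R, t]%classic : set R) < +oo)%E.
Proof.
by rewrite lebesgue_measure_itv/=; case: ifP => _ //; rewrite ltry.
Qed.

Lemma integrable_oc (t : R) (h : R -> R) (C : R) :
  measurable_fun (`]0, t] : set R) h -> (forall s, 0 < s <= t -> `|h s| <= C) ->
  leb.-integrable `]0, t] (EFin \o h).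
Proof.
move=> mh hC; apply: measurable_bounded_integrable => //.
  exact: lebesgue_oc_lty.
exists C; split; first exact: num_real.
by move=> y Cy s /=; rewrite in_itv/= => hs; exact: le_trans (hC _ hs) (ltW Cy).
Qed.

Lemma Rintegral_exp_decay (c t : R) : 0 < c -> 0 <= t ->
  \int[leb]_(s in `]0, t]) (c * expR (- (c * s))) = 1 - expR (- (c * t)).
Proof. by move=> c0 t0; rewrite /Rintegral integral_exp_decay. Qed.

(** The functions of time and age that can be exponentials [expR (- u t x)]. *)
Definition unit_valued (w : R -> R -> R) :=
  measurable_fun (`[0, +oo[ `*` `[0, +oo[ : set (R * R)) (fun tx : R * R => w tx.1 tx.2)
  /\ forall t x : R, 0 <= t -> 0 <= x -> 0 <= w t x <= 1.

(** The integrand of the cumulant equation. *)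
Definition cumulant_rate (w : R -> R -> R) t x s : R :=
  alpha (x + s) * (pgf p (x + s) (w (t - s) 0) - w (t - s) (x + s)).

Lemma measurable_cumulant_rate w (t x : R) : 0 <= x -> unit_valued w ->
  measurable_fun (`]0, t] : set R) (cumulant_rate w t x).
Proof.
move=> x0 [mw w01]; have [ma _ _] := halpha.
have mD : measurable (`]0, t]%classic : set R) by [].
have mxs : measurable_fun (`]0, t] : set R) (fun s => x + s).
  by apply: measurable_funTS; exact: measurable_funD.
have xs0 s : 0 < s <= t -> 0 <= x + s by move=> /andP[s0 _]; rewrite addr_ge0// ltW.
have ts0 s : 0 < s <= t -> 0 <= t - s by move=> /andP[_]; rewrite subr_ge0.
have mw' (y : R -> R) : measurable_fun (`]0, t] : set R) y ->
    (forall s, 0 < s <= t -> 0 <= y s) ->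
    measurable_fun (`]0, t] : set R) (fun s => w (t - s) (y s)).
  move=> my y0; apply: (measurable_comp _ _ mw (g := fun s : R => (t - s : R, y s : R))).
  - by apply: measurableX; exact: measurable_itv.
  - move=> z [s /=]; rewrite in_itv/= => hs <-.
    by split; rewrite /= in_itv/= andbT ?y0// ts0.
  - apply: measurable_fun_pair_on => //.
    by apply: measurable_funTS; exact: measurable_funB.
apply: measurable_funM.
  apply: (measurable_comp _ _ ma) => // z [s /=]; rewrite in_itv/= => hs <-.
  by rewrite in_itv/= andbT xs0.
apply: measurable_funB; last exact: mw'.
apply: measurable_pgf_comp => //; first exact: mw'.
by move=> s /=; rewrite in_itv/= => /ts0 h; exact: w01.
Qed.

Lemma cumulant_rate_bound w (t x s C : R) : (forall x, 0 <= x -> `|alpha x| <= C) ->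
  0 <= x -> unit_valued w -> 0 < s <= t ->
  `|cumulant_rate w t x s| <= C.
Proof.
move=> hC x0 [_ w01] /andP[s0 st].
have xs0 : 0 <= x + s by rewrite addr_ge0// ltW.
have ts0 : 0 <= t - s by rewrite subr_ge0.
have /andP[a0 a1] := w01 _ _ ts0 xs0.
have b01 := w01 _ _ ts0 (lexx 0).
have g0 := pgf_ge0 hp xs0 b01; have g1 := pgf_le1 hp xs0 b01.
rewrite /cumulant_rate normrM -[leRHS]mulr1; apply: ler_pM => //; first exact: hC.
by rewrite ler_norml; lra.
Qed.

(** If two solutions differ by at most [2 ^- n * expR (2 K t)], the equation and the
    Lipschitz bound halve the difference. *)
Lemma cumulant_equation_unique (w w' : R -> R -> R) :
  unit_valued w -> unit_valued w' ->
  (forall t x, 0 <= t -> 0 <= x -> w t x = expR (- f (x + t)) +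
     \int[leb]_(s in `]0, t]) cumulant_rate w t x s) ->
  (forall t x, 0 <= t -> 0 <= x -> w' t x = expR (- f (x + t)) +
     \int[leb]_(s in `]0, t]) cumulant_rate w' t x s) ->
  forall t x, 0 <= t -> 0 <= x -> w t x = w' t x.
Proof.
move=> uw uw' ew ew'; have [_ w01] := uw; have [_ w'01] := uw'.
have [_ [C hC] a0] := halpha.
have [m m0 hm] := offspring_mean hp.
have C0 : 0 <= C by apply: le_trans (hC 0 (lexx 0)).
pose K := C * (m + 1) + 1.
have K0 : 0 < K by rewrite ltr_wpDl// mulr_ge0// addr_ge0.
have step n t x : 0 <= t -> 0 <= x -> `|w t x - w' t x| <= 2^-1 ^+ n * expR (2 * K * t).
  elim: n t x => [|n IH] t x t0 x0.
    rewrite expr0 mul1r; apply: (@le_trans _ _ 1).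
      by have /andP[? ?] := w01 _ _ t0 x0; have /andP[? ?] := w'01 _ _ t0 x0;
         rewrite ler_norml; lra.
    by rewrite -expR0 ler_expR !mulr_ge0// ltW.
  have i1 : leb.-integrable `]0, t] (EFin \o cumulant_rate w t x).
    apply: (@integrable_oc _ _ C); first exact: measurable_cumulant_rate.
    by move=> s; exact: cumulant_rate_bound.
  have i2 : leb.-integrable `]0, t] (EFin \o cumulant_rate w' t x).
    apply: (@integrable_oc _ _ C); first exact: measurable_cumulant_rate.
    by move=> s; exact: cumulant_rate_bound.
  rewrite ew// ew'// opprD addrACA subrr add0r -RintegralB//.
  set h := fun s => cumulant_rate w t x s - cumulant_rate w' t x s.
  have mh : measurable_fun (`]0, t] : set R) h.
    by apply: measurable_funB; exact: measurable_cumulant_rate.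
  have hb s : 0 < s <= t -> `|h s| <= K * (2^-1 ^+ n * expR (2 * K * (t - s))).
    move=> hs; have /andP[s0 st] := hs.
    have xs0 : 0 <= x + s by rewrite addr_ge0// ltW.
    have ts0 : 0 <= t - s by rewrite subr_ge0.
    rewrite /h /cumulant_rate -mulrBr normrM.
    have := pgf_lipschitz hp hm xs0 (w01 _ _ ts0 (lexx 0)) (w'01 _ _ ts0 (lexx 0)).
    have := IH _ _ ts0 (lexx 0); have := IH _ _ ts0 xs0.
    set e := 2^-1 ^+ n * _ => h1 h2 h3.
    have e0 : 0 <= e by apply: le_trans h1.
    apply: le_trans (_ : C * ((m + 1) * e) <= _); last first.
      by rewrite mulrA ler_wpM2r// /K lerDl.
    apply: ler_pM => //; first exact: hC.
    rewrite (_ : _ - _ - _ = (pgf p (x + s) (w (t - s) 0) - pgf p (x + s) (w' (t - s) 0)) -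
        (w (t - s) (x + s) - w' (t - s) (x + s))); last by ring.
    apply: le_trans (ler_normB _ _) _; rewrite mulrDl mul1r; apply: lerD => //.
    by apply: le_trans h3 _; rewrite ler_wpM2l.
  have ih : leb.-integrable `]0, t] (EFin \o h).
    apply: (@integrable_oc _ _ (C + C)) => // s hs; apply: le_trans (ler_normB _ _) _.
    by apply: lerD; exact: cumulant_rate_bound.
  apply: le_trans (le_normr_Rintegral _ ih) _ => //.
  pose b s := (2^-1 ^+ n.+1 * expR (2 * K * t)) * (2 * K * expR (- (2 * K * s))).
  have K20 : 0 <= 2 * K by rewrite mulr_ge0// ltW.
  have mexp : measurable_fun (`]0, t] : set R) (fun s => 2 * K * expR (- (2 * K * s))).
    apply: measurable_funTS; apply: measurable_funM => //.
    apply: measurableT_comp; first exact: measurable_expR.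
    by apply: measurable_funN; exact: measurable_funM.
  have bexp s : 0 < s <= t -> `|2 * K * expR (- (2 * K * s))| <= 2 * K.
    move=> /andP[s0 _]; rewrite ger0_norm; last by rewrite mulr_ge0 ?expR_ge0.
    by rewrite ler_piMr// expR_le1 oppr_le0 mulr_ge0// ltW.
  have ib0 : leb.-integrable `]0, t] (EFin \o (fun s => 2 * K * expR (- (2 * K * s)))).
    exact: (@integrable_oc _ _ (2 * K)).
  have ib : leb.-integrable `]0, t] (EFin \o b).
    apply: (@integrable_oc _ _ (`|2^-1 ^+ n.+1 * expR (2 * K * t)| * (2 * K))).
      exact: measurable_funM.
    by move=> s hs; rewrite normrM ler_wpM2l// bexp.
  apply: le_trans (_ : \int[leb]_(s in `]0, t]) b s <= _).
    apply: le_Rintegral => //.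
    - apply: (@integrable_oc _ _ (C + C)); first exact: measurableT_comp.
      move=> s hs; rewrite normr_id; apply: le_trans (ler_normB _ _) _.
      by apply: lerD; exact: cumulant_rate_bound.
    - move=> s /=; rewrite in_itv/= => hs; apply: le_trans (hb _ hs) _.
      rewrite /b mulrBr expRD exprS le_eqVlt; apply/orP; left; apply/eqP.
      by field.
  rewrite /b RintegralZl// Rintegral_exp_decay ?mulr_gt0//.
  rewrite -[leRHS]mulr1 ler_wpM2l ?mulr_ge0 ?exprn_ge0 ?expR_ge0//.
move=> t x t0 x0; apply/eqP; rewrite -subr_eq0 -normr_le0.
have c : 2^-1 ^+ n * expR (2 * K * t) @[n --> \oo] --> (0 : R).
  rewrite -[X in _ --> X](mul0r (expR (2 * K * t))); apply: cvgMr_tmp; apply: cvg_expr.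
  by rewrite ger0_norm ?invr_ge0// invf_lt1// ltr1n.
rewrite -(cvg_lim _ c)//; apply: limr_ge; first by apply/cvg_ex; eexists; exact: c.
by apply: nearW => n; exact: step.
Qed.

Lemma cumulant_solution_unique u u' :
  cumulant_solution alpha (pgf p) f u -> cumulant_solution alpha (pgf p) f u' ->
  forall t x, 0 <= t -> 0 <= x -> u' t x = u t x.
Proof.
have unit v : cumulant_solution alpha (pgf p) f v ->
    unit_valued (fun t x => expR (- v t x)).
  move=> [mv v0 _]; split; last by move=> t x t0 x0; apply: expRN_itv; exact: v0.
  apply: measurableT_comp; first exact: measurable_expR.
  by apply: measurable_funN.
move=> hu hu' t x t0 x0; apply/eqP; rewrite -eqr_opp; apply/eqP/expR_inj.
apply: (cumulant_equation_unique (unit _ hu') (unit _ hu)) => // {}t {}x {}t0 {}x0.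
  by case: hu' => _ _; exact.
by case: hu => _ _; exact.
Qed.

End cumulant_uniqueness.

(** * Kernels and their monotone limits *)

Section density.
Local Open Scope ereal_scope.
Context d (T : measurableType d) (R : realType).
Variables (mu m : {measure set T -> \bar R}) (h : T -> R).
Hypotheses (mh : measurable_fun setT h) (h0 : forall x, (0 <= h x)%R).
Hypothesis m_density : forall A, measurable A -> m A = \int[mu]_(x in A) (h x)%:E.

Import HBNNSimple.

Let density_indic A : measurable A ->
  \int[m]_x (\1_A x)%:E = \int[mu]_x ((\1_A x)%:E * (h x)%:E).
Proof.
move=> mA; rewrite integral_indic// setIT m_density// integral_mkcond.
apply: eq_integral => x _; rewrite patchE indicE.
by case: ifP => _; rewrite ?mul1e ?mul0e.
Qed.

Let density_nnsfun (f : {nnsfun T >-> R}) :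
  \int[m]_x (f x)%:E = \int[mu]_x ((f x)%:E * (h x)%:E).
Proof.
under [LHS]eq_integral do rewrite fimfunE -fsumEFin//.
rewrite [LHS]ge0_integral_fsum//; last 2 first.
  - by move=> r; exact/measurable_EFinP/measurableT_comp.
  - by move=> n x _; rewrite EFinM nnfun_muleindic_ge0.
under [RHS]eq_integral.
  move=> x xD; rewrite fimfunE -fsumEFin// muleC ge0_mule_fsumr; last first.
    by move=> r; rewrite EFinM nnfun_muleindic_ge0.
  over.
rewrite [RHS]ge0_integral_fsum//; last 2 first.
  - move=> r; apply: emeasurable_funM; first exact/measurable_EFinP.
    by apply/measurable_EFinP; exact/measurableT_comp.
  - move=> n x _; apply: mule_ge0; first by rewrite lee_fin.
    by rewrite EFinM nnfun_muleindic_ge0.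
apply: eq_fsbigr => r _.
rewrite integralZl_indic_nnsfun//= density_indic//.
have [r0|r0] := leP 0%R r.
  rewrite -ge0_integralZl//; last 2 first.
  - apply: emeasurable_funM; last exact/measurable_EFinP.
    by apply/measurable_EFinP; exact: measurable_indic.
  - by move=> x _; rewrite mule_ge0// lee_fin.
  by apply: eq_integral => x _; rewrite EFinM muleA muleC.
rewrite preimage_nnfun0// !integral0_eq ?mule0// => x _.
  by rewrite indic0 mulr0 mule0.
by rewrite indic0 mul0e.
Qed.

Lemma ge0_integral_density f : measurable_fun setT f -> (forall x, 0 <= f x) ->
  \int[m]_x f x = \int[mu]_x (f x * (h x)%:E).
Proof.
move=> mf f0.
pose f_ := nnsfun_approx measurableT mf.
transitivity (lim (\int[m]_x (f_ n x)%:E @[n --> \oo])).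
  rewrite -monotone_convergence//=.
  - apply: eq_integral => ? /[!inE] xD; apply/esym/cvg_lim => //=.
    exact: cvg_nnsfun_approx.
  - by move=> n; exact/measurable_EFinP/measurable_funTS.
  - by move=> n ? _; rewrite lee_fin.
  - by move=> ? _ ? ? mn; rewrite lee_fin; exact/lefP/nd_nnsfun_approx.
transitivity (lim (\int[mu]_x ((f_ n x)%:E * (h x)%:E) @[n --> \oo])).
  by apply: congr_lim; apply/funext => n /=; exact: density_nnsfun.
rewrite -monotone_convergence//=.
- apply: eq_integral => x _; apply/cvg_lim => //=; apply: cvgeZr => //.
  exact: cvg_nnsfun_approx.
- by move=> n; apply: emeasurable_funM; exact/measurable_EFinP.
- by move=> n x _; rewrite mule_ge0 ?lee_fin.
- by move=> x _ a b ab; rewrite lee_pmul ?lee_fin//; exact/lefP/nd_nnsfun_approx.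
Qed.

End density.

Section increasing_measures.
Local Open Scope ereal_scope.
Context d (T : measurableType d) (R : realType).
Variable m : nat -> {finite_measure set T -> \bar R}.
Hypothesis m_nd : forall n A, measurable A -> m n A <= m n.+1 A.

Definition sup_measure (A : set T) := ereal_sup (range (fun n => m n A)).

Lemma sup_measure_nd A : measurable A -> nondecreasing_seq (fun n => m n A).
Proof. by move=> mA; apply/nondecreasing_seqP => n; exact: m_nd. Qed.

Lemma sup_measure_cvg A : measurable A -> m n A @[n --> \oo] --> sup_measure A.
Proof. by move=> mA; apply: ereal_nondecreasing_cvgn; exact: sup_measure_nd. Qed.

Let sup_measure0 : sup_measure set0 = 0.
Proof.
rewrite /sup_measure.
have -> : range (fun n => m n set0) = [set 0]; last exact: ereal_sup1.
apply/seteqP; split => [_ [n _ <-]|_ ->] /=; first exact: measure0.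
by exists 0%N => //; exact: measure0.
Qed.

Let sup_measure_ge0 A : 0 <= sup_measure A.
Proof.
by apply: le_trans (measure_ge0 (m 0%N) A) _; apply: ereal_sup_ubound; exists 0%N.
Qed.

(** Monotone convergence for the counting measure on the index of the union. *)
Let sup_measure_sigma_additive : semi_sigma_additive sup_measure.
Proof.
move=> F mF tF mUF.
have -> : sup_measure (\bigcup_n F n) = \sum_(i <oo) sup_measure (F i).
  have e1 n : m n (\bigcup_n F n) = \int[counting]_i m n (F i).
    by rewrite ge0_integral_count//; apply/esym/cvg_lim => //; exact: measure_semi_sigma_additive.
  rewrite -(cvg_lim _ (sup_measure_cvg mUF))//.
  under eq_fun do rewrite e1.
  rewrite -monotone_convergence//.
    rewrite ge0_integral_count//; last first.
      move=> i; apply: lime_ge; last by apply: nearW => n; exact: measure_ge0.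
      by apply/cvg_ex; eexists; exact: sup_measure_cvg.
    by apply: eq_eseriesr => i _; rewrite (cvg_lim _ (sup_measure_cvg (mF i))).
  by move=> i _; exact: sup_measure_nd.
by apply: is_cvg_nneseries => i _ _; exact: sup_measure_ge0.
Qed.

HB.instance Definition _ := isMeasure.Build _ _ _ sup_measure
  sup_measure0 sup_measure_ge0 sup_measure_sigma_additive.

Hypothesis m_le1 : forall n, m n setT <= 1.

Lemma sup_measure_le1 : sup_measure setT <= 1.
Proof. by apply: ge_ereal_sup => _ [n _ <-]; exact: m_le1. Qed.

Let sup_fin : fin_num_fun sup_measure.
Proof.
apply: lty_fin_num_fun; apply: le_lt_trans sup_measure_le1 _; exact: ltry.
Qed.

HB.instance Definition _ := Measure_isFinite.Build _ _ _ sup_measure sup_fin.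

(** For [f] and [1 - f] nonnegative, both integrals increase with the measure, so the
    error is at most the missing mass. *)
Lemma integral_sup_measure (f : T -> R) : measurable_fun setT f ->
  (forall x, (0 <= f x <= 1)%R) ->
  \int[m n]_x (f x)%:E @[n --> \oo] --> \int[sup_measure]_x (f x)%:E.
Proof.
move=> mf f01.
have le_sup n A : measurable A -> m n A <= sup_measure A.
  by move=> mA; apply: ereal_sup_ubound; exists n.
have int (q : {finite_measure set T -> \bar R}) (g : T -> R) : measurable_fun setT g ->
    (forall x, (0 <= g x <= 1)%R) -> q.-integrable setT (EFin \o g).
  move=> mg g01; apply: (@bounded_integrable _ _ _ q 1 g) => // x.
  by have /andP[g0 g1] := g01 x; rewrite ger0_norm.
pose f' x := (1 - f x)%R.
have mf' : measurable_fun setT f' by exact: measurable_funB.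
have f'01 x : (0 <= f' x <= 1)%R by have := f01 x; rewrite /f'; lra.
have e (q : {finite_measure set T -> \bar R}) :
    \int[q]_x (f' x)%:E = q setT - \int[q]_x (f x)%:E.
  rewrite -[q setT]mul1e -(integral_cst q measurableT 1) -integralB_EFin//.
    by apply: int => // x; rewrite ler01 lexx.
  exact: int.
have le_int n (g : T -> R) : measurable_fun setT g -> (forall x, (0 <= g x <= 1)%R) ->
    \int[m n]_x (g x)%:E <= \int[sup_measure]_x (g x)%:E.
  move=> mg g01; apply: ge0_le_measure_integral => //; first exact: le_sup.
    by move=> x; rewrite lee_fin; have /andP[] := g01 x.
  exact/measurable_EFinP.
have fn (q : {finite_measure set T -> \bar R}) : \int[q]_x (f x)%:E \is a fin_num.
  by apply: integrable_fin_num => //; exact: int.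
have lo n : \int[sup_measure]_x (f x)%:E - (sup_measure setT - m n setT)
    <= \int[m n]_x (f x)%:E.
  have aux (A B a b : \bar R) : A \is a fin_num -> B \is a fin_num -> a \is a fin_num ->
      b \is a fin_num -> B - b <= A - a -> a - (A - B) <= b.
    move=> /fineK <- /fineK <- /fineK <- /fineK <-.
    by rewrite -!EFinB !lee_fin; lra.
  apply: aux; rewrite ?fin_num_measure//; [exact: fn..|].
  by rewrite -!e; exact: le_int.
apply: (@squeeze_cvge _ _ _ _ (fun n => \int[sup_measure]_x (f x)%:E -
   (sup_measure setT - m n setT)) _ (cst (\int[sup_measure]_x (f x)%:E))).
- by apply: nearW => n; rewrite lo/=; exact: le_int.
- have fs : sup_measure setT \is a fin_num by exact: fin_num_measure.
  rewrite -[X in _ --> X]sube0 -[X in _ - X](subee fs).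
  apply: cvgeB => //; [by rewrite fin_num_adde_defr|exact: cvg_cst|].
  apply: cvgeB => //; [by rewrite fin_num_adde_defr|exact: cvg_cst|].
  exact: sup_measure_cvg.
- exact: cvg_cst.
Qed.

End increasing_measures.

Section subprobability_kernels.
Context {R : realType}.

Section packing.
Context d d' (X : measurableType d) (Y : measurableType d').
Variable k : X -> {measure set Y -> \bar R}.

Definition spk_fun (mk : forall U, measurable U -> measurable_fun setT (k ^~ U))
  (k1 : forall x, (k x setT <= 1)%E) : X -> {measure set Y -> \bar R} := k.

Hypothesis mk : forall U, measurable U -> measurable_fun setT (k ^~ U).
Hypothesis k1 : forall x, (k x setT <= 1)%E.

HB.instance Definition _ := isKernel.Build _ _ X Y R (spk_fun mk k1) mk.

Let spk_le1 : (ereal_sup [set spk_fun mk k1 x [set: Y] | x in [set: X]] <= 1)%E.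
Proof. exact: (proj2 (sprob_kernelP (fun x A => k x A))). Qed.

HB.instance Definition _ := Kernel_isSubProbability.Build _ _ X Y R (spk_fun mk k1) spk_le1.

Definition mk_spker : R.-spker X ~> Y := spk_fun mk k1.

End packing.

Section operations.
Context d d' d3 (X : measurableType d) (Y : measurableType d') (Z : measurableType d3).

Section precomposition.
Variables (phi : Z -> X) (mphi : measurable_fun setT phi) (k : R.-spker X ~> Y).
Lemma kprecomp_measurable U : measurable U -> measurable_fun setT (fun z => k (phi z) U).
Proof.
by move=> mU; apply: (measurableT_comp (measurable_kernel k U mU)).
Qed.
Definition kprecomp : R.-spker Z ~> Y :=
  mk_spker kprecomp_measurable (fun z => sprob_kernel_le1 k (phi z)).
End precomposition.

Section bind.
Variables (l : R.-spker X ~> Y) (k : R.-spker (X * Y) ~> Z).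

Lemma kbind_measurable U : measurable U -> measurable_fun setT (fun x => mkcomp l k x U).
Proof. exact: measurable_fun_mkcomp_sfinite. Qed.

Lemma kbind_le1 x : (mkcomp l k x setT <= 1)%E.
Proof.
apply: le_trans (sprob_kernel_le1 l x); rewrite /mkcomp /= /kcomp.
rewrite -[leRHS]mul1e -integral_cst//; apply: ge0_le_integral => //.
- by apply: measurableT_comp (measurable_kernel k _ measurableT) _; exact: pair1_measurable.
- by move=> y _; exact: sprob_kernel_le1.
Qed.

Definition kbind : R.-spker X ~> Z := mk_spker kbind_measurable kbind_le1.

Lemma integral_kbind x (f : Z -> \bar R) : (forall z, 0 <= f z)%E ->
  measurable_fun setT f ->
  (\int[kbind x]_z f z = \int[l x]_y \int[k (x, y)]_z f z)%E.
Proof. by move=> f0 mf; exact: integral_kcomp. Qed.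

End bind.

End operations.

Section more_operations.
Context d d' (X : measurableType d) (Y : measurableType d').

Section discrete.
Variable q : nat -> X -> R.
Hypotheses (mq : forall i, measurable_fun setT (q i)) (q0 : forall i x, 0 <= q i x).
Hypothesis q1 : forall n x, \sum_(i < n) q i x <= 1.

Definition discrete_measure x : {measure set nat -> \bar R} :=
  mseries (fun i => mscale (NngNum (q0 i x)) (\d_i : {measure set nat -> \bar R})) 0.

Lemma discrete_measurable U : measurable U -> measurable_fun setT (fun x => discrete_measure x U).
Proof.
move=> mU; apply: ge0_emeasurable_sum => [i x _ _|i _]; first exact: measure_ge0.
apply: emeasurable_funM; last exact: measurable_cst.
by apply/measurable_EFinP; exact: mq.
Qed.

Lemma discrete_le1 x : (discrete_measure x setT <= 1)%E.
Proof.
rewrite /discrete_measure /= /mseries; apply: lime_le.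
  by apply: is_cvg_nneseries => i _ _; exact: measure_ge0.
apply: nearW => n; rewrite big_mkord.
apply: le_trans (_ : ((\sum_(i < n) q i x)%:E <= 1)%E); last by rewrite lee_fin.
rewrite -sumEFin; apply: lee_sum => i _.
change ((q i x)%:E * (\1_[set: nat] (i : nat))%:E <= (q i x)%:E)%E.
by rewrite indicT mule1.
Qed.

Definition kdiscrete : R.-spker X ~> nat := mk_spker discrete_measurable discrete_le1.

Lemma integral_kdiscrete x (f : nat -> \bar R) : (forall i, 0 <= f i)%E ->
  (\int[kdiscrete x]_i f i = \sum_(i <oo) (q i x)%:E * f i)%E.
Proof.
move=> f0; rewrite /= ge0_integral_measure_series//.
apply: eq_eseriesr => i _; rewrite ge0_integral_mscale//.
by rewrite integral_dirac// diracT mul1e.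
Qed.

End discrete.

Section family.
Variable K : nat -> R.-spker X ~> Y.
Lemma kfamily_measurable U : measurable U ->
  measurable_fun setT (fun xi : X * nat => K xi.2 xi.1 U).
Proof.
move=> mU; apply: (@measurable_fun_nat_index _ _ _ _ snd (fun n (xi : X * nat) => K n xi.1 U)).
  exact: measurable_snd.
by move=> n; apply: (measurableT_comp (measurable_kernel (K n) U mU)).
Qed.
Definition kfamily : R.-spker (X * nat) ~> Y :=
  mk_spker kfamily_measurable (fun xi => sprob_kernel_le1 (K xi.2) xi.1).
End family.

Section constant.
Variable P : probability Y R.
Lemma kconst_measurable U : measurable U -> measurable_fun setT (fun _ : X => P U).
Proof. by []. Qed.
Lemma kconst_le1 (x : X) : (P setT <= 1)%E.
Proof. by rewrite probability_setT. Qed.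
Definition kconst : R.-spker X ~> Y := mk_spker (k := fun=> P) kconst_measurable kconst_le1.
End constant.

Section point_mass.
Variables (f : X -> Y) (mf : measurable_fun setT f).
Lemma kpoint_measurable U : measurable U ->
  measurable_fun setT (fun x => (\d_(f x) : {measure set Y -> \bar R}) U).
Proof. exact: (measurable_kernel (kdirac mf)). Qed.
Lemma kpoint_le1 x : ((\d_(f x) : {measure set Y -> \bar R}) setT <= 1)%E.
Proof. by change ((\1_[set: Y] (f x))%:E <= 1 :> \bar R)%E; rewrite indicT. Qed.
Definition kpoint : R.-spker X ~> Y := mk_spker kpoint_measurable kpoint_le1.
End point_mass.

Lemma kzero_measurable U : measurable U ->
  measurable_fun setT (fun _ : X => (mzero : {measure set Y -> \bar R}) U).
Proof. by []. Qed.
Lemma kzero_le1 (x : X) : ((mzero : {measure set Y -> \bar R}) setT <= 1)%E.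
Proof. exact: lee01. Qed.
Definition spkzero : R.-spker X ~> Y := mk_spker kzero_measurable kzero_le1.

Definition kernel_le (k k' : R.-spker X ~> Y) :=
  forall x U, measurable U -> (k x U <= k' x U)%E.

End more_operations.

Lemma kbind_mono d d' d3 (X : measurableType d) (Y : measurableType d')
    (Z : measurableType d3) (l l' : R.-spker X ~> Y) (k k' : R.-spker (X * Y) ~> Z) :
  kernel_le l l' -> kernel_le k k' -> kernel_le (kbind l k) (kbind l' k').
Proof.
move=> ll kk x U mU; rewrite /= /kcomp.
have mk (h : R.-spker (X * Y) ~> Z) : measurable_fun setT (fun y => h (x, y) U).
  by apply: measurableT_comp (measurable_kernel h _ mU) _; exact: pair1_measurable.
apply: (@le_trans _ _ (\int[l x]_y k' (x, y) U)%E).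
  by apply: ge0_le_integral => // y _; exact: kk.
by apply: ge0_le_measure_integral => // V mV; exact: ll.
Qed.

Lemma kfamily_mono d d' (X : measurableType d) (Y : measurableType d')
    (K K' : nat -> R.-spker X ~> Y) : (forall i, kernel_le (K i) (K' i)) ->
  kernel_le (kfamily K) (kfamily K').
Proof. by move=> h [x i] U mU; exact: h. Qed.

End subprobability_kernels.

Section convolution.
Context {R : realType} d (X : measurableType d).
Local Notation S := (nat_measure R).
Implicit Types k : R.-spker X ~> S.

Lemma measurable_add_pair : measurable_fun setT (fun z : X * S * S => nat_add z.1.2 z.2).
Proof.
apply: measurable_nat_add => //.
by apply: measurableT_comp; [exact: measurable_snd|exact: measurable_fst].
Qed.

(** Convolution of kernels: the two states are drawn independently and superposed. *)
Definition kconv k1 k2 : R.-spker X ~> S :=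
  kbind k1 (kbind (kprecomp (@measurable_fst _ _ X S) k2) (kpoint measurable_add_pair)).

Fixpoint kpow k i : R.-spker X ~> S :=
  if i is j.+1 then kconv (kpow k j) k
  else kpoint (@measurable_cst _ _ X S setT nat_measure0).

Lemma kernel_le_refl k : kernel_le k k. Proof. by move=> x U mU. Qed.

Lemma kconv_mono k1 k2 k1' k2' : kernel_le k1 k1' -> kernel_le k2 k2' ->
  kernel_le (kconv k1 k2) (kconv k1' k2').
Proof.
move=> h1 h2; apply: kbind_mono => //; apply: kbind_mono; last by move=> x U mU.
by move=> x U mU; exact: h2.
Qed.

Lemma kpow_mono k k' i : kernel_le k k' -> kernel_le (kpow k i) (kpow k' i).
Proof.
by move=> h; elim: i => [|i IH] /=; [exact: kernel_le_refl|exact: kconv_mono].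
Qed.

Section laplace_of_kernels.
Variable f : R -> R.
Hypothesis hf : bounded_borel_nonneg f.

Lemma measurable_laplaceE : measurable_fun setT (fun nu => (laplace f nu)%:E).
Proof. by apply/measurable_EFinP; apply: measurable_laplace; case: hf. Qed.

Lemma laplaceE_ge0 nu : (0 <= (laplace f nu)%:E)%E.
Proof. by rewrite lee_fin ltW// laplace_gt0. Qed.

Definition klap d' (Y : measurableType d') (k : R.-spker Y ~> S) (y : Y) : R :=
  fine (\int[k y]_nu (laplace f nu)%:E).

Section basic.
Context d' (Y : measurableType d') (k : R.-spker Y ~> S).

Lemma klap_integral_le1 y : (\int[k y]_nu (laplace f nu)%:E <= 1)%E.
Proof.
apply: le_trans (sprob_kernel_le1 k y); rewrite -[leRHS]mul1e -integral_cst//.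
apply: ge0_le_integral => //.
- by move=> nu _; exact: laplaceE_ge0.
- exact: measurable_laplaceE.
- by move=> nu _; rewrite lee_fin laplace_le1.
Qed.

Lemma klapE y : (klap k y)%:E = (\int[k y]_nu (laplace f nu)%:E)%E.
Proof.
rewrite fineK// ge0_fin_numE; last by apply: integral_ge0 => nu _; exact: laplaceE_ge0.
exact: le_lt_trans (klap_integral_le1 y) (ltry _).
Qed.

Lemma klap_01 y : 0 <= klap k y <= 1.
Proof.
rewrite -!lee_fin klapE klap_integral_le1 andbT.
by apply: integral_ge0 => nu _; exact: laplaceE_ge0.
Qed.

Lemma measurable_klap : measurable_fun setT (klap k).
Proof.
apply/measurable_EFinP; rewrite (_ : _ \o _ = fun y => (\int[k y]_nu (laplace f nu)%:E)%E).
  apply: measurable_fun_integral_kernel; [|exact: laplaceE_ge0|exact: measurable_laplaceE].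
  by move=> U mU; exact: measurable_kernel.
by apply/funext => y; exact: klapE.
Qed.

End basic.

Lemma klap_bind d' d3 (Y : measurableType d') (Z : measurableType d3)
    (l : R.-spker Y ~> Z) (k : R.-spker (Y * Z) ~> S) y :
  (klap (kbind l k) y)%:E = (\int[l y]_z (klap k (y, z))%:E)%E.
Proof.
rewrite klapE integral_kbind; [|exact: laplaceE_ge0|exact: measurable_laplaceE].
by apply: eq_integral => z _; rewrite klapE.
Qed.

Lemma klap_point d' (Y : measurableType d') (h : Y -> S) (mh : measurable_fun setT h) y :
  klap (kpoint mh) y = laplace f (h y).
Proof.
apply/eqP; rewrite -eqe klapE integral_dirac//=; last exact: measurable_laplaceE.
by rewrite diracT mul1e.
Qed.

Lemma klap_conv k1 k2 x : klap (kconv k1 k2) x = klap k1 x * klap k2 x.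
Proof.
have mf : measurable_fun (`[0, +oo[ : set R) f by case: hf.
have mL := measurable_laplaceE.
apply/eqP; rewrite -eqe EFinM klap_bind.
have e mu : (klap (kbind (kprecomp (@measurable_fst _ _ X S) k2) (kpoint measurable_add_pair))
    (x, mu))%:E = ((laplace f mu)%:E * (klap k2 x)%:E)%E.
  rewrite klap_bind [X in (_ * X)%E]klapE /= -ge0_integralZl//;
    [|by move=> nu _; exact: laplaceE_ge0|exact: laplaceE_ge0].
  apply: eq_integral => nu _; rewrite klap_point /= -EFinM /laplace -expRD -opprD.
  by rewrite pairing_nat_add.
under eq_integral do rewrite e.
rewrite ge0_integralZr//; last 2 first.
- by move=> nu _; exact: laplaceE_ge0.
- by rewrite lee_fin; have /andP[] := klap_01 k2 x.
by rewrite -klapE.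
Qed.

Lemma laplace_measure0 : laplace f (nat_measure0 : S) = 1.
Proof. by rewrite /laplace pairing0 ?oppr0 ?expR0//; case: hf. Qed.

Lemma klap_pow k i x : klap (kpow k i) x = klap k x ^+ i.
Proof.
elim: i => [|i IH]; first by rewrite klap_point laplace_measure0 expr0.
by rewrite /= klap_conv IH exprSr.
Qed.

End laplace_of_kernels.

Lemma klap0 d' (Y : measurableType d') (k : R.-spker Y ~> S) y :
  (klap (fun=> 0) k y)%:E = k y setT.
Proof.
rewrite klapE; last exact: bounded_borel_nonneg0.
under eq_integral do rewrite laplace0.
by rewrite integral_cst// mul1e.
Qed.

End convolution.

Section kernel_values.
Context {R : realType} d d' (X : measurableType d) (Y : measurableType d').

Lemma spker_fin (k : R.-spker X ~> Y) x : fin_num_fun (k x).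
Proof.
by apply: lty_fin_num_fun; apply: le_lt_trans (sprob_kernel_le1 k x) (ltry _).
Qed.

Definition spker_val (k : R.-spker X ~> Y) x : set Y -> \bar R := k x.

HB.instance Definition _ k x := isMeasure.Build _ _ _ (spker_val k x)
  (measure0 (k x)) (measure_ge0 (k x)) (@measure_semi_sigma_additive _ _ _ (k x)).

HB.instance Definition _ k x := Measure_isFinite.Build _ _ _ (spker_val k x) (spker_fin k x).

Definition spker_measure (k : R.-spker X ~> Y) x : {finite_measure set Y -> \bar R} :=
  spker_val k x.

Variable k : nat -> R.-spker X ~> Y.
Hypothesis k_nd : forall n, kernel_le (k n) (k n.+1).

Definition limit_measure (x : X) : {measure set Y -> \bar R}.
Proof.
refine (sup_measure (fun n => spker_measure (k n) x) : {measure set Y -> \bar R}).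
by move=> n A mA; exact: k_nd.
Defined.

Lemma limit_measure_cvg x A : measurable A -> k n x A @[n --> \oo] --> limit_measure x A.
Proof.
by move=> mA; apply: (sup_measure_cvg (m := fun n => spker_measure (k n) x)) => // n B mB;
  exact: k_nd.
Qed.

Lemma limit_measurable U : measurable U -> measurable_fun setT (fun x => limit_measure x U).
Proof.
move=> mU; apply: (emeasurable_fun_cvg (fun n x => k n x U)) => [n|x _].
  exact: measurable_kernel.
exact: limit_measure_cvg.
Qed.

Lemma limit_le1 x : (limit_measure x setT <= 1)%E.
Proof. by apply: ge_ereal_sup => _ [n _ <-]; exact: sprob_kernel_le1. Qed.

Definition klimit : R.-spker X ~> Y := mk_spker limit_measurable limit_le1.

Lemma integral_klimit x (f : Y -> R) : measurable_fun setT f ->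
  (forall y, 0 <= f y <= 1) ->
  (\int[k n x]_y (f y)%:E)%E @[n --> \oo] --> (\int[klimit x]_y (f y)%:E)%E.
Proof.
move=> mf f01.
exact: (@integral_sup_measure _ _ _ (fun n => spker_measure (k n) x)
  (fun n A mA => k_nd n x mA) (fun n => sprob_kernel_le1 (k n) x) f mf f01).
Qed.

End kernel_values.

(** * The descendants of one individual *)

Section one_particle_kernel.
Context {R : realType}.
Local Notation S := (nat_measure R).
Variables (alpha : R -> R) (p : R -> nat -> R) (c : R).
Hypotheses (halpha : bounded_borel_nonneg alpha) (hp : offspring_law p).
Hypotheses (c0 : 0 < c) (alphac : forall x, 0 <= x -> alpha x <= c).

(** Events of an individual are generated at the constant rate [c]; an event at age [y] is
    a branching with probability [branch_prob y] and changes nothing otherwise. *)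
Definition branch_prob (y : R) : R := alpha `|y| / c.

Lemma branch_prob_01 y : 0 <= branch_prob y <= 1.
Proof.
have [_ _ a0] := halpha.
by rewrite divr_ge0 ?a0 ?(ltW c0)//= ler_pdivrMr// mul1r alphac.
Qed.

Lemma measurable_branch_prob : measurable_fun setT branch_prob.
Proof.
apply: measurable_funM => //; apply: measurable_fun_nonneg_norm.
by case: halpha.
Qed.

Local Notation event := (R * R * measurableTypeR R)%type.

(** For an individual of age [e.1.2] observed after the time [e.1.1] and whose first
    event comes after the time [e.2], the three cases are: no event before the
    observation, fictitious event, branching into [i] offspring. *)
Definition event_weight (j : nat) (e : event) : R :=
  match j with
  | 0 => (e.1.1 < e.2)%R%:R
  | 1 => (e.2 <= e.1.1)%R%:R * (1 - branch_prob (e.1.2 + e.2))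
  | i.+2 => (e.2 <= e.1.1)%R%:R * (branch_prob (e.1.2 + e.2) * p `|e.1.2 + e.2| i)
  end.

Lemma measurable_age_at_event : measurable_fun setT (fun e : event => e.1.2 + e.2).
Proof.
apply: measurable_funD; last exact: measurable_snd.
by apply: measurableT_comp; [exact: measurable_snd|exact: measurable_fst].
Qed.

Lemma measurable_remaining_time : measurable_fun setT (fun e : event => e.1.1 - e.2).
Proof.
apply: measurable_funB; last exact: measurable_snd.
by apply: measurableT_comp; [exact: measurable_fst|exact: measurable_fst].
Qed.

Lemma measurable_event_before : measurable_fun setT (fun e : event => (e.2 <= e.1.1)%R%:R : R).
Proof.
rewrite (_ : (fun e => _) = \1_[set e : event | e.2 <= e.1.1]).
  apply: measurable_indic; apply: measurable_set_le; first exact: measurable_snd.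
  by apply: measurableT_comp; [exact: measurable_fst|exact: measurable_fst].
by apply/funext => e; rewrite indicE mem_setE.
Qed.

Lemma measurable_event_weight j : measurable_fun setT (event_weight j).
Proof.
case: j => [|[|i]] /=.
- rewrite (_ : event_weight 0 = fun e => 1 - (e.2 <= e.1.1)%R%:R).
    by apply: measurable_funB => //; exact: measurable_event_before.
  by apply/funext => e; rewrite /= ltNge; case: (_ <= _); rewrite ?subrr ?subr0.
- apply: measurable_funM; first exact: measurable_event_before.
  apply: measurable_funB => //.
  by apply: (measurableT_comp measurable_branch_prob); exact: measurable_age_at_event.
- apply: measurable_funM; first exact: measurable_event_before.
  apply: measurable_funM.
    by apply: (measurableT_comp measurable_branch_prob); exact: measurable_age_at_event.
  by apply: (measurableT_comp (measurable_offspring hp i)); exact: measurable_age_at_event.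
Qed.

Lemma event_weight_ge0 j e : 0 <= event_weight j e.
Proof.
have /andP[b0 b1] := branch_prob_01 (e.1.2 + e.2).
case: j => [|[|i]] //=; rewrite mulr_ge0 ?subr_ge0// mulr_ge0//.
exact: offspring_ge0.
Qed.

Lemma event_weight_sum (v : nat -> R) n e :
  \sum_(j < n.+2) event_weight j e * v j = (e.1.1 < e.2)%R%:R * v 0%N +
    (e.2 <= e.1.1)%R%:R * ((1 - branch_prob (e.1.2 + e.2)) * v 1%N +
      branch_prob (e.1.2 + e.2) * \sum_(i < n) p `|e.1.2 + e.2| i * v i.+2).
Proof.
rewrite 2!big_ord_recl /=; congr (_ + _).
rewrite [RHS]mulrDr mulrA; congr (_ + _); rewrite !mulr_sumr; apply: eq_bigr => i _.
by rewrite /bump /= !mulrA.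
Qed.

Lemma event_weight_le1 n e : \sum_(j < n) event_weight j e <= 1.
Proof.
apply: (@le_trans _ _ (\sum_(j < n.+2) event_weight j e)).
  have h k : \sum_(j < k) event_weight j e <= \sum_(j < k.+1) event_weight j e.
    by rewrite big_ord_recr lerDl event_weight_ge0.
  exact: le_trans (h n) (h n.+1).
under eq_bigr do rewrite -[event_weight _ _]mulr1.
rewrite (event_weight_sum (fun=> 1)) !mulr1.
have /andP[b0 b1] := branch_prob_01 (e.1.2 + e.2).
under eq_bigr do rewrite mulr1.
have s1 := offspring_partial_le1 hp n (normr_ge0 (e.1.2 + e.2)).
rewrite ltNge; case: (e.2 <= e.1.1); rewrite ?mul1r ?mul0r ?add0r ?addr0//=.
have := ler_piMr b0 s1; lra.
Qed.

Lemma measurable_newborn : measurable_fun setT (fun e : event => (e.1.1 - e.2, 0 : R)).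
Proof. by apply: measurable_fun_pair => //; exact: measurable_remaining_time. Qed.

Lemma measurable_survivor : measurable_fun setT (fun e : event => (e.1.1 - e.2, e.1.2 + e.2)).
Proof.
by apply: measurable_fun_pair; [exact: measurable_remaining_time|exact: measurable_age_at_event].
Qed.

Lemma measurable_observed : measurable_fun setT (fun e : event => nat_dirac (e.1.2 + e.1.1)).
Proof.
apply: measurable_nat_dirac; apply: measurable_funD.
  by apply: measurableT_comp; [exact: measurable_snd|exact: measurable_fst].
by apply: measurableT_comp; [exact: measurable_fst|exact: measurable_fst].
Qed.

Definition event_outcome (W : R.-spker (R * R) ~> S) (j : nat) : R.-spker event ~> S :=
  match j with
  | 0 => kpoint measurable_observed
  | 1 => kprecomp measurable_survivor W
  | i.+2 => kprecomp measurable_newborn (kpow W i)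
  end.

Definition event_clock : probability (measurableTypeR R) R.
Proof. refine (exponential_prob c : probability (measurableTypeR R) R); exact: c0. Defined.

Definition generation_step (W : R.-spker (R * R) ~> S) : R.-spker (R * R) ~> S :=
  kbind (kconst (R * R)%type event_clock)
    (kbind (kdiscrete measurable_event_weight event_weight_ge0 event_weight_le1)
           (kfamily (event_outcome W))).

(** [generation n (t, x)] is the law at time [t] of the descendants of an individual
    of age [x], restricted to histories in which each line of descent is restarted
    fewer than [n] times by an event. *)
Fixpoint generation n : R.-spker (R * R) ~> S :=
  if n is k.+1 then generation_step (generation k) else spkzero _ _.

Lemma generation_nd n : kernel_le (generation n) (generation n.+1).
Proof.
have step W W' : kernel_le W W' -> kernel_le (generation_step W) (generation_step W').
  move=> h; apply: kbind_mono; first by move=> x U mU.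
  apply: kbind_mono; first by move=> x U mU.
  apply: kfamily_mono => -[|[|i]] x U mU //=; first exact: h.
  exact: kpow_mono.
elim: n => [|n IH]; last exact: step.
by move=> x U mU; exact: measure_ge0.
Qed.

(** Histories with finitely many events exhaust the law, which has total mass one: see
    [population_total]. *)
Definition descent : R.-spker (R * R) ~> S := klimit generation_nd.

Section laplace_of_descent.
Variable f : R -> R.
Hypothesis hf : bounded_borel_nonneg f.

Definition mixed_value (w : R * R -> R) (t x s : R) : R :=
  (1 - branch_prob (x + s)) * w (t - s, x + s) +
  branch_prob (x + s) * pgf p `|x + s| (w (t - s, 0)).

Definition clock_value (w : R * R -> R) (t x s : R) : R :=
  (t < s)%R%:R * laplace f (nat_dirac (x + t)) + (s <= t)%R%:R * mixed_value w t x s.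

Lemma mixed_value_01 (w : R * R -> R) t x s : (forall tx, 0 <= w tx <= 1) -> 0 <= mixed_value w t x s <= 1.
Proof.
move=> w01; have /andP[b0 b1] := branch_prob_01 (x + s).
have /andP[w0 w1] := w01 (t - s, x + s).
have g0 := pgf_ge0 hp (normr_ge0 (x + s)) (w01 (t - s, 0)).
have g1 := pgf_le1 hp (normr_ge0 (x + s)) (w01 (t - s, 0)).
have h1 : 0 <= 1 - branch_prob (x + s) by rewrite subr_ge0.
apply/andP; split; first by apply: addr_ge0; exact: mulr_ge0.
by rewrite /mixed_value; have := ler_piMr h1 w1; have := ler_piMr b0 g1; lra.
Qed.

Lemma clock_value_01 (w : R * R -> R) t x s : (forall tx, 0 <= w tx <= 1) -> 0 <= clock_value w t x s <= 1.
Proof.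
move=> w01; rewrite /clock_value ltNge; case: (s <= t).
  by rewrite mul0r add0r mul1r mixed_value_01.
by rewrite mul0r addr0 mul1r ltW ?laplace_gt0//= laplace_le1.
Qed.

Lemma measurable_mixed_value (w : R * R -> R) t x :
  measurable_fun setT w -> (forall tx, 0 <= w tx <= 1) ->
  measurable_fun setT (mixed_value w t x).
Proof.
move=> mw w01.
have mxs : measurable_fun setT (fun s : R => x + s) by exact: measurable_funD.
have mts : measurable_fun setT (fun s : R => t - s) by exact: measurable_funB.
have mb : measurable_fun setT (fun s : R => branch_prob (x + s)).
  exact: (measurableT_comp measurable_branch_prob).
have mw' (y : R -> R) : measurable_fun setT y -> measurable_fun setT (fun s : R => w (t - s, y s)).
  by move=> my; apply: (measurableT_comp mw); exact: measurable_fun_pair.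
apply: measurable_funD; apply: measurable_funM => //.
- exact: measurable_funB.
- exact: mw'.
- apply: measurable_pgf_comp => //; first exact: measurableT_comp.
  exact: mw'.
Qed.

Lemma measurable_before (t : R) : measurable_fun setT (fun s : R => (s <= t)%R%:R : R).
Proof.
rewrite (_ : (fun s => _) = \1_[set s : R | s <= t]).
  by apply: measurable_indic; exact: measurable_set_le.
by apply/funext => s; rewrite indicE mem_setE.
Qed.

Lemma measurable_clock_value (w : R * R -> R) t x :
  measurable_fun setT w -> (forall tx, 0 <= w tx <= 1) ->
  measurable_fun setT (clock_value w t x).
Proof.
move=> mw w01; have ms := measurable_before t.
apply: measurable_funD; apply: measurable_funM => //; last exact: measurable_mixed_value.
rewrite (_ : (fun s => _) = fun s => 1 - (s <= t)%R%:R).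
  exact: measurable_funB.
by apply/funext => s; rewrite ltNge; case: (s <= t); rewrite ?subrr ?subr0.
Qed.

Lemma klap_generation_step W t x :
  (klap f (generation_step W) (t, x))%:E =
  (\int[event_clock]_s (clock_value (klap f W) t x s)%:E)%E.
Proof.
rewrite klap_bind//; apply: eq_integral => s _.
rewrite klap_bind//; set e : event := ((t, x), s).
rewrite integral_kdiscrete; last first.
  by move=> j; rewrite lee_fin; have /andP[] := klap_01 hf (kfamily (event_outcome W)) (e, j).
pose v j := klap f (event_outcome W j) e.
have w01 := klap_01 hf W (t - s, 0).
have v0 : v 0 = laplace f (nat_dirac (x + t)) by exact: klap_point.
have vi i : v i.+2 = klap f W (t - s, 0) ^+ i by exact: klap_pow.
apply/cvg_lim => //; rewrite -(cvg_shiftn 2).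
rewrite (_ : [sequence _]_n = fun n => ((t < s)%R%:R * v 0%N + (s <= t)%R%:R *
   ((1 - branch_prob (x + s)) * v 1%N + branch_prob (x + s) *
     pgf_trunc p `|x + s| (klap f W (t - s, 0)) n))%:E); last first.
  apply/funext => n /=; rewrite big_mkord addn2.
  rewrite (eq_bigr (fun j : 'I__ => (event_weight j e * v j)%:E)) => [|j _]; last by rewrite EFinM.
  rewrite sumEFin event_weight_sum; congr (_ + _ * (_ + _ * _))%:E.
  by apply: eq_bigr => i _; rewrite vi.
rewrite /clock_value /mixed_value -v0; apply: cvg_EFin; first exact: nearW.
apply: cvgD; first exact: cvg_cst.
apply: cvgMl_tmp; apply: cvgD; first exact: cvg_cst.
by apply: cvgMl_tmp; apply: pgf_cvg.
Qed.

Lemma klap_generation_cvg tx :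
  klap f (generation n) tx @[n --> \oo] --> klap f descent tx.
Proof.
have mL : measurable_fun setT (laplace f : S -> R) by apply: measurable_laplace; case: hf.
have L01 nu : 0 <= laplace f nu <= 1 by rewrite ltW ?laplace_gt0//= laplace_le1.
have := @integral_klimit _ _ _ _ _ generation generation_nd tx _ mL L01; rewrite -klapE// => h.
exact: fine_cvg h.
Qed.

Lemma klap_descent t x : (klap f descent (t, x))%:E =
  (\int[event_clock]_s (clock_value (klap f descent) t x s)%:E)%E.
Proof.
have w01 n tx : 0 <= klap f (generation n) tx <= 1 by exact: klap_01.
have mw n := measurable_klap hf (generation n).
have c1 : (klap f (generation n.+1) (t, x))%:E @[n --> \oo] --> (klap f descent (t, x))%:E.
  apply: cvg_EFin; first exact: nearW.
  by have := @klap_generation_cvg (t, x); rewrite -cvg_shiftS.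
have c2 : (\int[event_clock]_s (clock_value (klap f (generation n)) t x s)%:E)%E @[n --> \oo] -->
    (\int[event_clock]_s (clock_value (klap f descent) t x s)%:E)%E.
  apply: (@bounded_cvg_integral _ _ _ event_clock 1) => [n|n s|s].
  - exact: measurable_clock_value.
  - by have /andP[h0 h1] := clock_value_01 t x s (w01 n); rewrite ger0_norm.
  rewrite /clock_value /mixed_value; apply: cvgD; first exact: cvg_cst.
  apply: cvgMl_tmp; apply: cvgD; apply: cvgMl_tmp; first exact: klap_generation_cvg.
  have [m m0 hm] := offspring_mean hp.
  apply/cvgrPdist_le => eps e0.
  have cw := @klap_generation_cvg (t - s, 0).
  have e1 : 0 < eps / (m + 1) by rewrite divr_gt0// ltr_wpDl.
  move/cvgrPdist_le : cw => /(_ _ e1); apply: filterS => n hn.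
  apply: le_trans (pgf_lipschitz hp hm (normr_ge0 (x + s)) (klap_01 hf _ _) (klap_01 hf _ _)) _.
  apply: le_trans (_ : m * (eps / (m + 1)) <= _); first by rewrite ler_wpM2l.
  rewrite mulrA ler_pdivrMr ?ltr_wpDl// mulrDr mulr1 mulrC lerDl.
  exact: ltW.
rewrite -(cvg_lim _ c1)// -(cvg_lim _ c2)//; congr (lim _).
by under eq_fun do rewrite klap_generation_step.
Qed.

Lemma integral_clock_before (t : R) (h : R -> R) : 0 <= t -> measurable_fun setT h ->
  (forall s, 0 <= h s) ->
  (\int[event_clock]_s ((s <= t)%R%:R * h s)%:E =
   \int[lebesgue_measure]_(s in `]0%R, t]) (h s * (c * expR (- (c * s))))%:E)%E.
Proof.
move=> t0 mh h0.
have mb : measurable_fun setT (fun s : R => (s <= t)%R%:R * h s).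
  by apply: measurable_funM => //; exact: measurable_before.
have me : measurable_fun setT (fun s : R => h s * (c * expR (- (c * s)))).
  apply: measurable_funM => //; apply: measurable_funM => //.
  apply: measurableT_comp; first exact: measurable_expR.
  by apply: measurable_funN; exact: measurable_funM.
rewrite (ge0_integral_density (mu := lebesgue_measure) (h := exponential_pdf c)) //.
- rewrite integral_itv_obnd_cbnd; last by apply/measurable_EFinP; exact: measurable_funTS.
  rewrite [RHS]integral_mkcond; apply: eq_integral => s _; rewrite patchE mem_setE in_itv/=.
  case: (leP 0 s) => /= s0; last by rewrite lt0_exponential_pdf// mule0.
  rewrite exponential_pdfE//; case: (leP s t) => st; last by rewrite mul0r mul0e.
  by rewrite mul1r EFinM mulNr.
- exact: measurable_exponential_pdf.
- by move=> s; apply: exponential_pdf_ge0; exact: ltW.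
- exact/measurable_EFinP.
- by move=> s; rewrite lee_fin mulr_ge0.
Qed.

Lemma integral_clock_after (t : R) : 0 <= t ->
  (\int[event_clock]_s ((t < s)%R%:R)%:E = (expR (- (c * t)))%:E)%E.
Proof.
move=> t0.
have -> : (\int[event_clock]_s ((t < s)%R%:R)%:E =
    \int[event_clock]_s (1%:E - ((s <= t)%R%:R * 1)%:E))%E.
  apply: eq_integral => s _; rewrite mulr1 ltNge -EFinB.
  by case: (s <= t); rewrite ?subrr ?subr0.
rewrite integralB_EFin//; last 2 first.
- by apply: (@bounded_integrable _ _ _ event_clock 1) => // s; rewrite normr1.
- apply: (@bounded_integrable _ _ _ event_clock 1).
    by apply: measurable_funM => //; exact: measurable_before.
  by move=> s; rewrite mulr1; case: (s <= t); rewrite ?normr1 ?normr0.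
rewrite integral_clock_before// integral_cst// [X in (X - _)%E]mul1e.
transitivity (1 - (1 - expR (- (c * t)))%:E)%E; last by rewrite -EFinB opprB addrC subrK.
congr (_ - _)%E; first exact: probability_setT.
by under eq_integral do rewrite mul1r; exact: integral_exp_decay.
Qed.

(** Conditioning on the first event of the uniformized individual. *)
Lemma klap_descent_mild t x : 0 <= t ->
  klap f descent (t, x) = expR (- (c * t)) * expR (- f `|x + t|) +
    \int[lebesgue_measure]_(s in `]0, t])
      (mixed_value (klap f descent) t x s * (c * expR (- (c * s)))).
Proof.
move=> t0.
have w01 := klap_01 hf descent; have mw := measurable_klap hf descent.
have mm := measurable_mixed_value t x mw w01.
have m01 s := mixed_value_01 t x s w01.
have mf : measurable_fun (`[0, +oo[ : set R) f by case: hf.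
have ma : measurable_fun setT (fun s : R => (t < s)%R%:R : R).
  rewrite (_ : (fun s => _) = fun s => 1 - (s <= t)%R%:R).
    by apply: measurable_funB => //; exact: measurable_before.
  by apply/funext => s; rewrite ltNge; case: (s <= t); rewrite ?subrr ?subr0.
have e : (klap f descent (t, x))%:E =
    ((expR (- (c * t)))%:E * (laplace f (nat_dirac (x + t)))%:E +
     \int[lebesgue_measure]_(s in `]0%R, t])
       (mixed_value (klap f descent) t x s * (c * expR (- (c * s))))%:E)%E.
  rewrite klap_descent; under eq_integral do rewrite /clock_value EFinD.
  rewrite ge0_integralD//; last 4 first.
  - by move=> s _; rewrite lee_fin mulr_ge0// ltW// laplace_gt0.
  - by apply/measurable_EFinP; exact: measurable_funM.
  - by move=> s _; rewrite lee_fin mulr_ge0//; have /andP[] := m01 s.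
  - by apply/measurable_EFinP; apply: measurable_funM => //; exact: measurable_before.
  congr (_ + _)%E; last first.
    by apply: integral_clock_before => // s; have /andP[] := m01 s.
  under eq_integral do rewrite EFinM.
  rewrite ge0_integralZr//; last 2 first.
  - exact/measurable_EFinP.
  - by rewrite lee_fin ltW// laplace_gt0.
  by congr (_ * _)%E; exact: integral_clock_after.
rewrite -[LHS]/(fine (klap f descent (t, x))%:E) e fineD//.
  by rewrite -EFinM /laplace pairing_nat_dirac.
rewrite ge0_fin_numE.
  apply: (@le_lt_trans _ _ (\int[lebesgue_measure]_(s in `]0%R, t]) (c * expR (- (c * s)))%:E)%E).
    apply: ge0_le_integral => //.
    - move=> s _; rewrite lee_fin !mulr_ge0 ?expR_ge0 ?(ltW c0)//.
      by have /andP[] := m01 s.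
    - apply/measurable_EFinP; apply: measurable_funTS; apply: measurable_funM => //.
      apply: measurable_funM => //.
      apply: measurableT_comp; first exact: measurable_expR.
      by apply: measurable_funN; exact: measurable_funM.
    - apply/measurable_EFinP; apply: measurable_funTS; apply: measurable_funM => //.
      apply: measurableT_comp; first exact: measurable_expR.
      by apply: measurable_funN; exact: measurable_funM.
    - move=> s _; rewrite lee_fin ler_piMl// ?mulr_ge0 ?expR_ge0 ?(ltW c0)//.
      by have /andP[] := m01 s.
  by rewrite integral_exp_decay// ltry.
by apply: integral_ge0 => s _; rewrite lee_fin !mulr_ge0 ?expR_ge0 ?(ltW c0)//;
  have /andP[] := m01 s.
Qed.

End laplace_of_descent.

End one_particle_kernel.

(** * From the uniformized equation to the cumulant equation *)

Section lebesgue_isometries.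
Context {R : realType}.
Local Notation leb := (@lebesgue_measure R).
Local Open Scope ereal_scope.

(** The Lebesgue measure is determined by its values on intervals. *)
Lemma ge0_integral_isometry (phi : measurableTypeR R -> measurableTypeR R)
    (D : set (measurableTypeR R)) (f : R -> \bar R) :
  measurable_fun setT phi ->
  (forall a b : R, leb (phi @^-1` `]a, b]) = leb `]a, b]) ->
  measurable D -> measurable_fun D f -> (forall x, D x -> 0 <= f x) ->
  \int[leb]_(x in phi @^-1` D) f (phi x) = \int[leb]_(x in D) f x.
Proof.
move=> mphi hphi mD mf f0; rewrite -(ge0_integral_pushforward mphi leb mD mf)//; last first.
  by move=> x; rewrite inE; exact: f0.
apply: eq_measure_integral => //= A mA AS.
apply/esym/(@lebesgue_measure_unique _ (pushforward leb phi)) => // _ [[a b]] _ <-.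
by rewrite /pushforward; exact/esym/hphi.
Qed.

Lemma ge0_integral_translation (r a b : R) (f : R -> \bar R) :
  measurable_fun (`](r + a)%R, (r + b)%R]%classic : set R) f ->
  (forall x, (r + a < x <= r + b)%R -> 0 <= f x) ->
  \int[leb]_(s in `]a, b]%classic) f (r + s)%R =
  \int[leb]_(s in `](r + a)%R, (r + b)%R]%classic) f s.
Proof.
move=> mf f0.
have pre (u v : R) : (fun x : R => r + x)%R @^-1` `](r + u)%R, (r + v)%R] = `]u, v]%classic.
  by apply/seteqP; split => s; rewrite /= !in_itv/= ltrD2l lerD2l.
rewrite -[in LHS]pre (@ge0_integral_isometry (fun x : R => r + x)%R)//.
- by apply: measurable_funD.
- move=> u v; rewrite -[u in LHS](subrKC r) -[v in LHS](subrKC r) pre !lebesgue_measure_itv /=.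
  by rewrite !lte_fin ltrD2r; case: ifP => // _; rewrite -!EFinB; congr EFin; ring.
Qed.

Lemma integral_exp_growth (c t : R) : (0 < c)%R -> (0 <= t)%R ->
  \int[leb]_(s in `]0%R, t]) (c * expR (- (c * (t - s))))%:E = (1 - expR (- (c * t)))%:E.
Proof.
move=> c0 t0; rewrite -integral_exp_decay//.
have mf : measurable_fun setT (fun s : R => (c * expR (- (c * s)))%:E).
  apply/measurable_EFinP; apply: measurable_funM => //.
  apply: measurableT_comp; first exact: measurable_expR.
  by apply: measurable_funN; exact: measurable_funM.
rewrite [RHS]integral_itv_obnd_cbnd; last exact: measurable_funTS.
rewrite -[RHS]integral_itv_bndo_bndc; last exact: measurable_funTS.
have pre (a b : R) : (fun x : R => t - x)%R @^-1` `[a, b[ = `](t - b)%R, (t - a)%R]%classic.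
  by apply/seteqP; split => s; rewrite /= !in_itv/= => /andP[? ?]; apply/andP; split; lra.
have := @ge0_integral_isometry (fun x : R => t - x)%R `[0%R, t[%classic (fun s => (c * expR (- (c * s)))%:E).
rewrite pre subrr subr0; apply => //.
- exact: measurable_funB.
- move=> a b; rewrite (_ : _ @^-1` _ = `[(t - b)%R, (t - a)%R[%classic); last first.
    by apply/seteqP; split => s; rewrite /= !in_itv/= => /andP[? ?]; apply/andP; split; lra.
  rewrite !lebesgue_measure_itv /= !lte_fin ltrD2l ltrN2; case: ifP => // _.
  by rewrite -!EFinB; congr EFin; ring.
- exact: measurable_funTS.
- by move=> x _; rewrite lee_fin mulr_ge0 ?expR_ge0 ?ltW.
Qed.

Lemma Rintegral_translation (r b : R) (f : R -> R) :
  measurable_fun (`]r, (r + b)%R]%classic : set R) f ->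
  (\int[leb]_(s in `]0, b]) f (r + s) = \int[leb]_(s in `]r, r + b]) f s)%R.
Proof.
move=> mf; congr fine; rewrite integralE [RHS]integralE.
have h (g : R -> \bar R) : measurable_fun (`]r, (r + b)%R]%classic : set R) g ->
    (forall x, 0 <= g x) ->
    \int[leb]_(s in `]0%R, b]%classic) g (r + s)%R =
    \int[leb]_(s in `]r, (r + b)%R]%classic) g s.
  move=> mg g0; have := @ge0_integral_translation r 0%R b g.
  by rewrite addr0; apply => // x _.
have mE : measurable_fun (`]r, (r + b)%R]%classic : set R) (EFin \o f) by exact/measurable_EFinP.
congr (_ - _).
  rewrite -(h _ (measurable_funepos mE) (funepos_ge0 _)).
  by apply: eq_integral => s _; rewrite !funeposE.
rewrite -(h _ (measurable_funeneg mE) (funeneg_ge0 _)).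
by apply: eq_integral => s _; rewrite !funenegE.
Qed.

End lebesgue_isometries.

Lemma measurable_bool_indic {R : realType} d (T : measurableType d) (b : T -> bool) :
  measurable [set x | b x] -> measurable_fun setT (fun x => (b x)%:R : R).
Proof.
move=> mb; rewrite (_ : (fun x => _) = \1_[set x | b x]); first exact: measurable_indic.
by apply/funext => x; rewrite indicE mem_setE.
Qed.

Section killing.
Context {R : realType}.
Local Notation leb := (@lebesgue_measure R).
Variables (c t E K : R) (G phi : R -> R).
Hypotheses (c0 : 0 < c) (t0 : 0 <= t) (E0 : 0 <= E).
Hypotheses (mG : measurable_fun setT G) (G0 : forall s, 0 <= G s <= K).
Hypotheses (mphi : measurable_fun setT phi) (phi0 : forall s, 0 <= phi s <= K).
Hypothesis phiE : forall r, 0 <= r <= t -> phi r = expR (- (c * (t - r))) * E +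
  \int[leb]_(s in `]0, t - r]) (G (r + s) * (c * expR (- (c * s)))).

Let mexp (a : R) : measurable_fun setT (fun s : R => c * expR (- (c * (s + a)))).
Proof.
apply: measurable_funM => //; apply: measurableT_comp; first exact: measurable_expR.
by apply: measurable_funN; apply: measurable_funM => //; exact: measurable_funD.
Qed.

Let ce0 (s : R) : 0 <= c * expR (- (c * s)).
Proof. by rewrite mulr_ge0 ?expR_ge0 ?ltW. Qed.

Let GE s : 0 <= G s. Proof. by have /andP[] := G0 s. Qed.

(** The integrand of the double integral: an event at time [s] whose clock was
    restarted at time [r]. *)
Let kern (r s : R) : R :=
  [&& 0 < r, r < s & s <= t]%R%:R * (c * expR (- (c * (s - r))) * (c * G s)).

Let mkern : measurable_fun setT
  (fun z : measurableTypeR R * measurableTypeR R => (kern z.1 z.2)%:E).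
Proof.
apply/measurable_EFinP.
have m1 : measurable_fun setT (fst : measurableTypeR R * measurableTypeR R -> R).
  exact: measurable_fst.
have m2 : measurable_fun setT (snd : measurableTypeR R * measurableTypeR R -> R).
  exact: measurable_snd.
apply: measurable_funM.
  apply: measurable_bool_indic.
  rewrite (_ : [set _ | _] = [set z : R * R | 0 < z.1] `&` ([set z | z.1 < z.2] `&` [set z | z.2 <= t])).
    by do 2?[apply: measurableI]; [exact: measurable_set_lt|exact: measurable_set_lt|exact: measurable_set_le].
  by apply/seteqP; split => z; [move=> /and3P[]|move=> [? [? ?]]; apply/and3P].
apply: measurable_funM.
  apply: measurable_funM => //; apply: measurableT_comp; first exact: measurable_expR.
  apply: measurable_funN; apply: measurable_funM => //.
  by apply: measurable_funB.
by apply: measurable_funM => //; apply: measurableT_comp.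
Qed.

Let kern0 r s : 0 <= kern r s.
Proof. by rewrite !mulr_ge0 ?ler0n// ltW. Qed.

(** An individual killed at the rate [c] and replaced by the source [G] has a value
    that changes by [c * (G - phi)] per unit of time. Integrating [c * phi] over time
    and exchanging the integrals proves it without differentiating. *)
Lemma killed_equation : phi 0 = E + \int[leb]_(s in `]0, t]) (c * G s - c * phi s).
Proof.
have inner r : 0 < r <= t -> ((c * phi r)%:E = (c * expR (- (c * (t - r))) * E)%:E +
    \int[leb]_s (kern r s)%:E)%E.
  move=> /andP[r0 rt].
  have mk1 : measurable_fun setT (fun s : R => (kern r s)%:E).
    exact: (measurableT_comp mkern (@pair1_measurable _ _ (measurableTypeR R) (measurableTypeR R) r)).
  have e : (\int[leb]_s (kern r s)%:E =
      \int[leb]_(s in `]0%R, (t - r)%R]) (c * (G (r + s) * (c * expR (- (c * s)))))%:E)%E.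
    transitivity (\int[leb]_(s in `]0%R, (t - r)%R]%classic) (kern r (r + s))%:E)%E; last first.
      apply: eq_integral => s; rewrite inE/= in_itv/= => /andP[s0 st].
      rewrite /kern r0 ltrDl s0 (_ : r + s <= t) /=; last lra.
      by congr EFin; rewrite mul1r (_ : r + s - r = s); ring.
    rewrite (@ge0_integral_translation _ r 0 (t - r) (fun s => (kern r s)%:E)); last 2 first.
    - exact: measurable_funTS.
    - by move=> s _; rewrite lee_fin.
    rewrite addr0 subrKC [RHS]integral_mkcond; apply: eq_integral => s _.
    rewrite !patchE !mem_setE !in_itv/=; case: ifPn => // /negbTE h.
    by rewrite /kern h andbF mul0r.
  rewrite e.
  have m1 : measurable_fun setT (fun s => G (r + s) * (c * expR (- (c * s)))).
    apply: measurable_funM; first by apply: measurableT_comp => //; exact: measurable_funD.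
    by have := mexp 0; under eq_fun do rewrite addr0.
  rewrite phiE; last by rewrite (ltW r0).
  rewrite mulrDr EFinD mulrA; congr (_ + _)%E.
  under [RHS]eq_integral do rewrite EFinM.
  rewrite ge0_integralZl_EFin//; last 2 first.
  - by apply/measurable_EFinP; exact: measurable_funTS.
  - exact: ltW.
  - rewrite EFinM; congr (_ * _)%E; rewrite /Rintegral fineK//.
    apply: integrable_fin_num => //; apply: (@integrable_oc _ _ _ (K * c)).
      exact: measurable_funTS.
    move=> s /andP[s0 _]; rewrite ger0_norm; last by apply: mulr_ge0.
    apply: ler_pM => //.
      by have /andP[] := G0 (r + s).
    by rewrite ler_piMr ?(ltW c0)// expR_le1 oppr_le0 mulr_ge0// ltW.
  - by move=> s _; rewrite lee_fin mulr_ge0.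
have mcphi : measurable_fun setT (fun s => c * phi s) by exact: measurable_funM.
have mcG : measurable_fun setT (fun s => c * G s) by exact: measurable_funM.
have icphi : leb.-integrable `]0, t] (fun s => (c * phi s)%:E).
  apply: (@integrable_oc _ _ _ (c * K)); first exact: measurable_funTS.
  move=> s _.
  by have /andP[h0 h1] := phi0 s; rewrite ger0_norm ?mulr_ge0 ?(ltW c0)// ler_pM2l.
have cG1 s : `|c * G s| <= c * K.
  by have /andP[h0 h1] := G0 s; rewrite ger0_norm ?mulr_ge0 ?(ltW c0)// ler_pM2l.
have icG : leb.-integrable `]0, t] (fun s => (c * G s)%:E).
  by apply: (@integrable_oc _ _ _ (c * K)); [exact: measurable_funTS|move=> s _].
have mGe : measurable_fun setT (fun s => c * G s * expR (- (c * s))).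
  apply: measurable_funM => //; apply: measurableT_comp; first exact: measurable_expR.
  by apply: measurable_funN; exact: measurable_funM.
have iGe : leb.-integrable `]0, t] (fun s => (c * G s * expR (- (c * s)))%:E).
  apply: (@integrable_oc _ _ _ (c * K)); first exact: measurable_funTS.
  move=> s /andP[s0 _]; rewrite normrM -[leRHS]mulr1; apply: ler_pM => //.
  by rewrite ger0_norm ?expR_ge0// expR_le1 oppr_le0 mulr_ge0 ?ltW.
have total : (\int[leb]_(r in `]0%R, t]) (c * phi r)%:E = ((1 - expR (- (c * t))) * E)%:E +
    \int[leb]_(s in `]0%R, t]) (c * G s * (1 - expR (- (c * s))))%:E)%E.
  have m2 : measurable_fun setT (fun s : R => c * expR (- (c * (t - s))) * E).
    apply: measurable_funM => //; apply: measurable_funM => //.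
    apply: measurableT_comp; first exact: measurable_expR.
    by apply: measurable_funN; apply: measurable_funM => //; exact: measurable_funB.
  transitivity (\int[leb]_(r in `]0%R, t]) ((c * expR (- (c * (t - r))) * E)%:E +
    \int[leb]_s (kern r s)%:E))%E.
    by apply: eq_integral => r; rewrite inE/= in_itv/=; exact: inner.
  rewrite ge0_integralD//; last 4 first.
  - by move=> s _; rewrite lee_fin mulr_ge0.
  - by apply/measurable_EFinP; exact: measurable_funTS.
  - by move=> s _; apply: integral_ge0 => r _; rewrite lee_fin.
  - apply: measurable_funTS.
    by apply: (measurable_fun_fubini_tonelli_F (m2 := leb) _ mkern) => z; rewrite lee_fin.
  congr (_ + _)%E.
    under eq_integral do rewrite EFinM.
    rewrite ge0_integralZr//; last 2 first.
    - apply/measurable_EFinP; apply: measurable_funTS; apply: measurable_funM => //.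
      apply: measurableT_comp; first exact: measurable_expR.
      by apply: measurable_funN; apply: measurable_funM => //; exact: measurable_funB.
    - by move=> s _; rewrite lee_fin.
    by rewrite integral_exp_growth// EFinM.
  transitivity (\int[leb]_r \int[leb]_s (kern r s)%:E)%E.
    rewrite integral_mkcond; apply: eq_integral => r _; rewrite patchE mem_setE in_itv/=.
    case: ifPn => // /negP h; rewrite integral0_eq// => s _; rewrite /kern.
    by case: and3P => [[r0 rs st]|]; rewrite ?mul0r//; case: h; rewrite r0 (le_trans (ltW rs)).
  rewrite (fubini_tonelli (m1 := leb) (m2 := leb) _ mkern); last by move=> z; rewrite lee_fin.
  rewrite [RHS]integral_mkcond; apply: eq_integral => s _; rewrite patchE mem_setE in_itv/=.
  case: ifPn => [/andP[s0 st]|/negP h]; last first.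
    rewrite integral0_eq// => r _; rewrite /kern.
    by case: and3P => [[r0 rs st]|]; rewrite ?mul0r//; case: h; rewrite st (lt_trans r0 rs).
  have ms : measurable_fun setT (fun r : R => (c * expR (- (c * (s - r))))%:E).
    apply/measurable_EFinP; apply: measurable_funM => //.
    apply: measurableT_comp; first exact: measurable_expR.
    by apply: measurable_funN; apply: measurable_funM => //; exact: measurable_funB.
  transitivity (\int[leb]_(r in `]0%R, s]) ((c * expR (- (c * (s - r))))%:E * (c * G s)%:E))%E.
    rewrite -[RHS]integral_itv_bndo_bndc; last first.
      by apply: emeasurable_funM => //; exact: measurable_funTS.
    rewrite [RHS]integral_mkcond; apply: eq_integral => r _; rewrite patchE mem_setE in_itv/=.
    by rewrite /kern st andbT -EFinM; case: ifPn; rewrite ?mul1r ?mul0r.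
  rewrite ge0_integralZr//; last 3 first.
  - exact: measurable_funTS.
  - by move=> r _; rewrite lee_fin.
  - by rewrite lee_fin mulr_ge0// ltW.
  by rewrite integral_exp_growth 1?ltW// -EFinM mulrC.
have m1e : measurable_fun setT (fun s => c * G s * (1 - expR (- (c * s)))).
  apply: measurable_funM => //; apply: measurable_funB => //.
  apply: measurableT_comp; first exact: measurable_expR.
  by apply: measurable_funN; exact: measurable_funM.
have Rtotal : \int[leb]_(r in `]0, t]) (c * phi r) = (1 - expR (- (c * t))) * E +
    \int[leb]_(s in `]0, t]) (c * G s * (1 - expR (- (c * s)))).
  rewrite /Rintegral total fineD//.
  apply: integrable_fin_num => //; apply: (@integrable_oc _ _ _ (c * K)).
    exact: measurable_funTS.
  move=> s /andP[s0 _]; rewrite normrM -[leRHS]mulr1; apply: ler_pM => //.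
  rewrite ger0_norm; first by rewrite gerBl expR_ge0.
  by rewrite subr_ge0 expR_le1 oppr_le0 mulr_ge0 ?ltW.
rewrite RintegralB// Rtotal phiE ?lexx// subr0.
rewrite [in RHS](_ : (fun s => c * G s * (1 - _)) = fun s => c * G s - c * G s * expR (- (c * s))); last first.
  by apply/funext => s; rewrite mulrBr mulr1.
rewrite RintegralB//.
under [X in _ + X = _]eq_Rintegral do rewrite add0r mulrA (mulrC (G _)).
ring.
Qed.

End killing.
Local Opaque klap descent.

Section descent_law.
Context {R : realType}.
Local Notation S := (nat_measure R).
Local Notation leb := (@lebesgue_measure R).
Variables (alpha : R -> R) (p : R -> nat -> R) (c : R).
Hypotheses (halpha : bounded_borel_nonneg alpha) (hp : offspring_law p).
Hypotheses (c0 : 0 < c) (alphac : forall x, 0 <= x -> alpha x <= c).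

Local Notation D := (descent halpha hp c0 alphac).

Section fixed_function.
Variable f : R -> R.
Hypothesis hf : bounded_borel_nonneg f.

Definition survival (t x : R) : R := klap f D (t, x).

Lemma survival_01 t x : 0 <= survival t x <= 1. Proof. exact: klap_01. Qed.

Lemma measurable_survival d (T : measurableType d) (t x : T -> R) :
  measurable_fun setT t -> measurable_fun setT x ->
  measurable_fun setT (fun z => survival (t z) (x z)).
Proof.
move=> mt mx; apply: (measurableT_comp (measurable_klap hf D)).
exact: measurable_fun_pair.
Qed.

Lemma survival_unit_valued : unit_valued survival.
Proof.
split; last by move=> t x _ _; exact: survival_01.
by apply: measurable_funTS; apply: measurable_survival;
  [exact: measurable_fst|exact: measurable_snd].
Qed.

(** [killed_equation] along the line where time and age grow together: the fictitious
    events cancel and the uniformized equation becomes the cumulant equation. *)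
Lemma survival_equation t x : 0 <= t -> 0 <= x ->
  survival t x = expR (- f (x + t)) +
    \int[leb]_(s in `]0, t]) cumulant_rate alpha p survival t x s.
Proof.
move=> t0 x0.
have w01 := klap_01 hf D; have mw := measurable_klap hf D.
have := @killed_equation R c t (expR (- f (x + t))) 1 (mixed_value alpha p c (klap f D) t x)
  (fun r => survival (t - r) (x + r)).
rewrite subr0 addr0 => ->//.
- congr (_ + _); apply: eq_Rintegral => s; rewrite inE/= in_itv/= => /andP[s0 st].
  rewrite /cumulant_rate /mixed_value /branch_prob ger0_norm ?addr_ge0 ?(ltW s0)//.
  by rewrite /survival; field; rewrite gt_eqF.
- exact: measurable_mixed_value.
- by move=> s; exact: (mixed_value_01 halpha hp c0 alphac).
- by apply: measurable_survival; [exact: measurable_funB|exact: measurable_funD].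
- by move=> s; exact: survival_01.
move=> r /andP[r0 rt]; rewrite /survival (klap_descent_mild halpha hp c0 alphac hf); last first.
  by rewrite subr_ge0.
have e : \int[leb]_(s in `]0, t - r])
      (mixed_value alpha p c (klap f D) (t - r) (x + r) s * (c * expR (- (c * s)))) =
    \int[leb]_(s in `]0, t - r])
      (mixed_value alpha p c (klap f D) t x (r + s) * (c * expR (- (c * s)))).
  by apply: eq_Rintegral => s _; rewrite /mixed_value addrA opprD addrA.
have -> : x + r + (t - r) = x + t by ring.
by rewrite e ger0_norm ?addr_ge0.
Qed.

(** No event at all occurs before the time [t] with probability [expR (- (c * t))]. *)
Lemma survival_ge t x : 0 <= t -> 0 <= x -> expR (- (c * t)) * expR (- f (x + t)) <= survival t x.
Proof.
move=> t0 x0; rewrite /survival klap_descent_mild// ger0_norm ?addr_ge0// lerDl.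
apply: Rintegral_ge0 => s _; rewrite !mulr_ge0 ?expR_ge0 ?(ltW c0)//.
by have /andP[] := mixed_value_01 halpha hp c0 alphac t x s (klap_01 hf D).
Qed.

Lemma survival_gt0 t x : 0 <= t -> 0 <= x -> 0 < survival t x.
Proof. by move=> t0 x0; apply: lt_le_trans (survival_ge t0 x0); rewrite mulr_gt0// expR_gt0. Qed.

Lemma survival_rate_measurable t x : 0 <= x ->
  measurable_fun (`]0, t] : set R) (cumulant_rate alpha p survival t x).
Proof. by move=> x0; apply: measurable_cumulant_rate => //; exact: survival_unit_valued. Qed.

Lemma survival_rate_integrable t x : 0 <= x ->
  leb.-integrable `]0, t] (EFin \o cumulant_rate alpha p survival t x).
Proof.
move=> x0; have [_ [C hC] _] := halpha.
apply: (@integrable_oc _ _ _ C); first exact: survival_rate_measurable.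
by move=> s; apply: cumulant_rate_bound => //; exact: survival_unit_valued.
Qed.

(** The equation started at the time [s] along the same line of ages. *)
Lemma survival_split s t x : 0 <= s -> 0 <= t -> 0 <= x ->
  survival (s + t) x = survival t (x + s) +
    \int[leb]_(r in `]0, s]) cumulant_rate alpha p survival (s + t) x r.
Proof.
move=> s0 t0 x0; rewrite survival_equation ?addr_ge0// [in RHS]survival_equation ?addr_ge0//.
rewrite (addrA x) -!addrA; congr (_ + _).
rewrite (_ : \int[leb]_(r in `]0, t]) _ =
    \int[leb]_(r in `]s, s + t]) cumulant_rate alpha p survival (s + t) x r); last first.
  rewrite -Rintegral_translation; last first.
    apply: (@measurable_funS _ _ _ _ (`]0, s + t]%classic : set R)); [by []| |exact: survival_rate_measurable] => r.
    by rewrite /= !in_itv/= => /andP[sr ->]; rewrite (le_lt_trans s0 sr).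
  apply: eq_Rintegral => r _; rewrite /cumulant_rate.
  have -> : s + t - (s + r) = t - r by ring.
  by rewrite addrA.
have e : `]0, s + t]%classic = `]0, s] `|` `]s, s + t] :> set R.
  by rewrite -itv_bndbnd_setU// !bnd_simp// lerDl.
rewrite [in LHS]e Rintegral_setU//; first by rewrite addrC.
  by rewrite -e; exact: survival_rate_integrable.
apply/disj_setPS => r [] /=; rewrite !in_itv/= => /andP[_ rs] /andP[sr _].
by rewrite ltNge rs in sr.
Qed.

Definition cumulant (t x : R) : R := - ln (survival t x).

Lemma expR_cumulant t x : 0 <= t -> 0 <= x -> expR (- cumulant t x) = survival t x.
Proof. by move=> t0 x0; rewrite /cumulant opprK lnK// posrE survival_gt0. Qed.

Lemma cumulant_ge0 t x : 0 <= cumulant t x.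
Proof. by rewrite oppr_ge0 ln_le0//; have /andP[] := survival_01 t x. Qed.

Lemma cumulant_solves : cumulant_solution alpha (pgf p) f cumulant.
Proof.
split.
- apply: measurable_funTS; apply: measurable_funN.
  apply: (measurableT_comp (@measurable_ln R)).
  by apply: measurable_survival; [exact: measurable_fst|exact: measurable_snd].
- by move=> t x _ _; exact: cumulant_ge0.
move=> t x t0 x0; rewrite expR_cumulant// survival_equation//; congr (_ + _).
apply: eq_Rintegral => s; rewrite inE/= in_itv/= => /andP[s0 st].
by rewrite !expR_cumulant ?subr_ge0 ?addr_ge0// ltW.
Qed.

Lemma cumulant_borel t : 0 <= t -> bounded_borel_nonneg (cumulant t).
Proof.
move=> t0; split; last by move=> x _; exact: cumulant_ge0.
- apply: measurable_funTS; apply: measurable_funN.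
  by apply: (measurableT_comp (@measurable_ln R)); exact: measurable_survival.
have [_ [C hC] _] := hf; exists (c * t + C) => x x0.
rewrite ger0_norm ?cumulant_ge0// lerNl -ler_expR lnK ?posrE ?survival_gt0//.
apply: le_trans (survival_ge t0 x0); rewrite -expRD ler_expR opprD lerD2l lerN2.
by apply: le_trans (ler_norm _) (hC _ _); rewrite addr_ge0.
Qed.

End fixed_function.

Lemma cumulantP f : bounded_borel_nonneg f ->
  cumulant_unique_solution alpha (pgf p) f (cumulant f).
Proof.
move=> hf; split; first exact: cumulant_solves.
by move=> u' hu' t x t0 x0; exact: (cumulant_solution_unique halpha hp (cumulant_solves hf) hu').
Qed.

(** As functions of [s], both sides solve the cumulant equation with the initial value
    [cumulant f t]. *)
Lemma survival_flow f s t x : bounded_borel_nonneg f -> 0 <= s -> 0 <= t -> 0 <= x ->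
  survival f (s + t) x = survival (cumulant f t) s x.
Proof.
move=> hf s0 t0 x0; have hu := cumulant_borel hf t0.
apply: (cumulant_equation_unique halpha hp (f := cumulant f t)
  (w := fun s x => survival f (s + t) x) _ (survival_unit_valued hu)) => //.
- split; last by move=> *; exact: survival_01.
  apply: measurable_funTS; apply: (measurable_survival hf); last exact: measurable_snd.
  by apply: measurable_funD => //; exact: measurable_fst.
- move=> {}s {}x {}s0 {}x0; rewrite (survival_split hf s0 t0 x0) (expR_cumulant hf t0 (addr_ge0 x0 s0)).
  have e : \int[leb]_(r in `]0, s]) cumulant_rate alpha p (survival f) (s + t) x r =
      \int[leb]_(r in `]0, s]) cumulant_rate alpha p (fun q => survival f (q + t)) s x r.
    apply: eq_Rintegral => r _; rewrite /cumulant_rate.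
    by have -> : s + t - r = s - r + t by ring.
  by rewrite e.
- by move=> *; exact: survival_equation.
Qed.

Lemma cumulant_flow f s t x : bounded_borel_nonneg f -> 0 <= s -> 0 <= t -> 0 <= x ->
  cumulant f (s + t) x = cumulant (cumulant f t) s x.
Proof. by move=> hf s0 t0 x0; rewrite /cumulant survival_flow. Qed.

(** The constant 1 solves the equation for [f = 0], which expresses that the
    descendants have total mass one. *)
Lemma survival0 t x : 0 <= t -> 0 <= x -> survival (fun=> 0) t x = 1.
Proof.
have h0 := @bounded_borel_nonneg0 R.
apply: (cumulant_equation_unique halpha hp (f := fun=> 0) (w' := fun _ _ => 1)
  (survival_unit_valued h0)).
- by split => // *; rewrite ler01 lexx.
- by move=> *; exact: survival_equation.
move=> {}t {}x t0 x0; rewrite oppr0 expR0.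
under eq_Rintegral => s.
  rewrite inE/= in_itv/= => /andP[s0 _].
  rewrite /cumulant_rate pgf1 ?addr_ge0 ?(ltW s0)// subrr mulr0.
  over.
by rewrite /Rintegral integral0_eq// addr0.
Qed.

End descent_law.

(** * The transition semigroup *)

Section probability_packing.
Context {R : realType} d d' (X : measurableType d) (Y : measurableType d').
Variable k : X -> {measure set Y -> \bar R}.

Definition pk_fun (mk : forall U, measurable U -> measurable_fun setT (k ^~ U))
  (k1 : forall x, k x setT = 1%E) : X -> {measure set Y -> \bar R} := k.

Hypothesis mk : forall U, measurable U -> measurable_fun setT (k ^~ U).
Hypothesis k1 : forall x, k x setT = 1%E.

HB.instance Definition _ := isKernel.Build _ _ X Y R (pk_fun mk k1) mk.

HB.instance Definition _ := Kernel_isProbability.Build _ _ X Y R (pk_fun mk k1) k1.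

Definition mk_pker : R.-pker X ~> Y := pk_fun mk k1.

End probability_packing.

Section descent_law.
Context {R : realType}.
Local Notation S := (nat_measure R).
Local Notation leb := (@lebesgue_measure R).
Variables (alpha : R -> R) (p : R -> nat -> R) (c : R).
Hypotheses (halpha : bounded_borel_nonneg alpha) (hp : offspring_law p).
Hypotheses (c0 : 0 < c) (alphac : forall x, 0 <= x -> alpha x <= c).
Local Notation D := (descent halpha hp c0 alphac).
Local Notation cumulant := (cumulant halpha hp c0 alphac).
Local Notation cumulant_borel := (cumulant_borel halpha hp c0 alphac).

Lemma cumulant_at0 f x : bounded_borel_nonneg f -> 0 <= x -> cumulant f 0 x = f x.
Proof.
move=> hf x0; rewrite /cumulant survival_equation//.
by rewrite set_itvoc0 Rintegral_set0 !addr0 expRK opprK.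
Qed.

Section population.
Variable t : R.
Local Notation t' := (Num.max t 0).

Lemma max0_ge0 : 0 <= t'. Proof. by rewrite le_max lexx orbT. Qed.

Lemma measurable_atom_descent m : measurable_fun setT (fun sigma : S => (t', atom sigma m)).
Proof. by apply: measurable_fun_pair => //; exact: measurable_atom. Qed.

Fixpoint descent_of_atoms n : R.-spker S ~> S :=
  if n is m.+1 then kconv (descent_of_atoms m) (kprecomp (measurable_atom_descent m) D)
  else kpoint (@measurable_cst _ _ S S setT nat_measure0).

Lemma measurable_with_mass : measurable_fun setT (fun sigma : S => (sigma, mass sigma)).
Proof. by apply: measurable_fun_pair => //; exact: measurable_mass. Qed.

(** The lines of descent of the individuals of [sigma] are independent, so their laws
    are convolved. *)
Definition population_descent : R.-spker S ~> S :=
  kprecomp measurable_with_mass (kfamily descent_of_atoms).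

Lemma klap_descent_of_atoms f n sigma : bounded_borel_nonneg f ->
  klap f (descent_of_atoms n) sigma = expR (- \sum_(m < n) cumulant f t' (atom sigma m)).
Proof.
move=> hf; elim: n => [|n IH].
  by rewrite klap_point// laplace_measure0// big_ord0 oppr0 expR0.
rewrite big_ord_recr/= opprD expRD -IH (klap_conv hf); congr (_ * _).
by rewrite (expR_cumulant halpha hp c0 alphac hf) ?atom_ge0 ?max0_ge0.
Qed.

Lemma klap_population f sigma : bounded_borel_nonneg f ->
  klap f population_descent sigma = laplace (cumulant f t') sigma.
Proof.
move=> hf; rewrite /laplace pairingE; last by case: (cumulant_borel hf max0_ge0).
exact: klap_descent_of_atoms.
Qed.

Lemma population_total sigma : population_descent sigma setT = 1%E.
Proof.
rewrite -klap0 klap_population; last exact: bounded_borel_nonneg0.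
rewrite /laplace pairingE; last by case: (cumulant_borel (@bounded_borel_nonneg0 R) max0_ge0).
by rewrite big1 ?oppr0 ?expR0// => m _; rewrite /cumulant survival0 ?atom_ge0 ?max0_ge0// ln1 oppr0.
Qed.

End population.

Definition transition (t : R) : R.-pker S ~> S :=
  mk_pker (fun U mU => measurable_kernel (population_descent t) U mU) (population_total t).

Lemma klap_transition f t sigma : bounded_borel_nonneg f -> 0 <= t ->
  klap f (population_descent t) sigma = laplace (cumulant f t) sigma.
Proof. by move=> hf t0; rewrite (klap_population t sigma hf) (max_idPl t0). Qed.

Lemma transition_laplace f t sigma : bounded_borel_nonneg f -> 0 <= t ->
  (\int[transition t sigma]_nu (laplace f nu)%:E = (laplace (cumulant f t) sigma)%:E)%E.
Proof. by move=> hf t0; rewrite -klap_transition// klapE. Qed.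

(** The flow property of the cumulant gives both sides the same Laplace functionals. *)
Lemma transition_semigroupP : transition_semigroup transition.
Proof.
split => [sigma B mB|s t sigma B s0 t0 mB].
  apply: (@laplace_determines R (spker_measure (population_descent 0) sigma) (\d_sigma)) => // f hf.
  apply: (eq_trans (transition_laplace sigma hf (lexx 0))).
  rewrite integral_dirac//; last exact: measurable_laplaceE.
  rewrite diracT mul1e; congr EFin; rewrite /laplace.
  have mf : measurable_fun (`[0, +oo[ : set R) f by case: hf.
  rewrite !pairingE//; last by case: (cumulant_borel hf (lexx 0)).
  by congr (expR (- _)); apply: eq_bigr => m _; rewrite cumulant_at0 ?atom_ge0.
pose kt := kprecomp (@measurable_snd _ _ S S) (population_descent t).
pose k2 : R.-spker S ~> S := kbind (population_descent s) kt.
have -> : (\int[transition s sigma]_y transition t y B)%E = k2 sigma B by [].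
apply: (@laplace_determines R (spker_measure (population_descent (s + t)) sigma) (spker_measure k2 sigma)) => // f hf.
have st0 : 0 <= s + t by exact: addr_ge0.
apply: (eq_trans (esym (klapE hf (population_descent (s + t)) sigma))).
apply: (eq_trans _ (klapE hf k2 sigma)).
apply: (eq_trans _ (esym (klap_bind hf (population_descent s) kt sigma))).
have ht := cumulant_borel hf t0.
under eq_integral => nu _.
  rewrite (_ : klap f kt (sigma, nu) = laplace (cumulant f t) nu); last exact: klap_transition.
  over.
rewrite (klap_transition sigma hf st0).
apply: (eq_trans _ (klapE ht (population_descent s) sigma)).
rewrite (klap_transition sigma ht s0); apply: congr1.
rewrite /laplace !pairingE; last 2 first.
- by case: (cumulant_borel ht s0).
- by case: (cumulant_borel hf st0).
by congr (expR (- _)); apply: eq_bigr => m _; rewrite cumulant_flow ?atom_ge0.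
Qed.

Lemma transition_branching : age_branching_semigroup alpha (pgf p) transition.
Proof.
split; first exact: transition_semigroupP.
move=> f hf; exists (cumulant f); split; first exact: cumulantP.
by move=> t sigma t0; exact: transition_laplace.
Qed.

End descent_law.

(** * Points of a Poisson random measure *)

Section countable_generation.

(** A countable pi-system that generates the sigma-algebra. *)
Definition countable_generator d (T : measurableType d) (G : nat -> set T) :=
  [/\ forall i j, exists k, G k = G i `&` G j, exists i, G i = setT,
      forall i, measurable (G i) & measurable `<=` <<s range G >>].

Lemma countable_generator_prod d1 d2 (T1 : measurableType d1) (T2 : measurableType d2)
    (G1 : nat -> set T1) (G2 : nat -> set T2) :
  countable_generator G1 -> countable_generator G2 ->
  exists G : nat -> set (T1 * T2), countable_generator G.
Proof.
move=> [I1 [t1 T1E] M1 S1] [I2 [t2 T2E] M2 S2].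
pose G n : set (T1 * T2) := if unpickle n is Some ij then G1 (ij : nat * nat).1 `*` G2 ij.2 else setT.
have GE i j : G (pickle (i, j)) = G1 i `*` G2 j by rewrite /G pickleK.
have sG : sigma_algebra setT <<s range G >> by exact: smallest_sigma_algebra.
have [s0 sC sU] := sG.
have sub X : range G X -> <<s range G >> X by exact: sub_sigma_algebra.
exists G; split.
- move=> i j; rewrite /G; case: (unpickle i) => [[i1 i2]|]; last first.
    by exists j; rewrite setTI.
  case: (unpickle j) => [[j1 j2]|]; last by exists (pickle (i1, i2)); rewrite pickleK setIT.
  have [k1 e1] := I1 i1 j1; have [k2 e2] := I2 i2 j2.
  by exists (pickle (k1, k2)); rewrite pickleK /= e1 e2 setXI.
- by exists (pickle (t1, t2)); rewrite GE T1E T2E setXTT.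
- move=> i; rewrite /G; case: unpickle => [[a b]|//]; exact: measurableX.
rewrite measurable_prod_measurableType; apply: smallest_sub => // _ [A mA [B mB <-]].
have cyl1 : <<s range G >> (A `*` setT).
  have : <<s range G1 >> `<=` [set A | <<s range G >> (A `*` [set: T2])].
    apply: smallest_sub => [|_ [i _ <-]]; last first.
      by apply: sub; exists (pickle (i, t2)) => //; rewrite GE T2E.
    split => [|C /= h|F /= h].
    - by rewrite /= set0X.
    - have -> : (setT `\` C) `*` [set: T2] = setT `\` (C `*` setT).
        by apply/seteqP; split => z /=; tauto.
      exact: sC.
    - have -> : (\bigcup_k F k) `*` [set: T2] = \bigcup_k (F k `*` setT).
        by apply/seteqP; split => z [] => [[k _ zk] _|k _ [zk _]]; [exists k|split => //; exists k].
      exact: sU.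
  by apply; exact: S1.
have cyl2 : <<s range G >> (setT `*` B).
  have : <<s range G2 >> `<=` [set B | <<s range G >> ([set: T1] `*` B)].
    apply: smallest_sub => [|_ [i _ <-]]; last first.
      by apply: sub; exists (pickle (t1, i)) => //; rewrite GE T1E.
    split => [|C /= h|F /= h].
    - by rewrite /= setX0.
    - have -> : [set: T1] `*` (setT `\` C) = setT `\` (setT `*` C).
        by apply/seteqP; split => z /=; tauto.
      exact: sC.
    - have -> : [set: T1] `*` (\bigcup_k F k) = \bigcup_k (setT `*` F k).
        by apply/seteqP; split => z [] => [_ [k _ zk]|k _ [_ zk]]; [exists k|split => //; exists k].
      exact: sU.
  by apply; exact: S2.
have -> : A `*` B = (A `*` setT) `&` (setT `*` B).
  by rewrite -setXI setIT setTI.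
exact: (@measurableI _ (g_sigma_algebraType (range G))).
Qed.

Lemma countable_generator_real (R : realType) : exists G : nat -> set R, countable_generator G.
Proof.
pose G n : set R := if odflt None (unpickle n) is Some q then `]-oo, (ratr (q : rat))]%classic else setT.
have GE q : G (pickle (Some q)) = `]-oo, (ratr q)]%classic by rewrite /G pickleK.
have sG : sigma_algebra setT <<s range G >> by exact: smallest_sigma_algebra.
have [s0 sC sU] := sG.
exists G; split.
- move=> i j; rewrite /G; case: (odflt None (unpickle i)) => [q|]; last by exists j; rewrite setTI.
  case: (odflt None (unpickle j)) => [q'|]; last by exists (pickle (Some q)); rewrite pickleK setIT.
  exists (pickle (Some (Num.min q q'))); rewrite pickleK /= ; apply/seteqP; split => x /=; rewrite !in_itv/=.
    by move=> h; split; apply: (le_trans h); rewrite ler_rat ge_min lexx ?orbT.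
  by case: (leP q q') => _ [].
- by exists (pickle (None : option rat)); rewrite /G pickleK.
- by move=> i; rewrite /G; case: (odflt None (unpickle i)).
have e : @measurable _ R = <<s @RGenInftyO.G R >> by exact: RGenInftyO.measurableE.
rewrite e; apply: smallest_sub => // _ [x ->].
have -> : `]-oo, x[%classic = \bigcup_n (if unpickle n is Some q then
    (if (ratr (q : rat) < x)%R then `]-oo, (ratr q)]%classic else set0) else set0) :> set R.
  apply/seteqP; split => [y|y [n _]] /=; rewrite in_itv/=.
    move=> yx; have [q] := rat_in_itvoo yx; rewrite in_itv/= => /andP[yq qx].
    by exists (pickle q); [exact: I|rewrite pickleK qx /= in_itv/= ltW].
  by case: unpickle => // q; case: ifPn => // qx; rewrite /= in_itv/= => /le_lt_trans; apply.
apply: sU => n; case: unpickle => // q; case: ifPn => // _.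
by apply: sub_sigma_algebra; exists (pickle (Some q)) => //; rewrite GE.
Qed.

Lemma countable_generator_nat : exists G : nat -> set nat, countable_generator G.
Proof.
pose G n : set nat := if n is k.+1 then [set i | (i <= k)%N] else setT.
have sG : sigma_algebra setT <<s range G >> by exact: smallest_sigma_algebra.
have [s0 sC sU] := sG.
have sub n : <<s range G >> (G n) by apply: sub_sigma_algebra; exists n.
exists G; split.
- move=> [|i] [|j]; [by exists 0%N; rewrite setTI|by exists j.+1; rewrite setTI|by exists i.+1; rewrite setIT|].
  exists (minn i j).+1; apply/seteqP; split => k /=; rewrite leq_min; first by move=> /andP[].
  by move=> [-> ->].
- by exists 0%N.
- by [].
move=> A _.
have -> : A = \bigcup_n (if n \in A then [set n] else set0).
  apply/seteqP; split => [n An|n [k _]]; first by exists n => //; rewrite mem_set.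
  by case: ifPn => // kA -> ; exact: set_mem.
apply: sU => n; case: ifPn => // _.
have -> : [set n] = G n.+1 `&` (setT `\` (if n is k.+1 then G k.+1 else set0)).
  apply/seteqP; split => [k /= ->|k /=].
    by split => //; split => //; case: n => //= n; rewrite ltnn.
  case: n => [|n] /= [h [_ h']]; first by move: h; rewrite leqn0 => /eqP.
  by apply/eqP; rewrite eqn_leq h /=; rewrite ltnNge; apply/negP.
apply: (@measurableI _ (g_sigma_algebraType (range G))); [exact: sub|by apply: sC; case: n].
Qed.

Lemma countable_generator_mark (R : realType) :
  exists G : nat -> set (mark_space R), countable_generator G.
Proof.
have [G gG] := countable_generator_real R; have [N gN] := countable_generator_nat.
have [G2 g2] := countable_generator_prod gG gG.
have [G3 g3] := countable_generator_prod g2 gG.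
have [G4 g4] := countable_generator_prod g3 gN.
exact: (countable_generator_prod g4 gG).
Qed.

End countable_generation.

Section natural_measures.
Context {R : realType} d (T : measurableType d).
Variable m : {measure set T -> \bar R}.

Definition natural (x : \bar R) := exists n : nat, x = n%:R%:E.

(** An increasing sequence of integers with a finite limit is eventually constant. *)
Lemma natural_cvg (u : nat -> \bar R) (l : \bar R) : (l < +oo)%E ->
  (forall n, natural (u n)) -> {homo u : n k / (n <= k)%N >-> (n <= k)%E} ->
  u n @[n --> \oo] --> l -> natural l.
Proof.
move=> loo un nd ul.
have ule n : (u n <= l)%E.
  rewrite -(cvg_lim _ ul)//; apply: lime_ge; first by apply/cvg_ex; eexists; exact: ul.
  by exists n => // k /= nk; exact: nd.
have l0 : (0 <= l)%E by have [k e] := un 0%N; apply: le_trans (ule 0%N); rewrite e lee_fin.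
have lf : l \is a fin_num by rewrite ge0_fin_numE.
have uf : fine (u n) @[n --> \oo] --> fine l by apply: fine_cvg; rewrite fineK.
have [N _ hN] : \forall n \near \oo, fine l - 1 < fine (u n).
  by apply: (cvgr_gt _ uf); rewrite ltrBlDr ltrDl.
have [k e] := un N; exists k.
have const n : (N <= n)%N -> u n = k%:R%:E.
  move=> Nn; have [j ej] := un n; rewrite ej; congr (_%:R%:E); apply/eqP.
  rewrite eqn_leq; apply/andP; split; last first.
    by have := nd _ _ Nn; rewrite e ej lee_fin ler_nat.
  have := hN N (leqnn N); have := ule n; rewrite e ej -(fineK lf) lee_fin /= => h1 h2.
  by rewrite -ltnS -(ltr_nat R) -natr1; lra.
have uk : u n @[n --> \oo] --> (k%:R%:E : \bar R).
  by apply: cvg_near_cst; exists N => // n /= /const ->.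
by rewrite -(cvg_lim _ ul)// -(cvg_lim _ uk).
Qed.

(** The sets on which the measure is integer-valued form a Dynkin system, by
    [natural_cvg]. *)
Lemma natural_valued (G : nat -> set T) : (m setT < +oo)%E -> countable_generator G ->
  (forall i, natural (m (G i))) -> forall B, measurable B -> natural (m B).
Proof.
move=> moo [GI [t GT] mG SG] nG B mB.
pose H := [set B | measurable B /\ natural (m B)].
suff : <<s range G >> `<=` H by move=> /(_ B (SG _ mB))[].
have fin A : measurable A -> (m A < +oo)%E.
  by move=> mA; apply: le_lt_trans moo; apply: le_measure => //; rewrite inE.
apply: lambda_system_subset => //.
- by move=> _ _ [i _ <-] [j _ <-]; have [k e] := GI i j; exists k.
- split => //.
  + by split => //; rewrite -GT.
  + move=> A B' B'A [mA [a ea]] [mB' [b eb]]; split; first exact: measurableD.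
    exists (a - b)%N.
    have -> : m (A `\` B') = (m A - m (A `&` B'))%E by apply: measureD => //; exact: fin.
    rewrite (setIidr B'A) ea eb -EFinB natrB//.
    by rewrite -(ler_nat R) -lee_fin -ea -eb; apply: le_measure => //; rewrite inE.
  + move=> F ndF hF; have mF k : measurable (F k) by case: (hF k).
    have mU : measurable (\bigcup_k F k) by exact: bigcup_measurable.
    split => //; apply: (@natural_cvg (m \o F)); [exact: fin|by move=> n; case: (hF n)| |].
      by move=> n k nk /=; apply: le_measure; rewrite ?inE//; apply/subsetPset; exact: ndF.
    exact: nondecreasing_cvg_mu.
- by move=> _ [i _ <-]; split.
Qed.

(** The mass is carried by an atom of the countably generated sigma-algebra: intersect
    the generators of full measure with the complements of the null ones. *)
Lemma unit_mass_dirac (G : nat -> set T) : m setT = 1%E -> countable_generator G ->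
  (forall B, measurable B -> natural (m B)) ->
  exists e, forall B, measurable B -> m B = \d_e B.
Proof.
move=> m1 [GI [t GT] mG SG] nm.
have val B : measurable B -> m B = 0%E \/ m B = 1%E.
  move=> mB; have [[|[|n]] e] := nm B mB; [by left|by right|].
  have : (m B <= m setT)%E by apply: le_measure; rewrite ?inE.
  by rewrite e m1 lee_fin -[1](mulr1n 1) ler_nat.
pose K i := if m (G i) == 1%E then ~` G i else G i.
have mK i : measurable (K i) by rewrite /K; case: ifP => _; [exact: measurableC|].
have K0 i : m (K i) = 0%E.
  rewrite /K; case: ifPn => [/eqP h|/eqP h]; last by case: (val _ (mG i)).
  have e := measureU m (mG i) (measurableC (mG i)) (setICr _).
  have : (1 = 1 + m (~` G i))%E.
    apply: (etrans (esym m1)); apply: (etrans _ (etrans e _)); first by rewrite setUCr.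
    by congr (_ + _)%E.
  case: (val _ (measurableC (mG i))) => -> //.
  by move=> /eqP; rewrite eqe -[X in X == _]addr0 (inj_eq (addrI _)) eq_sym oner_eq0.
have U0 : m (\bigcup_i K i) = 0%E.
  apply/eqP; rewrite eq_le measure_ge0 andbT.
  apply: le_trans (measure_sigma_subadditive m mK _ (@subset_refl _ _)) _ ; first exact: bigcup_measurable.
  by rewrite eseries0// => i _ _; exact: K0.
have [e eU] : exists e, ~ (\bigcup_i K i) e.
  apply: contrapT => /forallNP h; have : m setT = 0%E.
    by rewrite -[setT](_ : \bigcup_i K i = setT)//; apply/seteqP; split => // x _; exact: contrapT (h x).
  by move=> /(etrans (esym m1)) /eqP; rewrite eqe oner_eq0.
exists e => B mB.
apply: (@measure_unique _ _ _ (range G) (fun=> setT) _ _ _ _ m (\d_e)) => //.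
- by apply/seteqP; split; [exact: SG|apply: smallest_sub => [|_ [i _ <-]]; [exact: sigma_algebra_measurable|]].
- by move=> _ _ [i _ <-] [j _ <-]; have [k ek] := GI i j; exists k.
- by exists t.
- by rewrite bigcup_const//; exists 0%N.
- move=> _ [i _ <-]; suff : m (G i) = (\1_(G i) e)%:E by [].
  rewrite indicE; have nK : ~ K i e by move=> h; apply: eU; exists i.
  move: nK; rewrite /K; case: ifPn => [/eqP -> h|/eqP h nGe].
    by rewrite mem_set//; exact: contrapT h.
  by rewrite memNset//; case: (val _ (mG i)).
- by move=> _; rewrite m1 ltry.
Qed.

End natural_measures.

Section sigma_finite_product.
Context d1 d2 (T1 : measurableType d1) (T2 : measurableType d2) (R : realType).
Variable m1 : {sigma_finite_measure set T1 -> \bar R}.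
Variable m2 : {sigma_finite_measure set T2 -> \bar R}.
Local Open Scope ereal_scope.

Definition prod_val : set (T1 * T2) -> \bar R := m1 \x m2.

HB.instance Definition _ := isMeasure.Build _ (T1 * T2)%type R prod_val
  (measure0 (m1 \x m2)) (measure_ge0 (m1 \x m2))
  (@measure_semi_sigma_additive _ _ _ (m1 \x m2)).

Let prod_sigma_finite : sigma_finite setT prod_val.
Proof.
have /sigma_finiteP[F [TF ndF Foo]] := sigma_finiteT m1.
have /sigma_finiteP[G [TG ndG Goo]] := sigma_finiteT m2.
exists (fun n => F n `*` G n).
  rewrite -setXTT TF TG predeqE => -[x y]; split.
    move=> [/= [n _ Fnx] [k _ Gky]]; exists (maxn n k) => //; split.
    - by move: x Fnx; exact/subsetPset/ndF/leq_maxl.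
    - by move: y Gky; exact/subsetPset/ndG/leq_maxr.
  by move=> [n _ []/= ? ?]; split; exists n.
move=> k; have [? ?] := Foo k; have [? ?] := Goo k.
split; first exact: measurableX.
by rewrite /prod_val product_measure1E// lte_mul_pinfty// ge0_fin_numE.
Qed.

HB.instance Definition _ := Measure_isSigmaFinite.Build _ _ _ prod_val prod_sigma_finite.

Definition sf_prod : {sigma_finite_measure set (T1 * T2)%type -> \bar R} := prod_val.

Lemma integral_sf_prod_mul (g : T1 -> \bar R) (h : T1 * T2 -> \bar R) :
  measurable_fun setT g -> (forall x, 0 <= g x) ->
  measurable_fun setT h -> (forall z, 0 <= h z) ->
  \int[sf_prod]_z (g z.1 * h z) = \int[m1]_x (g x * \int[m2]_y h (x, y)).
Proof.
move=> mg g0 mh h0.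
rewrite (_ : \int[sf_prod]_z _ = \int[m1 \x m2]_z (g z.1 * h z))//.
rewrite fubini_tonelli1//; last 2 first.
- by apply: emeasurable_funM => //; apply: (measurableT_comp mg).
- by move=> z; rewrite mule_ge0.
apply: eq_integral => x _; rewrite /fubini_F /= ge0_integralZl//.
exact: (measurableT_comp mh).
Qed.

Lemma measurable_partial_integral (h : T1 * T2 -> \bar R) :
  measurable_fun setT h -> (forall z, 0 <= h z) ->
  measurable_fun setT (fun x => \int[m2]_y h (x, y)).
Proof. by move=> mh h0; exact: (measurable_fun_fubini_tonelli_F (m2 := m2)). Qed.

End sigma_finite_product.

Section mark_measure.
Context {R : realType}.
Local Open Scope ereal_scope.

HB.instance Definition _ := @Measure_isSigmaFinite.Build _ nat R (@counting nat R)
  (sigma_finite_counting R).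

Definition leb : {sigma_finite_measure set (measurableTypeR R) -> \bar R} := @lebesgue_measure R.
Definition marks4 := sf_prod (sf_prod (sf_prod leb leb) leb) (@counting nat R).
Definition mark_measure := sf_prod marks4 leb.

Let mark0 : mark_intensity (set0 : set (mark_space R)) = 0%E.
Proof. exact: (measure0 mark_measure). Qed.
Let mark_ge0 (B : set (mark_space R)) : (0 <= mark_intensity B)%E.
Proof. exact: (measure_ge0 mark_measure). Qed.
Let mark_sigma_additive : semi_sigma_additive (@mark_intensity R).
Proof. exact: (@measure_semi_sigma_additive _ _ _ mark_measure). Qed.

HB.instance Definition _ := isMeasure.Build _ (mark_space R) R (@mark_intensity R)
  mark0 mark_ge0 mark_sigma_additive.

Lemma integral_mark_measure (f : mark_space R -> \bar R) : measurable_fun setT f ->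
  (forall e, 0 <= f e) -> \int[mark_intensity]_e f e = \int[mark_measure]_e f e.
Proof.
move=> mf f0.
pose T5 := (measurableTypeR R * measurableTypeR R * measurableTypeR R * nat * measurableTypeR R)%type.
pose phi : T5 -> mark_space R := id.
have mphi : measurable_fun setT phi by move=> _ Y mY; rewrite setTI; exact: mY.
transitivity (\int[mark_measure]_(x in phi @^-1` setT) (f \o phi) x)%E; last by [].
by rewrite -(ge0_integral_pushforward mphi mark_measure measurableT mf).
Qed.

Lemma integral_counting_eq (k : nat) : \int[@counting nat R]_z ((z == k)%:R)%:E = 1%E.
Proof.
rewrite (_ : (fun z => _) = (fun z : nat => (\1_[set k] z)%:E)).
  transitivity (@counting nat R ([set k] `&` setT)); first by rewrite integral_indic.
  rewrite setIT /counting; case: asboolP => [_|[]]; last exact: finite_set1.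
  by rewrite fset_set1 finmap.cardfs1.
by apply/funext => z; rewrite indicE (_ : (z \in [set k]) = (z == k))//; apply/idP/eqP; rewrite inE.
Qed.

(** The coordinates other than the time are integrated one at a time. *)
Lemma integral_mark_sections (psi : R -> R) (a b c : R * R -> R) (k : nat) :
  measurable_fun setT psi -> (forall s, (0 <= psi s)%R) ->
  measurable_fun setT a -> (forall z, (0 <= a z)%R) ->
  measurable_fun setT b -> (forall z, (0 <= b z)%R) ->
  measurable_fun setT c -> (forall z, (0 <= c z)%R) ->
  \int[mark_intensity]_e (let: (s, u, y, z, v) := e in
     (psi s * a (s, u) * b (s, y) * (z == k)%:R * c (s, v))%:E) =
  \int[lebesgue_measure]_s ((psi s)%:E * \int[lebesgue_measure]_u (a (s, u))%:E *
    \int[lebesgue_measure]_y (b (s, y))%:E * \int[lebesgue_measure]_v (c (s, v))%:E).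
Proof.
move=> mpsi psi0 ma a0 mb b0 mc c0.
have ms2 : measurable_fun setT (fun e : measurableTypeR R * measurableTypeR R => e.1 : R) by exact: measurable_fst.
pose A (s : R) := \int[leb]_u (a (s, u))%:E.
pose B (s : R) := \int[leb]_y (b (s, y))%:E.
pose C (s : R) := \int[leb]_v (c (s, v))%:E.
have mI (h : R * R -> R) : measurable_fun setT h -> (forall z, (0 <= h z)%R) ->
    measurable_fun (setT : set (measurableTypeR R)) (fun s => \int[leb]_u (h (s, u))%:E).
  move=> mh h0; apply: (@measurable_partial_integral _ _ (measurableTypeR R) (measurableTypeR R) R leb (fun z => (h z)%:E)) => [|z].
    exact/measurable_EFinP.
  by rewrite lee_fin.
have I0 (h : R * R -> R) s : (forall z, (0 <= h z)%R) -> 0 <= \int[leb]_u (h (s, u))%:E.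
  by move=> h0; apply: integral_ge0 => u _; rewrite lee_fin.
have mA := mI _ ma a0; have mB := mI _ mb b0; have mC := mI _ mc c0.
have mpsiE : measurable_fun (setT : set (measurableTypeR R)) (fun s => (psi s)%:E) by exact/measurable_EFinP.
pose T2 := (measurableTypeR R * measurableTypeR R)%type.
pose T3 := (T2 * measurableTypeR R)%type.
pose T4 := (T3 * nat)%type.
pose T5 := (T4 * measurableTypeR R)%type.
have m2 (h : R * R -> R) : measurable_fun setT h -> measurable_fun (setT : set T2) (fun e => (h e)%:E).
  by move=> mh; exact/measurable_EFinP.
have m3 (h : R * R -> R) : measurable_fun setT h ->
    measurable_fun (setT : set T3) (fun e => (h (e.1.1, e.2))%:E).
  move=> mh; apply/measurable_EFinP; apply: (measurableT_comp mh); apply: measurable_fun_pair => //.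
  by apply: measurableT_comp => //.
have m5 (h : R * R -> R) : measurable_fun setT h ->
    measurable_fun (setT : set T5) (fun e => (h (e.1.1.1.1, e.2))%:E).
  move=> mh; apply/measurable_EFinP; apply: (measurableT_comp mh); apply: measurable_fun_pair => //.
  by do 3!apply: measurableT_comp => //.
have mz : measurable_fun (setT : set T4) (fun e => ((e.2 == k)%:R)%:E : \bar R).
  by apply: (@measurableT_comp _ _ _ _ _ _ (fun z : nat => ((z == k)%:R)%:E : \bar R)).
have f2 : measurable_fun (setT : set T2) (fun e => e.1 : R) by exact: measurable_fst.
have f3 : measurable_fun (setT : set T3) (fun e => e.1 : R * R) by exact: measurable_fst.
have f31 : measurable_fun (setT : set T3) (fun e => e.1.1 : R) by exact: (measurableT_comp f2).
have f41 : measurable_fun (setT : set T4) (fun e => e.1 : T3) by exact: measurable_fst.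
have g2 : measurable_fun (setT : set T2) (fun e => psi e.1 * a e)%R.
  by apply: measurable_funM => //; exact: (measurableT_comp mpsi f2).
have g3 : measurable_fun (setT : set T3) (fun e => psi e.1.1 * a e.1 * b (e.1.1, e.2))%R.
  apply: measurable_funM; first exact: (measurableT_comp g2 (@measurable_fst _ _ T2 (measurableTypeR R))).
  by apply: (measurableT_comp mb); apply: measurable_fun_pair => //; exact: measurable_snd.
have g4 : measurable_fun (setT : set T4)
    (fun e => psi e.1.1.1 * a e.1.1 * b (e.1.1.1, e.1.2) * (e.2 == k)%:R)%R.
  apply: measurable_funM; first exact: (measurableT_comp g3 f41).
  by apply/measurable_EFinP; exact: mz.
have C2 : measurable_fun (setT : set T2) (fun e => C e.1) by exact: (measurableT_comp mC (@measurable_fst _ _ (measurableTypeR R) (measurableTypeR R))).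
have C3 : measurable_fun (setT : set T3) (fun e => C e.1.1) by exact: (measurableT_comp C2 (@measurable_fst _ _ T2 (measurableTypeR R))).
have g5 : measurable_fun (setT : set T5) (fun e => (psi e.1.1.1.1 * a e.1.1.1 *
    b (e.1.1.1.1, e.1.1.2) * (e.1.2 == k)%:R)%:E * (c (e.1.1.1.1, e.2))%:E).
  apply: emeasurable_funM; last exact: m5.
  by apply/measurable_EFinP; exact: (measurableT_comp g4 (@measurable_fst _ _ T4 (measurableTypeR R))).
transitivity (integral mark_intensity setT (fun e : mark_space R => (psi e.1.1.1.1 * a e.1.1.1 *
    b (e.1.1.1.1, e.1.1.2) * (e.1.2 == k)%:R)%:E * (c (e.1.1.1.1, e.2))%:E)).
  by apply: eq_integral => -[[[[s u] y] z] v] _.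
rewrite integral_mark_measure; [|exact: g5|by move=> e; rewrite -EFinM lee_fin !mulr_ge0].
rewrite (@integral_sf_prod_mul _ _ T4 _ R marks4 leb
  (fun e => (psi e.1.1.1 * a e.1.1 * b (e.1.1.1, e.1.2) * (e.2 == k)%:R)%:E)
  (fun e => (c (e.1.1.1.1, e.2))%:E)); [| |by move=> e; rewrite lee_fin !mulr_ge0|exact: m5|by move=> e; rewrite lee_fin]; last first.
  exact/measurable_EFinP.
transitivity (integral marks4 setT (fun e : T4 => (psi e.1.1.1 * a e.1.1 * b (e.1.1.1, e.1.2))%:E * C e.1.1.1 * ((e.2 == k)%:R)%:E)).
  by apply: eq_integral => e _; rewrite [in LHS]EFinM -!muleA; congr (_ * _); rewrite muleC.
rewrite (@integral_sf_prod_mul _ _ T3 _ R _ (@counting nat R)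
  (fun e => (psi e.1.1 * a e.1 * b (e.1.1, e.2))%:E * C e.1.1)
  (fun e => ((e.2 == k)%:R)%:E)); [| | |exact: mz|by move=> e; rewrite lee_fin]; last 2 first.
- by apply: emeasurable_funM => //; exact/measurable_EFinP.
- by move=> e; rewrite mule_ge0 ?I0// lee_fin !mulr_ge0.
transitivity (integral (sf_prod (sf_prod leb leb) leb) setT (fun e : T3 => (psi e.1.1 * a e.1)%:E * C e.1.1 * (b (e.1.1, e.2))%:E)).
  by apply: eq_integral => e _; rewrite integral_counting_eq mule1 [in LHS]EFinM -!muleA; congr (_ * _); rewrite muleC.
rewrite (@integral_sf_prod_mul _ _ T2 _ R (sf_prod leb leb) leb
  (fun e => (psi e.1 * a e)%:E * C e.1)
  (fun e => (b (e.1.1, e.2))%:E)); [| | |exact: m3|by move=> e; rewrite lee_fin]; last 2 first.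
- by apply: emeasurable_funM => //; exact/measurable_EFinP.
- by move=> e; rewrite mule_ge0 ?I0// lee_fin !mulr_ge0.
transitivity (integral (sf_prod leb leb) setT (fun e : T2 => (psi e.1)%:E * C e.1 * B e.1 * (a e)%:E)).
  apply: eq_integral => e _; rewrite [in LHS]EFinM -!muleA; congr (_ * _).
  by rewrite muleC -!muleA.
rewrite (@integral_sf_prod_mul _ _ (measurableTypeR R) _ R leb leb
  (fun s => (psi s)%:E * C s * B s) (fun e => (a e)%:E)); [| | |exact: m2|by move=> e; rewrite lee_fin]; last 2 first.
- by do 2?apply: emeasurable_funM.
- by move=> s; rewrite !mule_ge0 ?I0// lee_fin.
apply: eq_integral => s _; rewrite -/(A s) -/(B s) -/(C s) -!muleA; congr (_ * _).
by rewrite muleC (muleC (B s) (A s)) -muleA.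
Qed.

End mark_measure.

Section poisson_points.
Context {R : realType} {d : measure_display} {Omega : measurableType d}.
Variables (P : probability Omega R) (F : R -> set (set Omega)).
Variable M : R.-ker Omega ~> mark_space R.
Hypothesis hM : adapted_poisson_random_measure P F M.

Lemma measurable_prm_eq B (x : \bar R) : measurable B -> measurable [set w | M w B = x].
Proof.
move=> mB; have := measurable_kernel M B mB measurableT _ (emeasurable_set1 x).
by rewrite setTI.
Qed.

(** The Poisson weights sum to one. *)
Lemma prm_natural B : finite_mark_sets B -> {ae P, forall w, natural (M w B)}.
Proof.
move=> hB; have mB : measurable B by case: hB => -[].
pose E n := [set w | M w B = n%:R%:E].
have mE n : measurable (E n) by exact: measurable_prm_eq.
have mU : measurable (\bigcup_n E n) by exact: bigcup_measurable.
set l := fine (mark_intensity B).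
have P1 : P (\bigcup_n E n) = 1%E.
  rewrite measure_bigcup//; last first.
    apply/trivIsetP => i j _ _ ij; rewrite -subset0 => w [] /=; rewrite /E /= => -> /eqP.
    by rewrite eqe eqr_nat => /eqP ij'; rewrite ij' eqxx in ij.
  have PE n : P (E n) = (l ^+ n / n`!%:R * expR (- l))%:E := prm_poisson hM n hB.
  transitivity (\sum_(0 <= n <oo | n \in [set: nat]) (l ^+ n / n`!%:R * expR (- l))%:E)%E.
    by apply: eq_eseriesr => n _; exact: PE.
  apply/cvg_lim => //.
  have c : series (exp_coeff l) n * expR (- l) @[n --> \oo] --> (1 : R).
    rewrite -(expRxMexpNx_1 l); apply: cvgMr_tmp.
    exact: is_cvg_series_exp_coeff.
  rewrite (_ : (fun n => _) = fun n => (series (exp_coeff l) n * expR (- l))%:E).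
    by apply: cvg_EFin => //; exact: nearW.
  apply/funext => n; rewrite sumEFin /series /= mulr_suml; congr EFin.
  by apply: eq_big => [i|i _]; rewrite ?in_setT// /exp_coeff.
exists (~` \bigcup_n E n); split.
- exact: measurableC.
- by rewrite probability_setC// P1 subee.
- by move=> w /= nw [n _ /= h]; apply: nw; exists n.
Qed.

Lemma finite_mark_setsS (B E : set (mark_space R)) : finite_mark_sets B -> measurable E -> finite_mark_sets (E `&` B).
Proof.
move=> [[mB BD] fB] mE; split; first by split; [exact: measurableI|by move=> x [_ /BD]].
apply: le_lt_trans fB; apply: (@le_measure _ _ _ mark_intensity); rewrite ?inE//.
  exact: measurableI.
Qed.

(** Being integer-valued need only be checked on a countable pi-system. *)
Lemma prm_counting B : finite_mark_sets B ->
  {ae P, forall w, forall E, measurable E -> natural (M w (E `&` B))}.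
Proof.
move=> hB; have mB : measurable B by case: hB => -[].
have [G gG] := countable_generator_mark R; have [_ [t GT] mG _] := gG.
have := ae_foralln (fun i => prm_natural (finite_mark_setsS hB (mG i))).
apply: filterS => w hw E mE.
apply: (@natural_valued R _ _ (mrestr (M w) mB) G) => //.
by rewrite /= /mrestr -GT; have [n ->] := hw t; exact: ltry.
Qed.

End poisson_points.

(** * The individual designated by a mark *)

Section quantile.
Context {R : realType}.
Local Notation S := (nat_measure R).
Implicit Types (mu : S) (y : R) (m : nat).
Variable alpha : R -> R.
Hypothesis halpha : bounded_borel_nonneg alpha.
Hypothesis alpha_gt0 : forall x, 0 <= x -> 0 < alpha x.

Let malpha : measurable_fun (`[0, +oo[ : set R) alpha. Proof. by case: halpha. Qed.

Lemma atom_sorted mu i j : (i <= j)%N -> (j < mass mu)%N -> atom mu i <= atom mu j.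
Proof.
move=> ij jN; apply/(atomP _ (leq_ltn_trans ij jN)).
apply: le_trans (_ : (j.+1%:R%:E <= _)%E); first by rewrite lee_fin ler_nat.
exact/(atomP _ jN).
Qed.

Lemma atom_age_shift q mu m : 0 <= q -> (m < mass mu)%N ->
  atom (age_shift q mu) m = atom mu m + q.
Proof.
move=> q0 mN; have mN' : (m < mass (age_shift q mu))%N by rewrite (has_atoms_mass (age_shift_atoms _ q0)).
have h a : (atom (age_shift q mu) m <= a) = (atom mu m + q <= a).
  rewrite -lerBrDr; apply/idP/idP.
    by move/(atomP _ mN'); rewrite -distribution_fun_cdf distribution_age_shift// distribution_fun_cdf => /(atomP _ mN).
  by move/(atomP _ mN) => h; apply/(atomP _ mN'); rewrite -distribution_fun_cdf distribution_age_shift// distribution_fun_cdf.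
by apply/eqP; rewrite eq_le h lexx -h lexx.
Qed.

Lemma mass_age_shift q mu : 0 <= q -> mass (age_shift q mu) = mass mu.
Proof. by move=> q0; exact: (has_atoms_mass (age_shift_atoms _ q0)). Qed.

Definition partial_rate mu m : R := \sum_(j < m) alpha (atom mu j).

(** The interval of values of [y] that designates the individual [m]: a uniform [y]
    falls in it with a probability proportional to [alpha (atom mu m)]. *)
Definition in_slot mu m y : bool :=
  (partial_rate mu m <= pairing mu alpha * y) && (pairing mu alpha * y < partial_rate mu m.+1).

Lemma pairing_rate mu : pairing mu alpha = partial_rate mu (mass mu).
Proof. exact: pairingE. Qed.

Lemma partial_rateS mu m : partial_rate mu m.+1 = partial_rate mu m + alpha (atom mu m).
Proof. by rewrite /partial_rate big_ord_recr. Qed.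

Lemma partial_rate_mono mu i j : (i <= j)%N -> partial_rate mu i <= partial_rate mu j.
Proof.
elim: j => [|j IH]; first by rewrite leqn0 => /eqP ->.
rewrite leq_eqVlt => /predU1P[->//|]; rewrite ltnS => /IH /le_trans; apply.
by rewrite partial_rateS lerDl ltW// alpha_gt0// atom_ge0.
Qed.

Lemma partial_rate_ge0 mu m : 0 <= partial_rate mu m.
Proof. by have := partial_rate_mono mu (leq0n m); rewrite {1}/partial_rate big_ord0. Qed.

Lemma rate_gt0 mu : (0 < mass mu)%N -> 0 < pairing mu alpha.
Proof.
rewrite pairing_rate; case: (mass mu) => // n _.
by rewrite partial_rateS ltr_wpDl ?partial_rate_ge0// alpha_gt0// atom_ge0.
Qed.

Lemma rate_le mu (C : R) n : (forall x, 0 <= x -> alpha x <= C) -> 0 <= C -> (mass mu <= n)%N ->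
  pairing mu alpha <= C * n%:R.
Proof.
move=> hC C0 mn; rewrite pairing_rate /partial_rate.
apply: le_trans (_ : \sum_(j < mass mu) C <= _).
  by apply: ler_sum => j _; apply: hC; exact: atom_ge0.
by rewrite sumr_const card_ord -[C *+ _]mulr_natr ler_wpM2l// ler_nat.
Qed.

Lemma slot_uniq mu y i j : in_slot mu i y -> in_slot mu j y -> i = j.
Proof.
move=> /andP[i1 i2] /andP[j1 j2]; apply/eqP; rewrite eqn_leq; apply/andP; split; rewrite leqNgt; apply/negP => ij.
  by have := lt_le_trans j2 (le_trans (partial_rate_mono mu ij) i1); rewrite ltxx.
by have := lt_le_trans i2 (le_trans (partial_rate_mono mu ij) j1); rewrite ltxx.
Qed.

Lemma slot_exists mu y : (0 < mass mu)%N -> 0 <= y < 1 ->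
  exists2 m, (m < mass mu)%N & in_slot mu m y.
Proof.
move=> N0 /andP[y0 y1].
have ex : exists m, pairing mu alpha * y < partial_rate mu m.+1.
  exists (mass mu).-1; rewrite prednK// -pairing_rate -[ltRHS]mulr1.
  by rewrite ltr_pM2l// rate_gt0.
case: (ex_minnP ex) => m hm min; exists m; last first.
  rewrite /in_slot hm andbT; case: m hm min => [|m] hm min.
    by rewrite {1}/partial_rate big_ord0 mulr_ge0// pairing_rate partial_rate_ge0.
  by rewrite leNgt; apply/negP => /min; rewrite ltnn.
rewrite -(prednK N0) ltnS; apply: min.
by rewrite prednK// -pairing_rate -[ltRHS]mulr1 ltr_pM2l// rate_gt0.
Qed.

Lemma initial_rate mu w : \int[mu]_(x in `[0, w]) alpha x =
  \sum_(m < mass mu) alpha (atom mu m) * (atom mu m <= w)%R%:R.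
Proof. exact: Rintegral_initial. Qed.

Lemma initial_rate_le mu w : \int[mu]_(x in `[0, w]) alpha x <= pairing mu alpha.
Proof.
rewrite initial_rate pairing_rate; apply: ler_sum => m _.
by rewrite -[leRHS]mulr1 ler_wpM2l ?lern1 ?leq_b1// ltW// alpha_gt0// atom_ge0.
Qed.

(** The atoms are sorted, so the initial mass exceeds [pairing mu alpha * y] exactly
    from the [m]-th atom on. *)
Lemma age_quantile_slot mu y m : (m < mass mu)%N -> in_slot mu m y ->
  age_quantile alpha mu y = atom mu m.
Proof.
move=> mN /andP[y1 y2]; rewrite /age_quantile.
have widen k : (k <= mass mu)%N -> partial_rate mu k =
    \sum_(j < mass mu) alpha (atom mu j) * (j < k)%N%:R.
  move=> kN; rewrite /partial_rate (big_ord_widen _ (fun j => alpha (atom mu j)) kN) big_mkcond.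
  by apply: eq_bigr => j _; case: ifP; rewrite ?mulr1 ?mulr0.
have a0 j : 0 <= alpha (atom mu j) by rewrite ltW// alpha_gt0// atom_ge0.
rewrite (_ : [set w | _] = [set w | atom mu m <= w]).
  have lb : lbound [set w | atom mu m <= w] (atom mu m) by move=> w.
  apply/eqP; rewrite eq_le; apply/andP; split.
    by apply: ge_inf => //=; exists (atom mu m).
  by apply: lb_le_inf => //; exists (atom mu m) => /=.
apply/seteqP; split => w /= => [[w0]|hw].
  rewrite leNgt => h; apply/negP => wm; move: h; apply/negP; rewrite -leNgt.
  apply: le_trans y1; rewrite initial_rate (widen m (ltnW mN)).
  apply: ler_sum => j _; apply: ler_wpM2l => //; rewrite ler_nat.
  case: (leP (atom mu j) w) => // jw; rewrite lt0b ltnNge; apply/negP => mj.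
  by have := le_lt_trans (le_trans (atom_sorted mj (ltn_ord j)) jw) wm; rewrite ltxx.
split; first exact: le_trans (atom_ge0 _ _) hw.
apply: lt_le_trans y2 _; rewrite initial_rate (widen m.+1 mN).
apply: ler_sum => j _; apply: ler_wpM2l => //; rewrite ler_nat.
case: (ltnP j m.+1) => // jm; rewrite lt0b; apply: le_trans hw.
exact: atom_sorted.
Qed.

(** No [w] satisfies the strict inequality, and the infimum of the empty set is 0. *)
Lemma age_quantile_out mu y : 0 <= y -> (mass mu = 0%N \/ 1 <= y) -> age_quantile alpha mu y = 0.
Proof.
move=> y0 h; rewrite /age_quantile (_ : [set w | _] = set0) ?inf0//.
rewrite -subset0 => w /= [_]; apply/negP; rewrite -leNgt.
apply: le_trans (initial_rate_le mu w) _; case: h => [N0|y1].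
  by rewrite pairing_rate N0 /partial_rate big_ord0 mul0r.
by rewrite ler_peMr// pairing_rate partial_rate_ge0.
Qed.

Lemma age_quantileE mu y : 0 <= y -> age_quantile alpha mu y =
  \sum_(m < mass mu) (in_slot mu m y)%:R * atom mu m.
Proof.
move=> y0; have [[m mN sm]|none] := pselect (exists2 m, (m < mass mu)%N & in_slot mu m y).
  rewrite (age_quantile_slot mN sm) (bigD1 (Ordinal mN))//= sm mul1r big1 ?addr0// => j jm.
  case: (boolP (in_slot mu j y)) => [sj|]; last by rewrite mul0r.
  by case/eqP: jm; apply: val_inj; exact: slot_uniq sj sm.
rewrite age_quantile_out//; last first.
  have [N0|N0] := posnP (mass mu); [by left|right]; rewrite leNgt; apply/negP => y1.
  by apply: none; apply: slot_exists; rewrite // y0.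
rewrite big1// => j _; case: (boolP (in_slot mu j y)) => [sj|]; last by rewrite mul0r.
by exfalso; apply: none; exists j.
Qed.

Lemma age_quantile_ge0 mu y : 0 <= y -> 0 <= age_quantile alpha mu y.
Proof.
by move=> y0; rewrite age_quantileE// sumr_ge0// => m _; rewrite mulr_ge0// atom_ge0.
Qed.

Section measurability.
Context d (T : measurableType d) (h : T -> S).
Hypothesis mh : measurable_fun setT h.

Lemma measurable_partial_rate m : measurable_fun setT (fun t => partial_rate (h t) m).
Proof.
apply: measurable_sum => j.
rewrite (_ : (fun t => _) = (fun t => alpha `|atom (h t) j|)).
  apply: (measurableT_comp (measurable_fun_nonneg_norm malpha)).
  exact: measurable_atom_comp.
by apply/funext => t; rewrite ger0_norm// atom_ge0.
Qed.

Lemma measurable_rate : measurable_fun setT (fun t => pairing (h t) alpha).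
Proof. exact: measurable_pairing_comp. Qed.

Lemma measurable_slot_set (y : T -> R) m : measurable_fun setT y ->
  measurable [set t | in_slot (h t) m (y t)].
Proof.
move=> my; rewrite (_ : [set _ | _] = [set t | partial_rate (h t) m <= pairing (h t) alpha * y t] `&`
    [set t | pairing (h t) alpha * y t < partial_rate (h t) m.+1]).
  have mp : measurable_fun setT (fun t => pairing (h t) alpha * y t).
    by apply: measurable_funM => //; exact: measurable_rate.
  by apply: measurableI; [apply: measurable_set_le|apply: measurable_set_lt] => //;
    exact: measurable_partial_rate.
by apply/seteqP; split => t; rewrite /= /in_slot => /andP.
Qed.

Lemma measurable_in_slot (y : T -> R) m : measurable_fun setT y ->
  measurable_fun setT (fun t => (in_slot (h t) m (y t))%:R : R).
Proof. by move=> my; apply: measurable_bool_indic; exact: measurable_slot_set. Qed.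

Lemma measurable_age_quantile (y : T -> R) : measurable_fun setT y -> (forall t, 0 <= y t) ->
  measurable_fun setT (fun t => age_quantile alpha (h t) (y t)).
Proof.
move=> my y0; under eq_fun do rewrite age_quantileE//.
apply: (@measurable_fun_nat_index _ _ _ _ (fun t => mass (h t))
  (fun n t => \sum_(m < n) (in_slot (h t) m (y t))%:R * atom (h t) m)).
  exact: measurable_mass_comp.
move=> n; apply: measurable_sum => m; apply: measurable_funM; first exact: measurable_in_slot.
exact: measurable_atom_comp.
Qed.

End measurability.

Local Notation leb := (@lebesgue_measure R).

Lemma integral_bool_itv (b : R -> bool) (x y : R) : x <= y ->
  measurable [set s | b s] -> `]x, y[ `<=` [set s | b s] -> [set s | b s] `<=` `[x, y] ->
  (\int[leb]_s ((b s)%:R)%:E = (y - x)%:E)%E.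
Proof.
move=> xy mb sub1 sub2.
rewrite (_ : (fun s => _) = (fun s => (\1_[set s | b s] s)%:E)); last first.
  by apply/funext => s; rewrite indicE mem_setE.
rewrite integral_indic// setIT; apply/eqP; rewrite eq_le; apply/andP; split.
  apply: (@le_trans _ _ (leb `[x, y])); first by apply: le_measure; rewrite ?inE.
  by rewrite lebesgue_measure_itv/=; case: ifP => _; rewrite -?EFinB// lee_fin subr_ge0.
apply: (@le_trans _ _ (leb `]x, y[)); last by apply: le_measure; rewrite ?inE.
rewrite lebesgue_measure_itv/=; case: ifPn => [|]; rewrite -?EFinB// lte_fin -leNgt lee_fin => yx.
by rewrite subr_le0.
Qed.

Lemma integral_slot mu m : (m < mass mu)%N ->
  (\int[leb]_y ((((0 < y) && (y <= 1) && in_slot mu m y)%R%:R)%:E) =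
   (alpha (atom mu m) / pairing mu alpha)%:E)%E.
Proof.
move=> mN; have r0 : 0 < pairing mu alpha by rewrite rate_gt0// (leq_trans _ mN).
set r := pairing mu alpha in r0 *.
have -> : alpha (atom mu m) / r = partial_rate mu m.+1 / r - partial_rate mu m / r.
  by rewrite -mulrBl partial_rateS addrC addKr.
have le1 : partial_rate mu m.+1 / r <= 1.
  by rewrite ler_pdivrMr// mul1r /r pairing_rate; exact: partial_rate_mono.
apply: integral_bool_itv.
- by rewrite ler_pM2r ?invr_gt0// partial_rate_mono.
- rewrite (_ : [set _ | _] = `]0, 1]%classic `&` [set y : R | in_slot mu m y]).
    by apply: measurableI => //; exact: (@measurable_slot_set _ R (fun=> mu) _ id).
  by apply/seteqP; split => y; rewrite /= in_itv/= => /andP.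
- move=> y; rewrite /= in_itv/= => /andP[h1 h2].
  rewrite (le_lt_trans _ h1) ?divr_ge0 ?partial_rate_ge0 ?(ltW r0)//=.
  rewrite (le_trans (ltW h2) le1)/= /in_slot -/r mulrC.
  by move: h1 h2; rewrite ltr_pdivrMr// ltr_pdivlMr// => /ltW -> ->.
- move=> y /= /andP[_ /andP[h1 h2]]; rewrite in_itv/= ler_pdivrMr// ler_pdivlMr//.
  by rewrite (mulrC y) h1 ltW.
Qed.

End quantile.

(** * Marks in a short time interval *)

Section boxes.
Context {R : realType}.

(** The marks in the time interval of the step that can act on a population with rate
    at most [L], with at most [Z] offspring; its intensity is finite. *)
Definition box (r r' L : R) (Z : nat) : set (mark_space R) :=
  `]r, r'] `*` `]0, L] `*` `]0, 1] `*` [set z | (z <= Z)%N] `*` `]0, 1].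

Lemma measurable_box r r' L Z : measurable (box r r' L Z).
Proof. by rewrite /box; do 4?apply: measurableX. Qed.

Lemma box_domain r r' L Z : 0 <= r -> box r r' L Z `<=` mark_domain.
Proof.
move=> r0 [[[[s u] y] z] v] [[[[h1 h2] h3] _] h5]; split => //=.
split => //=; split => //=; split => /=; rewrite in_itv/= ?andbT.
  by move: h1; rewrite /= in_itv/= => /andP[/(le_lt_trans r0)].
by move: h2; rewrite /= in_itv/= => /andP[].
Qed.

Lemma counting_le (Z : nat) : counting [set z | (z <= Z)%N] = (Z.+1%:R%:E : \bar R).
Proof.
have c1 (k : nat) : @counting nat R [set k] = 1%E.
  by rewrite /counting; case: asboolP => [_|[]]; [rewrite fset_set1 finmap.cardfs1|exact: finite_set1].
elim: Z => [|Z IH].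
  rewrite (_ : [set z | _] = [set 0%N]) ?c1//.
  by apply/seteqP; split => z /=; rewrite leqn0 => /eqP.
rewrite (_ : [set z | _] = [set z | (z <= Z)%N] `|` [set Z.+1]); last first.
  apply/seteqP; split => z /=; last by move=> [/leqW|->].
  by rewrite leq_eqVlt => /predU1P[->|]; [right|rewrite ltnS; left].
rewrite (measureU (@counting nat R))//; last first.
  by apply/seteqP; split => z //= [h zZ]; rewrite zZ ltnn in h.
rewrite -[RHS]/(Z.+2%:R%:E) -[Z.+2%:R]natr1 EFinD; congr (_ + _)%E; first exact: IH.
exact: c1.
Qed.

Lemma mark_intensity_rectangle (A1 A2 A3 : set R) (A4 : set nat) (A5 : set R) :
  measurable A1 -> measurable A2 -> measurable A3 -> measurable A4 -> measurable A5 ->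
  (mark_intensity (A1 `*` A2 `*` A3 `*` A4 `*` A5) = lebesgue_measure A1 * lebesgue_measure A2 *
    lebesgue_measure A3 * counting A4 * lebesgue_measure A5)%E.
Proof.
move=> m1 m2 m3 m4 m5.
pose B1 : set (measurableTypeR R) := A1; pose B2 : set (measurableTypeR R) := A2.
pose B3 : set (measurableTypeR R) := A3; pose B5 : set (measurableTypeR R) := A5.
have n1 : measurable B1 by exact: m1.
have n2 : measurable B2 by exact: m2.
have n3 : measurable B3 by exact: m3.
have n5 : measurable B5 by exact: m5.
have m12 : measurable (B1 `*` B2) by exact: measurableX.
have m123 : measurable (B1 `*` B2 `*` B3) by exact: measurableX.
have m1234 : measurable (B1 `*` B2 `*` B3 `*` A4) by exact: measurableX.
transitivity (marks4 (B1 `*` B2 `*` B3 `*` A4) * leb B5)%E.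
  exact: (product_measure1E _ _ m1234 n5).
congr (_ * _)%E.
transitivity (sf_prod (sf_prod leb leb) leb (B1 `*` B2 `*` B3) * counting A4)%E.
  exact: (product_measure1E _ _ m123 m4).
congr (_ * _)%E.
transitivity (sf_prod leb leb (B1 `*` B2) * leb B3)%E.
  exact: (product_measure1E _ _ m12 n3).
by congr (_ * _)%E; exact: (product_measure1E _ _ n1 n2).
Qed.

Lemma box_intensity r r' L Z : r <= r' -> 0 <= L ->
  mark_intensity (box r r' L Z) = ((r' - r) * L * Z.+1%:R)%:E.
Proof.
move=> rr' L0.
have itv a b : a <= b -> lebesgue_measure (`]a, b]%classic : set R) = (b - a)%:E.
  move=> ab; rewrite lebesgue_measure_itv/= lte_fin; case: ifPn => [_|]; first by rewrite EFinB.
  by rewrite -leNgt => ba; congr EFin; apply/esym/eqP; rewrite subr_eq0 eq_le ab ba.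
transitivity ((r' - r)%:E * (L - 0)%:E * (1 - 0)%:E * Z.+1%:R%:E * (1 - 0)%:E)%E; last first.
  by rewrite !subr0 !mule1 -!EFinM.
rewrite -!itv// -counting_le; exact: mark_intensity_rectangle.
Qed.

Lemma finite_box r r' L Z : 0 <= r -> r <= r' -> 0 <= L -> finite_mark_sets (box r r' L Z).
Proof.
move=> r0 rr' L0; split; last by rewrite box_intensity// ltry.
by split; [exact: measurable_box|exact: box_domain].
Qed.

(** The edge [y = 1], where [age_quantile] is not the age of an individual, is
    negligible. *)
Lemma box_edge_null r r' L Z :
  mark_intensity ([set e | e.1.1.2 = 1] `&` box r r' L Z) = 0%E.
Proof.
have mi (a b : R) : measurable (`]a, b]%classic : set R) by exact: measurable_itv.
have -> : [set e | e.1.1.2 = 1] `&` box r r' L Z =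
    `]r, r'] `*` `]0, L] `*` [set 1] `*` [set z | (z <= Z)%N] `*` `]0, 1].
  apply/seteqP; split => -[[[[s u] y] z] v] /=.
    by move=> [-> [[[[h1 h2] _] h4] h5]].
  by move=> [[[[h1 h2] ->] h4] h5]; do 5?split => //=; rewrite in_itv/= ltr01 lexx.
rewrite mark_intensity_rectangle//; try exact: measurable_set1.
by rewrite lebesgue_measure_set1 mule0 !mul0e.
Qed.

End boxes.

Section hits.
Context {R : realType}.
Local Notation S := (nat_measure R).
Variables (alpha : R -> R) (p : R -> nat -> R).
Hypothesis halpha : bounded_borel_nonneg alpha.
Hypothesis alpha_gt0 : forall x, 0 <= x -> 0 < alpha x.
Hypothesis hp : offspring_law p.

(** The population ages without branching from the time [r] on; the maximum makes the
    definition total in [s]. *)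
Definition flow (r s : R) (sigma : S) := age_shift (Num.max (s - r) 0) sigma.

Lemma flow_shift r s sigma : r <= s -> flow r s sigma = age_shift (s - r) sigma.
Proof. by move=> rs; rewrite /flow; congr age_shift; apply/max_idPl; rewrite subr_ge0. Qed.

(** The mark [e] makes the individual [m] branch into [k] newborn ones, if no
    branching has occurred since the time [r]. *)
Definition hits (r r' : R) (m k : nat) (sigma : S) (e : mark_space R) : bool :=
  [&& (r < e.1.1.1.1) && (e.1.1.1.1 <= r'),
      (0 < e.1.1.1.2) && (e.1.1.1.2 <= pairing (flow r e.1.1.1.1 sigma) alpha),
      (0 < e.1.1.2) && (e.1.1.2 <= 1) && in_slot alpha (flow r e.1.1.1.1 sigma) m e.1.1.2,
      e.1.2 == k &
      (0 < e.2) && (e.2 <= p `|atom (flow r e.1.1.1.1 sigma) m| k)].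

Section measurability.
Context d (T : measurableType d) (s : T -> R) (h : T -> S).
Hypotheses (ms : measurable_fun setT s) (mh : measurable_fun setT h).

Lemma measurable_flow r : measurable_fun setT (fun t => flow r (s t) (h t)).
Proof.
apply: measurable_age_shift => //; apply: measurable_maxr => //.
exact: measurable_funB.
Qed.

Lemma measurable_below_rate r (u : T -> R) : measurable_fun setT u ->
  measurable [set t | (0 < u t) && (u t <= pairing (flow r (s t) (h t)) alpha)].
Proof.
move=> mu; rewrite (_ : [set _ | _] = [set t | 0 < u t] `&` [set t | u t <= pairing (flow r (s t) (h t)) alpha]).
  apply: measurableI; first exact: measurable_set_lt.
  by apply: measurable_set_le => //; apply: (measurable_rate halpha); exact: measurable_flow.
by apply/seteqP; split => t /= => /andP.
Qed.

Lemma measurable_in_flow_slot r m (y : T -> R) : measurable_fun setT y ->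
  measurable [set t | (0 < y t) && (y t <= 1) && in_slot alpha (flow r (s t) (h t)) m (y t)].
Proof.
move=> my; rewrite (_ : [set _ | _] = [set t | 0 < y t] `&` [set t | y t <= 1] `&`
    [set t | in_slot alpha (flow r (s t) (h t)) m (y t)]).
  apply: measurableI; last by apply: (measurable_slot_set halpha) => //; exact: measurable_flow.
  by apply: measurableI; [exact: measurable_set_lt|exact: measurable_set_le].
apply/seteqP; split => t /= => [/andP[/andP[]]|[[-> ->]]] //.
Qed.

Lemma measurable_below_offspring r m k (v : T -> R) : measurable_fun setT v ->
  measurable [set t | (0 < v t) && (v t <= p `|atom (flow r (s t) (h t)) m| k)].
Proof.
move=> mv; rewrite (_ : [set _ | _] = [set t | 0 < v t] `&` [set t | v t <= p `|atom (flow r (s t) (h t)) m| k]).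
  apply: measurableI; first exact: measurable_set_lt.
  apply: measurable_set_le => //; apply: (measurableT_comp (measurable_offspring hp k)).
  by apply: measurable_atom_comp; exact: measurable_flow.
by apply/seteqP; split => t /= => /andP.
Qed.

End measurability.

Section joint.
Context d (T : measurableType d) (h : T -> S) (g : T -> mark_space R).
Hypotheses (mh : measurable_fun setT h) (mg : measurable_fun setT g).

Lemma mark_coordinates : [/\ measurable_fun setT (fun t => (g t).1.1.1.1),
  measurable_fun setT (fun t => (g t).1.1.1.2), measurable_fun setT (fun t => (g t).1.1.2),
  measurable_fun setT (fun t => (g t).1.2) & measurable_fun setT (fun t => (g t).2)].
Proof.
have m1 := measurableT_comp measurable_fst mg.
have m2 := measurableT_comp measurable_fst m1.
have m3 := measurableT_comp measurable_fst m2.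
split; [exact: measurableT_comp measurable_fst m3|exact: measurableT_comp measurable_snd m3|
  exact: measurableT_comp measurable_snd m2|exact: measurableT_comp measurable_snd m1|
  exact: measurableT_comp measurable_snd mg].
Qed.

Lemma measurable_hits r r' m k : measurable [set t | hits r r' m k (h t) (g t)].
Proof.
have [ms mu my mz mv] := mark_coordinates.
rewrite (_ : [set _ | _] = ([set t | r < (g t).1.1.1.1] `&` [set t | (g t).1.1.1.1 <= r']) `&`
  ([set t | (0 < (g t).1.1.1.2) && ((g t).1.1.1.2 <= pairing (flow r (g t).1.1.1.1 (h t)) alpha)] `&`
  ([set t | (0 < (g t).1.1.2) && ((g t).1.1.2 <= 1) && in_slot alpha (flow r (g t).1.1.1.1 (h t)) m (g t).1.1.2] `&`
  ((fun t => (g t).1.2) @^-1` [set k] `&`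
   [set t | (0 < (g t).2) && ((g t).2 <= p `|atom (flow r (g t).1.1.1.1 (h t)) m| k)])))).
  do 4?[apply: measurableI].
  - exact: measurable_set_lt.
  - exact: measurable_set_le.
  - exact: measurable_below_rate.
  - exact: measurable_in_flow_slot.
  - by rewrite -[X in measurable X]setTI; exact: mz.
  - exact: measurable_below_offspring.
apply/seteqP; split => t /=.
  by case/and5P => /andP[? ?] ? ? /eqP ? ?.
by move=> [[h1 h2] [h3 [h4 [h5 h6]]]]; apply/and5P; split => //; [rewrite h1|apply/eqP].
Qed.

End joint.

Local Notation leb := (@lebesgue_measure R).

(** The coordinates [u], [y] and [v] contribute the factors [pairing alpha], [alpha
    (atom m) / pairing alpha] and [p k], and the rate of the population cancels. *)
Lemma integral_hits r r' m k sigma (psi : R -> R) : measurable_fun setT psi ->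
  (forall s, 0 <= psi s) -> (m < mass sigma)%N ->
  (\int[mark_intensity]_e (psi e.1.1.1.1 * (hits r r' m k sigma e)%:R)%:E =
   \int[leb]_(s in `]r, r']) (psi s * (alpha (atom sigma m + (s - r)) * p (atom sigma m + (s - r)) k))%:E)%E.
Proof.
move=> mpsi psi0 mN.
have idm : measurable_fun setT (fun z : R * R => z.1) by exact: measurable_fst.
have idm2 : measurable_fun setT (fun z : R * R => z.2) by exact: measurable_snd.
have msig : measurable_fun setT (fun _ : R * R => sigma) by exact: measurable_cst.
pose psi' s := psi s * ((r < s) && (s <= r'))%R%:R.
pose a (z : R * R) : R := ((0 < z.2) && (z.2 <= pairing (flow r z.1 sigma) alpha))%R%:R.
pose b (z : R * R) : R := ((0 < z.2) && (z.2 <= 1) && in_slot alpha (flow r z.1 sigma) m z.2)%R%:R.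
pose c (z : R * R) : R := ((0 < z.2) && (z.2 <= p `|atom (flow r z.1 sigma) m| k))%R%:R.
have mitv : measurable [set s : R | (r < s) && (s <= r')].
  by rewrite (_ : [set s | _] = `]r, r']%classic)//; apply/seteqP; split => s /=; rewrite in_itv.
have := @integral_mark_sections R psi' a b c k.
have -> : (fun e : mark_space R => let: (s, u, y, z, v) := e in
     (psi' s * a (s, u) * b (s, y) * (z == k)%:R * c (s, v))%:E) =
   (fun e => (psi e.1.1.1.1 * (hits r r' m k sigma e)%:R)%:E).
  apply/funext => -[[[[s u] y] z] v] /=; rewrite /psi' /a /b /c /hits /= -!mulrA -!natrM !mulnb.
  by rewrite !andbA.
move=> ->//.
- rewrite [RHS]integral_mkcond; apply: eq_integral => s _; rewrite patchE mem_setE in_itv/=.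
  rewrite /psi'; case: ifPn => [/andP[rs sr]|_]; last by rewrite mulr0 !mul0e.
  have rs0 : 0 <= s - r by rewrite subr_ge0 ltW.
  have fl : flow r s sigma = age_shift (s - r) sigma by rewrite flow_shift// ltW.
  have mN' : (m < mass (flow r s sigma))%N by rewrite fl mass_age_shift.
  have xE : atom (flow r s sigma) m = atom sigma m + (s - r) by rewrite fl atom_age_shift.
  have x0 : 0 <= atom sigma m + (s - r) by rewrite addr_ge0// atom_ge0.
  have rate0 : 0 < pairing (flow r s sigma) alpha by apply: rate_gt0 => //; exact: leq_ltn_trans mN'.
  rewrite mulr1 (integral_slot halpha alpha_gt0 mN') xE.
  have -> : (\int[leb]_u (a (s, u))%:E = (pairing (flow r s sigma) alpha - 0)%:E)%E.
    apply: integral_bool_itv; first exact: ltW.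
    - exact: (@measurable_below_rate _ R (fun=> s) (fun=> sigma) (measurable_cst _) (measurable_cst _) r id (@measurable_id _ _ _)).
    - by move=> u; rewrite /= in_itv/= => /andP[-> /ltW].
    - by move=> u /= /andP[h1 h2]; rewrite in_itv/= ltW.
  have -> : (\int[leb]_v (c (s, v))%:E = (p (atom sigma m + (s - r)) k - 0)%:E)%E.
    have cE : (fun v : R => (c (s, v))%:E) = (fun v => (((0 < v) && (v <= p (atom sigma m + (s - r)) k))%R%:R)%:E).
      by apply/funext => v; rewrite /c /= xE ger0_norm.
    rewrite cE; apply: integral_bool_itv; first exact: offspring_ge0.
    - have := @measurable_below_offspring _ R (fun=> s) (fun=> sigma) (measurable_cst _) (measurable_cst _) r m k id.
      by rewrite xE ger0_norm//; apply.
    - by move=> v; rewrite /= in_itv/= => /andP[-> /ltW].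
    - by move=> v /= /andP[h1 h2]; rewrite in_itv/= ltW.
  rewrite !subr0 -!EFinM; congr EFin; field; exact: lt0r_neq0.
- by apply: measurable_funM => //; exact: measurable_bool_indic.
- by move=> s; rewrite mulr_ge0.
- by apply: measurable_bool_indic; exact: measurable_below_rate.
- by apply: measurable_bool_indic; exact: measurable_in_flow_slot.
- by apply: measurable_bool_indic; exact: measurable_below_offspring.
Qed.

End hits.

(** * First-order expansion of the values *)

Section product_expansion.
Context {R : realType}.
Implicit Types (x y : nat -> R) (eta : R).

Lemma prod_01 x n (P : pred nat) : (forall j, (j < n)%N -> 0 <= x j <= 1) ->
  0 <= \prod_(j < n | P j) x j <= 1.
Proof.
move=> h; apply: (big_ind (fun z => 0 <= z <= 1)); first by rewrite ler01 lexx.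
  by move=> a b /andP[a0 a1] /andP[b0 b1]; rewrite mulr_ge0//= mulr_ile1.
by move=> j _; exact: h.
Qed.

Lemma prod_diff x y n eta : (forall j, (j < n)%N -> 0 <= x j <= 1) ->
  (forall j, (j < n)%N -> 0 <= y j <= 1) -> (forall j, (j < n)%N -> `|y j - x j| <= eta) ->
  `|\prod_(j < n) y j - \prod_(j < n) x j| <= n%:R * eta.
Proof.
elim: n => [|n IH] hx hy h; first by rewrite !big_ord0 subrr normr0 mul0r.
have hx' j : (j < n)%N -> 0 <= x j <= 1 by move=> jn; apply: hx; rewrite ltnS ltnW.
have hy' j : (j < n)%N -> 0 <= y j <= 1 by move=> jn; apply: hy; rewrite ltnS ltnW.
have h' j : (j < n)%N -> `|y j - x j| <= eta by move=> jn; apply: h; rewrite ltnS ltnW.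
rewrite !big_ord_recr/=.
set X := \prod_(j < n) x j; set Y := \prod_(j < n) y j.
have /andP[X0 X1] : 0 <= X <= 1 by exact: (@prod_01 x n predT).
have /andP[y0 y1] := hy n (ltnSn n).
rewrite (_ : _ - _ = (Y - X) * y n + X * (y n - x n)); last by ring.
apply: le_trans (ler_normD _ _) _; rewrite -[n.+1%:R]natr1 [leRHS]mulrDl mul1r; apply: lerD.
  rewrite normrM -[leRHS]mulr1; apply: ler_pM => //; first exact: IH.
  by rewrite ger0_norm.
by rewrite normrM -[leRHS]mul1r; apply: ler_pM => //; [rewrite ger0_norm|exact: h].
Qed.

(** Expanding the product at one factor after the other, each error is the product of
    two differences. *)
Lemma prod_expansion x y n eta : 0 <= eta -> (forall j, (j < n)%N -> 0 <= x j <= 1) ->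
  (forall j, (j < n)%N -> 0 <= y j <= 1) -> (forall j, (j < n)%N -> `|y j - x j| <= eta) ->
  `|\prod_(j < n) y j - \prod_(j < n) x j -
    \sum_(m < n) (y m - x m) * \prod_(j < n | j != m) x j| <= (n%:R * eta) ^+ 2.
Proof.
move=> eta0; elim: n => [|n IH] hx hy h.
  by rewrite !big_ord0 !subrr normr0 mul0r expr0n.
have hx' j : (j < n)%N -> 0 <= x j <= 1 by move=> jn; apply: hx; rewrite ltnS ltnW.
have hy' j : (j < n)%N -> 0 <= y j <= 1 by move=> jn; apply: hy; rewrite ltnS ltnW.
have h' j : (j < n)%N -> `|y j - x j| <= eta by move=> jn; apply: h; rewrite ltnS ltnW.
have IH' := IH hx' hy' h'.
rewrite !big_ord_recr/= .
set X := \prod_(j < n) x j in IH' *; set Y := \prod_(j < n) y j in IH' *.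
have dXY : `|Y - X| <= n%:R * eta by exact: prod_diff.
have /andP[y0 y1] := hy n (ltnSn n); have /andP[x0 x1] := hx n (ltnSn n).
have eS (m : 'I_n) : \prod_(j < n.+1 | j != widen_ord (leqnSn n) m) x j =
    (\prod_(j < n | j != m) x j) * x n.
  rewrite big_mkcond big_ord_recr/= -big_mkcond/=.
  congr (_ * _); last by rewrite ifT// -val_eqE /= neq_ltn ltn_ord orbT.
have eN : \prod_(j < n.+1 | j != ord_max) x j = X.
  rewrite big_mkcond big_ord_recr/= -big_mkcond/= eqxx/= mulr1.
  by apply: eq_bigl => j; rewrite -val_eqE /= neq_ltn ltn_ord.
rewrite eN; under eq_bigr do rewrite eS mulrA.
rewrite -mulr_suml; set E := \sum_(m < n) _ in IH' *.
rewrite (_ : _ - _ - _ = (Y - X - E) * x n + (Y - X) * (y n - x n)); last by ring.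
apply: le_trans (ler_normD _ _) _; rewrite !normrM.
have h1 : `|Y - X - E| * `|x n| <= (n%:R * eta) ^+ 2.
  by rewrite -[leRHS]mulr1; apply: ler_pM => //; rewrite ger0_norm.
have h2 : `|Y - X| * `|y n - x n| <= n%:R * eta * eta by apply: ler_pM => //; exact: h.
apply: le_trans (lerD h1 h2) _; rewrite -[n.+1%:R]natr1.
have : 0 <= (n%:R : R) by exact: ler0n.
move: (n%:R : R) => k k0; rewrite !expr2; nra.
Qed.

End product_expansion.

Section one_step.
Context {R : realType}.
Local Notation S := (nat_measure R).
Local Notation leb := (@lebesgue_measure R).
Variables (alpha : R -> R) (p : R -> nat -> R) (c : R).
Hypotheses (halpha : bounded_borel_nonneg alpha) (hp : offspring_law p).
Hypotheses (c0 : 0 < c) (alphac : forall x, 0 <= x -> alpha x <= c).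
Local Notation survival := (survival halpha hp c0 alphac).
Variable f : R -> R.
Hypothesis hf : bounded_borel_nonneg f.
Variables (t delta mean : R).
Hypotheses (t0 : 0 <= t) (delta0 : 0 <= delta) (mean0 : 0 <= mean).
Hypothesis hmean : forall x, 0 <= x -> forall n, \sum_(i < n) i%:R * p x i <= mean.

Let alpha01 x : 0 <= x -> `|alpha x| <= c.
Proof. by move=> x0; have [_ _ a0] := halpha; rewrite ger0_norm ?a0// alphac. Qed.

Lemma norm_Rintegral_oc (h : R -> R) (C s : R) : 0 <= s ->
  measurable_fun (`]0, s] : set R) h -> (forall q, 0 < q <= s -> `|h q| <= C) ->
  `|\int[leb]_(q in `]0, s]) h q| <= C * s.
Proof.
move=> s0 mh hC; have ih : leb.-integrable `]0, s] (EFin \o h) by exact: (@integrable_oc _ _ _ C).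
apply: le_trans (le_normr_Rintegral _ ih) _ => //.
apply: (@le_trans _ _ (\int[leb]_(q in `]0, s]) C)).
  apply: le_Rintegral => //.
  - by apply/integrable_norm.
  - apply: (@integrable_oc _ _ _ `|C|) => // q _.
rewrite Rintegral_cst//= lebesgue_measure_itv/= lte_fin; case: ifPn => [_|]; first by rewrite oppr0 addr0.
by rewrite -leNgt => s1; rewrite mulr0 (_ : s = 0) ?mulr0//; apply/eqP; rewrite eq_le s1.
Qed.

Lemma survival_rate_measurable_sub s u a : 0 <= a -> s <= u ->
  measurable_fun (`]0, s] : set R) (cumulant_rate alpha p (survival f) u a).
Proof.
move=> a0 su; apply: (@measurable_funS _ _ _ _ (`]0, u]%classic : set R)); [by []| |exact: survival_rate_measurable].
by move=> r; rewrite /= !in_itv/= => /andP[-> /le_trans]; apply.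
Qed.

Lemma survival_step s a : 0 <= s -> 0 <= a ->
  `|survival f (s + t) a - survival f t (a + s)| <= c * s.
Proof.
move=> s0 a0; rewrite (survival_split halpha hp c0 alphac hf s0 t0 a0).
rewrite addrC addKr.
have st : s <= s + t by rewrite lerDl.
apply: norm_Rintegral_oc => //; first exact: survival_rate_measurable_sub.
move=> q /andP[q0 qs]; apply: (cumulant_rate_bound hp alpha01 a0 (survival_unit_valued _ _ _ _ hf)).
by rewrite q0 (le_trans qs).
Qed.

(** The rate at which the value of the population changes by branchings of the
    individual [m] into at most [Z] offspring, all other individuals being aged to the
    end of the step. *)
Definition branch_gain (sigma : S) (Z m : nat) (q : R) : R :=
  alpha (atom sigma m + q) * ((\prod_(j < mass sigma | j != m :> nat) survival f t (atom sigma j + delta)) *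
    (pgf_trunc p (atom sigma m + q) (survival f t (delta - q)) Z.+1 -
     survival f t (atom sigma m + delta) * pgf_trunc p (atom sigma m + q) 1 Z.+1)).

Lemma branch_gain_error sigma Z m q : 0 < q <= delta -> (m < mass sigma)%N ->
  `|cumulant_rate alpha p (survival f) (delta + t) (atom sigma m) q *
      (\prod_(j < mass sigma | j != m :> nat) survival f t (atom sigma j + delta)) -
    branch_gain sigma Z m q| <= c * ((mean + 1) * (c * delta) + 2 * (mean / Z.+1%:R)).
Proof.
move=> /andP[q0 qd] mN; rewrite /cumulant_rate /branch_gain.
set a := atom sigma m; have a0 : 0 <= a by exact: atom_ge0.
have aq0 : 0 <= a + q by rewrite addr_ge0// ltW.
have dq0 : 0 <= delta - q by rewrite subr_ge0.
set G := \prod_(j < _ | _) _.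
have /andP[G0 G1] : 0 <= G <= 1.
  by apply: (@prod_01 _ (fun j => survival f t (atom sigma j + delta)) _ (fun j => j != m)) => j _; exact: survival_01.
have L1 := survival_step dq0 (lexx 0); have L2 := survival_step dq0 aq0.
have e1 : delta - q + t = delta + t - q by ring.
have e2 : a + q + (delta - q) = a + delta by ring.
rewrite add0r e1 in L1; rewrite e1 e2 in L2.
set l1 := survival f (delta + t - q) 0 in L1 *.
set l2 := survival f t (delta - q) in L1 *.
set l3 := survival f (delta + t - q) (a + q) in L2 *.
set l4 := survival f t (a + delta) in L2 *.
have l1_01 : 0 <= l1 <= 1 by exact: survival_01.
have l2_01 : 0 <= l2 <= 1 by exact: survival_01.
have /andP[l40 l41] : 0 <= l4 <= 1 by exact: survival_01.
have lip := pgf_lipschitz hp hmean aq0 l1_01 l2_01.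
have r2 := pgf_remainder_mean hp hmean Z aq0 l2_01.
have o01 : 0 <= (1 : R) <= 1 by rewrite ler01 lexx.
have r1 := pgf_remainder_mean hp hmean Z aq0 o01.
have t2 := pgf_trunc_le_pgf hp Z.+1 aq0 l2_01.
have t1 := pgf_trunc_le_pgf hp Z.+1 aq0 o01.
rewrite pgf1// in r1 t1.
set g1 := pgf p (a + q) l1 in lip *; set g2 := pgf p (a + q) l2 in lip r2 t2 *.
set T2 := pgf_trunc p (a + q) l2 Z.+1 in r2 t2 *.
set T1 := pgf_trunc p (a + q) 1 Z.+1 in r1 t1 *.
set M := mean / Z.+1%:R in r1 r2 *.
have M0 : 0 <= M by rewrite divr_ge0.
rewrite (_ : _ - _ = alpha (a + q) * (G * ((g1 - g2) + (g2 - T2) - (l3 - l4) - l4 * (1 - T1)))); last by ring.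
rewrite normrM; apply: ler_pM => //; first exact: alpha01.
rewrite normrM -[leRHS]mul1r; apply: ler_pM => //; first by rewrite ger0_norm.
have cq : c * (delta - q) <= c * delta by rewrite ler_pM2l// gerBl ltW.
have cd0 : 0 <= c * delta by rewrite mulr_ge0// ltW.
have b1 : `|g1 - g2| <= mean * (c * delta).
  by apply: le_trans lip _; apply: ler_wpM2l => //; exact: le_trans L1 cq.
have b2 : `|g2 - T2| <= M by rewrite ger0_norm ?subr_ge0// lerBlDl.
have b3 : `|l3 - l4| <= c * delta by exact: le_trans L2 cq.
have b4 : `|l4 * (1 - T1)| <= M.
  rewrite normrM -[leRHS]mul1r; apply: ler_pM => //; first by rewrite ger0_norm.
  by rewrite ger0_norm ?subr_ge0// lerBlDl.
apply: le_trans (ler_normB _ _) _; apply: le_trans (lerD (ler_normB _ _) (lexx _)) _.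
apply: le_trans (lerD (lerD (ler_normD _ _) (lexx _)) (lexx _)) _.
by move: b1 b2 b3 b4; lra.
Qed.

Lemma measurable_branch_gain sigma Z m :
  measurable_fun (`]0, delta] : set R) (branch_gain sigma Z m).
Proof.
have [ma _ _] := halpha.
apply: (@eq_measurable_fun _ _ _ _ _ (fun q => alpha `|atom sigma m + q| *
  ((\prod_(j < mass sigma | j != m :> nat) survival f t (atom sigma j + delta)) *
   ((\sum_(i < Z.+1) p `|atom sigma m + q| i * survival f t (delta - q) ^+ i) -
     survival f t (atom sigma m + delta) * (\sum_(i < Z.+1) p `|atom sigma m + q| i * 1 ^+ i))))).
  move=> q; rewrite inE/= in_itv/= => /andP[q0 _].
  by rewrite ger0_norm ?addr_ge0 ?atom_ge0 ?(ltW q0).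
apply: measurable_funTS.
have mq : measurable_fun setT (fun q : R => atom sigma m + q) by exact: measurable_funD.
have mpk i : measurable_fun setT (fun q : R => p `|atom sigma m + q| i).
  exact: (measurableT_comp (measurable_offspring hp i)).
apply: measurable_funM; first exact: (measurableT_comp (measurable_fun_nonneg_norm ma)).
apply: measurable_funM => //; apply: measurable_funB.
  apply: measurable_sum => i; apply: measurable_funM => //; apply: measurable_funX.
  by apply: measurable_survival => //; exact: measurable_funB.
apply: measurable_funM => //; apply: measurable_sum => i; exact: measurable_funM.
Qed.

Lemma branch_gain_bound sigma Z m q : 0 < q -> `|branch_gain sigma Z m q| <= c.
Proof.
move=> q0; rewrite /branch_gain; set a := atom sigma m.
have aq0 : 0 <= a + q by rewrite addr_ge0 ?atom_ge0// ltW.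
set G := \prod_(j < _ | _) _.
have /andP[G0 G1] : 0 <= G <= 1.
  by apply: (@prod_01 _ (fun j => survival f t (atom sigma j + delta)) _ (fun j => j != m)) => j _; exact: survival_01.
have s1 := survival_01 halpha hp c0 alphac hf t (delta - q).
have /andP[s20 s21] := survival_01 halpha hp c0 alphac hf t (a + delta).
have o01 : 0 <= (1 : R) <= 1 by rewrite ler01 lexx.
have T20 := pgf_trunc_ge0 hp Z.+1 aq0 (proj1 (andP s1)); have T21 := pgf_trunc_le1 hp Z.+1 aq0 s1.
have T10 := pgf_trunc_ge0 hp Z.+1 aq0 ler01; have T11 := pgf_trunc_le1 hp Z.+1 aq0 o01.
rewrite normrM -[leRHS]mulr1; apply: ler_pM => //; first exact: alpha01.
rewrite normrM -[leRHS]mulr1; apply: ler_pM => //; first by rewrite ger0_norm.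
set T1 := pgf_trunc _ _ 1 _ in T10 T11 *; set T2 := pgf_trunc _ _ _ _ in T20 T21 *.
have : 0 <= survival f t (a + delta) * T1 <= 1 by rewrite mulr_ge0//= mulr_ile1.
by move=> /andP[h0 h1]; rewrite ler_norml; lra.
Qed.

(** Over a short time the value of a population changes as if at most one individual
    branched: expand the product of the individual values to the first order. *)
Lemma one_step_value sigma Z n : (mass sigma <= n)%N ->
  `|\prod_(m < mass sigma) survival f (delta + t) (atom sigma m) -
    \prod_(m < mass sigma) survival f t (atom sigma m + delta) -
    \sum_(m < mass sigma) \int[leb]_(q in `]0, delta]) branch_gain sigma Z m q| <=
  (n%:R * (c * delta)) ^+ 2 + n%:R * (c * ((mean + 1) * (c * delta) + 2 * (mean / Z.+1%:R)) * delta).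
Proof.
move=> Nn; have cd0 : 0 <= c * delta by rewrite mulr_ge0// ltW.
have nN : (mass sigma)%:R <= n%:R :> R by rewrite ler_nat.
pose x j := survival f t (atom sigma j + delta); pose y j := survival f (delta + t) (atom sigma j).
have x01 j : (j < mass sigma)%N -> 0 <= x j <= 1 by move=> _; exact: survival_01.
have y01 j : (j < mass sigma)%N -> 0 <= y j <= 1 by move=> _; exact: survival_01.
have yx j : (j < mass sigma)%N -> `|y j - x j| <= c * delta.
  by move=> _; apply: survival_step => //; exact: atom_ge0.
have ex := prod_expansion cd0 x01 y01 yx.
set Bd := c * ((mean + 1) * (c * delta) + 2 * (mean / Z.+1%:R)).
have Bd0 : 0 <= Bd.
  have M0 : 0 <= mean / Z.+1%:R by rewrite divr_ge0.
  by apply: mulr_ge0; [exact: ltW|apply: addr_ge0; apply: mulr_ge0 => //; exact: addr_ge0].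
have term (m : 'I_(mass sigma)) : `|(y m - x m) * (\prod_(j < mass sigma | j != m) x j) -
    \int[leb]_(q in `]0, delta]) branch_gain sigma Z m q| <= Bd * delta.
  have a0 := atom_ge0 sigma m.
  rewrite /y (survival_split halpha hp c0 alphac hf delta0 t0 a0) -/(x m) (addrC (x m)) addrK.
  have dt : delta <= delta + t by rewrite lerDl.
  have mr := survival_rate_measurable_sub a0 dt.
  have hi : leb.-integrable `]0, delta] (EFin \o cumulant_rate alpha p (survival f) (delta + t) (atom sigma m)).
    apply: (@integrable_oc _ _ _ c) => // q /andP[q0 qs].
    apply: (cumulant_rate_bound hp alpha01 a0 (survival_unit_valued _ _ _ _ hf)).
    by rewrite q0 (le_trans qs).
  have hg : leb.-integrable `]0, delta] (EFin \o branch_gain sigma Z m).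
    apply: (@integrable_oc _ _ _ c); first exact: measurable_branch_gain.
    by move=> q /andP[q0 _]; exact: branch_gain_bound.
  set G := \prod_(j < _ | _) _.
  have hiG : leb.-integrable `]0, delta] (fun q => (cumulant_rate alpha p (survival f) (delta + t) (atom sigma m) q * G)%:E).
    apply: (@integrable_oc _ _ _ (c * `|G|)); first exact: measurable_funM.
    move=> q /andP[q0 qs]; rewrite normrM ler_wpM2r//.
    apply: (cumulant_rate_bound hp alpha01 a0 (survival_unit_valued _ _ _ _ hf)).
    by rewrite q0 (le_trans qs).
  rewrite -RintegralZr// -RintegralB//.
  apply: norm_Rintegral_oc => //.
    by apply: measurable_funB; [exact: measurable_funM|exact: measurable_branch_gain].
  by move=> q hq; exact: branch_gain_error.
have sum : `|\sum_(m < mass sigma) (y m - x m) * (\prod_(j < mass sigma | j != m) x j) -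
    \sum_(m < mass sigma) \int[leb]_(q in `]0, delta]) branch_gain sigma Z m q| <= n%:R * (Bd * delta).
  rewrite -sumrB; apply: le_trans (ler_norm_sum _ _ _) _.
  apply: le_trans (_ : \sum_(m < mass sigma) Bd * delta <= _); first exact: ler_sum.
  by rewrite sumr_const card_ord -[leLHS]mulr_natl; apply: ler_wpM2r => //; exact: mulr_ge0.
have sq : ((mass sigma)%:R * (c * delta)) ^+ 2 <= (n%:R * (c * delta)) ^+ 2.
  by apply: lerXn2r; rewrite ?nnegrE; [exact: mulr_ge0|exact: mulr_ge0|exact: ler_wpM2r].
move: ex sum sq; rewrite -/(x _) -/(y _).
set PY := \prod_(_ < _) y _; set PX := \prod_(_ < _) x _; set E1 := \sum_(_ < _) _; set E2 := \sum_(_ < _) _.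
move=> ex sum sq; rewrite (_ : PY - PX - E2 = (PY - PX - E1) + (E1 - E2)); last by ring.
by apply: le_trans (ler_normD _ _) _; apply: lerD => //; exact: le_trans ex sq.
Qed.

End one_step.

(** * The path during a short time interval *)

Section left_limits.
Context {R : realType}.
Local Notation S := (nat_measure R).

Lemma pairing_continuous f : bounded_continuous f -> continuous (fun mu : S => pairing mu f).
Proof.
move=> hf; pose h : bounded_continuous_fun R := exist _ f hf; apply/continuousP => A oA.
exists [set p : {ptws bounded_continuous_fun R -> R} | A (p h)] => //.
apply: (open_comp (f := fun p : {ptws bounded_continuous_fun R -> R} => p h) (D := A)) => //.
by move=> p _; exact: (@proj_continuous _ (fun=> R) h).
Qed.

Variable x : R -> S.
Hypothesis cx : cadlag x.

Lemma left_limit_pairing f s : bounded_continuous f -> 0 < s ->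
  pairing (x q) f @[q --> s^'-] --> pairing (left_limit x s) f.
Proof.
move=> hf s0; have [_ /(_ s s0) cl] := cx.
by move=> A /(@pairing_continuous f hf (left_limit x s) A) /cl.
Qed.

Lemma right_pairing f s : bounded_continuous f -> 0 <= s ->
  pairing (x q) f @[q --> s^'+] --> pairing (x s) f.
Proof.
move=> hf s0; have [/(_ s s0) cr _] := cx.
by move=> A /(@pairing_continuous f hf (x s) A) /cr.
Qed.

(** The left limit, extended to all times. *)
Definition left_state (s : R) : S := if 0 < s then left_limit x s else nat_measure0.

Definition grid_index (n : nat) (s : R) : nat := Num.truncn (Num.max s 0 * n.+1%:R).
(** A grid point strictly before [s], so that limits along the grids are left limits. *)
Definition grid_time (n : nat) (s : R) : R := (grid_index n s).-1%:R / n.+1%:R.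

Lemma grid_indexP n s : (grid_index n s)%:R <= Num.max s 0 * n.+1%:R < (grid_index n s).+1%:R.
Proof. by apply: truncn_itv; rewrite mulr_ge0 ?ler0n// le_max lexx orbT. Qed.

Lemma measurable_grid_index n : measurable_fun setT (grid_index n).
Proof.
apply: measurable_nat_fun => k.
have mm : measurable_fun setT (fun s : R => Num.max s 0 * n.+1%:R).
  by apply: measurable_funM => //; exact: measurable_maxr.
rewrite (_ : [set _ | _] = [set s | k%:R <= Num.max s 0 * n.+1%:R] `&`
    [set s | Num.max s 0 * n.+1%:R < k.+1%:R]).
  by apply: measurableI; [exact: measurable_set_le|exact: measurable_set_lt].
apply/seteqP; split => s /= => [<-|[h1 h2]]; first by have /andP[] := grid_indexP n s.
have /andP[g1 g2] := grid_indexP n s; apply/eqP; rewrite eqn_leq.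
by apply/andP; split; rewrite -ltnS -(ltr_nat R); [exact: le_lt_trans g1 h2|exact: le_lt_trans h1 g2].
Qed.

Lemma grid_time_cvg s : 0 < s -> grid_time n s @[n --> \oo] --> s^'-.
Proof.
move=> s0 A [e /= e0 eA].
have e2 : 0 < e / 2 by rewrite divr_gt0.
have ms : Num.max s 0 = s by apply/max_idPl/ltW.
suff : \forall n \near \oo, A (grid_time n s) by [].
near=> n.
have n1 : s * n.+1%:R >= 1.
  have : n.+1%:R^-1 < s by near: n; exact: (near_infty_natSinv_lt (PosNum s0)).
  by rewrite -(ltr_pM2r (ltr0Sn R n)) mulVf ?pnatr_eq0// => /ltW.
have n2 : 2 / n.+1%:R < e.
  have : n.+1%:R^-1 < e / 2 by near: n; exact: (near_infty_natSinv_lt (PosNum e2)).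
  by move=> h; rewrite mulrC -ltr_pdivlMr.
have /andP[g1 g2] := grid_indexP n s; rewrite ms in g1 g2.
have gi0 : (0 < grid_index n s)%N.
  by rewrite -ltnS -(ltr_nat R); apply: le_lt_trans g2.
have gp : (grid_index n s).-1%:R = (grid_index n s)%:R - 1 :> R.
  by rewrite -[in RHS](prednK gi0) -natr1 addrK.
have N0 : 0 < n.+1%:R :> R by [].
have lt_s : grid_time n s < s.
  by rewrite /grid_time ltr_pdivrMr// gp; lra.
apply: eA => //=.
rewrite ger0_norm ?subr_ge0 ?(ltW lt_s)//; apply: le_lt_trans n2.
rewrite /grid_time lerBlDr -mulrDl ler_pdivlMr// gp.
by rewrite -natr1 in g2; lra.
Unshelve. all: by end_near. Qed.

(** The left limits are limits along grids of times on the left, and the path takes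
    countably many values along a grid. *)
Lemma measurable_left_state : measurable_fun setT left_state.
Proof.
apply: measurable_state_of_pairing => f hf.
have mf := bounded_continuous_measurable hf.
pose g n (s : R) : R := (0 < s)%R%:R * pairing (x (grid_time n s)) f.
apply: (@measurable_fun_cvg _ _ _ setT g) => [n|s _].
  apply: measurable_funM; first by apply: measurable_bool_indic; exact: measurable_set_lt.
  apply: (@measurable_fun_nat_index _ _ _ _ (grid_index n) (fun k _ => pairing (x (k.-1%:R / n.+1%:R)) f)).
    exact: measurable_grid_index.
  by move=> k; exact: measurable_cst.
rewrite /g /left_state; case: ltP => [s0|s0]; last first.
  by rewrite pairing0//; under eq_fun do rewrite mul0r; exact: cvg_cst.
under eq_fun do rewrite mul1r.
by move=> A /(left_limit_pairing hf s0) /(grid_time_cvg s0).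
Qed.

Lemma left_stateE s : 0 < s -> left_state s = left_limit x s.
Proof. by rewrite /left_state => ->. Qed.

End left_limits.

Section jump_measurability.
Context {R : realType}.
Local Notation S := (nat_measure R).
Variables (alpha : R -> R) (p : R -> nat -> R) (x : R -> S).
Hypothesis halpha : bounded_borel_nonneg alpha.
Hypothesis alpha_gt0 : forall x, 0 <= x -> 0 < alpha x.
Hypothesis hp : offspring_law p.
Hypothesis cx : cadlag x.

Local Notation T := (mark_space R).

(** The absolute value only serves to make the age nonnegative for all marks. *)
Definition marked_age (e : T) : R := age_quantile alpha (left_state x e.1.1.1.1) `|e.1.1.2|.

Lemma marked_age_ge0 e : 0 <= marked_age e. Proof. exact: age_quantile_ge0. Qed.

Let coords := @mark_coordinates R _ T id (@measurable_id _ _ _).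

Lemma measurable_marked_state : measurable_fun setT (fun e : T => left_state x e.1.1.1.1).
Proof. by have [ms _ _ _ _] := coords; apply: (measurableT_comp (measurable_left_state cx)). Qed.

Lemma measurable_marked_age : measurable_fun setT marked_age.
Proof.
have [_ _ my _ _] := coords; apply: (measurable_age_quantile halpha alpha_gt0) => //.
  exact: measurable_marked_state.
exact: measurableT_comp.
Qed.

(** Replacing left limits by [left_state] gives a description that is measurable in
    the mark. *)
Lemma jump_regionE t : jump_region alpha p x t = mark_domain `&`
  ([set e | e.1.1.1.1 <= t] `&` ([set e | e.1.1.1.2 <= pairing (left_state x e.1.1.1.1) alpha] `&`
   [set e | e.2 <= p `|marked_age e| e.1.2])).
Proof.
apply/seteqP; split => -[[[[s u] y] z] v].
  move=> [D [h1 h2 h3]]; split => //; case: (D) => -[[[/= s0 _] y0] _] _.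
  move: s0 y0; rewrite /= !in_itv/= andbT => s0 /andP[y0 _].
  split => //=; rewrite left_stateE//; split => //=.
  by rewrite /marked_age/= left_stateE// ger0_norm ?age_quantile_ge0// (gtr0_norm y0).
move=> [D [/= h1 [h2 h3]]]; split => //; case: (D) => -[[[/= s0 _] y0] _] _.
move: s0 y0 h2 h3; rewrite /= !in_itv/= andbT => s0 /andP[y0 _].
by rewrite /marked_age/= left_stateE// ger0_norm ?age_quantile_ge0// (gtr0_norm y0).
Qed.

Lemma measurable_mark_domain : measurable (@mark_domain R).
Proof. by rewrite /mark_domain; do 4?apply: measurableX. Qed.

Lemma measurable_jump_region t : measurable (jump_region alpha p x t).
Proof.
have [ms mu my mz mv] := coords.
rewrite jump_regionE; apply: measurableI; first exact: measurable_mark_domain.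
apply: measurableI; first exact: measurable_set_le.
apply: measurableI.
  by apply: measurable_set_le => //; apply: (measurable_rate halpha); exact: measurable_marked_state.
apply: measurable_set_le => //.
apply: (@measurable_fun_nat_index _ _ _ _ (fun e : T => e.1.2) (fun k e => p `|marked_age e| k)) => // k.
exact: (measurableT_comp (measurable_offspring hp k) measurable_marked_age).
Qed.

Definition jump_value (t a : R) (e : T) : R := e.1.2%:R * (t - e.1.1.1.1 <= a)%R%:R -
  (marked_age e + t - e.1.1.1.1 <= a)%R%:R.

Lemma jump_sizeE t a e : mark_domain e -> jump_size alpha x t a e = jump_value t a e.
Proof.
case: e => [[[[s u] y] z] v] -[[[[/= s0 _] y0] _] _].
move: s0 y0; rewrite /= !in_itv/= andbT => s0 /andP[y0 _].
by rewrite /jump_size /jump_value /marked_age/= left_stateE// (gtr0_norm y0).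
Qed.

Lemma measurable_jump_value t a : measurable_fun setT (jump_value t a).
Proof.
have [ms mu my mz mv] := coords; have ma := measurable_marked_age.
apply: measurable_funB.
  apply: measurable_funM.
    by apply: (@measurableT_comp _ _ _ _ _ _ (fun k : nat => k%:R : R)).
  by apply: measurable_bool_indic; apply: measurable_set_le => //; exact: measurable_funB.
apply: measurable_bool_indic; apply: measurable_set_le => //.
by apply: measurable_funB => //; exact: measurable_funD.
Qed.

End jump_measurability.

Section state_congruence.
Context {R : realType}.
Local Notation S := (nat_measure R).
Variable alpha : R -> R.
Hypothesis halpha : bounded_borel_nonneg alpha.
Hypothesis alpha_gt0 : forall x, 0 <= x -> 0 < alpha x.
Implicit Types mu nu : S.

Lemma same_measure_atom mu nu m : same_measure mu nu -> atom mu m = atom nu m.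
Proof.
move=> h; rewrite /atom; congr inf; apply/seteqP; split => a /= [a0]; rewrite (h _ (measurable_itv _)) => h'; by split.
Qed.

Lemma same_measure_slot mu nu m y : same_measure mu nu ->
  in_slot alpha mu m y = in_slot alpha nu m y.
Proof.
move=> h; have [ma _ _] := halpha; rewrite /in_slot (same_measure_pairing h ma) /partial_rate.
by congr (_ && _); congr (_ _ _); apply: eq_bigr => j _; rewrite (same_measure_atom _ h).
Qed.

Lemma same_measure_quantile mu nu y : same_measure mu nu -> 0 <= y ->
  age_quantile alpha mu y = age_quantile alpha nu y.
Proof.
move=> h y0; rewrite !(age_quantileE halpha alpha_gt0)// (same_measure_mass h).
by apply: eq_bigr => j _; rewrite (same_measure_slot _ _ h) (same_measure_atom _ h).
Qed.

Lemma distribution_fin mu a : distribution_fun mu a \is a fin_num.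
Proof. by rewrite distribution_funE. Qed.

Lemma distribution_ge0 mu a : (0 <= distribution_fun mu a)%E. Proof. exact: measure_ge0. Qed.

Lemma distribution_lt0 mu a : a < 0 -> distribution_fun mu a = 0%E.
Proof. by move=> a0; rewrite distribution_fun_cdf nat_measure_lt0. Qed.

Lemma distribution_le_mass mu a : (distribution_fun mu a <= (mass mu)%:R%:E)%E.
Proof. by rewrite -massE; apply: le_measure; rewrite ?inE. Qed.

Lemma pairing_one mu : pairing mu (fun=> 1) = (mass mu)%:R.
Proof. by rewrite pairingE// sumr_const card_ord. Qed.

Lemma bounded_continuous_one : bounded_continuous (fun=> 1 : R).
Proof.
split; last by exists 1 => y _; rewrite normr1.
by apply: continuous_subspaceT => y; exact: cvg_cst.
Qed.

End state_congruence.

Section dirac_integral.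
Context {R : realType} d (T : measurableType d).
Variables (mu : {measure set T -> \bar R}) (B : set T) (e1 : T).
Hypothesis mB : measurable B.
Hypothesis dirac : forall E, measurable E -> mu (E `&` B) = (\1_E e1)%:E.

Lemma integral_single_point (f : T -> R) : measurable_fun setT f ->
  (\int[mu]_(e in B) (f e)%:E = (f e1)%:E)%E.
Proof.
move=> mf; have mE : measurable (f @^-1` [set f e1]) by rewrite -[X in measurable X]setTI; exact: mf.
have BE : B = (f @^-1` [set f e1] `&` B) `|` (~` (f @^-1` [set f e1]) `&` B).
  by rewrite -setIUl setUCr setTI.
have m1 : measurable (f @^-1` [set f e1] `&` B) by exact: measurableI.
have m2 : measurable (~` (f @^-1` [set f e1]) `&` B) by apply: measurableI => //; exact: measurableC.
have mfE D : measurable_fun D (fun e => (f e)%:E) by apply/measurable_EFinP; exact: measurable_funTS.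
rewrite [in LHS]BE integral_setU//; last first.
  by apply/disj_setPS => e [] [h _] [h' _].
rewrite [X in (_ + X)%E]null_set_integral//; last first.
  rewrite dirac; last exact: measurableC.
  by rewrite indicE memNset//= => h; exact: h.
rewrite adde0 (eq_integral (fun=> (f e1)%:E)); last by move=> e; rewrite inE => -[/= -> _].
rewrite integral_cst// dirac// indicE mem_set//.
by rewrite mule1.
Qed.

End dirac_integral.

Section step_functional.
Context {R : realType}.
Local Notation S := (nat_measure R).
Variables (alpha : R -> R) (p : R -> nat -> R) (r r' : R) (Z : nat) (W : R -> R).

Definition aged_value (sigma : S) := \prod_(j < mass sigma) W (atom sigma j + (r' - r)).

(** The value at the end of the step when the individual [m] has been replaced at the
    time [s] by [k] newborn ones. *)
Definition branch_value (sigma : S) (m k : nat) (s : R) :=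
  (\prod_(j < mass sigma | j != m :> nat) W (atom sigma j + (r' - r))) * W (r' - s) ^+ k.

(** The sum has at most one nonzero term, since a mark hits at most one individual. *)
Definition step_value (sigma : S) (e : mark_space R) :=
  aged_value sigma + \sum_(m < mass sigma) \sum_(k < Z.+1)
    (hits alpha p r r' m k sigma e)%:R * (branch_value sigma m k e.1.1.1.1 - aged_value sigma).

End step_functional.

Section path_step.
Context {R : realType}.
Local Notation S := (nat_measure R).
Local Notation T := (mark_space R).
Variables (alpha : R -> R) (p : R -> nat -> R) (x : R -> S).
Hypothesis halpha : bounded_borel_nonneg alpha.
Hypothesis alpha_gt0 : forall x, 0 <= x -> 0 < alpha x.
Hypothesis hp : offspring_law p.
Hypothesis cx : cadlag x.
Variable mu : {measure set T -> \bar R}.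
Hypothesis eqn : forall t a, 0 <= t -> 0 <= a ->
  (distribution_fun (x t) a = distribution_fun (x 0%R) (a - t)%R +
     \int[mu]_(e in jump_region alpha p x t) (jump_size alpha x t a e)%:E)%E.

Local Notation D := (jump_region alpha p x).
Local Notation value := (jump_value alpha x).

Let regionE t := @jump_regionE R alpha p x halpha alpha_gt0 t.

Definition step_region r t : set T := D t `&` [set e | r < e.1.1.1.1].

Lemma measurable_step r t : measurable (step_region r t).
Proof.
apply: measurableI; first exact: measurable_jump_region.
have [ms _ _ _ _] := @mark_coordinates R _ T id (@measurable_id _ _ _).
exact: measurable_set_lt.
Qed.

Lemma region_domain t : D t `<=` mark_domain. Proof. by move=> e []. Qed.

Let mvalue t a E : measurable_fun E (fun e => (value t a e)%:E).
Proof. by apply/measurable_EFinP; apply: measurable_funTS; exact: measurable_jump_value. Qed.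

(** Subtracting the equation at the time [r] and age [a - (t - r)] cancels the jumps
    before [r]: an individual of age at most [a] at the time [t] had at most that age
    at the time [r]. *)
Lemma increment r t a : 0 <= r -> r <= t -> 0 <= a ->
  (distribution_fun (x t) a = distribution_fun (x r) (a - (t - r))%R +
     \int[mu]_(e in step_region r t) (value t a e)%:E)%E.
Proof.
move=> r0 rt a0; have t0 := le_trans r0 rt.
have DU : D t = D r `|` step_region r t.
  apply/seteqP; split => e.
    case: (leP e.1.1.1.1 r) => [er|er] De; [left|by right].
    by move: De; rewrite !regionE => -[h1 [_ h2]]; split.
  case; last by case.
  rewrite !regionE => -[h1 [/= h2 h3]]; split => //; split => //.
  exact: le_trans h2 rt.
have disj : [disjoint D r & step_region r t].
  apply/disj_setPS => e []; rewrite regionE => -[_ [/= h _]] [_ /= h'].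
  by have := lt_le_trans h' h; rewrite ltxx.
have split_int : (\int[mu]_(e in D t) (jump_size alpha x t a e)%:E =
    \int[mu]_(e in D r) (value t a e)%:E + \int[mu]_(e in step_region r t) (value t a e)%:E)%E.
  rewrite -integral_setU//; [|exact: measurable_jump_region|exact: measurable_step].
  rewrite -DU; apply: eq_integral => e; rewrite inE => /region_domain De.
  by rewrite jump_sizeE.
rewrite (eqn t0 a0) split_int addeA; congr (_ + _)%E.
have [a'0|a'0] := leP 0 (a - (t - r)).
  rewrite (eqn r0 a'0) (_ : a - (t - r) - r = a - t); last by ring.
  congr (_ + _)%E; apply: eq_integral => e; rewrite inE => /region_domain De.
  rewrite jump_sizeE// /jump_value; congr (_%:E); congr (_ * _%:R - _%:R).
    by congr nat_of_bool; apply/idP/idP => ?; lra.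
  by congr nat_of_bool; apply/idP/idP => ?; lra.
rewrite (distribution_lt0 _ a'0) distribution_lt0 ?add0e; last by lra.
apply: integral0_eq => e; rewrite regionE => -[_ [/= er _]].
have A0 : 0 <= marked_age alpha x e by apply: marked_age_ge0.
rewrite /jump_value [(_ - _ <= a)%R](_ : _ = false); last by apply/negbTE; rewrite -ltNge; lra.
by rewrite [(_ <= a)%R](_ : _ = false) ?mulr0 ?subr0//; apply/negbTE; rewrite -ltNge; lra.
Qed.

Variables (r r' c L : R) (n Z : nat).
Hypotheses (r0 : 0 <= r) (rr' : r <= r') (c0 : 0 <= c) (nZ : (n.+1 < Z)%N).
Hypothesis mass_le : forall q, r <= q <= r' -> (mass (x q) <= n)%N.
Hypothesis alphac : forall y, 0 <= y -> alpha y <= c.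
Hypothesis cL : c * n%:R <= L.
Hypothesis nat_mu : forall K E, measurable E -> @natural R (mu (E `&` box r r' L K)).

Lemma left_rate_le s : r < s <= r' -> pairing (left_limit x s) alpha <= L.
Proof.
move=> /andP[rs sr']; have s0 := le_lt_trans r0 rs.
apply: le_trans cL; apply: (rate_le halpha alphac c0).
have := left_limit_pairing cx bounded_continuous_one s0; rewrite pairing_one => h.
rewrite -(ler_nat R) -(cvg_lim _ h)//; apply: limr_le; first by apply/cvg_ex; eexists; exact: h.
near=> q; rewrite pairing_one ler_nat; apply: mass_le.
have qs : q < s by near: q; exact: nbhs_left_lt.
rewrite (le_trans (ltW qs) sr') andbT.
by near: q; exact: nbhs_left_ge.
Unshelve. all: by end_near. Qed.

Lemma step_in_box t e : t <= r' -> step_region r t e -> box r r' L e.1.2 e.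
Proof.
move: e => [[[[s u] y] z] v] tr' [[[[[[/= s0 u0] y0] _] v0] [st uD _]] /= rs].
have sr' : r < s <= r' by rewrite rs (le_trans st tr').
do 4?split => //=.
move: u0; rewrite /= !in_itv/= andbT => ->.
exact: le_trans uD (left_rate_le sr').
Qed.

(** The points of the region lie in the boxes, where their number is an integer. *)
Lemma small_region_null E : measurable E -> E `<=` step_region r r' -> (mu E < 1)%E ->
  mu E = 0%E.
Proof.
move=> mE ES E1; apply/eqP; rewrite eq_le measure_ge0 andbT.
have EU : E `<=` \bigcup_K (E `&` box r r' L K).
  by move=> e Ee; exists e.1.2 => //; split => //; exact: step_in_box (lexx _) (ES _ Ee).
have mK K : measurable (E `&` box r r' L K) by apply: measurableI => //; exact: measurable_box.
apply: le_trans (measure_sigma_subadditive mu mK mE EU) _.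
rewrite eseries0// => K _ _; have [[|k] ek] := nat_mu K mE; first exact: ek.
have : (mu (E `&` box r r' L K) < 1)%E.
  by apply: le_lt_trans E1; apply: le_measure; rewrite ?inE//; exact: subIsetl.
by rewrite [X in (X < _)%E]ek lte_fin ltrn1.
Qed.

Hypothesis few : (mu (box r r' L Z) <= 1)%E.

Let value_ge e : step_region r r' e -> (1 <= e.1.2)%N -> e.1.2%:R - 1 <= value r' r' e.
Proof.
move=> [De /= re] z1; rewrite /jump_value.
have -> : (r' - e.1.1.1.1 <= r')%R by rewrite gerBl (le_trans r0)// ltW.
by rewrite mulr1 lerD2l lerN2 -[1]/(1%:R) ler_nat leq_b1.
Qed.

(** The jumps without offspring lie in the box, so there is at most one of them, and
    each other jump adds [z - 1] individuals. The number of individuals of age at most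
    [r'] at the end of the step thus increases by at least [Z] times the number of
    branchings into more than [Z] offspring, minus one, while it cannot exceed [n < Z
    - 1]. *)
Lemma large_births_null : mu (step_region r r' `&` [set e | (Z < e.1.2)%N]) = 0%E.
Proof.
set E := _ `&` _; have mS := measurable_step r r'.
have [_ _ _ mz _] := @mark_coordinates R _ T id (@measurable_id _ _ _).
have mE : measurable E.
  apply: measurableI => //; rewrite -[X in measurable X]setTI.
  exact: (mz measurableT [set z | (Z < z)%N]).
apply: small_region_null => //; first exact: subIsetl.
have r'0 := le_trans r0 rr'.
have inc := increment r0 rr' r'0; set I := (\int[mu]_(e in _) _)%E in inc.
have I_fin : I \is a fin_num.
  have := distribution_fin (x r') r'; rewrite inc fin_numD => /andP[] //.
have I_le : (I <= n%:R%:E)%E.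
  apply: (@le_trans _ _ (distribution_fun (x r') r')).
    by rewrite inc leeDr// distribution_ge0.
  apply: le_trans (distribution_le_mass _ _) _; rewrite lee_fin ler_nat.
  by apply: mass_le; rewrite rr' lexx.
pose j e := (value r' r' e)%:E : \bar R.
have mj : measurable_fun (step_region r r') j by exact: mvalue.
have neg_le : (\int[mu]_(e in step_region r r') j^\- e <= 1)%E.
  have mB := measurable_box r r' L Z.
  apply: (@le_trans _ _ (\int[mu]_(e in step_region r r') (\1_(box r r' L Z) e)%:E)%E); last first.
    rewrite integral_indic//; apply: le_trans few; apply: le_measure; rewrite ?inE//.
    exact: measurableI.
  apply: ge0_le_integral => //.
  - exact: measurable_funeneg.
  - by apply/measurable_EFinP; exact/measurable_funTS/measurable_indic.
  - move=> e Se; rewrite funenegE /j indicE.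
    have [z0|z1] := posnP e.1.2; last first.
      apply: (@le_trans _ _ 0%E); last by rewrite lee_fin.
      rewrite ge_max lexx andbT -EFinN lee_fin oppr_le0.
      by apply: le_trans (value_ge Se z1); rewrite subr_ge0 ler1n.
    rewrite mem_set; last first.
      have [[[[h1 h2] h3] _] h5] := step_in_box (lexx _) Se.
      by do 4?split => //=; rewrite z0.
    rewrite ge_max !lee_fin ler0n andbT /jump_value z0 mul0r add0r opprK.
    by rewrite ler_nat leq_b1.
have pos_ge : (Z%:R%:E * mu E <= \int[mu]_(e in step_region r r') j^\+ e)%E.
  rewrite -integral_cst//; apply: (@le_trans _ _ (\int[mu]_(e in E) j^\+ e)%E).
    apply: ge0_le_integral => //.
    - by move=> e _; rewrite lee_fin.
    - by apply: measurable_funepos; exact: mvalue.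
    - move=> e [Se /= zZ]; rewrite funeposE /j le_max lee_fin; apply/orP; left.
      have z1 : (1 <= e.1.2)%N by exact: leq_ltn_trans zZ.
      apply: le_trans (value_ge Se z1); rewrite lerBrDr natr1 ler_nat//.
  apply: ge0_subset_integral => //; first exact: measurable_funepos.
  exact: subIsetl.
have I_E : I = (\int[mu]_(e in step_region r r') j^\+ e - \int[mu]_(e in step_region r r') j^\- e)%E.
  by rewrite /I integralE.
set Ip := (\int[mu]_(e in _) j^\+ e)%E in pos_ge I_E; set In := (\int[mu]_(e in _) j^\- e)%E in neg_le I_E.
have In0 : (0 <= In)%E by apply: integral_ge0 => e _; exact: funeneg_ge0.
have In_fin : In \is a fin_num by rewrite ge0_fin_numE// (le_lt_trans neg_le)// ltry.
have : (Z%:R%:E * mu E <= n.+1%:R%:E)%E.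
  apply: le_trans pos_ge _; rewrite -(@subeK _ Ip In)// -I_E -natr1 EFinD.
  exact: leeD.
have Z0 : 0 < Z%:R :> R by rewrite ltr0n (leq_ltn_trans _ nZ).
rewrite -lee_pdivlMl// => /le_lt_trans; apply; rewrite -EFinM lte_fin mulrC ltr_pdivrMr// mul1r ltr_nat//.
Qed.

Lemma region_null E : measurable E -> E `<=` step_region r r' -> mu (E `&` box r r' L Z) = 0%E ->
  mu E = 0%E.
Proof.
move=> mE ES EZ; apply/eqP; rewrite eq_le measure_ge0 andbT.
have [_ _ _ mz _] := @mark_coordinates R _ T id (@measurable_id _ _ _).
have m1 : measurable (E `&` box r r' L Z) by apply: measurableI => //; exact: measurable_box.
have m2 : measurable (step_region r r' `&` [set e : T | (Z < e.1.2)%N]).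
  apply: measurableI; first exact: measurable_step.
  by rewrite -[X in measurable X]setTI; exact: (mz measurableT [set z | (Z < z)%N]).
apply: (@le_trans _ _ (mu ((E `&` box r r' L Z) `|` (step_region r r' `&` [set e | (Z < e.1.2)%N])))).
  apply: le_measure; rewrite ?inE//; first exact: measurableU.
  move=> e Ee; have [zZ|zZ] := leqP e.1.2 Z; [left|right]; split => //; [|exact: ES].
  have [[[[h1 h2] h3] _] h5] := step_in_box (lexx _) (ES _ Ee).
  by do 4?split.
apply: le_trans (measureU2 _ _ _) _ => //.
by rewrite [X in (X + _)%E]EZ [X in (_ + X)%E]large_births_null adde0.
Qed.

Lemma step_mono t : t <= r' -> step_region r t `<=` step_region r r'.
Proof.
move=> tr' e [De re]; split => //; move: De; rewrite !regionE => -[h1 [/= h2 h3]].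
by split => //; split => //=; exact: le_trans h2 tr'.
Qed.

(** Without points in the box nothing contributes to [increment], and points outside
    the box are excluded by [large_births_null]. *)
Lemma no_jump t : r <= t <= r' -> mu (step_region r t `&` box r r' L Z) = 0%E ->
  same_measure (x t) (age_shift (t - r) (x r)).
Proof.
move=> /andP[rt tr'] h; apply: same_measure_distribution => a a0.
rewrite distribution_age_shift ?subr_ge0// (increment r0 rt a0).
rewrite null_set_integral ?adde0//; first exact: measurable_step.
by apply: region_null => //; [exact: measurable_step|exact: step_mono].
Qed.

Section single_point.
Variable e1 : T.
Hypothesis box1 : box r r' L Z e1.
Hypothesis dirac : forall E, measurable E -> mu (E `&` box r r' L Z) = (\1_E e1)%:E.

Let s1 := e1.1.1.1.1.

Let s1_itv : r < s1 <= r'.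
Proof. by case: box1 => -[[[h _] _] _] _; move: h; rewrite /= in_itv. Qed.

(** Before its only point the box is empty, so the population has only aged. *)
Lemma left_limit_flow : same_measure (left_limit x s1) (flow r s1 (x r)).
Proof.
have /andP[rs sr'] := s1_itv; have s0 := le_lt_trans r0 rs.
rewrite flow_shift ?(ltW rs)//.
apply: same_measure_of_pairing => f hf; have mf := bounded_continuous_measurable hf.
have h1 := left_limit_pairing cx hf s0.
have h2 : pairing (x q) f @[q --> s1^'-] --> pairing (age_shift (s1 - r) (x r)) f.
  rewrite pairing_age_shift// ?subr_ge0 ?(ltW rs)//.
  apply: (@cvg_trans _ (\sum_(m < mass (x r)) f (atom (x r) m + (q - r)) @[q --> s1^'-])).
    apply: near_eq_cvg; near=> q.
    have qs : q < s1 by near: q; exact: nbhs_left_lt.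
    have rq : r <= q by near: q; exact: nbhs_left_ge.
    rewrite -pairing_age_shift ?subr_ge0//; apply/esym/same_measure_pairing => //.
    apply: no_jump; first by rewrite rq (le_trans (ltW qs)).
    rewrite dirac; last exact: measurable_step.
    rewrite indicE memNset// => -[De _]; move: De; rewrite regionE => -[_ [/= h _]].
    by have := le_lt_trans h qs; rewrite ltxx.
  apply: (@cvg_sum_ord _ _ _ _ _ (fun m q => f (atom (x r) m + (q - r))) (fun m => f (atom (x r) m + (s1 - r)))) => m _.
  have z0 : 0 < atom (x r) m + (s1 - r) by rewrite ltr_wpDl ?atom_ge0// subr_gt0.
  have [cf _] := hf; have [fi _] := (continuous_within_itvcyP 0 f).1 cf.
  have fz : {for (atom (x r) m + (s1 - r)), continuous f} by apply: fi; rewrite in_itv/= andbT.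
  have hq : atom (x r) m + (q - r) @[q --> s1^'-] --> atom (x r) m + (s1 - r).
    apply: cvg_at_left_filter.
    by apply: cvgD; [exact: cvg_cst|apply: cvgB; [exact: cvg_id|exact: cvg_cst]].
  by move=> A /fz /hq.
exact: (cvg_unique _ h1 h2).
Unshelve. all: by end_near. Qed.

Lemma single_jump a : 0 <= a ->
  (distribution_fun (x r') a = distribution_fun (x r) (a - (r' - r))%R +
    (if e1 \in step_region r r' then value r' a e1 else 0)%:E)%E.
Proof.
move=> a0; rewrite (increment r0 rr' a0); congr (_ + _)%E.
have mS := measurable_step r r'; have mB := measurable_box r r' L Z.
have m1 : measurable (step_region r r' `&` box r r' L Z) by exact: measurableI.
have m2 : measurable (step_region r r' `\` box r r' L Z) by exact: measurableD.
have SE : step_region r r' = (step_region r r' `&` box r r' L Z) `|` (step_region r r' `\` box r r' L Z).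
  by rewrite setUIDK.
rewrite [in LHS]SE integral_setU//; last first.
  by apply/disj_setPS => e [] [_ h] [_ h'].
rewrite [X in (_ + X)%E]null_set_integral ?adde0//; last first.
  apply: region_null; [exact: m2|by move=> e []|].
  by rewrite setDE -setIA setICl setI0 measure0.
pose g e := if e \in step_region r r' then value r' a e else 0.
have gE : g = (value r' a) \_ (step_region r r') by apply/funext => e; rewrite patchE.
have mg : measurable_fun setT g.
  by rewrite gE; apply/(measurable_restrictT _ _).1 => //; apply: measurable_funTS; exact: measurable_jump_value.
rewrite -(integral_single_point mB dirac mg) setIC integral_mkcondr.
by apply: eq_integral => e _; rewrite /g patchE; case: ifP.
Qed.


Variable f : R -> R.
Hypothesis hf : bounded_borel_nonneg f.
Local Notation W := (fun y => expR (- f `|y|)).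
Local Notation aged := (aged_value r r' W (x r)).
Local Notation fl := (flow r s1 (x r)).
Local Notation y1 := e1.1.1.2.
Local Notation z1 := e1.1.2.

Let mass_fl : mass fl = mass (x r).
Proof. by have /andP[rs _] := s1_itv; rewrite flow_shift ?(ltW rs)// mass_age_shift// subr_ge0 ltW. Qed.

Let atom_fl m : (m < mass (x r))%N -> atom fl m = atom (x r) m + (s1 - r).
Proof.
by move=> mN; have /andP[rs _] := s1_itv; rewrite flow_shift ?(ltW rs)// atom_age_shift// subr_ge0 ltW.
Qed.

Let left_fl : same_measure (left_state x s1) fl.
Proof.
have /andP[rs _] := s1_itv; rewrite left_stateE; last exact: le_lt_trans r0 rs.
exact: left_limit_flow.
Qed.

Let y1_itv : 0 < y1 <= 1.
Proof. by case: box1 => -[[_ h] _] _; move: h; rewrite /= in_itv. Qed.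

Let marked_slot m : (m < mass (x r))%N -> in_slot alpha fl m y1 ->
  marked_age alpha x e1 = atom fl m.
Proof.
move=> mN sl; have /andP[y0 _] := y1_itv; rewrite /marked_age (gtr0_norm y0).
rewrite (same_measure_quantile halpha alpha_gt0 left_fl (ltW y0)).
by rewrite (age_quantile_slot halpha alpha_gt0 _ sl)// mass_fl.
Qed.

Lemma hits_step m k : (m < mass (x r))%N -> hits alpha p r r' m k (x r) e1 =
  [&& e1 \in step_region r r', in_slot alpha fl m y1 & z1 == k].
Proof.
move=> mN; have /andP[rs sr] := s1_itv; have [ma _ _] := halpha.
have hv : 0 < e1.2 by case: box1 => _; rewrite /= in_itv => /andP[].
have hu : 0 < e1.1.1.1.2 by case: box1 => -[[[_ h] _] _] _; move: h; rewrite /= in_itv => /andP[].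
rewrite /hits -/s1 rs sr hu y1_itv hv /= -(same_measure_pairing left_fl ma).
apply/idP/idP.
  case/and4P => h1 h2 /eqP h3 h4; rewrite h2 h3 eqxx !andbT; apply/mem_set; split => //.
  rewrite regionE; split; first exact: box_domain r0 _ box1.
  by split => //; split => //=; rewrite (marked_slot mN h2) h3.
case/and3P; rewrite inE => -[]; rewrite regionE => -[_ [_ [/= h1 h4]]] _ h2 h3.
by rewrite h1 h2 h3 -(eqP h3) -(marked_slot mN h2).
Qed.

Lemma step_slot : step_region r r' e1 -> y1 < 1 ->
  exists2 m, (m < mass (x r))%N & in_slot alpha fl m y1.
Proof.
move=> [De _] y11; have /andP[y0 _] := y1_itv; rewrite -mass_fl.
apply: (slot_exists halpha alpha_gt0); last by rewrite y11 (ltW y0).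
move: De; rewrite regionE => -[[[[[_ u0] _] _] _] [_ [/= h _]]].
have [ma _ _] := halpha; rewrite lt0n; apply/eqP => m0.
move: h u0; rewrite (same_measure_pairing left_fl ma) pairing_rate// m0 /partial_rate big_ord0.
by move=> h; rewrite /= in_itv/= andbT ltNge h.
Qed.

(** After adding the individual that branches to the final state, and its offspring to
    the initial one, both have the same distribution function. *)
Lemma laplace_jump m : (m < mass (x r))%N -> step_region r r' e1 -> in_slot alpha fl m y1 ->
  laplace f (x r') = branch_value r r' W (x r) m z1 s1.
Proof.
move=> mN Se sl; have [mf _ _] := hf; have /andP[rs sr] := s1_itv.
have d0 : 0 <= r' - r by rewrite subr_ge0.
have b0 : 0 <= r' - s1 by rewrite subr_ge0.
have am0 : 0 <= atom (x r) m + (r' - r) by rewrite addr_ge0// atom_ge0.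
have h : same_measure (nat_add (x r') (nat_dirac (atom (x r) m + (r' - r))))
    (nat_add (age_shift (r' - r) (x r)) (of_atoms z1 (fun=> r' - s1))).
  apply: same_measure_distribution => a a0.
  rewrite /distribution_fun !nat_addE//.
  have E1 := single_jump a0; rewrite mem_set// in E1.
  have E2 := distribution_age_shift (x r) a d0.
  rewrite /distribution_fun in E1 E2; rewrite [X in (X + _)%E = _]E1 E2 -addeA; congr (_ + _)%E.
  rewrite (has_atoms_of_atoms_ge0 (fun _ _ => b0))// (@has_atoms_of_atoms_ge0 _ 1 _ (fun _ _ => am0))//.
  rewrite big_ord1 sumr_const card_ord -EFinD; congr (_%:E).
  rewrite /jump_value (marked_slot mN sl) (atom_fl mN) -/s1 !indicE !mem_setE !in_itv/= b0 am0/=.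
  rewrite (_ : atom (x r) m + (s1 - r) + r' - s1 = atom (x r) m + (r' - r)); last by ring.
  by rewrite mulr_natl subrK.
have := same_measure_pairing h mf.
rewrite !pairing_nat_add// pairing_nat_dirac// pairing_age_shift//.
rewrite (pairing_has_atoms (has_atoms_of_atoms_ge0 (fun _ _ => b0)))// sumr_const card_ord => hE.
(* Both sides contain the positive factor of the individual [m]. *)
rewrite /branch_value /laplace; apply: (mulIf (lt0r_neq0 (expR_gt0 (- f `|atom (x r) m + (r' - r)|)))).
rewrite -expRD -opprD hE opprD expRD -mulNrn -mulr_natl expRM_natl [in RHS]mulrAC; congr (_ * _).
  rewrite (bigD1 (Ordinal mN))//= opprD expRD mulrC ger0_norm//; congr (_ * _).
  rewrite -sumrN expR_sum; apply: eq_bigr => j _; rewrite ger0_norm// addr_ge0// atom_ge0//.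
by rewrite ger0_norm.
Qed.

Lemma laplace_aged : same_measure (x r') (age_shift (r' - r) (x r)) -> laplace f (x r') = aged.
Proof.
move=> h; have [mf _ _] := hf; rewrite /laplace (same_measure_pairing h mf).
rewrite pairing_age_shift ?subr_ge0// -sumrN expR_sum; apply: eq_bigr => j _.
by rewrite ger0_norm// addr_ge0 ?atom_ge0// subr_ge0.
Qed.

(** A point that is not a jump hits nobody; otherwise it hits the individual
    designated by its coordinate [y], and nobody else. *)
Lemma single_jump_value : y1 < 1 ->
  laplace f (x r') = step_value alpha p r r' Z W (x r) e1.
Proof.
move=> y11; rewrite /step_value.
have [Se|nS] := pselect (step_region r r' e1).
  have [m mN sl] := step_slot Se y11.
  have zZ : (z1 < Z.+1)%N by case: box1 => -[_ h] _.
  rewrite (bigD1 (Ordinal mN))//= [X in _ + (_ + X)]big1 ?addr0; last first.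
    move=> m' m'm; apply: big1 => k _; rewrite hits_step//.
    case: (boolP (in_slot _ _ _ _)) => [sl'|_]; last by rewrite andbF mul0r.
    by case/eqP: m'm; apply/val_inj; exact: (slot_uniq alpha_gt0 sl' sl).
  rewrite (bigD1 (Ordinal zZ))//= [X in _ + (_ + X)]big1 ?addr0; last first.
    move=> k kz; rewrite hits_step// (_ : z1 == k = false) ?andbF ?mul0r//.
    by apply/negbTE; apply: contra kz => /eqP e; apply/eqP/val_inj.
  rewrite hits_step// mem_set// sl eqxx mul1r addrC subrK.
  exact: laplace_jump.
rewrite big1 ?addr0; last first.
  by move=> m _; apply: big1 => k _; rewrite hits_step// memNset// mul0r.
apply: laplace_aged; apply: same_measure_distribution => a a0.
by rewrite distribution_age_shift ?subr_ge0// (single_jump a0) memNset// adde0.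
Qed.

End single_point.

Variable f : R -> R.
Hypothesis hf : bounded_borel_nonneg f.
Local Notation W := (fun y => expR (- f `|y|)).

Lemma no_point_value : mu (box r r' L Z) = 0%E ->
  laplace f (x r') = aged_value r r' W (x r).
Proof.
move=> h; apply: laplace_aged => //; apply: no_jump; first by rewrite rr' lexx.
apply/eqP; rewrite eq_le measure_ge0 andbT -h.
have mB := measurable_box r r' L Z; have mS := measurable_step r r'.
by apply: le_measure; rewrite ?inE//; exact: measurableI.
Qed.

Lemma measurable_step_value sigma : measurable_fun setT (step_value alpha p r r' Z W sigma).
Proof.
have [mf _ _] := hf.
apply: measurable_funD => //; apply: measurable_sum => m; apply: measurable_sum => k.
apply: measurable_funM.
  apply: measurable_bool_indic; apply: (@measurable_hits _ alpha p halpha hp _ T (fun=> sigma) id) => //.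
apply: measurable_funB => //; apply: measurable_funM => //; apply: measurable_funX.
have [ms _ _ _ _] := @mark_coordinates R _ T id (@measurable_id _ _ _).
apply: measurableT_comp => //; apply: measurableT_comp => //.
apply: (measurableT_comp (measurable_fun_nonneg_norm mf)).
exact: measurable_funB.
Qed.

(** The mark measure on the box is a Dirac mass at its only point, at which the
    integrand is evaluated. *)
Lemma one_point_value : mu (box r r' L Z) = 1%E ->
  mu ([set e | e.1.1.2 = 1] `&` box r r' L Z) = 0%E ->
  ((laplace f (x r'))%:E = \int[mu]_(e in box r r' L Z) (step_value alpha p r r' Z W (x r) e)%:E)%E.
Proof.
move=> h1 h0; have mB := measurable_box r r' L Z.
have [_ _ my _ _] := @mark_coordinates R _ T id (@measurable_id _ _ _).
have m1 : mrestr mu mB setT = 1%E by rewrite /mrestr setTI.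
have nm E : measurable E -> natural (mrestr mu mB E) by exact: nat_mu.
have [G hG] := countable_generator_mark R.
have [e1 he] := unit_mass_dirac m1 hG nm.
have dirac E : measurable E -> mu (E `&` box r r' L Z) = (\1_E e1)%:E by exact: he.
have box1 : box r r' L Z e1.
  have := dirac _ mB; rewrite setIid h1 indicE; case: (boolP (e1 \in _)) => [|_]; first by rewrite inE.
  by move=> [] /eqP; rewrite oner_eq0.
have my1 : measurable [set e : T | e.1.1.2 = 1].
  by rewrite -[X in measurable X]setTI; exact: (my measurableT [set 1]).
have y1 : e1.1.1.2 < 1.
  case: (box1) => -[[_ h] _] _; move: h; rewrite /= in_itv/= => /andP[_].
  rewrite le_eqVlt => /predU1P[e|//]; have := dirac _ my1; rewrite h0 indicE mem_set// => -[] /eqP.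
  by rewrite eq_sym oner_eq0.
rewrite (integral_single_point mB dirac (measurable_step_value _)).
by congr (_%:E); exact: single_jump_value.
Qed.

End path_step.

(** * Freezing the past *)

Section restricted_integrals.
Local Open Scope ereal_scope.
Context {R : realType}.

Lemma integral_mrestr d (T : measurableType d) (mu : {measure set T -> \bar R}) (B : set T)
    (mB : measurable B) (f : T -> \bar R) : measurable_fun setT f ->
  \int[mrestr mu mB]_x f x = \int[mu]_(x in B) f x.
Proof.
move=> mf; have mC : measurable (~` B) by exact: measurableC.
transitivity (\int[mrestr mu mB]_(x in B `|` ~` B) f x); first by rewrite setUCr.
rewrite integral_setU//; [|by rewrite setUCr|by apply/disj_setPS => x []].
rewrite [X in _ + X]null_set_integral//; last 2 first.
- exact: measurable_funTS.
- by rewrite /= /mrestr setICl measure0.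
rewrite adde0; apply: eq_measure_integral => A _ AB /=.
by rewrite /mrestr setIidl.
Qed.

Lemma measure_rectangles d1 d2 (T1 : measurableType d1) (T2 : measurableType d2)
    (m1 m2 : {measure set (T1 * T2) -> \bar R}) :
  (forall A B, measurable A -> measurable B -> m1 (A `*` B) = m2 (A `*` B)) ->
  m1 setT < +oo -> forall U, measurable U -> m1 U = m2 U.
Proof.
move=> h fin U mU.
apply: (@measure_unique _ _ _ [set A `*` B | A in measurable & B in measurable] (fun=> setT)
  _ _ _ _ m1 m2) => //.
- exact: measurable_prod_measurableType.
- move=> _ _ [A1 mA1 [B1 mB1 <-]] [A2 mA2 [B2 mB2 <-]]; rewrite -setXI.
  by exists (A1 `&` A2); [exact: measurableI|exists (B1 `&` B2) => //; exact: measurableI].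
- by move=> _; exists setT => //; exists setT => //; rewrite setXTT.
- by rewrite bigcup_const.
- by move=> _ [A mA [B mB <-]]; exact: h.
Qed.

End restricted_integrals.

Section joint_law.
Local Open Scope ereal_scope.
Context {R : realType} d d1 d2 (Omega : measurableType d) (S : measurableType d1) (T : measurableType d2).
Variables (P : probability Omega R) (h : Omega -> S).
Hypothesis mh : measurable_fun setT h.

Let observed (z : unit * Omega * T) : S * T := (h z.1.2, z.2).

Let measurable_observed : measurable_fun setT observed.
Proof.
apply: measurable_fun_pair; last exact: measurable_snd.
by apply: (measurableT_comp mh); apply: (measurableT_comp measurable_snd); exact: measurable_fst.
Qed.

(** The law of the pair of [h] and a point drawn from [K]. *)
Definition joint (K : R.-spker Omega ~> T) : {measure set (S * T) -> \bar R} :=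
  kbind (kconst unit P)
    (kbind (kprecomp (@measurable_snd _ _ unit Omega) K) (kpoint measurable_observed)) tt.

Lemma integral_joint K (f : S * T -> \bar R) : (forall z, 0 <= f z) -> measurable_fun setT f ->
  \int[joint K]_z f z = \int[P]_w \int[K w]_e f (h w, e).
Proof.
move=> f0 mf; rewrite /joint integral_kbind//; apply: eq_integral => w _.
rewrite integral_kbind//; apply: eq_integral => e _.
by rewrite (integral_dirac (observed (tt, w, e)) measurableT mf) diracT mul1e.
Qed.

Lemma joint_rectangle K V E : measurable V -> measurable E ->
  joint K (V `*` E) = \int[P]_(w in h @^-1` V) K w E.
Proof.
move=> mV mE; have mX := measurableX mV mE.
have -> : joint K (V `*` E) = \int[joint K]_z (\1_(V `*` E) z)%:E.
  by rewrite (integral_indic (joint K) measurableT mX) setIT.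
rewrite integral_joint; last 2 first.
- by move=> z; rewrite lee_fin.
- by apply/measurable_EFinP; exact: measurable_indic.
rewrite [in RHS]integral_mkcond; apply: eq_integral => w _; rewrite patchE.
have -> : (w \in h @^-1` V) = (h w \in V) by apply/idP/idP; rewrite !inE.
case: ifPn => hw.
  have -> : K w E = \int[K w]_e (\1_E e)%:E by rewrite integral_indic// setIT.
  apply: eq_integral => e _.
  by rewrite !indicE in_setX hw.
apply: integral0_eq => e _; rewrite indicE in_setX/= (negbTE hw)//.
Qed.

Lemma joint_le1 K : joint K setT <= 1. Proof. exact: sprob_kernel_le1. Qed.

(** The rectangles form a pi-system that generates the product sigma-algebra. *)
Lemma joint_eq (K K' : R.-spker Omega ~> T) :
  (forall V E, measurable V -> measurable E ->
    \int[P]_(w in h @^-1` V) K w E = \int[P]_(w in h @^-1` V) K' w E) ->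
  forall f : S * T -> \bar R, (forall z, 0 <= f z) -> measurable_fun setT f ->
  \int[P]_w \int[K w]_e f (h w, e) = \int[P]_w \int[K' w]_e f (h w, e).
Proof.
move=> hK f f0 mf; rewrite -(integral_joint K f0 mf) -(integral_joint K' f0 mf).
apply: eq_measure_integral => U mU _.
apply: (measure_rectangles (m1 := joint K) (m2 := joint K')) mU => [V E mV mE|].
  by rewrite (joint_rectangle K mV mE) (joint_rectangle K' mV mE); exact: hK.
by apply: le_lt_trans (joint_le1 K) _; rewrite ltry.
Qed.

End joint_law.

Section poisson_step.
Local Open Scope ereal_scope.
Context {R : realType} {d : measure_display} {Omega : measurableType d}.
Local Notation S := (nat_measure R).
Local Notation T := (mark_space R).
Variables (P : probability Omega R) (F : R -> set (set Omega)) (M : R.-ker Omega ~> T).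
Hypothesis hF : usual_filtration P F.
Hypothesis hM : adapted_poisson_random_measure P F M.
Variables (r : R) (A : set Omega) (h : Omega -> S) (B : set T) (e0 : T).
Hypotheses (r0 : (0 <= r)%R) (FA : F r A) (Fh : forall V, measurable V -> F r (h @^-1` V)).
Hypotheses (hB : finite_mark_sets B) (future : B `<=` [set e | (r < e.1.1.1.1)%R]).

Let mB : measurable B. Proof. by case: hB => -[]. Qed.
Let l : R := fine (mark_intensity B).

Let lE : mark_intensity B = l%:E.
Proof. by rewrite fineK// ge0_fin_numE//; case: hB. Qed.

Let l0 : (0 <= l)%R. Proof. by rewrite -lee_fin -lE. Qed.

Lemma filtration_setI t C D : (0 <= t)%R -> F t C -> F t D -> F t (C `&` D).
Proof.
move=> t0 FC FD; have sF := filtration_sigma hF t0.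
rewrite -(setCK (C `&` D)) setCI.
have FCc E : F t E -> F t (~` E) by case: sF => _ h' _ /h'; rewrite setTD.
apply: (FCc); rewrite -bigcup2E; case: sF => _ _; apply => -[|[|i]] /=; [exact: FCc..|].
by case: (filtration_sigma hF t0).
Qed.

Let mF C : F r C -> measurable C. Proof. exact: (filtration_measurable hF). Qed.
Let mA : measurable A. Proof. exact: mF. Qed.

Let mM E x : measurable E -> measurable [set w | M w E = x].
Proof. by move=> mE; exact: measurable_prm_eq. Qed.

Let sub_mark E : measurable E -> finite_mark_sets (E `&` B).
Proof. by move=> mE; exact: finite_mark_setsS. Qed.

Let future_eq E x : measurable E -> future_sigma M r [set w | M w (E `&` B) = x].
Proof.
move=> mE; apply: sub_sigma_algebra; exists (E `&` B), [set x]; split => //.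
- by case: (sub_mark mE).
- by move=> e [_ /future].
Qed.

Let P_none E : measurable E -> P [set w | M w (E `&` B) = 0] =
  (expR (- fine (mark_intensity (E `&` B))))%:E.
Proof. by move=> mE; rewrite (prm_poisson hM 0 (sub_mark mE)) expr0 fact0 divr1 mul1r. Qed.

Let P_single E : measurable E ->
  P ([set w | M w (E `&` B) = 1] `&` [set w | M w (~` E `&` B) = 0]) =
  (expR (- l))%:E * mark_intensity (E `&` B).
Proof.
move=> mE; have mC : measurable (~` E) by exact: measurableC.
pose D (i : 'I_2) := if i == ord0 then E `&` B else ~` E `&` B.
pose V (i : 'I_2) : set (\bar R) := if i == ord0 then [set 1] else [set 0].
have -> : [set w | M w (E `&` B) = 1] `&` [set w | M w (~` E `&` B) = 0] =
    \bigcap_i [set w | V i (M w (D i))].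
  apply/seteqP; split => w /=.
    move=> [h1 h2] i _; rewrite /V /D; case: ifP => _ //.
  by move=> hw; split; [have := hw ord0 I|have := hw ord_max I]; rewrite /V /D.
rewrite (prm_independent hM); last 3 first.
- by move=> i; rewrite /D; case: ifP => _; exact: sub_mark.
- apply/trivIsetP => i j _ _; rewrite /D -subset0.
  have two (k : 'I_2) : k = ord0 \/ k = ord_max.
    by case: k => -[|[|k]] // hk; [left|right]; exact/val_inj.
  by case: (two i) => ->; case: (two j) => -> //= _ e; [move=> [[h1 _] [h2 _]]|move=> [[h1 _] [h2 _]]].
- by move=> i; rewrite /V; case: ifP.
rewrite big_ord_recl big_ord1 /V /D /= P_none// (prm_poisson hM 1 (sub_mark mE)).
have fin E' : measurable E' -> mark_intensity (E' `&` B) = (fine (mark_intensity (E' `&` B)))%:E.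
  by move=> mE'; rewrite fineK// ge0_fin_numE//; case: (sub_mark mE').
have lS : l = (fine (mark_intensity (E `&` B)) + fine (mark_intensity (~` E `&` B)))%R.
  apply: EFin_inj; rewrite EFinD -(fin _ mE) -(fin _ mC) -lE -measureU; [by rewrite -setIUl setUCr setTI| | |].
  - exact: measurableI.
  - exact: measurableI.
  - by rewrite -subset0 => e [[h1 _] [h2 _]].
rewrite [X in _ = _ * X](fin E mE) lS.
move: (fine _) (fine _) => a b; rewrite -!EFinM; congr (_%:E).
by rewrite opprD expRD expr1 divr1; ring.
Qed.

Let none := A `&` [set w | M w B = 0].
Let one := A `&` [set w | M w B = 1].

(** The point of [B] if there is exactly one, and [e0] if there is none; other
    outcomes and the complement of [A] carry no mass. *)
Definition first_point_fun (w : Omega) : {measure set T -> \bar R} :=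
  if w \in none then (\d_e0 : {measure set T -> \bar R})
  else if w \in one then (mrestr (M w) mB : {measure set T -> \bar R})
  else (mzero : {measure set T -> \bar R}).

Let mA0 : measurable (none). Proof. by apply: measurableI => //; exact: mM. Qed.
Let mA1 : measurable (one). Proof. by apply: measurableI => //; exact: mM. Qed.

Let first_pointE w E : first_point_fun w E =
  (\1_(none) w)%:E * (\1_E e0)%:E +
  (\1_(one) w)%:E * M w (E `&` B).
Proof.
rewrite /first_point_fun !indicE; case: (boolP (w \in _)) => h0.
  rewrite (_ : (w \in A `&` _) = false) ?mul0e ?adde0 ?mul1e ?diracE//.
  apply/negP; move: h0; rewrite !inE => -[_ /= h0] [_ /=]; rewrite h0 => /eqP.
  by rewrite eq_sym onee_eq0.
by case: ifP => h1; rewrite mul0e add0e ?mul1e ?mul0e.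
Qed.

Let first_point_measurable E : measurable E -> measurable_fun setT (first_point_fun ^~ E).
Proof.
move=> mE; under eq_fun do rewrite first_pointE.
apply: emeasurable_funD; apply: emeasurable_funM => //.
- by apply/measurable_EFinP; exact: measurable_indic.
- by apply/measurable_EFinP; exact: measurable_indic.
- by apply: measurable_kernel; exact: measurableI.
Qed.

Let first_point_le1 w : first_point_fun w setT <= 1.
Proof.
rewrite /first_point_fun; case: ifP => _; first by rewrite /= diracT.
case: ifPn => [|_]; last by rewrite /= /mzero.
by rewrite inE => -[_ /= h1]; rewrite /= /mrestr setTI h1.
Qed.

Definition first_point : R.-spker Omega ~> T := mk_spker first_point_measurable first_point_le1.

(** The law of [first_point_fun] conditionally on the past: the numbers of points in
    [E `&` B] and in the rest of [B] are independent and Poisson. *)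
Definition frozen_point_fun (w : Omega) : {measure set T -> \bar R} :=
  if w \in A then (mscale (NngNum (expR_ge0 (- l)))
    (measure_add (\d_e0 : {measure set T -> \bar R}) (mrestr (@mark_intensity R) mB)) : {measure set T -> \bar R})
  else (mzero : {measure set T -> \bar R}).

Let frozen_pointE w E : frozen_point_fun w E =
  (\1_A w)%:E * ((expR (- l))%:E * ((\1_E e0)%:E + mark_intensity (E `&` B))).
Proof.
rewrite /frozen_point_fun indicE; case: ifP => _; last by rewrite mul0e.

rewrite mul1e; transitivity ((expR (- l))%:E * (\d_e0 E + mrestr (@mark_intensity R) mB E)).
  by congr (_ * _); exact: measure_addE.
by rewrite diracE.
Qed.

Let frozen_point_measurable E : measurable E -> measurable_fun setT (frozen_point_fun ^~ E).
Proof.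
move=> mE; under eq_fun do rewrite frozen_pointE.
by apply: emeasurable_funM => //; apply/measurable_EFinP; exact: measurable_indic.
Qed.

Let frozen_point_le1 w : frozen_point_fun w setT <= 1.
Proof.
rewrite frozen_pointE setTI lE indicT [cst _ _]/= (indicE _ A) -EFinD -!EFinM lee_fin.
apply: (@le_trans _ _ (1 * (expR (- l) * expR l))%R).
  apply: ler_pM; rewrite ?ler0n ?lern1 ?leq_b1 ?mulr_ge0 ?expR_ge0 ?addr_ge0//.
  by apply: ler_wpM2l; [exact: expR_ge0|exact: expR_ge1Dx].
by rewrite -expRD addNr expR0 mul1r.
Qed.

Definition frozen_point : R.-spker Omega ~> T := mk_spker frozen_point_measurable frozen_point_le1.

(** Almost surely, exactly one point in [B] that lies in [E] means one point in [E `&`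
    B] and none in the rest of [B]; this event is independent of the past. *)
Lemma frozen_rectangle V E : measurable V -> measurable E ->
  \int[P]_(w in h @^-1` V) first_point w E = \int[P]_(w in h @^-1` V) frozen_point w E.
Proof.
move=> mV mE; have mC : measurable (~` E) by exact: measurableC.
have FV : F r (A `&` h @^-1` V) by apply: filtration_setI => //; exact: Fh.
have mhV : measurable (h @^-1` V) by apply: mF; exact: Fh.
have mAV : measurable (A `&` h @^-1` V) by exact: mF.
pose C := [set w | M w (E `&` B) = 1] `&` [set w | M w (~` E `&` B) = 0].
have mC' : measurable C by apply: measurableI; apply: mM; exact: measurableI.
have C_future : future_sigma M r C.
  have h1 := future_eq 1 mE; have h2 := future_eq 0 mC.
  exact: (@measurableI _ (g_sigma_algebraType _) _ _ h1 h2).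
have B_future : future_sigma M r [set w | M w B = 0].
  by have := future_eq 0 measurableT; rewrite setTI.
have mB0 : measurable [set w | M w B = 0] by exact: mM.
transitivity (\int[P]_(w in h @^-1` V) ((\1_(none) w)%:E * (\1_E e0)%:E +
    (\1_(A `&` C) w)%:E)).
  apply: ae_eq_integral => //.
  - by apply: measurable_funTS; exact: first_point_measurable.
  - apply: measurable_funTS; apply: emeasurable_funD; [apply: emeasurable_funM => //|];
    by apply/measurable_EFinP; apply: measurable_indic => //; exact: measurableI.
  have n1 := prm_natural hM (sub_mark mE); have n2 := prm_natural hM (sub_mark mC).
  move: n1 n2; apply: filterS2 => w [i hi] [j hj] _.
  rewrite /first_point /= first_pointE; congr (_ + _).
  have MB : M w B = (i + j)%:R%:E.
    rewrite natrD EFinD -hi -hj -measureU; [by rewrite -setIUl setUCr setTI| | |].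
    - exact: measurableI.
    - exact: measurableI.
    - by rewrite -subset0 => e [[h1 _] [h2 _]].
  rewrite !indicE hi.
  have [Aw|nA] := pselect (A w); last first.
    by rewrite !memNset ?mul0e//= => -[].
  have -> : (w \in one) = (i + j == 1)%N.
    apply/idP/idP; first by rewrite inE => -[_ /=]; rewrite MB => -[/eqP]; rewrite (eqr_nat R _ 1).
    by move=> /eqP e; apply/mem_set; split => //=; rewrite MB e.
  have -> : (w \in A `&` C) = ((i == 1) && (j == 0))%N.
    apply/idP/idP; rewrite inE.
      by move=> [_ [/= ]]; rewrite hi hj => -[/eqP] + [/eqP]; rewrite (eqr_nat R _ 1) (eqr_nat R _ 0) => -> ->.
    by move=> /andP[/eqP i1 /eqP j0]; split => //; split => /=; rewrite ?hi ?hj ?i1 ?j0.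
  rewrite -EFinM; congr (_%:E); case: i hi MB => [|[|i]] hi MB; case: j hj MB => [|[|j]] hj MB;
    rewrite /= ?mulr0 ?mulr1 ?mul0r//.
transitivity (P (A `&` h @^-1` V `&` [set w | M w B = 0]) * (\1_E e0)%:E + P (A `&` h @^-1` V `&` C)).
  rewrite ge0_integralD; [|exact: mhV| | | |]; last 4 first.
  - by move=> w _; rewrite -EFinM lee_fin.
  - by apply: measurable_funTS; apply: emeasurable_funM => //; apply/measurable_EFinP; exact: measurable_indic.
  - by move=> w _; rewrite lee_fin.
  - by apply/measurable_funTS/measurable_EFinP; apply: measurable_indic; exact: measurableI.
  rewrite ge0_integralZr; [|exact: mhV| | |]; last 3 first.
  - by apply/measurable_funTS/measurable_EFinP; apply: measurable_indic.
  - by move=> w _; rewrite lee_fin.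
  - by rewrite lee_fin.
  rewrite !integral_indic//; last exact: measurableI.
  by congr (P _ * _ + P _); rewrite setIAC.
rewrite (prm_future_independent hM r0 FV B_future) (prm_future_independent hM r0 FV C_future).
rewrite P_single//; have := P_none measurableT; rewrite setTI -/l => ->.
under eq_integral do rewrite /frozen_point /= frozen_pointE.
rewrite ge0_integralZr; [|exact: mhV| | |]; last 3 first.
- by apply/measurable_funTS/measurable_EFinP; apply: measurable_indic.
- by move=> w _; rewrite lee_fin.
- by rewrite mule_ge0 ?lee_fin ?expR_ge0// adde_ge0// lee_fin.
have a0 : 0 <= (\1_E e0)%:E :> \bar R by rewrite lee_fin.
have x0 : 0 <= (expR (- l))%:E :> \bar R by rewrite lee_fin expR_ge0.
have b0 := measure_ge0 (@mark_intensity R) (E `&` B).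
rewrite integral_indic// (ge0_muleDr _ a0 b0) (ge0_muleDr _ (mule_ge0 x0 a0) (mule_ge0 x0 b0)).
by rewrite -!muleA.
Qed.

Hypothesis mh : measurable_fun setT h.

(** The state [h] belongs to the past, so it can be treated as a constant when
    averaging over the first point. *)
Lemma frozen_campbell (f : S * T -> \bar R) : (forall z, 0 <= f z) -> measurable_fun setT f ->
  \int[P]_w \int[first_point w]_e f (h w, e) = \int[P]_w \int[frozen_point w]_e f (h w, e).
Proof. exact: (joint_eq mh frozen_rectangle). Qed.

Lemma frozen_point_integral f w : A w -> (forall e, 0 <= f e) -> measurable_fun setT f ->
  \int[frozen_point w]_e f e =
  (expR (- l))%:E * (f e0 + \int[mark_intensity]_(e in B) f e).
Proof.
move=> Aw f0 mf; rewrite -[LHS]/(\int[frozen_point_fun w]_e f e) /frozen_point_fun mem_set//.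
rewrite ge0_integral_mscale//; congr (_ * _).
etransitivity; first by apply: ge0_integral_measure_add => // e _; exact: f0.
have E1 : \int[\d_e0]_x f x = f e0.
  by rewrite (integral_dirac e0 measurableT mf) diracT mul1e.
exact: (congr2 adde E1 (integral_mrestr (@mark_intensity R) mB mf)).
Qed.

Lemma frozen_point_outside f w : ~ A w -> \int[frozen_point w]_e f e = 0.
Proof.
by move=> nA; rewrite -[LHS]/(\int[frozen_point_fun w]_e f e) /frozen_point_fun memNset ?integral_measure_zero.
Qed.

Lemma first_point_none f w : A w -> M w B = 0 -> measurable_fun setT f ->
  \int[first_point w]_e f e = f e0.
Proof.
move=> Aw h0 mf; rewrite -[LHS]/(\int[first_point_fun w]_e f e) /first_point_fun mem_set//.
by rewrite integral_dirac// diracT mul1e.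
Qed.

Lemma first_point_one f w : A w -> M w B = 1 -> measurable_fun setT f ->
  \int[first_point w]_e f e = \int[M w]_(e in B) f e.
Proof.
move=> Aw h1 mf; rewrite -[LHS]/(\int[first_point_fun w]_e f e) /first_point_fun memNset; last first.
  by move=> [_ /=]; rewrite h1 => /eqP; rewrite onee_eq0.
by rewrite mem_set// integral_mrestr.
Qed.

Lemma first_point_outside f w : ~ A w -> \int[first_point w]_e f e = 0.
Proof.
by move=> nA; rewrite -[LHS]/(\int[first_point_fun w]_e f e) /first_point_fun !memNset ?integral_measure_zero// => -[].
Qed.

(** [1 - expR (- l) * (1 + l) <= l ^+ 2]. *)
Lemma prob_many : P (~` ([set w | M w B = 0] `|` [set w | M w B = 1])) <= (l ^+ 2)%:E.
Proof.
have m0 := mM 0 mB; have m1 := mM 1 mB.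
rewrite probability_setC; last exact: measurableU.
have -> : P ([set w | M w B = 0] `|` [set w | M w B = 1]) = (expR (- l) + l * expR (- l))%:E.
  rewrite measureU//; last first.
    by rewrite -subset0 => w [/= ->] /eqP; rewrite eq_sym onee_eq0.
  apply: (eq_trans (congr2 adde (prm_poisson hM 0 hB) (prm_poisson hM 1 hB))).
  by rewrite -/l expr0 expr1 !divr1 mul1r.
rewrite -EFinB lee_fin.
have key (y z : R) : (0 <= y -> 1 - y <= z -> 1 - (z + y * z) <= y ^+ 2)%R.
  by move=> y0 yz; have := ler_wpM2l (addr_ge0 ler01 y0) yz; rewrite expr2; lra.
by apply: key => //; exact: expR_ge1Dx.
Qed.

End poisson_step.

(** * The one-step estimate *)

Section step_integral.
Context {R : realType}.
Local Notation S := (nat_measure R).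
Local Notation T := (mark_space R).
Local Notation leb := (@lebesgue_measure R).
Variables (alpha : R -> R) (p : R -> nat -> R) (c : R).
Hypothesis halpha : bounded_borel_nonneg alpha.
Hypothesis alpha_gt0 : forall x, 0 <= x -> 0 < alpha x.
Hypothesis hp : offspring_law p.
Hypotheses (c0 : 0 <= c) (alphac : forall y, 0 <= y -> alpha y <= c).
Variables (r r' L : R) (n Z : nat) (W : R -> R).
Hypotheses (rr' : r <= r') (cL : c * n%:R <= L).
Hypotheses (mW : measurable_fun setT W) (W01 : forall y, 0 <= W y <= 1).

Local Notation aged := (aged_value r r' W).
Local Notation branched := (branch_value r r' W).
Local Notation step := (step_value alpha p r r' Z W).
Local Notation delta := (r' - r).
Local Notation hit := (hits alpha p r r').

Let delta0 : 0 <= delta. Proof. by rewrite subr_ge0. Qed.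

Lemma aged_01 sigma : 0 <= aged sigma <= 1.
Proof. by apply: (@prod_01 _ (fun j => W (atom sigma j + delta)) _ predT) => j _; exact: W01. Qed.

Lemma branched_01 sigma m k s : 0 <= branched sigma m k s <= 1.
Proof.
have /andP[a0 a1] : 0 <= \prod_(j < mass sigma | j != m :> nat) W (atom sigma j + delta) <= 1.
  by apply: (@prod_01 _ (fun j => W (atom sigma j + delta)) _ (fun j => j != m)) => j _; exact: W01.
have /andP[b0 b1] := W01 (r' - s).
by rewrite /branch_value mulr_ge0 ?exprn_ge0//= mulr_ile1 ?exprn_ge0 ?exprn_ile1.
Qed.

Lemma step_no_hit sigma e :
  (forall m k, (m < mass sigma)%N -> (k <= Z)%N -> ~~ hit m k sigma e) ->
  step sigma e = aged sigma.
Proof.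
move=> h; rewrite /step_value big1 ?addr0// => m _; apply: big1 => k _.
by rewrite (negbTE (h _ _ _ _)) ?mul0r// -ltnS.
Qed.

(** The slots of the individuals are disjoint, so a mark makes at most one of them
    branch. *)
Lemma step_hit sigma e m k : (m < mass sigma)%N -> (k <= Z)%N -> hit m k sigma e ->
  step sigma e = branched sigma m k e.1.1.1.1.
Proof.
move=> mN kZ hmk; have [/and5P[_ _ /andP[_ sl] /eqP zk _]] : hit m k sigma e by [].
have uniq m' k' : hit m' k' sigma e -> m' = m /\ k' = k.
  move=> /and5P[_ _ /andP[_ sl'] /eqP zk' _]; split; last by rewrite -zk zk'.
  exact: (slot_uniq alpha_gt0 sl' sl).
rewrite /step_value (bigD1 (Ordinal mN))//= [X in _ + (_ + X)]big1 ?addr0; last first.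
  move=> m' m'm; apply: big1 => k' _; case: (boolP (hit _ _ _ _)) => [/uniq[e1 _]|_]; last by rewrite mul0r.
  by case/eqP: m'm; exact/val_inj.
have kZ' : (k < Z.+1)%N by [].
rewrite (bigD1 (Ordinal kZ'))//= [X in _ + (_ + X)]big1 ?addr0; last first.
  move=> k' k'k; case: (boolP (hit _ _ _ _)) => [/uniq[_ e1]|_]; last by rewrite mul0r.
  by case/eqP: k'k; exact/val_inj.
by rewrite hmk mul1r addrC subrK.
Qed.

Lemma step_01 sigma e : 0 <= step sigma e <= 1.
Proof.
have [[m [k [mN kZ h]]]|none] := pselect (exists m k, [/\ (m < mass sigma)%N, (k <= Z)%N & hit m k sigma e]).
  by rewrite (step_hit mN kZ h) branched_01.
rewrite step_no_hit ?aged_01// => m k mN kZ; apply/negP => h.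
by apply: none; exists m, k.
Qed.

Section joint_measurability.
Context d (X : measurableType d) (h : X -> S) (g : X -> T).
Hypotheses (mh : measurable_fun setT h) (mg : measurable_fun setT g).

Let mage j : measurable_fun setT (fun x => W (atom (h x) j + delta)).
Proof.
by apply: (measurableT_comp mW); apply: measurable_funD => //; exact: measurable_atom_comp.
Qed.

Let maged : measurable_fun setT (fun x => aged (h x)).
Proof.
apply: (@measurable_fun_nat_index _ _ _ _ (fun x => mass (h x))
  (fun k x => \prod_(j < k) W (atom (h x) j + delta))); first exact: measurable_mass_comp.
by move=> k; apply: measurable_prod => j _; exact: mage.
Qed.

Let mbranched m k : measurable_fun setT (fun x => branched (h x) m k (g x).1.1.1.1).
Proof.
apply: measurable_funM.
  apply: (@measurable_fun_nat_index _ _ _ _ (fun x => mass (h x))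
    (fun k x => \prod_(j < k | j != m :> nat) W (atom (h x) j + delta))); first exact: measurable_mass_comp.
  move=> i; under eq_fun do rewrite big_mkcond.
  by apply: measurable_prod => j _; case: (j != m :> nat); [exact: mage|exact: measurable_cst].
apply: measurable_funX; apply: (measurableT_comp mW); apply: measurable_funB => //.
by have [] := mark_coordinates mg.
Qed.

Lemma measurable_step_comp : measurable_fun setT (fun x => step (h x) (g x)).
Proof.
apply: measurable_funD => //.
apply: (@measurable_fun_nat_index _ _ _ _ (fun x => mass (h x)) (fun i x => \sum_(m < i) \sum_(k < Z.+1)
    (hit m k (h x) (g x))%:R * (branched (h x) m k (g x).1.1.1.1 - aged (h x)))); first exact: measurable_mass_comp.
move=> i; apply: measurable_sum => m; apply: measurable_sum => k; apply: measurable_funM.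
  by apply: measurable_bool_indic; exact: measurable_hits.
by apply: measurable_funB; [exact: mbranched|exact: maged].
Qed.

End joint_measurability.

Variable sigma : S.
Hypothesis mass_n : (mass sigma <= n)%N.

Let L0 : 0 <= L. Proof. by apply: le_trans cL; exact: mulr_ge0. Qed.

Let rate (m k : nat) (s : R) : R := alpha (atom sigma m + (s - r)) * p (atom sigma m + (s - r)) k.

Let rate_ge0 m k s : r < s -> 0 <= rate m k s.
Proof.
have [_ _ a0] := halpha; move=> rs; have h : 0 <= atom sigma m + (s - r) by rewrite addr_ge0 ?atom_ge0// subr_ge0 ltW.
by apply: mulr_ge0; [exact: a0|exact: offspring_ge0].
Qed.

Let measurable_rate_oc m k (psi : R -> R) : measurable_fun setT psi ->
  measurable_fun (`]r, r'] : set R) (fun s => psi s * rate m k s).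
Proof.
move=> mpsi; have [ma _ _] := halpha.
apply: (@eq_measurable_fun _ _ _ _ _ (fun s => psi s * (alpha `|atom sigma m + (s - r)| * p `|atom sigma m + (s - r)| k))).
  move=> s; rewrite inE/= in_itv/= => /andP[rs _]; rewrite /rate ger0_norm// addr_ge0 ?atom_ge0//.
  by rewrite subr_ge0 ltW.
have mq : measurable_fun setT (fun s : R => atom sigma m + (s - r)).
  by apply: measurable_funD => //; exact: measurable_funB.
apply: measurable_funTS; apply: measurable_funM => //; apply: measurable_funM.
  exact: (measurableT_comp (measurable_fun_nonneg_norm ma)).
exact: (measurableT_comp (measurable_offspring hp k)).
Qed.

Lemma hit_in_box m k e : (k <= Z)%N -> hit m k sigma e -> box r r' L Z e.
Proof.
move: e => [[[[s u] y] z] v] kZ /and5P[/= /andP[h1 h1'] /andP[h2 h2'] /andP[/andP[h3 h3'] sl] /eqP -> /andP[h5 h5']].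
do 4?split => //=; rewrite in_itv/=; apply/andP; split => //.
  apply: le_trans cL; apply: le_trans h2' _; apply: (rate_le halpha alphac c0).
  by rewrite flow_shift ?(ltW h1)// mass_age_shift// subr_ge0 ltW.
apply: le_trans h5' _; apply: (offspring_le1 hp); exact: normr_ge0.
Qed.

Let measurable_shifted (psi : nat -> nat -> R -> R) m :
  (forall m k, measurable_fun setT (psi m k)) -> forall k,
  measurable_fun (`]0, delta] : set R) (fun q => psi m k (r + q) * rate m k (r + q)).
Proof.
move=> mpsi k.
apply: (@measurable_comp _ _ _ _ _ _ `]r, r']%classic (fun s : R => psi m k s * rate m k s)
  `]0, delta]%classic (fun q : R => r + q)) => //; last 2 first.
- exact: measurable_rate_oc.
- by apply: measurable_funTS; exact: measurable_funD.
by move=> _ /= [q] + <-; rewrite /= !in_itv/=; lra.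
Qed.

Let integrable_hits (psi : nat -> nat -> R -> R) m :
  (forall m k, measurable_fun setT (psi m k)) -> (forall m k s, 0 <= psi m k s <= 1) ->
  leb.-integrable `]0, delta]
    (EFin \o (fun q => \sum_(k < Z.+1) psi m k (r + q) * rate m k (r + q))).
Proof.
move=> mpsi psi01; have psi0 m' k s : 0 <= psi m' k s by have /andP[] := psi01 m' k s.
apply: (@integrable_oc _ _ _ c); first by apply: measurable_sum => k; exact: measurable_shifted.
move=> q /andP[q0 _]; have rq : r < r + q by rewrite ltrDl.
have aq : 0 <= atom sigma m + (r + q - r) by rewrite addr_ge0 ?atom_ge0// subr_ge0 ltW.
have [_ _ a0] := halpha.
rewrite ger0_norm; last by rewrite sumr_ge0// => k _; rewrite mulr_ge0// rate_ge0.
apply: (@le_trans _ _ (\sum_(k < Z.+1) rate m k (r + q))).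
  by apply: ler_sum => k _; have /andP[_ h] := psi01 m k (r + q); rewrite ler_piMl// rate_ge0.
rewrite -mulr_sumr -[leRHS]mulr1; apply: ler_pM => //; [exact: a0|..|exact: alphac|].
  by rewrite sumr_ge0// => k _; exact: offspring_ge0.
exact: offspring_partial_le1.
Qed.

(** Termwise by [integral_hits], after the translation of the time interval to the
    origin. *)
Let hits_integral (psi : nat -> nat -> R -> R) :
  (forall m k, measurable_fun setT (psi m k)) -> (forall m k s, 0 <= psi m k s <= 1) ->
  (\int[mark_intensity]_(e in box r r' L Z)
     (\sum_(m < mass sigma) \sum_(k < Z.+1) (hit m k sigma e)%:R * psi m k e.1.1.1.1)%:E =
   (\sum_(m < mass sigma) \int[leb]_(q in `]0, delta]) \sum_(k < Z.+1) psi m k (r + q) * rate m k (r + q))%:E)%E.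
Proof.
move=> mpsi psi01.
have psi0 m k s : 0 <= psi m k s by have /andP[] := psi01 m k s.
have mB := measurable_box r r' L Z.
have [ms _ _ _ _] := @mark_coordinates R _ T id (@measurable_id _ _ _).
have mh m k : measurable_fun setT (fun e : T => (hit m k sigma e)%:R * psi m k e.1.1.1.1).
  apply: measurable_funM; last exact: (measurableT_comp (mpsi m k)).
  by apply: measurable_bool_indic; apply: (@measurable_hits _ alpha p halpha hp _ T (fun=> sigma) id).
have h0 m k e : 0 <= (hit m k sigma e)%:R * psi m k e.1.1.1.1 by rewrite mulr_ge0.
under eq_integral do rewrite -sumEFin.
rewrite ge0_integral_sum//; last 2 first.
- move=> m; apply/measurable_EFinP; apply: measurable_funTS; apply: measurable_sum => k; exact: mh.
- by move=> m e _; rewrite lee_fin sumr_ge0.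
rewrite -sumEFin; apply: eq_bigr => m _.
under eq_integral do rewrite -sumEFin.
rewrite ge0_integral_sum//; last 2 first.
- by move=> k; apply/measurable_EFinP; apply: measurable_funTS; exact: mh.
- by move=> k e _; rewrite lee_fin.
transitivity (\sum_(k < Z.+1) \int[leb]_(q in `]0%R, delta]) (psi m k (r + q) * rate m k (r + q))%:E)%E.
  apply: eq_bigr => k _.
  transitivity (\int[mark_intensity]_e (psi m k e.1.1.1.1 * (hit m k sigma e)%:R)%:E)%E.
    rewrite integral_mkcond; apply: eq_integral => e _; rewrite patchE; case: ifPn => he.
      by rewrite mulrC.
    case: (boolP (hit _ _ _ _)) => [hh|_]; last by rewrite mulr0.
    by case/negP: he; apply/mem_set; apply: hit_in_box hh; rewrite -ltnS.
  rewrite (integral_hits halpha alpha_gt0 hp)//.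
  have := @ge0_integral_translation R r 0 delta (fun s => (psi m k s * rate m k s)%:E).
  rewrite addr0 subrKC => ->//.
    by apply/measurable_EFinP; exact: measurable_rate_oc.
  by move=> s /andP[rs _]; rewrite lee_fin; apply: mulr_ge0 => //; exact: rate_ge0.
have mr := measurable_shifted m mpsi.
rewrite -ge0_integral_sum//; last 2 first.
- by move=> k; apply/measurable_EFinP; exact: mr.
- move=> k q; rewrite /= in_itv/= => /andP[q0 _]; rewrite lee_fin; apply: mulr_ge0 => //.
  by apply: rate_ge0; rewrite ltrDl.
under eq_integral do rewrite sumEFin.
by rewrite /Rintegral fineK//; apply: integrable_fin_num => //; exact: integrable_hits.
Qed.

(** The part of the expected value after the step that comes from branchings. *)
Definition mean_gain : R := \sum_(m < mass sigma) \int[leb]_(q in `]0, delta])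
  \sum_(k < Z.+1) (branched sigma m k (r + q) - aged sigma) * rate m k (r + q).

(** [step_value] is a difference of two nonnegative terms with finite integrals. *)
Lemma integral_step : (\int[mark_intensity]_(e in box r r' L Z) (step sigma e)%:E =
  (aged sigma * (delta * L * Z.+1%:R) + mean_gain)%:E)%E.
Proof.
have mB := measurable_box r r' L Z.
have [ms _ _ _ _] := @mark_coordinates R _ T id (@measurable_id _ _ _).
have [/andP[g0 g1] gb] := (aged_01 sigma, branched_01 sigma).
have mb m k : measurable_fun setT (branched sigma m k).
  apply: measurable_funM => //; apply: measurable_funX; apply: (measurableT_comp mW).
  exact: measurable_funB.
have mg (m k : nat) : measurable_fun setT (fun _ : R => aged sigma) by exact: measurable_cst.
have g01 (m k : nat) (s : R) : 0 <= aged sigma <= 1 by exact: aged_01.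
have mterm (psi : nat -> nat -> R -> R) : (forall m k, measurable_fun setT (psi m k)) ->
    measurable_fun (box r r' L Z) (fun e => (\sum_(m < mass sigma) \sum_(k < Z.+1)
      (hit m k sigma e)%:R * psi m k e.1.1.1.1)%:E).
  move=> mpsi; apply/measurable_EFinP; apply: measurable_funTS.
  apply: measurable_sum => m; apply: measurable_sum => k.
  apply: measurable_funM; last exact: (measurableT_comp (mpsi m k)).
  by apply: measurable_bool_indic; apply: (@measurable_hits _ alpha p halpha hp _ T (fun=> sigma) id).
have term0 (psi : nat -> nat -> R -> R) e : (forall m k s, 0 <= psi m k s) ->
    0 <= \sum_(m < mass sigma) \sum_(k < Z.+1) (hit m k sigma e)%:R * psi m k e.1.1.1.1.
  by move=> psi0; do 2!apply: sumr_ge0 => ? _; rewrite mulr_ge0.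
have b0 m k s : 0 <= branched sigma m k s by have /andP[] := gb m k s.
have IB := hits_integral mb gb; have IA := hits_integral mg g01.
set PB := (\sum_(m < mass sigma) _)%:E in IB; set PA := (\sum_(m < mass sigma) _)%:E in IA.
have mstep : measurable_fun (box r r' L Z) (fun e => (step sigma e)%:E).
  apply/measurable_EFinP; apply: measurable_funTS.
  exact: (@measurable_step_comp _ _ (fun=> sigma) id).
have sum : (\int[mark_intensity]_(e in box r r' L Z) (step sigma e)%:E + PA =
    (aged sigma * (delta * L * Z.+1%:R))%:E + PB)%E.
  rewrite -IA -IB EFinM -(box_intensity Z rr' L0) -integral_cst// -!ge0_integralD//.
  all: try by [exact: (mterm _ mb)|exact: (mterm _ mg)].
  all: try by move=> e _; rewrite lee_fin; first [exact: (term0 (branched sigma) e b0)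
    |exact: (term0 (fun _ _ _ => aged sigma) e (fun _ _ _ => g0))|case/andP: (step_01 sigma e)].
  apply: eq_integral => e _; rewrite /= -!EFinD; congr (_%:E).
  rewrite /step_value -addrA; congr (_ + _); rewrite -big_split/=; apply: eq_bigr => m _.
  by rewrite -big_split/=; apply: eq_bigr => k _; rewrite mulrBr subrK.
have key (I : \bar R) (x a b : R) : (I + a%:E = x%:E + b%:E -> I = (x + (b - a))%:E)%E.
  by case: I => [y| |] //=; rewrite -!EFinD => -[e]; congr EFin; rewrite addrA -e addrK.
rewrite /PA /PB in sum; rewrite (key _ _ _ _ sum); congr ((_ + _)%:E).
rewrite -sumrB; apply: eq_bigr => m _; rewrite -RintegralB//; last 2 first.
- exact: (integrable_hits m mb gb).
- exact: (integrable_hits m mg g01).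
by apply: eq_Rintegral => q _; rewrite -sumrB; apply: eq_bigr => k _; rewrite mulrBl.
Qed.

End step_integral.

Section step_error.
Context {R : realType}.
Local Notation S := (nat_measure R).
Local Notation leb := (@lebesgue_measure R).
Variables (alpha : R -> R) (p : R -> nat -> R) (c : R).
Hypotheses (halpha : bounded_borel_nonneg alpha) (hp : offspring_law p).
Hypotheses (c0 : 0 < c) (alphac : forall x, 0 <= x -> alpha x <= c).
Local Notation survival := (survival halpha hp c0 alphac).
Local Notation cumulant := (cumulant halpha hp c0 alphac).
Variable f : R -> R.
Hypothesis hf : bounded_borel_nonneg f.
Variables (t r r' L mean : R) (n Z : nat).
Hypotheses (t0 : 0 <= t) (rr' : r <= r') (mean0 : 0 <= mean) (L0 : 0 <= L).
Hypothesis hmean : forall x, 0 <= x -> forall n, \sum_(i < n) i%:R * p x i <= mean.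
Local Notation delta := (r' - r).

(** The value at the end of the step of an individual of age [y]; the absolute value
    makes it measurable on the whole line. *)
Definition value_weight (y : R) : R := expR (- cumulant f t `|y|).

Lemma value_weightE y : 0 <= y -> value_weight y = survival f t y.
Proof. by move=> y0; rewrite /value_weight ger0_norm// (expR_cumulant halpha hp c0 alphac hf t0 y0). Qed.

Lemma value_weight_01 y : 0 <= value_weight y <= 1.
Proof.
rewrite /value_weight (expR_cumulant halpha hp c0 alphac hf t0 (normr_ge0 y)).
exact: survival_01.
Qed.

Lemma measurable_value_weight : measurable_fun setT value_weight.
Proof.
have [mc _ _] := cumulant_borel halpha hp c0 alphac hf t0.
by apply: measurableT_comp => //; apply: measurableT_comp => //; exact: (measurable_fun_nonneg_norm mc).
Qed.

Let delta0 : 0 <= delta. Proof. by rewrite subr_ge0. Qed.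

Lemma laplace_cumulant u sigma : 0 <= u ->
  laplace (cumulant f u) sigma = \prod_(m < mass sigma) survival f u (atom sigma m).
Proof.
move=> u0; have [mc _ _] := cumulant_borel halpha hp c0 alphac hf u0.
rewrite /laplace (pairingE _ mc) -sumrN expR_sum; apply: eq_bigr => m _.
exact: (expR_cumulant halpha hp c0 alphac hf u0 (atom_ge0 _ _)).
Qed.

Lemma aged_valueE sigma : aged_value r r' value_weight sigma =
  \prod_(m < mass sigma) survival f t (atom sigma m + delta).
Proof. by apply: eq_bigr => m _; rewrite value_weightE// addr_ge0// atom_ge0. Qed.

Lemma branch_gainE sigma (m : 'I_(mass sigma)) q : 0 < q <= delta ->
  \sum_(k < Z.+1) (branch_value r r' value_weight sigma m k (r + q) -
    aged_value r r' value_weight sigma) *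
      (alpha (atom sigma m + (r + q - r)) * p (atom sigma m + (r + q - r)) k) =
  branch_gain halpha hp c0 alphac f t delta sigma Z m q.
Proof.
move=> /andP[q0 qd].
set G := \prod_(j < mass sigma | j != m) survival f t (atom sigma j + delta).
set w := survival f t (delta - q); set v := survival f t (atom sigma m + delta).
transitivity (\sum_(k < Z.+1) (G * w ^+ k - v * G) * (alpha (atom sigma m + q) * p (atom sigma m + q) k)).
  apply: eq_bigr => k _; rewrite /branch_value.
  rewrite (_ : r + q - r = q); last by ring.
  rewrite (_ : r' - (r + q) = delta - q); last by ring.
  rewrite aged_valueE [X in _ - X](bigD1 m)//=.
  rewrite value_weightE ?subr_ge0//; congr ((_ * _ - _) * _).
  by apply: eq_bigr => j _; rewrite value_weightE// addr_ge0// atom_ge0.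
rewrite /branch_gain /pgf_trunc (mulr_sumr _ _ _ v) -sumrB !mulr_sumr; apply: eq_bigr => k _.
by rewrite expr1n -/w -/v -/G; ring.
Qed.

Lemma mean_gainE sigma : mean_gain alpha p r r' Z value_weight sigma =
  \sum_(m < mass sigma) \int[leb]_(q in `]0, delta])
    branch_gain halpha hp c0 alphac f t delta sigma Z m q.
Proof.
apply: eq_bigr => m _; apply: eq_Rintegral => q; rewrite inE/= in_itv/= => qd.
exact: branch_gainE.
Qed.

Let lambda := delta * L * Z.+1%:R.

(** The first two terms come from replacing [expR (- lambda)] by its first-order
    expansion, the others from [one_step_value]. *)
Definition step_error : R := lambda ^+ 2 + lambda * (n%:R * (c * delta)) + ((n%:R * (c * delta)) ^+ 2 +
  n%:R * (c * ((mean + 1) * (c * delta) + 2 * (mean / Z.+1%:R)) * delta)).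

(** [expR (- lambda) * (1 + lambda)] is 1 up to [lambda ^+ 2], and the remaining terms
    are those of [one_step_value]. *)
Lemma step_value_error sigma : (mass sigma <= n)%N ->
  `|expR (- lambda) * (aged_value r r' value_weight sigma * (1 + lambda) +
      mean_gain alpha p r r' Z value_weight sigma) -
    laplace (cumulant f (delta + t)) sigma| <= step_error.
Proof.
move=> Nn; have dt0 : 0 <= delta + t by exact: addr_ge0.
have l0 : 0 <= lambda by rewrite /lambda !mulr_ge0.
have cd0 : 0 <= c * delta by rewrite mulr_ge0// ltW.
have e1 := one_step_value halpha hp c0 alphac hf t0 delta0 mean0 hmean Z Nn.
rewrite (laplace_cumulant sigma dt0) mean_gainE aged_valueE.
have gain_le : `|\sum_(m < mass sigma) \int[leb]_(q in `]0, delta])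
    branch_gain halpha hp c0 alphac f t delta sigma Z m q| <= n%:R * (c * delta).
  apply: le_trans (ler_norm_sum _ _ _) _.
  apply: (@le_trans _ _ (\sum_(m < mass sigma) c * delta)).
    apply: ler_sum => m _; apply: norm_Rintegral_oc => //; first exact: measurable_branch_gain.
    by move=> q /andP[q0 _]; exact: branch_gain_bound.
  by rewrite sumr_const card_ord -[leLHS]mulr_natl ler_wpM2r// ler_nat.
have /andP[g0 g1] : 0 <= \prod_(m < mass sigma) survival f t (atom sigma m + delta) <= 1.
  by apply: (@prod_01 _ (fun j => survival f t (atom sigma j + delta)) _ predT) => j _; exact: survival_01.
move: e1 gain_le g0 g1; rewrite /step_error.
set E := (X in _ <= X -> _); set g := \prod_(m < _) survival f t _; set G := \sum_(m < _) _.
set h := \prod_(m < _) survival f _ _; set B := n%:R * (c * delta).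
have x1 : 1 - lambda <= expR (- lambda) by exact: expR_ge1Dx.
have x2 : expR (- lambda) <= 1 by rewrite expR_le1 oppr_le0.
have x3 : expR (- lambda) * (1 + lambda) <= 1.
  rewrite -[leRHS](expR0 R) -(addNr lambda) expRD.
  by rewrite ler_wpM2l ?expR_ge0// expR_ge1Dx.
move: (expR (- lambda)) x1 x2 x3 => y y1 y2 y3 e1 GB g0 g1.
have y4 : 1 - lambda ^+ 2 <= y * (1 + lambda).
  by have := ler_wpM2r (addr_ge0 ler01 l0) y1; rewrite expr2; lra.
rewrite (_ : _ - h = g * (y * (1 + lambda) - 1) + (y - 1) * G + - (h - g - G)); last by ring.
apply: le_trans (ler_normD _ _) _; apply: lerD; last by rewrite normrN.
apply: le_trans (ler_normD _ _) _; apply: lerD.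
  rewrite normrM -[leRHS]mul1r; apply: ler_pM => //; first by rewrite ger0_norm.
  by rewrite ler_norml; apply/andP; split; have := sqr_ge0 lambda; lra.
rewrite normrM; apply: ler_pM => //.
by rewrite ler_norml; apply/andP; split; lra.
Qed.

End step_error.

Section bounded_expectations.
Context {R : realType} d (Omega : measurableType d) (P : probability Omega R).
Implicit Types f g h : Omega -> R.

Lemma probability_integrable f (C : R) : measurable_fun setT f -> (forall w, `|f w| <= C) ->
  P.-integrable setT (EFin \o f).
Proof. by move=> mf fC; exact: (@bounded_integrable _ _ _ P C). Qed.

Lemma expectation_gap f g h (C : R) : measurable_fun setT f -> measurable_fun setT g ->
  measurable_fun setT h -> (forall w, `|f w| <= C) -> (forall w, `|g w| <= C) ->
  (forall w, `|h w| <= C) ->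
  (forall w, `|f w - g w| <= h w) ->
  `|(\int[P]_w f w) - (\int[P]_w g w)| <= \int[P]_w h w.
Proof.
move=> mf mg mh bf bg bh fgh.
have i1 := probability_integrable mf bf; have i2 := probability_integrable mg bg.
have i3 := probability_integrable mh bh.
have m4 : measurable_fun setT (fun w => f w - g w) by exact: measurable_funB.
have i4 : P.-integrable setT (EFin \o (fun w => f w - g w)).
  apply: (@probability_integrable _ (C + C)) => // w.
  by apply: le_trans (ler_normB _ _) _; exact: lerD.
rewrite -RintegralB//; apply: le_trans (le_normr_Rintegral measurableT i4) _.
have i5 : P.-integrable setT (EFin \o (fun w => `|f w - g w|)).
  apply: (@probability_integrable _ (C + C)) => [|w]; first exact: measurableT_comp.
  by rewrite normr_id; apply: le_trans (ler_normB _ _) _; exact: lerD.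
by apply: le_Rintegral => // w _; exact: fgh.
Qed.

Lemma Rintegral_indic A : measurable A -> \int[P]_w (\1_A w : R) = fine (P A).
Proof. by move=> mA; rewrite /Rintegral integral_indic// setIT. Qed.

End bounded_expectations.

Section one_step_expectation.
Context {R : realType} {d : measure_display} {Omega : measurableType d}.
Local Notation S := (nat_measure R).
Local Notation T := (mark_space R).
Variables (P : probability Omega R) (F : R -> set (set Omega)) (M : R.-ker Omega ~> T).
Hypothesis hF : usual_filtration P F.
Hypothesis hM : adapted_poisson_random_measure P F M.
Variables (alpha : R -> R) (p : R -> nat -> R) (X : R -> Omega -> S) (c : R).
Hypothesis halpha : bounded_borel_nonneg alpha.
Hypothesis alpha_gt0 : forall x, 0 <= x -> 0 < alpha x.
Hypothesis hp : offspring_law p.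
Hypotheses (c0 : 0 < c) (alphac : forall x, 0 <= x -> alpha x <= c).
Hypothesis sol : stochastic_equation_solution P F M alpha p X.
Local Notation cumulant := (cumulant halpha hp c0 alphac).
Variable f : R -> R.
Hypothesis hf : bounded_borel_nonneg f.
Variables (t r r' mean : R) (n Z : nat).
Hypotheses (t0 : 0 <= t) (r0 : 0 <= r) (rr' : r <= r') (mean0 : 0 <= mean) (nZ : (n.+1 < Z)%N).
Hypothesis hmean : forall x, 0 <= x -> forall n, \sum_(i < n) i%:R * p x i <= mean.
Local Notation delta := (r' - r).
Let L := c * n%:R.
Let lambda := delta * L * Z.+1%:R.

Lemma measurable_solution s : 0 <= s -> measurable_fun setT (X s).
Proof.
move=> s0 _ V mV; rewrite setTI; apply: (filtration_measurable hF s0).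
by have [ad _] := sol; exact: ad.
Qed.

Let L0 : 0 <= L. Proof. by rewrite /L mulr_ge0// ltW. Qed.
Let r'0 : 0 <= r'. Proof. exact: le_trans rr'. Qed.
Let delta0 : 0 <= delta. Proof. by rewrite subr_ge0. Qed.
Let lambda0 : 0 <= lambda. Proof. by apply: mulr_ge0 => //; exact: mulr_ge0. Qed.
Local Notation B := (box r r' L Z).
Local Notation error := (step_error c r r' L mean n Z).

Lemma step_error_ge0 : 0 <= error.
Proof.
have cd0 : 0 <= c * delta by rewrite mulr_ge0// ltW.
have m0 : 0 <= mean / Z.+1%:R by rewrite divr_ge0.
have nc0 : 0 <= n%:R * (c * delta) by exact: mulr_ge0.
apply: addr_ge0; first by apply: addr_ge0; [exact: sqr_ge0|exact: (mulr_ge0 lambda0 nc0)].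
apply: addr_ge0; first exact: sqr_ge0.
apply: mulr_ge0 => //; apply: mulr_ge0 => //; apply: mulr_ge0; first exact: ltW.
by apply: addr_ge0; apply: mulr_ge0 => //; exact: addr_ge0.
Qed.

Let hB : finite_mark_sets B. Proof. exact: finite_box. Qed.
Let mB : measurable B. Proof. exact: measurable_box. Qed.

Let B_future : B `<=` [set e | r < e.1.1.1.1].
Proof. by move=> [[[[s u] y] z] v] [[[[h _] _] _] _]; move: h; rewrite /= in_itv => /andP[]. Qed.

Let lE : fine (mark_intensity B) = lambda. Proof. by rewrite box_intensity. Qed.

(** Almost surely the points in all the boxes can be counted, and none lies on the
    edge [y = 1]. *)
Let good (w : Omega) := [/\ cadlag (X ^~ w), solves_equation M alpha p (X ^~ w) w,
  forall K E, measurable E -> @natural R (M w (E `&` box r r' L K)) &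
  M w ([set e | e.1.1.2 = 1] `&` B) = 0%E].

Let ae_good : {ae P, forall w, good w}.
Proof.
have [_ h1] := sol.
have h2 := ae_foralln (fun K => prm_counting hM (finite_box K r0 rr' L0)).
have mE : measurable ([set e : T | e.1.1.2 = 1] `&` B).
  apply: measurableI => //; have [_ _ my _ _] := @mark_coordinates R _ T id (@measurable_id _ _ _).
  by rewrite -[X in measurable X]setTI; exact: (my measurableT [set 1]).
have fE : finite_mark_sets ([set e : T | e.1.1.2 = 1] `&` B).
  by split; [split => // e [_ /(box_domain r0)]|rewrite box_edge_null ltry].
have h3 : {ae P, forall w, M w ([set e | e.1.1.2 = 1] `&` B) = 0%E}.
  have mN : measurable [set w | M w ([set e | e.1.1.2 = 1] `&` B) = 0%E] by exact: measurable_prm_eq.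
  have P1 : P [set w | M w ([set e | e.1.1.2 = 1] `&` B) = 0%E] = 1%E.
    apply: (eq_trans (prm_poisson hM 0 fE)).
    by rewrite box_edge_null /= oppr0 expR0 expr0 divr1 mul1r.
  exists (~` [set w | M w ([set e | e.1.1.2 = 1] `&` B) = 0%E]); split => //.
  - exact: measurableC.
  - by rewrite probability_setC// P1 subee.
move: h1 h2 h3; apply: filterS3 => w [g1 g2] g3 g4; split => // K E; exact: g3.
Qed.

Variables A A' : set Omega.
Hypotheses (FA : F r A) (mA' : measurable A') (A'A : A' `<=` A).
Hypothesis A_mass : forall w, A w -> (mass (X r w) <= n)%N.
Hypothesis A'_mass : forall w q, A' w -> r <= q <= r' -> (mass (X q w) <= n)%N.

Local Notation W := (value_weight halpha hp c0 alphac f t).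
Local Notation step := (step_value alpha p r r' Z W).
(** A mark at the time [r] itself lies outside the box and hits nobody. *)
Let e0 : T := ((((r, 0), 0), 0%N), 0).
Local Notation drawn := (@first_point R d Omega P F M hF r A B e0 r0 FA hB).
Local Notation frozen := (@frozen_point R d Omega P F hF r A B e0 r0 FA hB).

Let psi (z : S * T) : \bar R := (step z.1 z.2)%:E.

Let mW := measurable_value_weight halpha hp c0 alphac hf t0.
Let W01 := value_weight_01 halpha hp c0 alphac hf t0.

Let psi_01 z : (0 <= psi z <= 1)%E.
Proof. by rewrite !lee_fin; exact: step_01. Qed.

Let mpsi : measurable_fun setT psi.
Proof.
apply/measurable_EFinP.
exact: (@measurable_step_comp _ _ _ halpha hp _ _ _ _ mW _ _ fst snd).
Qed.

Let average (K : R.-spker Omega ~> T) (w : Omega) : R := fine (\int[K w]_e psi (X r w, e))%E.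

Let mpsi_at w : measurable_fun setT (fun e => psi (X r w, e)).
Proof. by apply: (measurableT_comp mpsi); exact: pair1_measurable. Qed.

Let average_itv (K : R.-spker Omega ~> T) w : (0 <= \int[K w]_e psi (X r w, e) <= 1)%E.
Proof.
apply/andP; split; first by apply: integral_ge0 => e _; case/andP: (psi_01 (X r w, e)).
apply: (@le_trans _ _ (\int[K w]_e 1)%E).
  apply: ge0_le_integral => //; first by move=> e _; case/andP: (psi_01 (X r w, e)).
  by move=> e _; case/andP: (psi_01 (X r w, e)).
by rewrite integral_cst// mul1e sprob_kernel_le1.
Qed.

Let averageK (K : R.-spker Omega ~> T) w : ((average K w)%:E = \int[K w]_e psi (X r w, e))%E.
Proof.
have /andP[a b] := average_itv K w; rewrite /average fineK// ge0_fin_numE//.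
by apply: le_lt_trans b _; rewrite ltry.
Qed.

Let average_01 (K : R.-spker Omega ~> T) w : 0 <= average K w <= 1.
Proof. by rewrite -!lee_fin averageK average_itv. Qed.

Let maverage (K : R.-spker Omega ~> T) : measurable_fun setT (average K).
Proof.
apply: measurableT_comp => //.
apply: (measurable_fun_integral_sfinite_kernel (fun z : Omega * T => psi (X r z.1, z.2)) K).
  by move=> z; case/andP: (psi_01 (X r z.1, z.2)).
apply: (measurableT_comp mpsi); apply: measurable_fun_pair; last exact: measurable_snd.
by apply: (measurableT_comp (measurable_solution r0)); exact: measurable_fst.
Qed.

Let norm_01 (x : R) : 0 <= x <= 1 -> `|x| <= 1.
Proof. by move=> /andP[x0 x1]; rewrite ger0_norm. Qed.

Let average_frozen : \int[P]_w average drawn w = \int[P]_w average frozen w.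
Proof.
congr fine; under eq_integral do rewrite averageK.
under [in RHS]eq_integral do rewrite averageK.
apply: (frozen_campbell hF hM e0 r0 FA _ hB B_future (measurable_solution r0)) => //.
- by move=> V mV; have [ad _] := sol; exact: ad.
- by move=> z; case/andP: (psi_01 z).
Qed.

Let step_e0 sigma : step sigma e0 = aged_value r r' W sigma.
Proof. by apply: step_no_hit => m k _ _; rewrite /hits/= ltxx. Qed.

Let frozen_value w : A w -> average frozen w =
  expR (- lambda) * (aged_value r r' W (X r w) * (1 + lambda) + mean_gain alpha p r r' Z W (X r w)).
Proof.
move=> Aw; apply: EFin_inj; rewrite averageK.
rewrite (frozen_point_integral hF e0 r0 FA hB Aw)//; last by move=> e; case/andP: (psi_01 (X r w, e)).
rewrite lE /psi /= (integral_step halpha alpha_gt0 hp (ltW c0) alphac Z rr' (lexx L) mW W01 (A_mass Aw)).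
by rewrite step_e0 -EFinD -EFinM; congr (_%:E); rewrite -/lambda; ring.
Qed.

Let value_next w := laplace (cumulant f t) (X r' w).
Let value_now w := laplace (cumulant f (delta + t)) (X r w).

Let laplace_01 u w s : 0 <= u -> 0 <= laplace (cumulant f u) (X s w) <= 1.
Proof.
move=> u0; rewrite (ltW (laplace_gt0 _ _)) /=; apply: laplace_le1.
exact: (cumulant_borel halpha hp c0 alphac hf u0).
Qed.

Let measurable_value u s : 0 <= u -> 0 <= s -> measurable_fun setT (fun w => laplace (cumulant f u) (X s w)).
Proof.
move=> u0 s0; have [mc _ _] := cumulant_borel halpha hp c0 alphac hf u0.
exact: (measurableT_comp (measurable_laplace mc) (measurable_solution s0)).
Qed.

(** [no_point_value] and [one_point_value], depending on the number of points in the
    box. *)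
Let drawn_value w : good w -> A' w -> (M w B = 0%E \/ M w B = 1%E) ->
  value_next w = average drawn w.
Proof.
move=> [cx eqn nat edge] Aw hM01; have Aw' := A'A Aw.
have hc := cumulant_borel halpha hp c0 alphac hf t0.
have ml : forall q, r <= q <= r' -> (mass (X q w) <= n)%N by move=> q; exact: A'_mass.
apply: EFin_inj; rewrite averageK; case: hM01 => hMB.
  have few : (M w B <= 1)%E by rewrite hMB.
  rewrite (first_point_none hF e0 r0 FA hB Aw' hMB (mpsi_at w)) /psi /= step_e0.
  congr (_%:E).
  exact: (no_point_value halpha alpha_gt0 hp cx eqn r0 rr' (ltW c0) nZ ml alphac (lexx L) nat few hc hMB).
have few : (M w B <= 1)%E by rewrite hMB.
rewrite (first_point_one hF e0 r0 FA hB Aw' hMB (mpsi_at w)) /psi /=.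
exact: (one_point_value halpha alpha_gt0 hp cx eqn r0 rr' (ltW c0) nZ ml alphac (lexx L) nat few hc hMB edge).
Qed.

(** Outside an event of probability at most [lambda ^+ 2] the box has at most one
    point, which can be averaged by [frozen_campbell]; the part of [A] on which the
    population exceeds the bound during the step is simply lost. *)
Lemma one_step_expectation :
  `|(\int[P]_w (\1_A' w * value_next w)) - (\int[P]_w (\1_A w * value_now w))| <=
  fine (P (A `\` A')) + (lambda ^+ 2 + error).
Proof.
have dt0 : 0 <= delta + t by exact: addr_ge0.
have mA : measurable A by exact: (filtration_measurable hF r0).
have [N1 [mN1 PN1 sub1]] := ae_good.
pose many := ~` ([set w | M w B = 0%E] `|` [set w | M w B = 1%E]).
have m_many : measurable many.
  by apply: measurableC; apply: measurableU; exact: measurable_prm_eq.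
(* Adding the exceptional null set makes the comparison below hold pointwise. *)
pose bad := many `|` N1.
have mbad : measurable bad by exact: measurableU.
have Pbad : fine (P bad) <= lambda ^+ 2.
  have := prob_many hM hB; rewrite lE -/many => h.
  have : (P bad <= (lambda ^+ 2)%:E)%E.
    by apply: le_trans (measureU2 _ _ _) _ => //; rewrite [X in (_ + X)%E]PN1 adde0.
  by move=> h'; rewrite -lee_fin fineK// fin_num_measure.
have m1 : measurable_fun setT (fun w => \1_A' w * value_next w).
  by apply: measurable_funM; [exact: measurable_indic|exact: measurable_value].
have m2 : measurable_fun setT (fun w => \1_A w * value_now w).
  by apply: measurable_funM; [exact: measurable_indic|exact: measurable_value].
have i01 (E : set Omega) w : 0 <= (\1_E w : R) <= 1 by rewrite indicE; case: (_ \in _); rewrite ?lexx ?ler01.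
have b1 w : 0 <= \1_A' w * value_next w <= 1.
  have /andP[a0 a1] := i01 A' w; have /andP[l0 l1] := laplace_01 w r' t0.
  by rewrite mulr_ge0//= mulr_ile1.
have b2 w : 0 <= \1_A w * value_now w <= 1.
  have /andP[a0 a1] := i01 A w; have /andP[l0 l1] := laplace_01 w r dt0.
  by rewrite mulr_ge0//= mulr_ile1.
have mD : measurable (A `\` A') by exact: measurableD.
have g1 : `|(\int[P]_w (\1_A' w * value_next w)) - (\int[P]_w average drawn w)| <=
    \int[P]_w (\1_(A `\` A') w + \1_bad w).
  apply: (@expectation_gap _ _ _ _ _ _ _ 2); [exact: m1|exact: maverage| | | | |].
  - by apply: measurable_funD; exact: measurable_indic.
  - by move=> w; apply: le_trans (norm_01 (b1 w)) _; lra.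
  - by move=> w; apply: le_trans (norm_01 (average_01 _ w)) _; lra.
  - move=> w; apply: le_trans (ler_normD _ _) _; have := norm_01 (i01 (A `\` A') w).
    by have := norm_01 (i01 bad w); lra.
  move=> w; have /andP[x0 x1] := b1 w; have /andP[y0 y1] := average_01 drawn w.
  have /andP[u0 u1] := i01 (A `\` A') w; have /andP[v0 v1] := i01 bad w.
  have [wb|nb] := pselect (bad w).
    by rewrite [\1_bad w]indicE mem_set//= ler_norml; lra.
  have gw : good w by apply: contrapT => h; apply: nb; right; exact: sub1.
  have fw : M w B = 0%E \/ M w B = 1%E.
    by apply: contrapT => h; apply: nb; left => -[h'|h']; apply: h; [left|right].
  have [wA'|nA'] := pselect (A' w).
    by rewrite [\1_A' w]indicE mem_set//= mul1r (drawn_value gw wA' fw) subrr normr0 addr_ge0.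
  have [wA|nA] := pselect (A w).
    by rewrite [\1_(_ `\` _) w]indicE mem_set//= ler_norml; lra.
  rewrite [\1_A' w]indicE memNset// mul0r sub0r normrN /average.
  by rewrite (first_point_outside M hF e0 r0 FA hB _ nA) /= normr0 addr_ge0.
have g2 : `|(\int[P]_w average frozen w) - (\int[P]_w (\1_A w * value_now w))| <=
    \int[P]_w (cst error w).
  have e0' := step_error_ge0.
  apply: (@expectation_gap _ _ _ _ _ _ _ (error + 1));
    [exact: maverage|exact: m2|exact: measurable_cst| | | |].
  - by move=> w; apply: le_trans (norm_01 (average_01 _ w)) _; rewrite lerDr.
  - by move=> w; apply: le_trans (norm_01 (b2 w)) _; rewrite lerDr.
  - by move=> w; rewrite ger0_norm//= lerDl.
  move=> w /=; have [wA|nA] := pselect (A w).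
    rewrite [\1_A w]indicE mem_set//= mul1r (frozen_value wA).
    by apply: (step_value_error halpha hp c0 alphac hf) => //; exact: A_mass.
  rewrite [\1_A w]indicE memNset// mul0r subr0 /average.
  by rewrite (frozen_point_outside hF e0 r0 FA hB _ nA) /= normr0.
have i1 E : measurable E -> P.-integrable setT (EFin \o (\1_E : Omega -> R)).
  by move=> mE; apply: (@probability_integrable _ _ _ _ _ 1) => // w; exact: norm_01.
rewrite RintegralD ?Rintegral_indic// in g1; [|exact: i1..].
have gE : \int[P]_w (cst error w) = error.
  rewrite Rintegral_cst//; transitivity (error * fine 1%E); last by rewrite mulr1.
  by congr (_ * fine _); exact: probability_setT.
rewrite gE in g2.
rewrite average_frozen in g1.
rewrite -(subrKA (\int[P]_w average frozen w)).
apply: le_trans (ler_normD _ _) _; rewrite addrA; apply: lerD => //.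
by apply: le_trans g1 _; rewrite lerD2l.
Qed.

End one_step_expectation.

(** * The Markov property *)

Section bounded_paths.
Context {R : realType}.
Local Notation S := (nat_measure R).
Variable x : R -> S.
Hypothesis cx : cadlag x.
Variables (s q : R).
Hypothesis s0 : 0 <= s.

Let right_mass u : 0 <= u -> (mass (x v))%:R @[v --> u^'+] --> ((mass (x u))%:R : R).
Proof.
move=> u0; have := right_pairing cx (@bounded_continuous_one R) u0.
by rewrite pairing_one; under eq_fun do rewrite pairing_one.
Qed.

(** The total mass is right-continuous and integer-valued. *)
Lemma dense_mass_le n : s <= q -> (forall y : rat, (mass (x (Num.max s (Num.min q (ratr y)))) <= n)%N) ->
  forall u, s <= u <= q -> (mass (x u) <= n)%N.
Proof.
move=> sq h u /andP[su]; rewrite le_eqVlt => /predU1P[->|uq].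
  have [y] := @rat_in_itvoo R q (q + 1) (ltr_pwDr ltr01 (lexx q)); rewrite in_itv/= => /andP[qy _].
  by have := h y; rewrite (min_idPl (ltW qy)) (max_idPr sq).
rewrite leqNgt; apply/negP => nm.
have gt : n%:R < (mass (x u))%:R :> R by rewrite ltr_nat.
have [e /= e0 he] := cvgr_gt _ (right_mass (le_trans s0 su)) _ gt.
have uqe : u < Num.min q (u + e) by rewrite lt_min uq ltrDl.
have [y] := rat_in_itvoo uqe; rewrite in_itv/= lt_min => /andP[uy /andP[yq ye]].
have := h y; rewrite (min_idPr (ltW yq)) (max_idPr (ltW (le_lt_trans su uy))).
have := he (ratr y) _ uy; rewrite /= distrC ger0_norm ?subr_ge0 ?(ltW uy)// ltrBlDl => /(_ ye).
by rewrite ltr_nat ltnNge => /negbTE ->.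
Qed.

(** The total mass has a limit on the right of each time of the compact interval and
    is bounded on its left. *)
Lemma mass_bounded : exists n, forall u, s <= u <= q -> (mass (x u) <= n)%N.
Proof.
have /compact_near_coveringP cov := @segment_compact R s q.
have [] := cov nat \oo%classic (fun i u => s <= u <= q -> (mass (x u) <= i)%N) _ _; last first.
  by move=> n _ hn; exists n => u usq; apply: (hn n (leqnn n)) => //=; rewrite in_itv.
move=> u; rewrite /= in_itv/= => /andP[su uq]; have u0 := le_trans s0 su.
have lt1 (a : R) : a < a + 1 by rewrite ltrDl.
have hr : \forall v \near u, u < v -> (mass (x v))%:R < (mass (x u))%:R + 1 :> R.
  exact: (cvgr_lt _ (right_mass u0) _ (lt1 _)).
have [k hl] : exists k, \forall v \near u, s <= v -> v < u -> (mass (x v) <= k)%N.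
  move: su; rewrite le_eqVlt => /predU1P[->|su].
    by exists 0%N; apply: filterS (@filterT _ (nbhs u) _) => v _ uv vu; have := le_lt_trans uv vu; rewrite ltxx.
  have h := left_limit_pairing cx (@bounded_continuous_one R) (le_lt_trans s0 su).
  have hl : \forall v \near u, v < u ->
      pairing (x v) (fun=> 1) < pairing (left_limit x u) (fun=> 1) + 1.
    exact: (cvgr_lt _ h _ (lt1 _)).
  exists (mass (left_limit x u)); apply: filterS hl => v hv _ vu; have := hv vu; rewrite !pairing_one natr1 ltr_nat ltnS//.
exists ([set v | (u < v -> (mass (x v))%:R < (mass (x u))%:R + 1 :> R) /\
    (s <= v -> v < u -> (mass (x v) <= k)%N)], [set i | (maxn k (mass (x u)) <= i)%N]).
  by split; [exact: filterI|exists (maxn k (mass (x u)))].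
move=> [v i] /= [[h1 h2]]; rewrite geq_max => /andP[ki ui] /andP[sv vq].
have [vu|uv|->//] := ltgtP v u; first exact: leq_trans (h2 sv vu) ki.
by apply: leq_trans ui; have := h1 uv; rewrite natr1 ltr_nat ltnS.
Qed.

End bounded_paths.

Section archimedean.
Context {R : realType}.

Lemma archimedean_le (a b y : R) : (forall j : nat, y <= b + a / j.+1%:R) -> y <= b.
Proof.
move=> h; apply/ler_addgt0Pr => e e0.
have [a0|a0] := ltP 0 a; last first.
  apply: le_trans (h 0%N) _; rewrite divr1; lra.
have [k _ hk] := near_infty_natSinv_lt (PosNum (divr_gt0 e0 a0)).
apply: le_trans (h k) _; rewrite lerD2l; have /= := hk k (leqnn k).
by rewrite ltr_pdivlMr// mulrC => /ltW.
Qed.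

Lemma norm_chain (a b u v m y z : R) : `|a - u| <= m - z -> `|b - v| <= m - z ->
  `|u - v| <= y - z -> y <= m -> `|a - b| <= 3 * (m - z).
Proof. by rewrite !ler_norml => /andP[? ?] /andP[? ?] /andP[? ?] ?; apply/andP; split; lra. Qed.

End archimedean.

Section markov_expectation.
Context {R : realType} {d : measure_display} {Omega : measurableType d}.
Local Notation S := (nat_measure R).
Local Notation T := (mark_space R).
Variables (P : probability Omega R) (F : R -> set (set Omega)) (M : R.-ker Omega ~> T).
Hypothesis hF : usual_filtration P F.
Hypothesis hM : adapted_poisson_random_measure P F M.
Variables (alpha : R -> R) (p : R -> nat -> R) (X : R -> Omega -> S) (c : R).
Hypothesis halpha : bounded_borel_nonneg alpha.
Hypothesis alpha_gt0 : forall x, 0 <= x -> 0 < alpha x.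
Hypothesis hp : offspring_law p.
Hypotheses (c0 : 0 < c) (alphac : forall x, 0 <= x -> alpha x <= c).
Hypothesis sol : stochastic_equation_solution P F M alpha p X.
Local Notation cumulant := (cumulant halpha hp c0 alphac).
Variable f : R -> R.
Hypothesis hf : bounded_borel_nonneg f.
Variables (s T1 : R) (A : set Omega).
Hypotheses (s0 : 0 <= s) (sT : s <= T1) (FA : F s A).

Let mF u E : 0 <= u -> F u E -> measurable E.
Proof. by move=> u0; exact: (filtration_measurable hF u0). Qed.

Let regular := [set w | cadlag (X ^~ w)].

Let F_regular u : 0 <= u -> F u regular.
Proof.
move=> u0; apply: (filtration_mono hF (lexx 0) u0).
have nC : P.-negligible (~` regular).
  by have [_] := sol; apply: filterS => w [].
have := filtration_complete hF nC; case: (filtration_sigma hF (lexx 0)) => _ h _ /h.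
by rewrite setTD setCK.
Qed.

Let P_regular : P (~` regular) = 0%E.
Proof.
have [_ ae] := sol; have mC : measurable (~` regular) by apply: measurableC; exact: mF (F_regular (lexx 0)).
apply/negligibleP => //; move: ae; apply: filterS => w [] //.
Qed.

(** A countable intersection over rational times, in order to be an event. *)
Let tame n q := \bigcap_i [set w |
  (mass (X (Num.max s (Num.min q (ratr (odflt (0 : rat) (unpickle i))))) w) <= n)%N].

Let F_bigcap u (E : nat -> set Omega) : 0 <= u -> (forall i, F u (E i)) -> F u (\bigcap_i E i).
Proof.
move=> u0 FE; case: (filtration_sigma hF u0) => _ hC hU.
rewrite -(setCK (\bigcap_i E i)) setC_bigcap -setTD; apply: (hC); apply: hU => i.
by rewrite -setTD; exact: hC.
Qed.

Let F_tame n q : s <= q -> F q (tame n q).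
Proof.
move=> sq; have q0 := le_trans s0 sq; apply: F_bigcap => // i; set u := Num.max _ _.
have u0 : 0 <= u by rewrite le_max s0.
have uq : u <= q by rewrite ge_max sq ge_min lexx.
apply: (filtration_mono hF u0 uq); have [ad _] := sol.
apply: (ad u [set mu | (mass mu <= n)%N]) => //.
have := @measurable_mass R measurableT [set m | (m <= n)%N] _; rewrite setTI; exact.
Qed.

Let tameP n q w : s <= q -> regular w -> tame n q w ->
  forall u, s <= u <= q -> (mass (X u w) <= n)%N.
Proof.
move=> sq cw tw; apply: (dense_mass_le cw s0 sq) => y.
by have := tw (pickle y) I; rewrite /= pickleK.
Qed.

Let tameI n q w : s <= q -> (forall u, s <= u <= q -> (mass (X u w) <= n)%N) -> tame n q w.
Proof.
by move=> sq h i _ /=; apply: h; rewrite le_max lexx ge_max sq ge_min lexx.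
Qed.

Let event n q := A `&` regular `&` tame n q.

Let F_event n q : s <= q -> F q (event n q).
Proof.
move=> sq; have q0 := le_trans s0 sq.
apply: (filtration_setI hF q0); last exact: F_tame.
apply: (filtration_setI hF q0); last exact: F_regular.
exact: (filtration_mono hF s0 sq).
Qed.

Let m_event n q : s <= q -> measurable (event n q).
Proof. by move=> sq; apply: mF (F_event n sq); exact: le_trans sq. Qed.

Let event_mono n q q' : s <= q -> q <= q' -> event n q' `<=` event n q.
Proof.
move=> sq qq' w [[Aw cw] tw]; split; first by [].
apply: tameI => // u /andP[su uq]; apply: (tameP _ cw tw); first exact: le_trans qq'.
by rewrite su (le_trans uq).
Qed.

Let prob n q : R := fine (P (event n q)).

Let prob_diff n q q' : s <= q -> q <= q' -> fine (P (event n q `\` event n q')) = prob n q - prob n q'.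
Proof.
move=> sq qq'; have m1 := m_event n sq; have m2 := m_event n (le_trans sq qq').
rewrite measureD//; last exact: (le_lt_trans (probability_le1 P m1) (ltry _)).
rewrite setIidr; last exact: event_mono.
by rewrite fineB// fin_num_measure.
Qed.

Let expected n q : R := \int[P]_w (\1_(event n q) w * laplace (cumulant f (T1 - q)) (X q w)).

Let unit_01 u q w : 0 <= u -> 0 <= laplace (cumulant f u) (X q w) <= 1.
Proof.
move=> u0; rewrite (ltW (laplace_gt0 _ _)) /=; apply: laplace_le1.
exact: (cumulant_borel halpha hp c0 alphac hf u0).
Qed.

Let measurable_unit u q : 0 <= u -> 0 <= q -> measurable_fun setT (fun w => laplace (cumulant f u) (X q w)).
Proof.
move=> u0 q0; have [mc _ _] := cumulant_borel halpha hp c0 alphac hf u0.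
exact: (measurableT_comp (measurable_laplace mc) (measurable_solution hF sol q0)).
Qed.

Section grid.
Variables (mean : R) (n : nat).
Hypothesis mean0 : 0 <= mean.
Hypothesis hmean : forall x, 0 <= x -> forall n, \sum_(i < n) i%:R * p x i <= mean.
Local Notation tau := (T1 - s).

Let tau0 : 0 <= tau. Proof. by rewrite subr_ge0. Qed.

Let quadratic (Z : nat) : R := 2 * (c * n%:R * Z.+1%:R) ^+ 2 + (c * n%:R * Z.+1%:R) * (n%:R * c) +
  (n%:R * c) ^+ 2 + n%:R * c * (mean + 1) * c.
Let linear : R := n%:R * c * 2 * mean.

(** [one_step_expectation], with its error sorted by powers of the length of the step. *)
Let one_step Z q q' : (n.+1 < Z)%N -> s <= q -> q <= q' -> q' <= T1 ->
  `|expected n q' - expected n q| <= prob n q - prob n q' +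
    (quadratic Z * (q' - q) ^+ 2 + linear / Z.+1%:R * (q' - q)).
Proof.
move=> nZ sq qq' q'T; have q0 := le_trans s0 sq; have t0 : 0 <= T1 - q' by rewrite subr_ge0.
have sq' := le_trans sq qq'.
have := @one_step_expectation R d Omega P F M hF hM alpha p X c halpha alpha_gt0 hp c0 alphac sol
  f hf (T1 - q') q q' mean n Z t0 q0 qq' mean0 nZ hmean (event n q) (event n q')
  (F_event n sq) (m_event n sq') (event_mono sq qq').
rewrite (_ : q' - q + (T1 - q') = T1 - q); last by ring.
rewrite prob_diff//.
have -> : (((q' - q) * (c * n%:R) * Z.+1%:R) ^+ 2 + step_error c q q' (c * n%:R) mean n Z) =
    quadratic Z * (q' - q) ^+ 2 + linear / Z.+1%:R * (q' - q).
  by rewrite /step_error /quadratic /linear; set zi := Z.+1%:R^-1; ring.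
apply.
- by move=> w [[_ cw] tw]; apply: (tameP sq cw tw); rewrite sq lexx.
- move=> w u [[_ cw] tw] /andP[qu uq']; apply: (tameP sq' cw tw).
  by rewrite (le_trans sq qu).
Qed.

Let telescoped Z J k : (n.+1 < Z)%N -> (k <= J.+1)%N ->
  `|expected n (s + k%:R * (tau / J.+1%:R)) - expected n s| <=
  prob n s - prob n (s + k%:R * (tau / J.+1%:R)) +
    k%:R * (quadratic Z * (tau / J.+1%:R) ^+ 2 + linear / Z.+1%:R * (tau / J.+1%:R)).
Proof.
move=> nZ; elim: k => [|k IH] kJ; first by rewrite !mul0r addr0 !subrr normr0 addr0.
set h := tau / J.+1%:R in IH *; have h0 : 0 <= h by rewrite divr_ge0.
have hJ : J.+1%:R * h = tau by rewrite /h mulrCA divff ?mulr1// pnatr_eq0.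
have kh : k.+1%:R * h <= tau by rewrite -hJ; apply: ler_wpM2r => //; rewrite ler_nat.
have hk : s + k.+1%:R * h - (s + k%:R * h) = h by rewrite -[k.+1%:R]natr1; ring.
have := @one_step Z (s + k%:R * h) (s + k.+1%:R * h) nZ.
rewrite hk => /(_ _ _ _)/wrap[].
  by rewrite lerDl mulr_ge0.
  by rewrite lerD2l ler_wpM2r// ler_nat.
  by rewrite -lerBrDl.
move=> h1; have h2 := IH (ltnW kJ).
rewrite -(subrKA (expected n (s + k%:R * h))).
apply: le_trans (ler_normD _ _) _; apply: le_trans (lerD h1 h2) _.
rewrite -[X in _ <= _ + X * _]natr1; set K := _ * h ^+ 2 + _; lra.
Qed.

(** The losses of probability telescope, and the other errors add up to a multiple of
    the length of the steps plus a multiple of [Z.+1%:R^-1]. *)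
Lemma expected_gap : `|expected n T1 - expected n s| <= prob n s - prob n T1.
Proof.
have linear0 : 0 <= linear by rewrite /linear !mulr_ge0// ltW.
apply: (@archimedean_le _ (linear * tau)) => i.
(* The bound on the offspring has to exceed [n.+1]. *)
pose Z := (n.+2 + i)%N; have nZ : (n.+1 < Z)%N by rewrite /Z addSn ltnS leq_addr.
apply: (@archimedean_le _ (quadratic Z * tau ^+ 2)) => j.
have := @telescoped Z j j.+1 nZ (leqnn _).
have j0 : j.+1%:R != 0 :> R by rewrite pnatr_eq0.
rewrite (_ : j.+1%:R * (tau / j.+1%:R) = tau); last by field.
rewrite (_ : s + tau = T1); last by ring.
set b := prob n s - prob n T1.
move=> /le_trans; apply; rewrite -[leRHS]addrA lerD2l mulrDr [leRHS]addrC; apply: lerD.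
  rewrite (_ : j.+1%:R * _ = quadratic Z * tau ^+ 2 / j.+1%:R)//; by field.
rewrite (_ : j.+1%:R * _ = linear * tau / Z.+1%:R); last first.
  by rewrite mulrCA (mulrCA _ tau) divff// mulr1 mulrAC.
apply: ler_wpM2l; first exact: mulr_ge0.
by rewrite lef_pV2 ?posrE ?ltr0n// ler_nat ltnS /Z addSn leqW// leq_addl.
Qed.

End grid.

Let prob_cvg : prob n T1 @[n --> \oo] --> fine (P A).
Proof.
have mA : measurable A by exact: mF FA.
have mR : measurable regular by exact: mF (F_regular (lexx 0)).
have U : \bigcup_n event n T1 = A `&` regular.
  apply/seteqP; split => w; first by move=> [n _ []].
  move=> [Aw cw]; have [n hn] := mass_bounded cw T1 s0.
  by exists n => //; split => //; exact: tameI.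
have PA : P (A `&` regular) = P A.
  rewrite -[in RHS](setUIDK A regular) measureU//; last 3 first.
  - exact: measurableI.
  - exact: measurableD.
  - by rewrite -subset0 => w [[_ h] [_ h']].
  rewrite [X in (_ + X)%E](_ : _ = 0%E) ?adde0//.
  apply/eqP; rewrite eq_le measure_ge0 andbT -P_regular; apply: le_measure; rewrite ?inE.
  - exact: measurableD.
  - exact: measurableC.
  - by move=> w [].
rewrite -PA -U; apply: fine_cvg; rewrite fineK ?fin_num_measure//; last first.
  by rewrite U; exact: measurableI.
apply: nondecreasing_cvg_mu; [by move=> n; exact: m_event|by rewrite U; exact: measurableI|].
move=> i j ij; apply/subsetPset => w [cw tw]; split => //.
case: (cw) => _ rw; apply: tameI => // u /andP[su uT]; apply: leq_trans ij.
by apply: (tameP sT rw tw); rewrite su uT.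
Qed.

Let restrict_gap (g : Omega -> R) n q : s <= q -> q <= T1 -> measurable_fun setT g ->
  (forall w, 0 <= g w <= 1) ->
  `|(\int[P]_w (\1_A w * g w)) - (\int[P]_w (\1_(event n q) w * g w))| <= fine (P A) - prob n T1.
Proof.
move=> sq qT mg g01; have mA : measurable A by exact: mF FA.
have mE := m_event n sq; have mET := m_event n sT.
have mD : measurable (A `\` event n T1) by exact: measurableD.
have i01 (E : set Omega) w : 0 <= (\1_E w : R) <= 1 by rewrite indicE; case: (_ \in _); rewrite ?lexx ?ler01.
have b01 (E : set Omega) w : `|\1_E w * g w| <= 1.
  have /andP[a0 a1] := i01 E w; have /andP[l0 l1] := g01 w.
  by rewrite ger0_norm ?mulr_ge0//= mulr_ile1.
have -> : fine (P A) - prob n T1 = \int[P]_w \1_(A `\` event n T1) w.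
  rewrite Rintegral_indic// measureD//; last exact: (le_lt_trans (probability_le1 P mA) (ltry _)).
  rewrite setIidr; last by move=> w [[]].
  by rewrite fineB// fin_num_measure.
apply: (@expectation_gap _ _ _ _ _ _ _ 1).
- by apply: measurable_funM => //; exact: measurable_indic.
- by apply: measurable_funM => //; exact: measurable_indic.
- exact: measurable_indic.
- exact: b01.
- exact: b01.
- by move=> w; have /andP[a0 a1] := i01 (A `\` event n T1) w; rewrite ger0_norm.
move=> w; have /andP[l0 l1] := g01 w; rewrite -mulrBl normrM (ger0_norm l0) -[leRHS]mulr1.
apply: ler_pM => //; rewrite !indicE.
case: (boolP (w \in event n q)) => [|hq].
  by rewrite inE => -[[Aw _] _]; rewrite mem_set// subrr normr0 ler0n.
have hT : (w \in event n T1) = false.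
  by apply/negbTE; apply: contra hq; rewrite !inE; exact: event_mono.
rewrite subr0 ger0_norm ?ler0n// ler_nat; case: (boolP (w \in A)) => //= wA.
by rewrite mem_set//; split; [exact: set_mem|move=> /mem_set; rewrite hT].
Qed.

(** The populations are bounded on [[s, T1]], so the events [event n T1] increase to
    [A] up to a null set, and [expected_gap] becomes an equality in the limit. *)
Lemma markov_laplace :
  \int[P]_w (\1_A w * laplace f (X T1 w)) = \int[P]_w (\1_A w * laplace (cumulant f (T1 - s)) (X s w)).
Proof.
have T0 := le_trans s0 sT; have tau0 : 0 <= T1 - s by rewrite subr_ge0.
have [mean mean0 hmean] := offspring_mean hp.
have at_end w : laplace (cumulant f (T1 - T1)) (X T1 w) = laplace f (X T1 w).
  rewrite subrr; congr (expR (- _)); apply: eq_Rintegral => y; rewrite inE/= in_itv/= andbT => y0.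
  exact: (cumulant_at0 halpha hp c0 alphac hf y0).
under eq_Rintegral do rewrite -at_end.
apply/eqP; rewrite -subr_eq0 -normr_le0.
(* Losses of probability at both ends and in between give the factor 3. *)
have bound n : `|(\int[P]_w (\1_A w * laplace (cumulant f (T1 - T1)) (X T1 w))) -
    (\int[P]_w (\1_A w * laplace (cumulant f (T1 - s)) (X s w)))| <= 3 * (fine (P A) - prob n T1).
  have z0 : 0 <= T1 - T1 by rewrite subrr.
  have h1 := restrict_gap n sT (lexx _) (measurable_unit z0 T0) (fun w => unit_01 T1 w z0).
  have h2 := restrict_gap n (lexx _) sT (measurable_unit tau0 s0) (fun w => unit_01 s w tau0).
  have h3 := expected_gap n mean0 hmean.
  have h4 : prob n s <= fine (P A).
    have mA : measurable A by exact: mF FA.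
    apply: fine_le; rewrite ?fin_num_measure//; [exact: m_event|].
    by apply: le_measure; rewrite ?inE//; [exact: m_event|move=> w [[]]].
  exact: (norm_chain h1 h2 h3 h4).
have lim0 : 3 * (fine (P A) - prob n T1) @[n --> \oo] --> (0 : R).
  have -> : (0 : R) = 3 * (fine (P A) - fine (P A)) by rewrite subrr mulr0.
  by apply: cvgM; [exact: cvg_cst|apply: cvgB; [exact: cvg_cst|exact: prob_cvg]].
rewrite -(cvg_lim _ lim0)//; apply: limr_ge; last exact: nearW.
by apply/cvg_ex; eexists; exact: lim0.
Qed.

End markov_expectation.

Section restricted_expectations.
Context {R : realType} d (Omega : measurableType d) (P : probability Omega R).

Lemma integral_indic_mul (A : set Omega) (g : Omega -> R) : measurable A ->
  measurable_fun setT g -> (forall w, 0 <= g w <= 1) ->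
  (\int[P]_(w in A) (g w)%:E = (\int[P]_w (\1_A w * g w))%:E)%E.
Proof.
move=> mA mg g01; rewrite /Rintegral fineK; last first.
  apply: integrable_fin_num => //; apply: (@probability_integrable _ _ _ _ _ 1).
    by apply: measurable_funM => //; exact: measurable_indic.
  move=> w; have /andP[g0 g1] := g01 w; rewrite indicE; case: (_ \in _).
    by rewrite mul1r ger0_norm.
  by rewrite mul0r normr0.
rewrite [LHS]integral_mkcond; apply: eq_integral => w _; rewrite patchE indicE.
by case: ifP => _; rewrite ?mul1r ?mul0r.
Qed.

End restricted_expectations.

Section mixture.
Local Open Scope ereal_scope.
Context {R : realType} d d' (Omega : measurableType d) (Y : measurableType d').
Variables (P : probability Omega R) (A : set Omega).
Hypothesis mA : measurable A.
Variable K : R.-spker Omega ~> Y.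

Definition kernel_on_fun (w : Omega) : {measure set Y -> \bar R} :=
  if w \in A then K w else (mzero : {measure set Y -> \bar R}).

Let kernel_onE w E : kernel_on_fun w E = (\1_A w)%:E * K w E.
Proof. by rewrite /kernel_on_fun indicE; case: ifP => _; rewrite ?mul1e ?mul0e. Qed.

Let kernel_on_measurable E : measurable E -> measurable_fun setT (kernel_on_fun ^~ E).
Proof.
move=> mE; under eq_fun do rewrite kernel_onE.
apply: emeasurable_funM; first by apply/measurable_EFinP; exact: measurable_indic.
exact: measurable_kernel.
Qed.

Let kernel_on_le1 w : kernel_on_fun w setT <= 1.
Proof. by rewrite /kernel_on_fun; case: ifP => _; [exact: sprob_kernel_le1|exact: lee01]. Qed.

Definition kernel_on : R.-spker Omega ~> Y := mk_spker kernel_on_measurable kernel_on_le1.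

(** The law of a point drawn from [K], restricted to the event [A]. *)
Definition mixture : {finite_measure set Y -> \bar R} :=
  spker_measure (kbind (kconst unit P) (kprecomp (@measurable_snd _ _ unit Omega) kernel_on)) tt.

Lemma integral_mixture (f : Y -> \bar R) : (forall y, 0 <= f y) -> measurable_fun setT f ->
  \int[mixture]_y f y = \int[P]_(w in A) \int[K w]_y f y.
Proof.
move=> f0 mf.
transitivity (\int[kbind (kconst unit P) (kprecomp (@measurable_snd _ _ unit Omega) kernel_on) tt]_y f y) => //.
rewrite integral_kbind// [in RHS]integral_mkcond; apply: eq_integral => w _.
rewrite patchE -[LHS]/(\int[kernel_on_fun w]_y f y) /kernel_on_fun.
by case: ifP => _; rewrite ?integral_measure_zero.
Qed.

Lemma mixtureE B : measurable B -> mixture B = \int[P]_(w in A) K w B.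
Proof.
move=> mB.
have -> : mixture B = \int[mixture]_y (\1_B y)%:E.
  by rewrite (integral_indic mixture measurableT mB) setIT.
rewrite integral_mixture//; last first.
  by apply/measurable_EFinP; exact: measurable_indic.
by apply: eq_integral => w _; rewrite (integral_indic (K w) measurableT mB) setIT.
Qed.

End mixture.

Theorem theorem2p9 (R : realType) (d : measure_display)
    (Omega : measurableType d) (P : probability Omega R)
    (F : R -> set (set Omega))
    (M : R.-ker Omega ~> mark_space R)
    (alpha : R -> R) (p : R -> nat -> R)
    (X : R -> Omega -> nat_measure R) :
  bounded_borel_nonneg alpha -> bounded_away_from_zero alpha ->
  offspring_law p ->
  usual_filtration P F ->
  adapted_poisson_random_measure P F M ->
  stochastic_equation_solution P F M alpha p X ->
  age_structured_branching_process P F alpha (pgf p) X.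
Proof.
move=> halpha [a [a0 aalpha]] hp hF hM sol.
have alpha_gt0 x : 0 <= x -> 0 < alpha x by move=> x0; exact: lt_le_trans a0 (aalpha x x0).
(* The rate of the uniformization can be any positive bound of [alpha]. *)
have [_ [C hC] _] := halpha; pose c : R := `|C| + 1.
have c0 : 0 < c by rewrite ltr_pwDr.
have alphac x : 0 <= x -> alpha x <= c.
  move=> x0; apply: le_trans (ler_norm _) _; apply: le_trans (hC x x0) _.
  by apply: le_trans (ler_norm _) _; rewrite lerDl.
exists (transition halpha hp c0 alphac); split; first exact: transition_branching.
split; first by case: sol.
move=> s t A B s0 st FA mB; have t0 := le_trans s0 st.
have ts0 : 0 <= t - s by rewrite subr_ge0.
have mA : measurable A by exact: (filtration_measurable hF s0).
have ms := measurable_solution hF sol s0; have mt := measurable_solution hF sol t0.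
pose K1 : R.-spker Omega ~> nat_measure R := kpoint mt.
pose K2 : R.-spker Omega ~> nat_measure R := kprecomp ms (transition halpha hp c0 alphac (t - s)).
have -> : P (A `&` X t @^-1` B) = mixture P mA K1 B.
  rewrite (mixtureE P mA K1 mB) setIC -(integral_indic P mA); last first.
    by rewrite -[X in measurable X]setTI; exact: (mt measurableT B mB).
  by apply: eq_integral => w _; rewrite /= diracE indicE.
transitivity (mixture P mA K2 B); last exact: mixtureE.
apply: (laplace_determines _ mB) => f hf.
have [mf _ _] := hf.
have ml : measurable_fun setT (fun nu : nat_measure R => (laplace f nu)%:E).
  by apply/measurable_EFinP; exact: measurable_laplace.
have l0 (nu : nat_measure R) : (0 <= (laplace f nu)%:E)%E by rewrite lee_fin ltW// laplace_gt0.
rewrite (integral_mixture P mA K1 l0 ml) (integral_mixture P mA K2 l0 ml).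
have key := markov_laplace hF hM halpha alpha_gt0 hp c0 alphac sol hf s0 st FA.
have hc := cumulant_borel halpha hp c0 alphac hf ts0; have [mc _ _] := hc.
have unit01 g nu : bounded_borel_nonneg g -> 0 <= laplace g nu <= (1 : R).
  by move=> hg; rewrite (ltW (laplace_gt0 _ _)) /=; exact: laplace_le1.
have m1 := measurableT_comp (measurable_laplace mf) mt.
have m2 := measurableT_comp (measurable_laplace mc) ms.
transitivity (\int[P]_(w in A) (laplace f (X t w))%:E)%E.
  by apply: eq_integral => w _; rewrite (integral_dirac (X t w) measurableT ml) diracT mul1e.
transitivity (\int[P]_(w in A) (laplace (cumulant halpha hp c0 alphac f (t - s)) (X s w))%:E)%E.
  have e1 := integral_indic_mul P mA m1 (fun w => unit01 f (X t w) hf).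
  have e2 := integral_indic_mul P mA m2 (fun w => unit01 _ (X s w) hc).
  exact: (eq_trans e1 (eq_trans (congr1 EFin key) (esym e2))).
apply: eq_integral => w _; apply: esym.
exact: (transition_laplace halpha hp c0 alphac (X s w) hf ts0).
Qed.
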